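(* Let $T>0$, let $k,d,m$ be positive integers and $\mathcal J=\{1,\dots,m\}$. Let $b:[0,T]\times\mathbb R^k\to\mathbb R^k$ and $\sigma:[0,T]\times\mathbb R^k\to\mathbb R^{k\times d}$ be jointly continuous with $|b(t,x)|+|\sigma(t,x)|\le C(1+|x|)$ and $|b(t,x)-b(t,x')|+|\sigma(t,x)-\sigma(t,x')|\le C|x-x'|$ for some constant $C\ge 0$ and all $t\in[0,T]$, $x,x'\in\mathbb R^k$. Assume that for every $i\in\mathcal J$ the function $f_i:[0,T]\times\mathbb R^k\times\mathbb R\times\mathbb R^d\to\mathbb R$, $(t,x,y,z)\mapsto f_i(t,x,y,z)$, is such that: $(t,x)\mapsto f_i(t,x,y,z)$ is continuous uniformly with respect to $(y,z)$; $|f_i(t,x,y,z)-f_i(t,x,\bar y,\bar z)|\le C(|y-\bar y|+|z-\bar z|)$ for some $C\ge0$ and all arguments; and $(t,x)\mapsto f_i(t,x,0,0)$ is Borel measurable and of polynomial growth. Assume that for all $i\ne j$ in $\mathcal J$ the function $g_{ij}:[0,T]\times\mathbb R^k\to\mathbb R$ is continuous, non-negative and of polynomial growth, and that for every $(t,x)\in[0,T]\times\mathbb R^k$ and every finite sequence $i_1,\dots,i_N\in\mathcal J$ with $N\ge3$, $i_1=i_N$ and $\mathrm{card}\{i_1,\dots,i_N\}=N-1$ one has $g_{i_1i_2}(t,x)+\dots+g_{i_{N-1}i_N}(t,x)>0$. Assume that every $h_i:\mathbb R^k\to\mathbb R$ is continuous, of polynomial growth, and $h_i(x)\ge\max_{j\in\mathcal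 J\setminus\{i\}}(h_j(x)-g_{ij}(T,x))$ for all $x\in\mathbb R^k$. Then the system: for all $i\in\mathcal J$, $$\min\Big\{v_i(t,x)-\max_{j\in\mathcal J\setminus\{i\}}(v_j(t,x)-g_{ij}(t,x));\ -\partial_tv_i(t,x)-\mathcal Lv_i(t,x)-f_i(t,x,v_i(t,x),\sigma^\top(t,x)D_xv_i(t,x))\Big\}=0,\qquad v_i(T,x)=h_i(x),$$ has a unique continuous viscosity solution $(v_i)_{i\in\mathcal J}$ with components of polynomial growth.
   Context: $\mathcal L\varphi(t,x)=\frac12\mathrm{Tr}[(\sigma\sigma^\top)(t,x)D^2_{xx}\varphi(t,x)]+b(t,x)^\top D_x\varphi(t,x)$. A function $\phi$ is of polynomial growth if $|\phi(t,x)|\le C(1+|x|^\gamma)$ (resp. $|\phi(x)|\le C(1+|x|^\gamma)$) for some constants $C,\gamma\ge0$. A maximum over the empty set is read as $-\infty$. Envelopes. For locally bounded $u:[0,T]\times\mathbb R^k\to\mathbb R$, $u_*(t,x)=\liminf_{(t',x')\to(t,x),\,t'<T}u(t',x')$ and $u^*(t,x)=\limsup_{(t',x')\to(t,x),\,t'<T}u(t',x')$ (for continuous $u$ both equal $u$). Jets. For $u:[0,T]\times\mathbb R^k\to\mathbb R$ lower (resp. upper) semicontinuous, the parabolic subjet $J^-u(t,x)$ (resp. superjet $J^+u(t,x)$) is the set of triples $(p,q,M)\in\mathbb R\times\mathbb R^k\times\mathbb S^k$ ($\mathbb S^k$ = symmetric real $k\times k$ matrices) with $u(t',x')\ge$ (resp.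 $\le$) $u(t,x)+p(t'-t)+\langle q,x'-x\rangle+\frac12\langle x'-x,M(x'-x)\rangle+o(|t'-t|+|x'-x|^2)$ as $(t',x')\to(t,x)$ in $[0,T]\times\mathbb R^k$. The limiting subjet $\bar J^-u(t,x)$ (resp. limiting superjet $\bar J^+u(t,x)$) is the set of limits $(p,q,M)=\lim_n(p_n,q_n,M_n)$ with $(p_n,q_n,M_n)\in J^-u(t_n,x_n)$ (resp. $J^+u(t_n,x_n)$), $(t_n,x_n)\to(t,x)$ and $u(t_n,x_n)\to u(t,x)$. Viscosity solutions. $(v_i)_{i\in\mathcal J}$ with every $v_i$ lower (resp. upper) semicontinuous on $[0,T]\times\mathbb R^k$ is a viscosity supersolution (resp. subsolution) of the system if for every $i\in\mathcal J$, every $(t,x)\in[0,T)\times\mathbb R^k$ and every $(p,q,M)\in\bar J^-v_i(t,x)$ (resp. $\bar J^+v_i(t,x)$), $$\min\Big\{v_i(t,x)-\max_{j\in\mathcal J\setminus\{i\}}(v_j(t,x)-g_{ij}(t,x));\ -p-b(t,x)^\top q-\tfrac12\mathrm{Tr}[(\sigma\sigma^\top)(t,x)M]-f_i(t,x,v_i(t,x),\sigma(t,x)^\top q)\Big\}\ge0\ (\text{resp. }\le0),$$ and $v_i(T,x)\ge h_i(x)$ (resp. $\le h_i(x)$) for all $x\in\mathbb R^k$. A locally bounded $(v_1,\dots,v_m):[0,T]\times\mathbb R^k\to\mathbb R^m$ is a viscosity solution if $((v_1)_*,\dots,(v_m)_* )$ is a viscosity supersolution and $(v_1^*,\dots,v_m^*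 )$ is a viscosity subsolution. *)

(* Defs.v *)
From HB Require Import structures.
From mathcomp Require Import all_boot all_order all_algebra.
From mathcomp Require Import all_classical all_reals all_analysis.

Set Implicit Arguments.
Unset Strict Implicit.
Unset Printing Implicit Defensive.

Import Order.TTheory GRing.Theory Num.Theory.
Import numFieldNormedType.Exports.

Local Open Scope classical_set_scope.
Local Open Scope ring_scope.

(* The library's norm on matrices is the sup norm, whence this Euclidean
   (Frobenius) one. *)
Definition enorm {R : realType} {m n : nat} (A : 'M[R]_(m, n)) : R :=
  Num.sqrt (\sum_i \sum_j A i j ^+ 2).

Definition dot {R : realType} {n : nat} (u v : 'cV[R]_n) : R :=
  (u^T *m v) ord0 ord0.

(* Functions on [0,T] x R^k are total functions on R * 'cV[R]_k of which only
   the values on [strip T k] are ever used. *)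
Definition strip {R : realType} (T : R) (k : nat) : set (R * 'cV[R]_k) :=
  `[0, T]%classic `*` setT.

Definition strip_open {R : realType} (T : R) (k : nat) : set (R * 'cV[R]_k) :=
  `[0, T[%classic `*` setT.

Arguments strip {R} T k _.
Arguments strip_open {R} T k _.

Definition poly_growth {R : realType} {k : nat} (phi : 'cV[R]_k -> R) : Prop :=
  exists C gamma : R, [/\ 0 <= C, 0 <= gamma &
    forall x, `|phi x| <= C * (1 + enorm x `^ gamma)].

Definition poly_growth_strip {R : realType} (T : R) {k : nat}
    (phi : R * 'cV[R]_k -> R) : Prop :=
  exists C gamma : R, [/\ 0 <= C, 0 <= gamma &
    forall p, strip T k p -> `|phi p| <= C * (1 + enorm p.2 `^ gamma)].

Definition borel_on_strip {R : realType} (T : R) {k : nat}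
    (phi : R * 'cV[R]_k -> R) : Prop :=
  let borel := g_sigma_algebraType (@open (R * 'cV[R]_k)%type) in
  measurable_fun (strip T k : set borel) (phi : borel -> measurableTypeR R).

Definition lsc_on {R : realType} {X : topologicalType} (D : set X)
    (u : X -> R) : Prop :=
  @lower_semicontinuous (subspace D) R (fun p => (u p)%:E).

Definition usc_on {R : realType} {X : topologicalType} (D : set X)
    (u : X -> R) : Prop :=
  lsc_on D (\- u).

(* The limits include the point itself when its time is < T. They are finite at
   the points of [strip T k] as soon as u is locally bounded there. *)
Definition lower_env {R : realType} (T : R) {k : nat}
    (u : R * 'cV[R]_k -> R) (p : R * 'cV[R]_k) : R :=
  fine (limf_einf (fun p' => (u p')%:E) (within (strip_open T k) (nbhs p))).

Definition upper_env {R : realType} (T : R) {k : nat}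
    (u : R * 'cV[R]_k -> R) (p : R * 'cV[R]_k) : R :=
  fine (limf_esup (fun p' => (u p')%:E) (within (strip_open T k) (nbhs p))).

Definition jet_poly {R : realType} {k : nat} (c : R) (p : R * 'cV[R]_k)
    (a : R) (q : 'cV[R]_k) (M : 'M[R]_k) (p' : R * 'cV[R]_k) : R :=
  c + a * (p'.1 - p.1) + dot q (p'.2 - p.2)
    + 2^-1 * dot (p'.2 - p.2) (M *m (p'.2 - p.2)).

Definition jet_gauge {R : realType} {k : nat} (p p' : R * 'cV[R]_k) : R :=
  `|p'.1 - p.1| + enorm (p'.2 - p.2) ^+ 2.

(* The jets of u at a point of [strip T k], as sets of ((a, q), M). *)
Definition subjet {R : realType} (T : R) {k : nat} (u : R * 'cV[R]_k -> R)
    (p : R * 'cV[R]_k) : set (R * 'cV[R]_k * 'M[R]_k) :=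
  [set J | J.2^T = J.2 /\
    exists2 r : R * 'cV[R]_k -> R,
      r =o_ (within (strip T k) (nbhs p)) (jet_gauge p) &
      \forall p' \near within (strip T k) (nbhs p),
        jet_poly (u p) p J.1.1 J.1.2 J.2 p' + r p' <= u p'].

Definition superjet {R : realType} (T : R) {k : nat} (u : R * 'cV[R]_k -> R)
    (p : R * 'cV[R]_k) : set (R * 'cV[R]_k * 'M[R]_k) :=
  [set J | J.2^T = J.2 /\
    exists2 r : R * 'cV[R]_k -> R,
      r =o_ (within (strip T k) (nbhs p)) (jet_gauge p) &
      \forall p' \near within (strip T k) (nbhs p),
        u p' <= jet_poly (u p) p J.1.1 J.1.2 J.2 p' + r p'].

Definition limiting_jet {R : realType} (T : R) {k : nat}
    (jet : R * 'cV[R]_k -> set (R * 'cV[R]_k * 'M[R]_k))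
    (u : R * 'cV[R]_k -> R) (p : R * 'cV[R]_k) :
    set (R * 'cV[R]_k * 'M[R]_k) :=
  [set J | exists (P : nat -> R * 'cV[R]_k)
      (Js : nat -> R * 'cV[R]_k * 'M[R]_k),
    [/\ forall n, strip T k (P n), forall n, jet (P n) (Js n),
        P @ \oo --> p, (u \o P) @ \oo --> u p & Js @ \oo --> J]].

Definition limiting_subjet {R : realType} (T : R) {k : nat}
    (u : R * 'cV[R]_k -> R) :=
  limiting_jet T (subjet T u) u.

Definition limiting_superjet {R : realType} (T : R) {k : nat}
    (u : R * 'cV[R]_k -> R) :=
  limiting_jet T (superjet T u) u.

(* max_(j != i) (y_j - c_ij), equal to -oo when m = 1. *)
Definition obstacle {R : realType} {m : nat} (y : 'I_m -> R)
    (c : 'I_m -> 'I_m -> R) (i : 'I_m) : \bar R :=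
  \big[maxe/-oo%E]_(j < m | j != i) (y j - c i j)%:E.

Definition pde_part {R : realType} {k d : nat}
    (b : R * 'cV[R]_k -> 'cV[R]_k) (sigma : R * 'cV[R]_k -> 'M[R]_(k, d))
    (fi : R * 'cV[R]_k -> R -> 'cV[R]_d -> R)
    (p : R * 'cV[R]_k) (y : R) (J : R * 'cV[R]_k * 'M[R]_k) : R :=
  - J.1.1 - dot (b p) J.1.2
    - 2^-1 * \tr (sigma p *m (sigma p)^T *m J.2)
    - fi p y ((sigma p)^T *m J.1.2).

Definition system_op {R : realType} {k d m : nat}
    (b : R * 'cV[R]_k -> 'cV[R]_k) (sigma : R * 'cV[R]_k -> 'M[R]_(k, d))
    (f : 'I_m -> R * 'cV[R]_k -> R -> 'cV[R]_d -> R)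
    (g : 'I_m -> 'I_m -> R * 'cV[R]_k -> R)
    (v : 'I_m -> R * 'cV[R]_k -> R)
    (i : 'I_m) (p : R * 'cV[R]_k) (J : R * 'cV[R]_k * 'M[R]_k) : \bar R :=
  mine ((v i p)%:E - obstacle (fun j => v j p) (fun l j => g l j p) i)%E
       (pde_part b sigma (f i) p (v i p) J)%:E.

Definition viscosity_supersolution {R : realType} (T : R) {k d m : nat}
    (b : R * 'cV[R]_k -> 'cV[R]_k) (sigma : R * 'cV[R]_k -> 'M[R]_(k, d))
    (f : 'I_m -> R * 'cV[R]_k -> R -> 'cV[R]_d -> R)
    (g : 'I_m -> 'I_m -> R * 'cV[R]_k -> R) (h : 'I_m -> 'cV[R]_k -> R)
    (v : 'I_m -> R * 'cV[R]_k -> R) : Prop :=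
  [/\ forall i, lsc_on (strip T k) (v i),
      forall i p J, strip_open T k p -> limiting_subjet T (v i) p J ->
        (0 <= system_op b sigma f g v i p J)%E
    & forall i x, h i x <= v i (T, x)].

Definition viscosity_subsolution {R : realType} (T : R) {k d m : nat}
    (b : R * 'cV[R]_k -> 'cV[R]_k) (sigma : R * 'cV[R]_k -> 'M[R]_(k, d))
    (f : 'I_m -> R * 'cV[R]_k -> R -> 'cV[R]_d -> R)
    (g : 'I_m -> 'I_m -> R * 'cV[R]_k -> R) (h : 'I_m -> 'cV[R]_k -> R)
    (v : 'I_m -> R * 'cV[R]_k -> R) : Prop :=
  [/\ forall i, usc_on (strip T k) (v i),
      forall i p J, strip_open T k p -> limiting_superjet T (v i) p J ->
        (system_op b sigma f g v i p J <= 0)%E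
    & forall i x, v i (T, x) <= h i x].

Definition viscosity_solution {R : realType} (T : R) {k d m : nat}
    (b : R * 'cV[R]_k -> 'cV[R]_k) (sigma : R * 'cV[R]_k -> 'M[R]_(k, d))
    (f : 'I_m -> R * 'cV[R]_k -> R -> 'cV[R]_d -> R)
    (g : 'I_m -> 'I_m -> R * 'cV[R]_k -> R) (h : 'I_m -> 'cV[R]_k -> R)
    (v : 'I_m -> R * 'cV[R]_k -> R) : Prop :=
  [/\ forall i, [locally [bounded v i p | p in strip T k]],
      viscosity_supersolution T b sigma f g h (fun i => lower_env T (v i))
    & viscosity_subsolution T b sigma f g h (fun i => upper_env T (v i))].

Definition continuous_poly_growth_solution {R : realType} (T : R) {k d m : nat}
    (b : R * 'cV[R]_k -> 'cV[R]_k) (sigma : R * 'cV[R]_k -> 'M[R]_(k, d))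
    (f : 'I_m -> R * 'cV[R]_k -> R -> 'cV[R]_d -> R)
    (g : 'I_m -> 'I_m -> R * 'cV[R]_k -> R) (h : 'I_m -> 'cV[R]_k -> R)
    (v : 'I_m -> R * 'cV[R]_k -> R) : Prop :=
  [/\ forall i, {within strip T k, continuous (v i)},
      forall i, poly_growth_strip T (v i)
    & viscosity_solution T b sigma f g h v].

(* Main.v *)
(** Comparison. The usual doubling of variables is carried out without Aleksandrov's theorem: all
    that is needed at a maximum point of u(t,x) - w(s,y) - (penalisation) is an inequality between
    the traces Tr(sigma sigma^T X) over nearby superjets X of u and subjets of w. Let U(g) be the
    supremum over z of u(z) minus a steep paraboloid around the maximum point shifted by sigma g,
    with g in R^d. If U - H has an interior maximum for a function H of constant Laplacian c, then a
    Schur complement computation produces a superjet of u near the point with Tr(sigma sigma^T X)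
    at most about c. Hence if all these traces are at least c1 > c, then U <= H on a sphere
    implies U <= H inside. The same holds for w, and since any continuous function on a sphere is
    uniformly close to a polynomial of prescribed constant Laplacian, the two bounds can be played
    against each other. At a maximum of (u_i - w_i) / zeta, with zeta = e^(mu(T-t)) (1+|x|^2)^m,
    the no-free-loop condition gives an index at which u is off its obstacle.

    Existence is by Perron's method: K zeta and - K zeta are barriers, the supremum v of all
    subsolutions lies below h at time T by the no-free-loop condition again, its upper envelope
    is a subsolution and hence equal to v, and a bump shows that its lower envelope is a
    supersolution. Comparison makes v continuous. *)

Require Import Defs.
From HB Require Import structures.
From mathcomp Require Import all_boot all_order all_algebra ring lra.
From mathcomp Require Import -(notations) mpoly.
From mathcomp Require Import all_classical all_reals all_analysis.
Import Order.TTheory GRing.Theory Num.Theory.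
Import numFieldNormedType.Exports.
Local Open Scope classical_set_scope.
Local Open Scope ring_scope.
Set Implicit Arguments.
Unset Strict Implicit.
Unset Printing Implicit Defensive.

(** * Euclidean norms *)

Section Euclid.
Variable R : realType.

(** The auxiliary variable g lives in the noise space R^d: because the shift is [sigma *m g], the
    quantity Tr(sigma sigma^T X) becomes a Laplacian in g, which is why functions of constant
    Laplacian are the right comparison functions. A bound on the traces over all jets near the
    maximum point takes the place of a pair of matrices at that point; it is available because
    continuity freezes the first-order part of the operator there up to a small error. The
    coefficients are Lipschitz in space but merely continuous in time, so space and time are
    penalised with separate weights, the time weight being chosen last. The exponent mu of the
    weight zeta absorbs all the contributions of b, sigma and the Lipschitz constant of f; linear
    growth of b and sigma makes these proportional to zeta. Only a subsolution faces an alternative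
    between equation and obstacle, while a supersolution satisfies both inequalities; hence the
    search for an index at which u is strictly above its obstacle. Limiting jets are always reduced
    to ordinary jets at nearby points. *)

Lemma cauchy_schwarz_sum (I : finType) (a b : I -> R) :
  (\sum_i a i * b i) ^+ 2 <= (\sum_i a i ^+ 2) * (\sum_i b i ^+ 2).
Proof.
set A := \sum_i a i ^+ 2; set B := \sum_i b i ^+ 2; set C := \sum_i a i * b i.
have A0 : 0 <= A by apply: sumr_ge0 => i _; exact: sqr_ge0.
have key (s t : R) : 0 <= s ^+ 2 * A + 2 * s * t * C + t ^+ 2 * B.
  have -> : s ^+ 2 * A + 2 * s * t * C + t ^+ 2 * B = \sum_i (s * a i + t * b i) ^+ 2.
    rewrite !mulr_sumr -!big_split /=; apply: eq_bigr => i _; ring.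
  by apply: sumr_ge0 => i _; exact: sqr_ge0.
have [A_0|A_n0] := eqVneq A 0.
  have a0 i : a i = 0.
    move/eqP: A_0; rewrite psumr_eq0; last by move=> j _; exact: sqr_ge0.
    by move=> /allP/(_ i (mem_index_enum _)); rewrite /= sqrf_eq0 => /eqP.
  rewrite /C (eq_bigr (fun=> 0)) => [|i _]; last by rewrite a0 mul0r.
  by rewrite big1_eq A_0 expr0n mul0r.
have A_gt0 : 0 < A by rewrite lt_neqAle eq_sym A_n0.
(* At this argument the form equals A times the discriminant A B - C^2. *)
have := key (- C) A; rewrite sqrrN.
have -> : C ^+ 2 * A + 2 * - C * A * C + A ^+ 2 * B = A * (A * B - C ^+ 2) by ring.
by rewrite pmulr_rge0 // subr_ge0.
Qed.

Lemma dotE n (u v : 'cV[R]_n) : dot u v = \sum_i u i ord0 * v i ord0.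
Proof. by rewrite /dot mxE; apply: eq_bigr => i _; rewrite mxE. Qed.

Lemma dotC n (u v : 'cV[R]_n) : dot u v = dot v u.
Proof. by rewrite !dotE; apply: eq_bigr => i _; rewrite mulrC. Qed.

Lemma dotDl n (u v w : 'cV[R]_n) : dot (u + v) w = dot u w + dot v w.
Proof. by rewrite /dot linearD mulmxDl mxE. Qed.
Lemma dotDr n (u v w : 'cV[R]_n) : dot w (u + v) = dot w u + dot w v.
Proof. by rewrite /dot mulmxDr mxE. Qed.
Lemma dotNl n (u w : 'cV[R]_n) : dot (- u) w = - dot u w.
Proof. by rewrite /dot linearN mulNmx mxE. Qed.
Lemma dotNr n (u w : 'cV[R]_n) : dot w (- u) = - dot w u.
Proof. by rewrite /dot mulmxN mxE. Qed.
Lemma dotZl n a (u w : 'cV[R]_n) : dot (a *: u) w = a * dot u w.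
Proof. by rewrite /dot linearZ -scalemxAl mxE. Qed.
Lemma dotZr n a (u w : 'cV[R]_n) : dot w (a *: u) = a * dot w u.
Proof. by rewrite /dot -scalemxAr mxE. Qed.
Lemma dot0l n (w : 'cV[R]_n) : dot 0 w = 0.
Proof. by rewrite /dot trmx0 mul0mx mxE. Qed.
Lemma dot0r n (w : 'cV[R]_n) : dot w 0 = 0.
Proof. by rewrite dotC dot0l. Qed.
Lemma dot_mull m n (A : 'M[R]_(m, n)) u w : dot (A *m u) w = dot u (A^T *m w).
Proof. by rewrite /dot trmx_mul mulmxA. Qed.
Lemma dot_mulr m n (A : 'M[R]_(m, n)) u w : dot w (A *m u) = dot (A^T *m w) u.
Proof. by rewrite dotC dot_mull dotC. Qed.

Definition dotlin := (dotDl, dotDr, dotNl, dotNr, dotZl, dotZr).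

Lemma enorm_sqr m n (A : 'M[R]_(m, n)) : enorm A ^+ 2 = \sum_i \sum_j A i j ^+ 2.
Proof.
rewrite sqr_sqrtr //; apply: sumr_ge0 => i _; apply: sumr_ge0 => j _.
exact: sqr_ge0.
Qed.

Lemma enorm_ge0 m n (A : 'M[R]_(m, n)) : 0 <= enorm A.
Proof. exact: sqrtr_ge0. Qed.
Hint Resolve enorm_ge0 : core.

Lemma dot_enorm n (u : 'cV[R]_n) : dot u u = enorm u ^+ 2.
Proof.
rewrite enorm_sqr dotE; apply: eq_bigr => i _.
by rewrite big_ord1 expr2.
Qed.

Lemma dot_ge0 n (u : 'cV[R]_n) : 0 <= dot u u.
Proof. by rewrite dot_enorm sqr_ge0. Qed.

Lemma enorm0 m n : enorm (0 : 'M[R]_(m, n)) = 0.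
Proof.
rewrite /enorm big1 ?sqrtr0// => i _; rewrite big1// => j _.
by rewrite mxE expr0n.
Qed.

Lemma enormZ m n a (A : 'M[R]_(m, n)) : enorm (a *: A) = `|a| * enorm A.
Proof.
apply/eqP; rewrite -(eqrXn2 (n:=2)) ?mulr_ge0// exprMn !enorm_sqr real_normK ?num_real//.
rewrite mulr_sumr; apply/eqP/eq_bigr => i _; rewrite mulr_sumr; apply: eq_bigr => j _.
by rewrite mxE exprMn.
Qed.

Lemma enormN m n (A : 'M[R]_(m, n)) : enorm (- A) = enorm A.
Proof. by rewrite -scaleN1r enormZ normrN1 mul1r. Qed.

Lemma enormB m n (A B : 'M[R]_(m, n)) : enorm (A - B) = enorm (B - A).
Proof. by rewrite -enormN opprB. Qed.

Definition mdot m n (A B : 'M[R]_(m, n)) : R := \sum_i \sum_j A i j * B i j.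

Lemma mdot_le m n (A B : 'M[R]_(m, n)) : mdot A B <= enorm A * enorm B.
Proof.
apply: le_trans (ler_norm _) _; rewrite -(ler_pXn2r (n:=2)) ?nnegrE ?mulr_ge0//.
rewrite real_normK ?num_real// exprMn !enorm_sqr /mdot !pair_big /=.
exact: (cauchy_schwarz_sum (fun p => A p.1 p.2) (fun p => B p.1 p.2)).
Qed.

Lemma enormD m n (A B : 'M[R]_(m, n)) : enorm (A + B) <= enorm A + enorm B.
Proof.
rewrite -(ler_pXn2r (n:=2)) ?nnegrE ?addr_ge0//.
have -> : enorm (A + B) ^+ 2 = enorm A ^+ 2 + 2 * mdot A B + enorm B ^+ 2.
  rewrite !enorm_sqr /mdot mulr_sumr -!big_split /=; apply: eq_bigr => i _.
  rewrite mulr_sumr -!big_split /=; apply: eq_bigr => j _; rewrite !mxE; ring.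
have := mdot_le A B; rewrite sqrrD -mulr_natl; lra.
Qed.

Lemma dotC_le n (u v : 'cV[R]_n) : `|dot u v| <= enorm u * enorm v.
Proof.
have le (u' v' : 'cV[R]_n) : dot u' v' <= enorm u' * enorm v'.
  rewrite dotE; apply: le_trans (mdot_le _ _).
  by rewrite /mdot; under [leRHS]eq_bigr do rewrite big_ord1.
by rewrite ler_norml le andbT lerNl -dotNl -[enorm u]enormN.
Qed.

Lemma dot_le n (u v : 'cV[R]_n) : dot u v <= enorm u * enorm v.
Proof. exact: le_trans (ler_norm _) (dotC_le _ _). Qed.

Lemma enorm_tr m n (A : 'M[R]_(m, n)) : enorm A^T = enorm A.
Proof.
rewrite /enorm exchange_big /=; congr Num.sqrt; apply: eq_bigr => i _.
by apply: eq_bigr => j _; rewrite mxE.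
Qed.

Lemma enormM m n p (A : 'M[R]_(m, n)) (B : 'M[R]_(n, p)) :
  enorm (A *m B) <= enorm A * enorm B.
Proof.
rewrite -(ler_pXn2r (n:=2)) ?nnegrE ?mulr_ge0// exprMn !enorm_sqr.
have -> : (\sum_i \sum_j A i j ^+ 2) * (\sum_i \sum_j B i j ^+ 2) =
  \sum_i \sum_k ((\sum_j A i j ^+ 2) * (\sum_j B j k ^+ 2)).
  rewrite [X in _ * X]exchange_big /= mulr_suml; apply: eq_bigr => i _.
  by rewrite mulr_sumr.
apply: ler_sum => i _; apply: ler_sum => k _; rewrite mxE.
exact: cauchy_schwarz_sum.
Qed.

Lemma enorm_le_coord m n (A : 'M[R]_(m, n)) i j : `|A i j| <= enorm A.
Proof.
rewrite -(ler_pXn2r (n:=2)) ?nnegrE// real_normK ?num_real// enorm_sqr.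
rewrite (bigD1 i) //= (bigD1 j) //= -addrA lerDl addr_ge0//.
  by apply: sumr_ge0 => *; exact: sqr_ge0.
by apply: sumr_ge0 => *; apply: sumr_ge0 => *; exact: sqr_ge0.
Qed.

Lemma enorm_coord_le m n (A : 'M[R]_(m, n)) e : 0 <= e ->
  (forall i j, `|A i j| <= e) -> enorm A <= (m * n)%:R * e.
Proof.
move=> e0 Ae; rewrite -(ler_pXn2r (n:=2)) ?nnegrE ?mulr_ge0// enorm_sqr.
apply: (@le_trans _ _ (\sum_(i < m) \sum_(j < n) e ^+ 2)).
  apply: ler_sum => i _; apply: ler_sum => j _.
  by rewrite -real_normK ?num_real// ler_pXn2r ?nnegrE.
have -> : \sum_(i < m) \sum_(j < n) e ^+ 2 = (m * n)%:R * e ^+ 2.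
  by rewrite !sumr_const !card_ord -mulrnA mulnC mulr_natl.
rewrite exprMn; apply: ler_wpM2r; first exact: sqr_ge0.
by rewrite -natrX ler_nat; case: (m * n)%N => [|x]//; rewrite leq_pmull.
Qed.

Lemma enorm_eq0 m n (A : 'M[R]_(m, n)) : enorm A = 0 -> A = 0.
Proof.
move=> A0; apply/matrixP => i j; rewrite mxE; apply/eqP.
by rewrite -normr_eq0 eq_le normr_ge0 -A0 enorm_le_coord.
Qed.

Lemma enormD_sqr n (u v : 'cV[R]_n) :
  enorm (u + v) ^+ 2 = enorm u ^+ 2 + 2 * dot u v + enorm v ^+ 2.
Proof. rewrite -!dot_enorm !dotlin (dotC v u); ring. Qed.

Lemma enorm_sqrD_le n (u v : 'cV[R]_n) :
  enorm (u + v) ^+ 2 <= 2 * enorm u ^+ 2 + 2 * enorm v ^+ 2.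
Proof.
have := sqr_ge0 (enorm (u - v)); rewrite !enormD_sqr enormN dotNr; lra.
Qed.

(** Summing over the columns of [s] turns an inequality between quadratic forms into one between
    traces along the noise. *)
Lemma mx_psd_trace k d (s : 'M[R]_(k, d)) (M : 'M[R]_k) :
  \tr (s *m s^T *m M) = \sum_l dot (col l s) (M *m col l s).
Proof.
rewrite -mulmxA mxtrace_mulC /mxtrace; apply: eq_bigr => l _.
rewrite -mulmxA mxE dotE; apply: eq_bigr => i _; rewrite !mxE; congr (_ * _).
by apply: eq_bigr => j _; rewrite !mxE.
Qed.

Lemma enorm_cols k d (s : 'M[R]_(k, d)) :
  enorm s ^+ 2 = \sum_l enorm (col l s) ^+ 2.
Proof.
rewrite enorm_sqr exchange_big /=; apply: eq_bigr => l _.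
rewrite enorm_sqr; apply: eq_bigr => i _; by rewrite big_ord1 mxE.
Qed.

End Euclid.
#[export] Hint Resolve enorm_ge0 : core.

(** * Polynomials with constant Laplacian and given values on a sphere *)

Section Harmonic.
Variables (R : realType) (d : nat).
Local Notation poly := (mpoly.mpoly d R).
Local Notation D := (@mpoly.mderiv d R).
Local Notation xx i := (@mpoly.mpolyX d R (mpoly.mnm1 i)).
Implicit Types p q s F G : poly.

Definition lap (p : poly) : poly := \sum_i D i (D i p).
(** Euler's operator. Homogeneity of degree k is expressed below by [eul p = p *+ k], which combines
    directly with the commutation rules for [lap] and [sqnorm]. *)
Definition eul (p : poly) : poly := \sum_i xx i * D i p.
Definition sqnorm : poly := \sum_i xx i ^+ 2.

Lemma mderiv_X i j : D i (xx j) = (i == j)%:R.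
Proof.
rewrite mpoly.mderivX mpoly.mnm1E eq_sym; case: eqVneq => [->|_].
  rewrite scale1r (_ : mpoly.mnm_sub _ _ = mpoly.mnm0) ?mpoly.mpolyX0//.
  by apply/mpoly.mnmP => l; rewrite mpoly.mnmBE mpoly.mnm0E subnn.
by rewrite scale0r.
Qed.

Lemma mderiv_Xid i : D i (xx i) = 1.
Proof. by rewrite mderiv_X eqxx. Qed.

Lemma mderiv_sum (I : finType) (P : pred I) i (F : I -> poly) :
  D i (\sum_(j | P j) F j) = \sum_(j | P j) D i (F j).
Proof. exact: raddf_sum. Qed.

Lemma mderiv_sqnorm i : D i sqnorm = xx i *+ 2.
Proof.
rewrite mderiv_sum (bigD1 i) //= big1 ?addr0 => [|j ji].
  by rewrite expr2 mpoly.mderivM mderiv_X eqxx mul1r mulr1 mulr2n.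
by rewrite expr2 mpoly.mderivM mderiv_X eq_sym (negbTE ji) mul0r mulr0 addr0.
Qed.

Lemma lapD p q : lap (p + q) = lap p + lap q.
Proof. by rewrite -big_split; apply: eq_bigr => i _; rewrite !raddfD. Qed.
Lemma lapZ a p : lap (a *: p) = a *: lap p.
Proof. by rewrite scaler_sumr; apply: eq_bigr => i _; rewrite !linearZ. Qed.
Lemma lapB p q : lap (p - q) = lap p - lap q.
Proof. by rewrite lapD -scaleN1r lapZ scaleN1r. Qed.
Lemma eulD p q : eul (p + q) = eul p + eul q.
Proof.
by rewrite -big_split; apply: eq_bigr => i _; rewrite raddfD mulrDr.
Qed.
Lemma eulZ a p : eul (a *: p) = a *: eul p.
Proof.
by rewrite scaler_sumr; apply: eq_bigr => i _; rewrite linearZ /= scalerAr.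
Qed.
Lemma eulB p q : eul (p - q) = eul p - eul q.
Proof. by rewrite eulD -scaleN1r eulZ scaleN1r. Qed.

Lemma lap_sqnormM F :
  lap (sqnorm * F) = sqnorm * lap F + eul F *+ 4 + F *+ (2 * d).
Proof.
have -> : F *+ (2 * d) = \sum_(i < d) F *+ 2.
  by rewrite sumr_const card_ord mulrnA.
rewrite /lap /eul mulr_sumr -sumrMnl -!big_split /=; apply: eq_bigr => i _.
rewrite mpoly.mderivM mderiv_sqnorm mpoly.mderivD !mpoly.mderivM mderiv_sqnorm.
rewrite raddfMn /= mderiv_Xid; ring.
Qed.

Lemma eul_sqnormM F : eul (sqnorm * F) = sqnorm * F *+ 2 + sqnorm * eul F.
Proof.
have -> : sqnorm * F *+ 2 = \sum_i xx i ^+ 2 * F *+ 2.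
  by rewrite /sqnorm mulr_suml sumrMnl.
rewrite /eul mulr_sumr -big_split /=; apply: eq_bigr => i _.
by rewrite mpoly.mderivM mderiv_sqnorm; ring.
Qed.

(** The commutator of [lap] and [eul] is twice [lap]; hence the Laplacian of a form of degree k + 2
    has degree k. *)
Lemma eul_lap F : lap (eul F) = lap F *+ 2 + eul (lap F).
Proof.
rewrite /lap /eul.
under [X in _ = _ + X]eq_bigr do rewrite mderiv_sum mulr_sumr.
rewrite exchange_big /= -sumrMnl -big_split /=; apply: eq_bigr => i _.
rewrite !mderiv_sum [RHS]addrC (bigD1 i) //= [X in _ = X + _](bigD1 i) //=.
rewrite [RHS]addrAC; congr (_ + _).
  by rewrite !(mpoly.mderivM, mpoly.mderivD) !mderiv_Xid -[1]/(mpoly.mpolyC _ 1) mpoly.mderivC; ring.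
apply: eq_bigr => j ji.
rewrite !(mpoly.mderivM, mpoly.mderivD) !mderiv_X eq_sym (negbTE ji) mpoly.mderiv0.
rewrite !mul0r !add0r; congr (_ * _).
by rewrite [RHS](mpoly.mderiv_comm i j) (mpoly.mderiv_comm i j F).
Qed.

Lemma eul_monomial m :
  eul (@mpoly.mpolyX d R m) = @mpoly.mpolyX d R m *+ mpoly.mdeg m.
Proof.
rewrite mpoly.mdegE -sumrMnr /eul; apply: eq_bigr => i _.
rewrite mpoly.mderivX -scalerAr -mpoly.mpolyXD scaler_nat.
have [->|mi0] := posnP (m i); first by rewrite !mulr0n.
congr (_ *+ _); congr (mpoly.mpolyX _ _); apply/mpoly.mnmP => j.
rewrite mpoly.mnmDE mpoly.mnmBE mpoly.mnm1E; case: eqVneq => [<-|_] /=.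
  by rewrite add1n subn1 prednK.
by rewrite subn0.
Qed.

Lemma mcoeff_eul p m : mpoly.mcoeff m (eul p) = mpoly.mcoeff m p *+ mpoly.mdeg m.
Proof.
rewrite (mpoly.mpolyE p); elim: (mpoly.msupp p) => [|k r IH].
  by rewrite big_nil mpoly.mcoeff0 mul0rn /eul big1 ?mpoly.mcoeff0// => i _; rewrite raddf0 mulr0.
rewrite big_cons eulD eulZ eul_monomial !mpoly.mcoeffD mulrnDl IH; congr (_ + _).
rewrite !mpoly.mcoeffZ mpoly.mcoeffMn !mpoly.mcoeffX.
by case: eqVneq => [->|_]; rewrite ?mul0rn ?mulr0 ?mul0rn// mulr1 mulr_natr.
Qed.

(** By [eul_lap], the coefficient c of a monomial of degree n in [lap F] satisfies k c = (n + 2) c,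
    hence vanishes for k < 2. *)
Lemma lap_low k F : eul F = F *+ k -> (k < 2)%N -> lap F = 0.
Proof.
move=> EF k2; have := eul_lap F; rewrite EF.
have -> : lap (F *+ k) = lap F *+ k.
  by rewrite /lap -sumrMnl; apply: eq_bigr => i _; rewrite !raddfMn.
move=> E; apply/mpoly.mpolyP => m; rewrite mpoly.mcoeff0.
move/(congr1 (mpoly.mcoeff m)): E.
rewrite mpoly.mcoeffD !mpoly.mcoeffMn mcoeff_eul -mulrnDr => /eqP.
rewrite -subr_eq0 -mulr_natr -[X in _ - X]mulr_natr -mulrBr mulf_eq0 => /orP[/eqP//|].
rewrite subr_eq0 eqr_nat => /eqP kE; move: k2; rewrite kE.
by rewrite -[X in (_ < X)%N]addn0 ltn_add2l.
Qed.

(** Apply the Laplacian to the equation for a form of degree k + 2: t = [lap s] must solve the same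
    equation for [lap p], of degree k, with c increased by 4 k + 2 d. Once t is known by induction,
    the equation itself gives s = c^-1 (p - |x|^2 t). *)
Lemma sqnorm_lap_onto n k (c : R) p : (k <= n)%N -> 0 < c -> eul p = p *+ k ->
  exists2 s, eul s = s *+ k & sqnorm * lap s + c *: s = p.
Proof.
elim: n k c p => [|n IH] k c p kn c0 Ep.
  exists (c^-1 *: p); first by rewrite eulZ Ep scalerMnr.
  rewrite lapZ (lap_low Ep) ?scaler0 ?mulr0 ?add0r ?scalerA ?divff ?gt_eqF ?scale1r//.
  by rewrite (leq_ltn_trans kn).
case: (ltnP k 2) => k2.
  exists (c^-1 *: p); first by rewrite eulZ Ep scalerMnr.
  by rewrite lapZ (lap_low Ep)// scaler0 mulr0 add0r scalerA divff ?gt_eqF// scale1r.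
case: k k2 kn Ep => [|[|k]]// _ kn Ep.
have c'0 : 0 < c + (4 * k + 2 * d)%:R by rewrite ltr_wpDr.
have Elp : eul (lap p) = lap p *+ k.
  have := eul_lap p; rewrite Ep.
  have -> : lap (p *+ k.+2) = lap p *+ k.+2.
    by rewrite /lap -sumrMnl; apply: eq_bigr => i _; rewrite !raddfMn.
  by rewrite -addn2 mulrnDr addrC => /addrI.
have [|t Et Ht] := IH k _ _ _ c'0 Elp; first exact: ltnW kn.
exists (c^-1 *: (p - sqnorm * t)).
  rewrite eulZ eulB eul_sqnormM Et Ep scalerMnr; congr (_ *: _).
  by rewrite mulrnAr -mulrnDr add2n mulrnBl.
have -> : lap (c^-1 *: (p - sqnorm * t)) = t.
  rewrite lapZ lapB lap_sqnormM Et -Ht -[_ + _ *+ 4 + _]addrA.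
  have -> : t *+ k *+ 4 + t *+ (2 * d) = (4 * k + 2 * d)%:R *: t.
    by rewrite -mulrnA -mulrnDr mulnC scaler_nat.
  rewrite opprD addrACA subrr add0r -scalerBl addrK.
  by rewrite scalerA mulVf ?gt_eqF// scale1r.
by rewrite scalerA divff ?gt_eqF// scale1r addrC subrK.
Qed.

(** For p of degree k + 2, choose s of degree k such that |x|^2 s has the Laplacian of p: this is
    [sqnorm_lap_onto] with constant 4 k + 2 d, positive since d > 0. Then p - |x|^2 s is harmonic,
    and in |x|^2 s = rho s + (|x|^2 - rho) s the form s is decomposed by induction. *)
Lemma harmonic_decomp_homog (d_gt0 : (0 < d)%N) (rho : R) k p :
  eul p = p *+ k ->
  exists q s, lap q = 0 /\ p = q + (sqnorm - rho *: 1) * s.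
Proof.
elim: k {-2}k (leqnn k) p => [|n IH] k kn p Ep.
  exists p, 0; rewrite mulr0 addr0 (lap_low Ep)//; exact: leq_ltn_trans kn _.
case: (ltnP k 2) => k2; first by exists p, 0; rewrite mulr0 addr0 (lap_low Ep).
case: k k2 kn Ep => [|[|k]]// _ kn Ep.
have c0 : (0 : R) < (4 * k + 2 * d)%:R by rewrite ltr0n addn_gt0 orbC muln_gt0 d_gt0.
have Elp : eul (lap p) = lap p *+ k.
  have := eul_lap p; rewrite Ep.
  have -> : lap (p *+ k.+2) = lap p *+ k.+2.
    by rewrite /lap -sumrMnl; apply: eq_bigr => i _; rewrite !raddfMn.
  by rewrite -addn2 mulrnDr addrC => /addrI.
have [s Es Hs] := sqnorm_lap_onto (leqnn k) c0 Elp.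
have kn' : (k <= n)%N by exact: ltnW kn.
have [q1 [s1 [Lq1 s_eq]]] := IH k kn' s Es.
exists (p - sqnorm * s + rho *: q1), (s + rho *: s1); split.
  rewrite lapD lapB lapZ Lq1 scaler0 addr0 -Hs lap_sqnormM Es -[_ + _ *+ 4 + _]addrA.
  have -> : s *+ k *+ 4 + s *+ (2 * d) = (4 * k + 2 * d)%:R *: s.
    by rewrite -mulrnA -mulrnDr mulnC scaler_nat.
  by rewrite subrr.
have sc (x : poly) : rho *: x = (rho *: 1) * x by rewrite -scalerAl mul1r.
rewrite (sc q1) (sc s1); set C : poly := rho *: 1 in s_eq *.
apply: subr0_eq; rewrite (_ : _ - _ = C * (s - (q1 + (sqnorm - C) * s1))); last by ring.
by rewrite -s_eq subrr mulr0.
Qed.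

Lemma harmonic_decomp (d_gt0 : (0 < d)%N) (rho : R) p :
  exists q s, lap q = 0 /\ p = q + (sqnorm - rho *: 1) * s.
Proof.
rewrite [p]mpoly.mpolyE; elim: (mpoly.msupp _) => [|m ms [q [s [Lq E]]]].
  exists 0, 0; rewrite big_nil mulr0 addr0; split=> //.
  by rewrite /lap big1// => i _; rewrite !raddf0.
have [q1 [s1 [Lq1 E1]]] :=
  harmonic_decomp_homog d_gt0 rho (eul_monomial m).
rewrite big_cons; set c := mpoly.mcoeff m _.
exists (c *: q1 + q), (c *: s1 + s); split.
  by rewrite lapD lapZ Lq Lq1 scaler0 addr0.
by rewrite E {1}E1 scalerDr mulrDr -scalerAr addrACA.
Qed.

End Harmonic.

(** * Second-order expansions of polynomials *)

Section Taylor.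
Variables (R : realType) (d : nat).
Local Notation poly := (mpoly.mpoly d R).
Local Notation D := (@mpoly.mderiv d R).
Local Notation xx i := (@mpoly.mpolyX d R (mpoly.mnm1 i)).
Implicit Types (p q : poly) (g : 'cV[R]_d).

Definition peval p g : R := mpoly.meval (fun i => g i ord0) p.

Lemma pevalD p q g : peval (p + q) g = peval p g + peval q g.
Proof. exact: mpoly.mevalD. Qed.
Lemma pevalM p q g : peval (p * q) g = peval p g * peval q g.
Proof. exact: mpoly.mevalM. Qed.
Lemma pevalZ a p g : peval (a *: p) g = a * peval p g.
Proof. exact: mpoly.mevalZ. Qed.
Lemma pevalC a g : peval (mpoly.mpolyC _ a) g = a.
Proof. exact: mpoly.mevalC. Qed.
Lemma pevalX i g : peval (xx i) g = g i ord0.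
Proof. exact: mpoly.mevalXU. Qed.
Lemma peval_sum (I : finType) (F : I -> poly) g :
  peval (\sum_i F i) g = \sum_i peval (F i) g.
Proof. exact: raddf_sum. Qed.

(** The regularity asked of the functions of g in the trace inequality: an expansion whose remainder
    is little-o of |c|^2. *)
Definition taylor2 (H : 'cV[R]_d -> R) g (G : 'cV[R]_d) (M : 'M[R]_d) :=
  forall e : R, 0 < e -> exists2 r : R, 0 < r & forall c, enorm c <= r ->
    `|H (g + c) - H g - dot G c - 2^-1 * dot c (M *m c)| <= e * enorm c ^+ 2.

Definition pgrad p g : 'cV[R]_d := \col_i peval (D i p) g.
Definition phess p g : 'M[R]_d := \matrix_(i, j) peval (D j (D i p)) g.

Let lin p g (c : 'cV[R]_d) := \sum_i peval (D i p) g * c i ord0.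
Let quad p g (c : 'cV[R]_d) :=
  \sum_i \sum_j peval (D j (D i p)) g * (c i ord0 * c j ord0).

Let linM p q g c : lin (p * q) g c = peval p g * lin q g c + peval q g * lin p g c.
Proof.
rewrite /lin !mulr_sumr -big_split; apply: eq_bigr => i _ /=.
by rewrite mpoly.mderivM pevalD !pevalM; ring.
Qed.

Let quadM p q g c : quad (p * q) g c =
  peval p g * quad q g c + peval q g * quad p g c + 2 * (lin p g c * lin q g c).
Proof.
have -> : 2 * (lin p g c * lin q g c) = \sum_i \sum_j
   (peval (D i p) g * peval (D j q) g + peval (D j p) g * peval (D i q) g)
     * (c i ord0 * c j ord0).
  transitivity (lin p g c * lin q g c + lin q g c * lin p g c); first by ring.
  rewrite /lin !mulr_suml -big_split; apply: eq_bigr => i _ /=.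
  by rewrite !mulr_sumr -big_split; apply: eq_bigr => j _ /=; ring.
rewrite /quad !mulr_sumr -!big_split; apply: eq_bigr => i _ /=.
rewrite !mulr_sumr -!big_split; apply: eq_bigr => j _ /=.
by rewrite !(mpoly.mderivM, mpoly.mderivD) !pevalD !pevalM; ring.
Qed.

Let rem p g c := peval p (g + c) - peval p g - lin p g c - 2^-1 * quad p g c.

(** A remainder of third order, for increments in the unit ball. Constants and variables have it,
    sums and products preserve it, so [cubicP] follows by induction on the polynomial. *)
Let cubic p := forall g, exists2 C : R, 0 <= C & forall c, enorm c <= 1 ->
  `|rem p g c| <= C * enorm c ^+ 3.

Let lin_le p g : exists2 C : R, 0 <= C & forall c, `|lin p g c| <= C * enorm c.
Proof.
exists (enorm (pgrad p g)) => // c; apply: le_trans (dotC_le _ _).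
by rewrite dotE /lin; under [in leRHS]eq_bigr do rewrite mxE.
Qed.

Let quad_dot p g c : quad p g c = dot c (phess p g *m c).
Proof.
rewrite dotE; apply: eq_bigr => i _; rewrite mxE mulr_sumr; apply: eq_bigr => j _.
by rewrite mxE; ring.
Qed.

Let quad_le p g : exists2 C : R, 0 <= C & forall c, `|quad p g c| <= C * enorm c ^+ 2.
Proof.
exists (enorm (phess p g)) => // c; rewrite quad_dot.
apply: le_trans (dotC_le _ _) _; rewrite expr2 mulrA [leRHS]mulrC ler_wpM2l ?enorm_ge0//.
exact: enormM.
Qed.

Let cubicM p q : cubic p -> cubic q -> cubic (p * q).
Proof.
move=> cp cq g.
have [Cp Cp0 hp] := cp g; have [Cq Cq0 hq] := cq g.
have [A A0 hA] := lin_le p g; have [A' A'0 hA'] := lin_le q g.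
have [B B0 hB] := quad_le p g; have [B' B'0 hB'] := quad_le q g.
set P := peval p g; set Q := peval q g.
exists (`|P| * Cq + `|Q| * Cp + A * B' + B * A' + B * B' + Cp * (A' + B' + Cq)
        + Cq * (A + B)).
  by rewrite !addr_ge0// !mulr_ge0// ?addr_ge0.
move=> c c1; have n0 := enorm_ge0 c; set n := enorm c in c1 n0 *.
(* Multiplying the two expansions leaves exactly these terms; each contains a remainder or has total
   order at least three. *)
have -> : rem (p * q) g c = P * rem q g c + Q * rem p g c
   + 2^-1 * (lin p g c * quad q g c) + 2^-1 * (quad p g c * lin q g c)
   + 4^-1 * (quad p g c * quad q g c)
   + rem p g c * (lin q g c + 2^-1 * quad q g c + rem q g c)
   + rem q g c * (lin p g c + 2^-1 * quad p g c).
  by rewrite /rem linM quadM !pevalM -/P -/Q; field.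
move: (hp c c1) (hq c c1) (hA c) (hA' c) (hB c) (hB' c).
move: (rem p g c) (rem q g c) (lin p g c) (lin q g c) (quad p g c) (quad q g c).
rewrite -/n => rp rq lp lq qp qq hrp hrq hlp hlq hqp hqq.
have n2 : n ^+ 2 <= n by rewrite expr2 ler_piMr.
have n3 : n ^+ 3 <= n ^+ 2 by rewrite exprS ler_piMl ?exprn_ge0.
have n30 : 0 <= n ^+ 3 by rewrite exprn_ge0.
have n20 : 0 <= n ^+ 2 by rewrite exprn_ge0.
have half (x : R) : `|2^-1 * x| <= `|x|.
  by rewrite normrM (ger0_norm (_ : 0 <= 2^-1)) ?invr_ge0//; have := normr_ge0 x; lra.
have M3 (x y a b : R) k l : 0 <= a -> 0 <= b -> `|x| <= a * n ^+ k ->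
    `|y| <= b * n ^+ l -> (3 <= k + l)%N -> `|x * y| <= a * b * n ^+ 3.
  move=> a0 b0 hx hy kl; rewrite normrM; apply: le_trans (ler_pM _ _ hx hy) _ => //.
  rewrite mulrACA -exprD ler_wpM2l ?mulr_ge0//.
  by rewrite -(subnKC kl) exprD ler_piMr// exprn_ile1.
have hlp1 : `|lp| <= A * n ^+ 1 by rewrite expr1.
have hlq1 : `|lq| <= A' * n ^+ 1 by rewrite expr1.
have up (x a : R) k : 0 <= a -> `|x| <= a * n ^+ k.+1 -> `|x| <= a * n ^+ 1.
  move=> a0 hx; apply: le_trans hx _; rewrite ler_wpM2l// exprS expr1 ler_piMr//.
  exact: exprn_ile1.
rewrite !mulrDl.
apply: le_trans (ler_normD _ _) (lerD _ _); last first.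
  apply: (M3 _ _ _ _ 3 1) => //; first by rewrite addr_ge0.
  rewrite mulrDl; apply: le_trans (ler_normD _ _) (lerD hlp1 _).
  exact: le_trans (half _) (up _ _ _ B0 hqp).
apply: le_trans (ler_normD _ _) (lerD _ _); last first.
  apply: (M3 _ _ _ _ 3 1) => //; first by rewrite !addr_ge0.
  rewrite !mulrDl; apply: le_trans (ler_normD _ _) (lerD _ _); last exact: up hrq.
  apply: le_trans (ler_normD _ _) (lerD hlq1 _).
  exact: le_trans (half _) (up _ _ _ B'0 hqq).
apply: le_trans (ler_normD _ _) (lerD _ _); last first.
  rewrite normrM; apply: le_trans; last exact: (M3 _ _ _ _ 2 2 B0 B'0 hqp hqq).
  rewrite (ger0_norm (_ : 0 <= 4^-1)) ?invr_ge0//.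
  by have := normr_ge0 (qp * qq); lra.
apply: le_trans (ler_normD _ _) (lerD _ _); last first.
  exact: le_trans (half _) (M3 _ _ _ _ 2 1 B0 A'0 hqp hlq1 _).
apply: le_trans (ler_normD _ _) (lerD _ _); last first.
  exact: le_trans (half _) (M3 _ _ _ _ 1 2 A0 B'0 hlp1 hqq _).
apply: le_trans (ler_normD _ _) (lerD _ _).
  by rewrite normrM -mulrA ler_wpM2l.
by rewrite normrM -mulrA ler_wpM2l.
Qed.

Let cubicC a : cubic (mpoly.mpolyC _ a).
Proof.
move=> g; exists 0 => // c _; rewrite mul0r /rem !pevalC subrr /lin big1 => [|i _].
  rewrite /quad big1 ?mulr0 ?subr0 ?normr0// => i _; rewrite big1// => j _.
  by rewrite mpoly.mderivC mpoly.mderiv0 -(mpoly.mpolyC0) pevalC mul0r.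
by rewrite mpoly.mderivC -(mpoly.mpolyC0) pevalC mul0r.
Qed.

Let cubicX i : cubic (xx i).
Proof.
have DX j : D j (xx i) = mpoly.mpolyC _ (j == i)%:R by rewrite mderiv_X mpolyC_nat.
move=> g; exists 0 => // c _; rewrite mul0r /rem !pevalX mxE.
have -> : lin (xx i) g c = c i ord0.
  rewrite /lin (bigD1 i) //= DX eqxx pevalC mul1r big1 ?addr0// => j ji.
  by rewrite DX (negbTE ji) pevalC mul0r.
have -> : quad (xx i) g c = 0.
  rewrite /quad big1// => j _; rewrite big1// => l _.
  by rewrite DX mpoly.mderivC -(mpoly.mpolyC0) pevalC mul0r.
by rewrite mulr0 subr0 (_ : _ - _ = 0) ?normr0//; ring.
Qed.

Let cubicD p q : cubic p -> cubic q -> cubic (p + q).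
Proof.
move=> cp cq g; have [C C0 hC] := cp g; have [C' C'0 hC'] := cq g.
exists (C + C') => [|c c1]; first exact: addr_ge0.
have -> : rem (p + q) g c = rem p g c + rem q g c.
  have -> : rem (p + q) g c = peval p (g + c) + peval q (g + c) - (peval p g + peval q g)
      - (lin p g c + lin q g c) - 2^-1 * (quad p g c + quad q g c).
    rewrite /rem !pevalD; congr (_ - _ - _ * _).
      by rewrite -big_split; apply: eq_bigr => i _ /=; rewrite raddfD /= pevalD mulrDl.
    rewrite /quad -big_split; apply: eq_bigr => i _ /=; rewrite -big_split.
    by apply: eq_bigr => j _ /=; rewrite !raddfD /= pevalD mulrDl.
  by rewrite /rem; ring.
by rewrite mulrDl; apply: le_trans (ler_normD _ _) (lerD (hC _ c1) (hC' _ c1)).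
Qed.

Let cubicP p : cubic p.
Proof.
have c1 : cubic 1 by rewrite -mpoly.mpolyC1; exact: cubicC.
rewrite (mpoly.mpolyE p); elim: (mpoly.msupp p) => [|m r IH].
  by rewrite big_nil -mpoly.mpolyC0; exact: cubicC.
rewrite big_cons -mpoly.mul_mpolyC; apply: cubicD => //; apply: cubicM.
  exact: cubicC.
rewrite mpoly.mpolyXE_id; elim: (index_enum _) => [|i s IHs]; first by rewrite big_nil.
rewrite big_cons; apply: cubicM => //.
elim: (fun_of_multinom m i) => [|k IHk]; first by rewrite expr0.
by rewrite exprS; exact: cubicM.
Qed.

Lemma taylor2_poly p g : taylor2 (peval p) g (pgrad p g) (phess p g).
Proof.
move=> e e0; have [C C0 hC] := cubicP p g.
exists (Num.min 1 (e / (C + 1))) => [|c].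
  by rewrite lt_min ltr01 divr_gt0// ltr_wpDl.
rewrite le_min => /andP[c1 ce].
have -> : dot (pgrad p g) c = lin p g c.
  by rewrite dotE; apply: eq_bigr => i _; rewrite mxE.
rewrite -quad_dot; apply: le_trans (hC c c1) _.
rewrite exprSr mulrCA [leRHS]mulrC ler_wpM2l ?sqr_ge0//.
have := ce; rewrite ler_pdivlMr ?ltr_wpDl//.
have := enorm_ge0 c; nra.
Qed.

Lemma trace_phess p g : \tr (phess p g) = peval (lap p) g.
Proof. by rewrite peval_sum; apply: eq_bigr => i _; rewrite mxE. Qed.

Lemma phess_sym p g : (phess p g)^T = phess p g.
Proof. by apply/matrixP => i j; rewrite !mxE mpoly.mderiv_comm. Qed.

End Taylor.

(** * Approximation of Lipschitz functions by Bernstein polynomials *)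

Section Bernstein.
Variable R : realType.

(* The mean of phi under a binomial law with n trials and success weight y. *)
Fixpoint binom_mean (A : comNzRingType) (n : nat) (y : A) (phi : nat -> A) : A :=
  if n is n'.+1 then
    y * binom_mean n' y (phi \o succn) + (1 - y) * binom_mean n' y phi
  else phi 0%N.

(** Evaluation at a point is such a morphism: the polynomial built by the recursion in the
    polynomial ring takes there the value of the same recursion in R. *)
Lemma binom_mean_morph (A B : comNzRingType) (f : {rmorphism A -> B}) n y phi :
  f (binom_mean n y phi) = binom_mean n (f y) (f \o phi).
Proof.
by elim: n phi => [|n IH] phi //=; rewrite rmorphD !rmorphM rmorphB rmorph1 !IH.
Qed.

Lemma binom_mean_dist n (y c : R) phi psi : 0 <= y <= 1 ->
  (forall k, `|phi k - c| <= psi k) ->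
  `|binom_mean n y phi - c| <= binom_mean n y psi.
Proof.
move=> y01; have /andP[y0 y1] := y01.
elim: n phi psi => [|n IH] phi psi le //=.
have -> : y * binom_mean n y (phi \o succn) + (1 - y) * binom_mean n y phi - c =
  y * (binom_mean n y (phi \o succn) - c) + (1 - y) * (binom_mean n y phi - c).
  by ring.
apply: le_trans (ler_normD _ _) (lerD _ _).
  by rewrite normrM ger0_norm// ler_wpM2l// IH// => k; exact: le.
by rewrite normrM (@ger0_norm _ (1 - y)) ?subr_ge0// ler_wpM2l ?subr_ge0// IH.
Qed.

(** Mean n y and variance n y (1 - y) of the binomial law; the shift [a] lets the induction on n go
    through. *)
Lemma binom_mean_sqr n (y A B a : R) :
  binom_mean n y (fun k => A + B * (k%:R + a) ^+ 2) =
  A + B * ((n%:R * y + a) ^+ 2 + n%:R * y * (1 - y)).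
Proof.
elim: n a => [|n IH] a /=; first by rewrite !mul0r addr0.
rewrite (_ : _ \o _ = fun k => A + B * (k%:R + (1 + a)) ^+ 2); last first.
  by apply/funext => k /=; rewrite -natr1 addrA.
by rewrite !IH -natr1; ring.
Qed.

Section Multi.
Variables (d : nat) (f : 'cV[R]_d -> R) (L r : R).
Hypothesis L0 : 0 <= L.
Hypothesis f_lip : forall x y, `|f x - f y| <= L * enorm (x - y).
Hypothesis r_gt0 : 0 < r.
Local Notation poly := (mpoly.mpoly d R).
Local Notation xx i := (@mpoly.mpolyX d R (mpoly.mnm1 i)).

Let node (n k : nat) : R := r * (2 * (k%:R / n.+1%:R) - 1).

Let setc (a : 'cV[R]_d) (i : 'I_d) (t : R) : 'cV[R]_d :=
  \col_j if j == i then t else a j ord0.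

Let unit_var i : poly := (2 * r)^-1 *: xx i + (mpoly.mpolyC _ 2^-1).

(** Bernstein polynomial in the coordinates listed, built one coordinate at a time; the remaining
    coordinates are frozen at their values in [a]. The nodes divide [-r, r] into n + 1 equal
    parts. *)
Let fixpoly (n : nat) : seq 'I_d -> 'cV[R]_d -> poly :=
  fix F (s : seq 'I_d) (a : 'cV[R]_d) : poly :=
    if s is i :: s' then
      binom_mean n.+1 (unit_var i) (fun k => F s' (setc a i (node n k)))
    else mpoly.mpolyC _ (f a).

Let mix (s : seq 'I_d) (a x : 'cV[R]_d) : 'cV[R]_d :=
  \col_j if j \in s then x j ord0 else a j ord0.

(** Randomising one coordinate costs L times the mean distance of the random node from x_i. That
    distance z is bounded by e + z^2 / (2 e), whose mean involves only the binomial variance. *)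
Let fixpolyP n s a (x : 'cV[R]_d) (e : R) : 0 < e -> uniq s -> (forall i, `|x i ord0| <= r) ->
  `|peval (fixpoly n s a) x - f (mix s a x)|
    <= (size s)%:R * (L * (e + r ^+ 2 / (n.+1%:R * e))).
Proof.
move=> e0 + xr; elim: s a => [|i s IH] a /=.
  rewrite pevalC (_ : mix _ _ _ = a) ?subrr ?normr0 ?mul0r//.
  by apply/matrixP => j l; rewrite mxE [l]ord1.
move=> /andP[is_ us].
(* Success weight for which the mean node is x_i. *)
set y : R := (2 * r)^-1 * x i ord0 + 2^-1.
have n0 : (0 : R) < n.+1%:R by rewrite ltr0n.
have y01 : 0 <= y <= 1.
  have := xr i; rewrite ler_norml => /andP[h1 h2].
  rewrite /y mulrC; apply/andP; split.
    by rewrite -lerBlDr sub0r ler_pdivlMr ?mulr_gt0//; lra.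
  by rewrite -lerBrDr ler_pdivrMr ?mulr_gt0//; lra.
have -> : peval (binom_mean n.+1 (unit_var i)
    (fun k => fixpoly n s (setc a i (node n k)))) x =
  binom_mean n.+1 y (fun k => peval (fixpoly n s (setc a i (node n k))) x).
  rewrite /peval binom_mean_morph; congr (binom_mean _ _ _).
  by rewrite -[LHS]/(peval (unit_var i) x) /unit_var pevalD pevalZ pevalX pevalC.
set E := L * (e + _).
pose b := mix s a x.
have xi : x i ord0 = r * (2 * y - 1) by rewrite /y; field; rewrite gt_eqF.
pose psi (k : nat) := (size s)%:R * E + L * e
  + (L * (2 * r / n.+1%:R) ^+ 2 / (2 * e)) * (k%:R + (- n.+1%:R * y)) ^+ 2.
apply: le_trans (@binom_mean_dist n.+1 y (f (mix (i :: s) a x)) _ psi y01 _) _.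
  move=> k; set p := peval _ _.
  have -> : p - f (mix (i :: s) a x) =
      (p - f (mix s (setc a i (node n k)) x))
      + (f (mix s (setc a i (node n k)) x) - f (mix (i :: s) a x)) by ring.
  apply: le_trans (ler_normD _ _) _; rewrite /psi -addrA; apply: lerD; first exact: IH.
  apply: le_trans (f_lip _ _) _.
  have -> : mix s (setc a i (node n k)) x - mix (i :: s) a x =
     (node n k - x i ord0) *: delta_mx i ord0.
    apply/matrixP => j l; rewrite !mxE inE [l]ord1 eqxx andbT.
    have [->|ji] := eqVneq j i; first by rewrite (negbTE is_) mulr1.
    by case: (j \in s) => /=; rewrite subrr mulr0.
  have -> : enorm ((node n k - x i ord0) *: delta_mx i ord0 : 'cV[R]_d) = `|node n k - x i ord0|.
    rewrite enormZ (_ : enorm (delta_mx i ord0 : 'cV[R]_d) = 1) ?mulr1//.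
    rewrite /enorm (bigD1 i) //= big_ord1 !mxE !eqxx expr1n big1 ?addr0 ?sqrtr1// => j ji.
    by rewrite big_ord1 mxE (negbTE ji) expr0n.
  set B := (_ + - _ * y) ^+ 2; set A := (2 * r / _) ^+ 2.
  have -> : L * A / (2 * e) * B = L * (A / (2 * e) * B) by rewrite !mulrA.
  rewrite -mulrDr ler_wpM2l// /A /B.
  have -> : node n k - x i ord0 = 2 * r / n.+1%:R * (k%:R - n.+1%:R * y).
    by rewrite xi /node; move: n0; set N : R := n.+1%:R => n0; field; rewrite gt_eqF.
  set z := _ * (_ - _).
  have -> : (2 * r / n.+1%:R) ^+ 2 / (2 * e) * (k%:R + - n.+1%:R * y) ^+ 2 = z ^+ 2 / (2 * e).
    by rewrite /z; move: n0; set N : R := n.+1%:R => n0; field; rewrite !gt_eqF.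
  have e20 : 0 < 2 * e by rewrite mulr_gt0.
  have : z ^+ 2 / (2 * e) * (2 * e) = `|z| ^+ 2.
    by rewrite divfK ?gt_eqF// real_normK ?num_real.
  move: (z ^+ 2 / (2 * e) : R) => w hw; rewrite -(@ler_pM2r _ (2 * e))// [leRHS]mulrDl hw.
  have := sqr_ge0 (`|z| - e); rewrite sqrrB -mulr_natr; nra.
rewrite /psi binom_mean_sqr.
have -> : (size s).+1%:R * E = (size s)%:R * E + E by rewrite -natr1 mulrDl mul1r.
rewrite -addrA lerD2l /E [leRHS]mulrDr lerD2l -mulrA -mulrA ler_wpM2l//.
have -> : (n.+1%:R * y + - n.+1%:R * y) ^+ 2 = 0 :> R by rewrite mulNr subrr expr0n.
rewrite add0r; set N : R := n.+1%:R in n0 *.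
have -> : (2 * r / N) ^+ 2 * ((2 * e)^-1 * (N * y * (1 - y))) =
  (r ^+ 2 / (N * e)) * (2 * (y * (1 - y))).
  by field; rewrite !gt_eqF.
rewrite ler_piMr ?divr_ge0 ?sqr_ge0 ?mulr_ge0 ?ltW//.
have := sqr_ge0 (y - 2^-1); nra.
Qed.

Lemma lipschitz_poly_approx (e : R) : 0 < e ->
  exists p : poly, forall x : 'cV[R]_d, (forall i, `|x i ord0| <= r) -> `|peval p x - f x| <= e.
Proof.
move=> e0.
set M : R := d%:R * L + 1.
have M0 : 0 < M by rewrite ltr_wpDl// mulr_ge0.
(* The error is at most d L (e' + r^2 / (N e')): e' is fixed here, and N is then taken so large that
   the quotient is at most e' as well. *)
have [e' e'0 e'E] : exists2 e', 0 < e' & e' * (2 * M) = e.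
  by exists (e / (2 * M)); rewrite ?divr_gt0 ?mulr_gt0 ?divfK ?gt_eqF ?mulr_gt0.
have [n hn] : exists n : nat, r ^+ 2 / (n.+1%:R * e') <= e'.
  exists (Num.bound (r ^+ 2 / (e' * e'))).
  have h0 : 0 <= r ^+ 2 / (e' * e') by rewrite divr_ge0 ?sqr_ge0 ?mulr_ge0 ?ltW.
  have /ltW h := archi_boundP h0.
  rewrite ler_pdivrMr ?mulr_gt0 ?ltr0n// mulrCA -ler_pdivrMr ?mulr_gt0//.
  by apply: le_trans h _; rewrite ler_nat.
exists (fixpoly n (enum 'I_d) 0) => x xr.
have := fixpolyP n 0 e'0 (enum_uniq 'I_d) xr.
rewrite (_ : mix _ _ _ = x); last first.
  by apply/matrixP => j l; rewrite mxE mem_enum [l]ord1.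
move/le_trans; apply; rewrite size_enum_ord.
apply: (@le_trans _ _ (M * (e' + e'))).
  rewrite mulrA; apply: ler_pM.
  - by rewrite mulr_ge0.
  - by rewrite addr_ge0 ?divr_ge0 ?sqr_ge0 ?mulr_ge0// ltW.
  - by rewrite /M lerDl ler01.
  - by rewrite lerD2l.
by rewrite -e'E le_eqVlt; apply/orP; left; apply/eqP; ring.
Qed.

End Multi.

(* The boundary datum is approximated by a polynomial, which is replaced by the
   harmonic polynomial with the same values on the sphere. *)
Lemma sphere_interpolation d (f : 'cV[R]_d -> R) (L r c e : R) :
  (0 < d)%N -> 0 <= L -> 0 < r -> 0 < e ->
  (forall x y, `|f x - f y| <= L * enorm (x - y)) ->
  exists (H : 'cV[R]_d -> R) (G : 'cV[R]_d -> 'cV[R]_d) (M : 'cV[R]_d -> 'M[R]_d),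
    [/\ forall g, taylor2 H g (G g) (M g),
        forall g, (M g)^T = M g,
        forall g, \tr (M g) = c
      & forall g, enorm g = r -> `|H g - f g| <= e].
Proof.
move=> d0 L0 r0 e0 fl.
have [p hp] := lipschitz_poly_approx L0 fl r0 e0.
have [q [s [Lq pE]]] := harmonic_decomp d0 (r ^+ 2) p.
have dR0 : (d%:R : R) != 0 by rewrite pnatr_eq0 -lt0n.
(* This multiple vanishes on the sphere and has Laplacian c, because |x|^2 has Laplacian 2 d. *)
pose w := (c / (2 * d%:R)) *: (sqnorm R d - r ^+ 2 *: 1).
exists (peval (q + w)), (pgrad (q + w)), (phess (q + w)); split.
- by move=> g; exact: taylor2_poly.
- by move=> g; exact: phess_sym.
- move=> g; rewrite trace_phess.
  have -> : lap (q + w) = mpoly.mpolyC _ c.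
    rewrite lapD Lq add0r /w lapZ lapB lapZ.
    have -> : lap (1 : mpoly.mpoly d R) = 0.
      rewrite /lap big1// => i _.
      by rewrite -mpoly.mpolyC1 mpoly.mderivC mpoly.mderiv0.
    rewrite scaler0 subr0.
    have -> : lap (sqnorm R d) = (2 * d)%:R.
      rewrite /lap (eq_bigr (fun=> 2%:R)) => [|i _].
        by rewrite sumr_const card_ord -mulrnA.
      by rewrite mderiv_sqnorm raddfMn /= mderiv_Xid.
    have -> : (2 * d)%:R = (2 * d)%:R *: (1 : mpoly.mpoly d R) by rewrite scaler_nat.
    rewrite scalerA -mulrA natrM mulVf ?mulr1 ?mulf_neq0 ?pnatr_eq0 -?lt0n//.
    by rewrite -mpoly.mul_mpolyC mulr1.
  by rewrite pevalC.
- move=> g gr.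
  have sq : peval (sqnorm R d - r ^+ 2 *: 1) g = 0.
    rewrite -scaleN1r scalerA pevalD pevalZ -mpoly.mpolyC1 pevalC mulr1 peval_sum -gr.
    rewrite enorm_sqr (eq_bigr (fun i => \sum_(j < 1) g i j ^+ 2)) => [|i _].
      by rewrite mulN1r subrr.
    by rewrite expr2 pevalM pevalX big_ord1 expr2.
  have -> : peval (q + w) g = peval p g.
    by rewrite pE /w !pevalD pevalZ pevalM sq mulr0 mul0r.
  apply: hp => i; rewrite -gr; exact: enorm_le_coord.
Qed.

End Bernstein.

(** * Semicontinuity and jets *)

Section Topology.
Variable R : realType.

Lemma nbhs_enorm m n (A : 'M[R]_(m, n)) (P : set 'M[R]_(m, n)) :
  nbhs A P <-> exists2 e : R, 0 < e & forall B, enorm (B - A) < e -> P B.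
Proof.
split.
  move=> /nbhs_ballP[e /= e0 h]; exists e => // B hB; apply: h; split=> // i j /=.
  rewrite -ball_normE /= distrC; apply: le_lt_trans hB.
  by have := enorm_le_coord (B - A) i j; rewrite !mxE.
move=> [e e0 h]; apply/nbhs_ballP.
have N0 : 0 < (m * n)%:R + 1 :> R by rewrite ltr_wpDl.
exists (e / ((m * n)%:R + 1)) => [|B hB]; first by rewrite /= divr_gt0.
apply: h; apply: (@le_lt_trans _ _ ((m * n)%:R * (e / ((m * n)%:R + 1)))).
  apply: enorm_coord_le => [|i j]; first by rewrite divr_ge0 ?ltW.
  have := hB.2 i j; rewrite -ball_normE /= distrC !mxE; exact: ltW.
by rewrite mulrA ltr_pdivrMr// mulrDr mulr1 mulrC ltrDl.
Qed.

(** Products of a time interval with a Euclidean ball form a base of neighbourhoods, so local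
    statements are given by radii from here on. *)
Definition close (k : nat) (r : R) (p p' : R * 'cV[R]_k) : Prop :=
  `|p'.1 - p.1| < r /\ enorm (p'.2 - p.2) < r.

Lemma nbhs_close k (p : R * 'cV[R]_k) (P : set (R * 'cV[R]_k)) :
  nbhs p P <-> exists2 e : R, 0 < e & forall p', close e p p' -> P p'.
Proof.
split.
  move=> [[U V] /= [hU hV] h].
  have [e1 /= e10 h1] := (nbhs_ballP _ _).1 hU.
  have [e2 e20 h2] := (nbhs_enorm _ _).1 hV.
  exists (Num.min e1 e2) => [|[t x] /= [ht hx]]; first by rewrite lt_min e10.
  apply: (h (t, x)); split => /=.
    by apply: h1; rewrite -ball_normE /= distrC; move: ht; rewrite lt_min => /andP[].
  by apply: h2; move: hx; rewrite lt_min => /andP[].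
move=> [e e0 h].
exists ([set t | `|t - p.1| < e], [set x | enorm (x - p.2) < e]) => /=.
  split; last by apply/nbhs_enorm; exists e.
  apply/nbhs_ballP; exists e => //= t.
  by rewrite -ball_normE /= distrC.
by move=> [t x] /= [ht hx]; apply: h.
Qed.

Lemma near_close k (D : set (R * 'cV[R]_k)) (p : R * 'cV[R]_k) (P : set (R * 'cV[R]_k)) :
  (\forall p' \near within D (nbhs p), P p') <->
  exists2 e : R, 0 < e & forall p', D p' -> close e p p' -> P p'.
Proof.
rewrite near_withinE; split.
  by move=> /nbhs_close[e e0 h]; exists e => // p' Dp' c; exact: h.
by move=> [e e0 h]; apply/nbhs_close; exists e => // p' c Dp'; exact: h.
Qed.

Lemma enorm_lip_continuous m n m' n' (f : 'M[R]_(m, n) -> 'M[R]_(m', n')) (C : R) :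
  0 <= C -> (forall A B, enorm (f B - f A) <= C * enorm (B - A)) -> continuous f.
Proof.
move=> C0 h A P /nbhs_enorm[e e0 hP]; apply/nbhs_enorm.
have C1 : 0 < C + 1 by rewrite ltr_wpDl.
exists (e / (C + 1)) => [|B hB]; first exact: divr_gt0.
apply: hP; apply: le_lt_trans (h _ _) _.
apply: (@le_lt_trans _ _ (C * (e / (C + 1)))); first by rewrite ler_wpM2l// ltW.
by rewrite mulrA ltr_pdivrMr// mulrDr mulr1 mulrC ltrDl.
Qed.

Lemma mulmx_continuous m n l (S : 'M[R]_(m, n)) :
  continuous (fun A : 'M[R]_(n, l) => S *m A).
Proof.
apply: (@enorm_lip_continuous _ _ _ _ _ (enorm S)) => [|A B]; first exact: enorm_ge0.
by rewrite -mulmxBr enormM.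
Qed.

Lemma enorm_continuous m n : continuous (@enorm R m n).
Proof.
move=> A P /nbhs_ballP[e /= e0 h]; apply/nbhs_enorm; exists e => // B hB.
apply: h; rewrite -ball_normE /= ltr_norml; apply/andP; split.
  have := enormD (B - A) A; rewrite subrK; lra.
have := enormD (A - B) B; rewrite subrK enormB; lra.
Qed.

Lemma dot_continuous n (q : 'cV[R]_n) : continuous (dot q).
Proof.
move=> x P /nbhs_ballP[e /= e0 h]; apply/nbhs_enorm.
have C1 : 0 < enorm q + 1 by rewrite ltr_wpDl ?enorm_ge0.
exists (e / (enorm q + 1)) => [|y hy]; first exact: divr_gt0.
apply: h; rewrite -ball_normE /= -dotNr -dotDr; apply: le_lt_trans (dotC_le _ _) _.
rewrite enormB; apply: (@le_lt_trans _ _ (enorm q * (e / (enorm q + 1)))).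
  by rewrite ler_wpM2l ?enorm_ge0// ltW.
by rewrite mulrA ltr_pdivrMr// mulrDr mulr1 mulrC ltrDl.
Qed.

Lemma compact_enorm_ball n (x : 'cV[R]_n) (r : R) :
  compact [set y | enorm (y - x) <= r].
Proof.
(* Closed bounded sets of row vectors are compact; transposition carries this over to columns. *)
have -> : [set y | enorm (y - x) <= r] =
   (fun v : 'rV[R]_n => v^T) @` [set v | enorm (v^T - x) <= r].
  apply/seteqP; split => [y /= hy|_ [v /= hv <-]//].
  by exists y^T; rewrite /= ?trmxK.
have tc : continuous (fun v : 'rV[R]_n => v^T).
  apply: (@enorm_lip_continuous _ _ _ _ _ 1) => // A B.
  by rewrite -linearB enorm_tr mul1r.
apply: continuous_compact; first exact: continuous_subspaceT.
apply: bounded_closed_compact.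
  exists (enorm x + r); split; first exact: num_real.
  move=> M hM v /= hv; rewrite [leLHS]/Num.norm /= mx_normrE.
  apply: (big_ind (fun a => a <= M)) => [|a b ha hb|[i j] _].
  - apply: le_trans (ltW hM); rewrite addr_ge0 ?enorm_ge0//.
    exact: le_trans (enorm_ge0 _) hv.
  - by rewrite ge_max ha.
  - apply: le_trans (enorm_le_coord v i j) _; rewrite -enorm_tr.
    apply: le_trans (ltW hM); have := enormD (v^T - x) x; rewrite subrK; lra.
have -> : [set v : 'rV[R]_n | enorm (v^T - x) <= r] =
  (fun v : 'rV[R]_n => enorm (v^T - x)) @^-1` [set t | t <= r] by [].
apply: preimage_closed; last exact: closed_le.
move=> v _.
apply: (@continuous_comp _ _ _ (fun v : 'rV[R]_n => v^T - x) (@enorm R n 1)).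
  apply: (@enorm_lip_continuous _ _ _ _ _ 1) => // A B.
  by rewrite opprD opprK addrACA addNr addr0 -linearB enorm_tr mul1r.
exact: enorm_continuous.
Qed.

Definition usc_in (X : topologicalType) (A : set X) (f : X -> R) :=
  forall x, A x -> forall e : R, 0 < e ->
    \forall y \near within A (nbhs x), f y < f x + e.

(** Without a maximum, the superlevel sets of the values of f form a base of a proper filter. At a
    cluster point x some y has f x < f y, and near x all values are below f y by semicontinuity, so
    the superlevel set of y cannot cluster there. *)
Lemma usc_max (X : topologicalType) (A : set X) (f : X -> R) :
  compact A -> A !=set0 -> usc_in A f ->
  exists2 x, A x & forall y, A y -> f y <= f x.
Proof.
move=> cA [a Aa] uf; apply: contrapT => nomax.
have big x : A x -> exists2 y, A y & f x < f y.
  move=> Ax; apply: contrapT => h; apply: nomax; exists x => // y Ay.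
  by rewrite leNgt; apply/negP => xy; apply: h; exists y.
pose F := filter_from A (fun x => [set y | A y /\ f x <= f y]).
have FF : ProperFilter F.
  apply: filter_from_proper; last by move=> x Ax; exists x.
  apply: filter_from_filter; first by exists a.
  move=> x y Ax Ay; have [xy|/ltW yx] := leP (f x) (f y).
    by exists y => // z [Az yz]; split; split => //; exact: le_trans yz.
  by exists x => // z [Az xz]; split; split => //; exact: le_trans xz.
have FA : F A by exists a => // z [].
have [x [Ax clx]] := cA F FF FA.
have [y Ay xy] := big x Ax.
have /(uf x Ax) : 0 < f y - f x by rewrite subr_gt0.
rewrite near_withinE addrC subrK => hn.
have [|z [[Az yz] h]] := clx [set z | A z /\ f y <= f z] _ _ hn; first by exists y.
by have := h Az; rewrite ltNge yz.
Qed.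

Lemma usc_inD (X : topologicalType) (A : set X) (f g : X -> R) :
  usc_in A f -> usc_in A g -> usc_in A (f \+ g).
Proof.
move=> uf ug x Ax e e0; have e2 : 0 < e / 2 by rewrite divr_gt0.
near=> y => /=.
have h1 : f y < f x + e / 2 by near: y; exact: uf.
have h2 : g y < g x + e / 2 by near: y; exact: ug.
lra.
Unshelve. all: by end_near. Qed.

Lemma usc_in_comp (X Y : topologicalType) (A : set X) (B : set Y) (f : Y -> R)
    (h : X -> Y) :
  usc_in B f -> (forall x, A x -> h @ within A (nbhs x) --> h x) ->
  (forall x, A x -> B (h x)) -> usc_in A (f \o h).
Proof.
move=> uf ch AB x Ax e e0.
have H0 : nbhs (h x) (fun y => B y -> f y < f (h x) + e) := uf _ (AB x Ax) e e0.
have H : nbhs x (fun z => A z -> B (h z) -> f (h z) < f (h x) + e) := ch x Ax _ H0.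
rewrite near_withinE; near=> y => Ay.
have H' : A y -> B (h y) -> f (h y) < f (h x) + e by near: y; exact: H.
exact: H' Ay (AB _ Ay).
Unshelve. all: by end_near. Qed.

Lemma continuous_usc_in (X : topologicalType) (A : set X) (f : X -> R) :
  (forall x, A x -> f @ within A (nbhs x) --> f x) -> usc_in A f.
Proof.
move=> cf x Ax e e0; have /cvgrPdist_lt /(_ e e0) := cf x Ax.
apply: filterS => y; rewrite ltr_norml => /andP[h1 h2]; lra.
Qed.

Lemma cvg_usc_in (X : topologicalType) (A : set X) (f : X -> R) :
  continuous f -> usc_in A f.
Proof.
move=> cf; apply: continuous_usc_in => x _; apply: cvg_within_filter; exact: cf.
Qed.

Lemma usc_in_sub (X : topologicalType) (A B : set X) (f : X -> R) :
  A `<=` B -> usc_in B f -> usc_in A f.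
Proof.
move=> AB uf x Ax e e0; have := uf x (AB _ Ax) e e0; rewrite !near_withinE.
by apply: filterS => y h /AB.
Qed.

End Topology.

(** * Jets with explicit remainders *)

Section Jets.
Variables (R : realType) (T : R) (k : nat).
Local Notation point := (R * 'cV[R]_k)%type.
Implicit Types (u : point -> R) (p : point) (J : point * 'M[R]_k).

Lemma jet_gauge_ge0 p p' : 0 <= jet_gauge p p'.
Proof. by rewrite addr_ge0 ?sqr_ge0. Qed.

Lemma superjetP u p J :
  superjet T u p J <-> J.2^T = J.2 /\ forall e : R, 0 < e ->
    exists2 r : R, 0 < r & forall p', strip T k p' -> close r p p' ->
      u p' <= jet_poly (u p) p J.1.1 J.1.2 J.2 p' + e * jet_gauge p p'.
Proof.
split=> [[Js [r ro near_u]]|[Js h]]; split=> //.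
  move=> e e0; move/eqoP: ro => /(_ e e0) ro.
  have [s1 s10 h1] := (near_close _ _ _).1 ro.
  have [s2 s20 h2] := (near_close _ _ _).1 near_u.
  exists (Num.min s1 s2) => [|p' sp' [c1 c2]]; first by rewrite lt_min s10.
  move: c1 c2; rewrite !lt_min => /andP[c11 c12] /andP[c21 c22].
  have {}h1 := h1 p' sp' (conj c11 c21); have {}h2 := h2 p' sp' (conj c12 c22).
  apply: le_trans h2 _; rewrite lerD2l; apply: le_trans (ler_norm _) _.
  by rewrite -[in leRHS](ger0_norm (jet_gauge_ge0 p p')).
(* The remainder is the positive part of the excess of u over the polynomial. *)
exists (fun p' => Num.max 0 (u p' - jet_poly (u p) p J.1.1 J.1.2 J.2 p')).
  apply/eqoP => e e0; apply/near_close; have [s s0 hs] := h e e0.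
  exists s => // p' sp' cp'; rewrite ger0_norm ?le_max ?lexx//.
  rewrite (ger0_norm (jet_gauge_ge0 _ _)) ge_max; apply/andP; split.
    by rewrite mulr_ge0 ?jet_gauge_ge0 ?ltW.
  by rewrite lerBlDl; exact: hs.
apply/near_close; exists 1 => // p' _ _.
by rewrite -lerBlDl le_max lexx orbT.
Qed.

Lemma subjet_opp u p J :
  subjet T u p J <-> superjet T (\- u) p (- J.1.1, - J.1.2, - J.2).
Proof.
have jp p' : jet_poly (- u p) p (- J.1.1) (- J.1.2) (- J.2) p' =
    - jet_poly (u p) p J.1.1 J.1.2 J.2 p'.
  by rewrite /jet_poly mulNmx dotNl dotNr; ring.
split=> -[/= Js [r ro hr]]; split=> /=.
- by rewrite linearN /= Js.
- exists (\- r); first by apply/eqoP => e e0; move/eqoP: ro => /(_ e e0);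
    apply: filterS => x /=; rewrite normrN.
  move: hr; apply: filterS => p' h; rewrite jp /= -opprB opprK; lra.
- by apply: oppr_inj; rewrite -[RHS]Js linearN.
- exists (\- r); first by apply/eqoP => e e0; move/eqoP: ro => /(_ e e0);
    apply: filterS => x /=; rewrite normrN.
  move: hr; apply: filterS => p' /=; rewrite jp /=; lra.
Qed.

Lemma subjetP u p J :
  subjet T u p J <-> J.2^T = J.2 /\ forall e : R, 0 < e ->
    exists2 r : R, 0 < r & forall p', strip T k p' -> close r p p' ->
      jet_poly (u p) p J.1.1 J.1.2 J.2 p' - e * jet_gauge p p' <= u p'.
Proof.
have jp p' : jet_poly (- u p) p (- J.1.1) (- J.1.2) (- J.2) p' =
    - jet_poly (u p) p J.1.1 J.1.2 J.2 p'.
  by rewrite /jet_poly mulNmx dotNl dotNr; ring.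
split=> [/subjet_opp/superjetP[Js h]|[Js h]].
  split; first by apply: oppr_inj; rewrite -[RHS]Js linearN.
  move=> e e0; have [r r0 hr] := h e e0; exists r => // p' sp cp.
  by have /= := hr p' sp cp; rewrite jp; lra.
apply/subjet_opp/superjetP; split; first by rewrite /= linearN /= Js.
move=> e e0; have [r r0 hr] := h e e0; exists r => // p' sp cp /=.
by have /= := hr p' sp cp; rewrite jp; lra.
Qed.

(** A multiple of the squared time increment is o(|t' - t|), so a quadratic penalty in time enters
    the jet only through its slope. *)
Lemma superjet_quad u p a (q : 'cV[R]_k) (M : 'M[R]_k) (C : R) :
  M^T = M ->
  (forall e : R, 0 < e -> exists2 r : R, 0 < r &
    forall p', strip T k p' -> close r p p' ->
    u p' <= jet_poly (u p) p a q M p' + C * (p'.1 - p.1) ^+ 2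
       + e * enorm (p'.2 - p.2) ^+ 2) ->
  superjet T u p (a, q, M).
Proof.
move=> Ms h; apply/superjetP; split=> // e e0.
have [s s0 hs] := h e e0.
have C0 : 0 < `|C| + 1 by rewrite ltr_wpDl.
exists (Num.min s (e / (`|C| + 1))); first by rewrite lt_min s0 divr_gt0.
move=> p' sp' [c1 c2]; move: c1 c2; rewrite !lt_min => /andP[c1 c3] /andP[c2 _].
apply: le_trans (hs p' sp' (conj c1 c2)) _.
rewrite -addrA lerD2l /jet_gauge mulrDr lerD2r.
rewrite -real_normK ?num_real// expr2 mulrA; apply: ler_wpM2r => //.
rewrite ltr_pdivlMr// in c3.
have := ler_norm C; have := normr_ge0 (p'.1 - p.1); nra.
Qed.

End Jets.

(** * A trace inequality in place of the theorem on sums *)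

Section Schur.
Variable R : realType.

Lemma quad_form_le n (Q : 'M[R]_n) (c : 'cV[R]_n) :
  `|dot c (Q *m c)| <= enorm Q * enorm c ^+ 2.
Proof.
apply: le_trans (dotC_le _ _) _; rewrite expr2 mulrA [leRHS]mulrC.
by rewrite ler_wpM2l ?enorm_ge0 ?enormM.
Qed.

Lemma second_order_min n (D : 'cV[R]_n) (Q : 'M[R]_n) :
  (forall e : R, 0 < e -> exists2 r : R, 0 < r & forall c, enorm c <= r ->
     0 <= dot D c + 2^-1 * dot c (Q *m c) + e * enorm c ^+ 2) ->
  D = 0 /\ forall c, 0 <= dot c (Q *m c).
Proof.
move=> h; have scale s c : 0 <= s -> dot (s *: c) (Q *m (s *: c)) = s ^+ 2 * dot c (Q *m c).
  by move=> s0; rewrite -scalemxAr !dotlin; ring.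
have D0 : D = 0.
  apply: enorm_eq0; have [r r0 hr] := h 1 ltr01.
  set N := enorm D; have N0 : 0 <= N by exact: enorm_ge0.
  apply/eqP; rewrite eq_le N0 andbT leNgt; apply/negP => Np.
  set C := 2^-1 * enorm Q + 1.
  have C0 : 0 < C by rewrite ltr_wpDl ?mulr_ge0 ?enorm_ge0.
  (* Along - s D the linear term is - s |D|^2, and for s <= 1 / (2 C) the second-order terms offset
     at most half of it. *)
  set s := Num.min (r / N) (1 / (2 * C)).
  have s0 : 0 < s by rewrite lt_min !divr_gt0 ?mulr_gt0.
  have := hr (- s *: D); rewrite enormZ normrN gtr0_norm// -/N.
  have -> : s * N <= r by rewrite -ler_pdivlMr// ge_min lexx.
  move=> /(_ isT); rewrite dotZr dot_enorm -/N.
  have -> : dot (- s *: D) (Q *m (- s *: D)) = s ^+ 2 * dot D (Q *m D).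
    by rewrite -scalemxAr !dotlin; ring.
  have hQ := le_trans (ler_norm _) (quad_form_le Q D); rewrite -/N in hQ.
  have sC : s * (2 * C) <= 1 by rewrite -ler_pdivlMr ?mulr_gt0// ge_min lexx orbT.
  have N2 : 0 < N ^+ 2 by rewrite exprn_gt0.
  have : 2^-1 * (s ^+ 2 * dot D (Q *m D)) + 1 * (s * N) ^+ 2 <= s * (s * C * N ^+ 2).
    rewrite /C exprMn; have := ler_wpM2l (sqr_ge0 s) hQ; nra.
  have : s * C * N ^+ 2 <= 2^-1 * N ^+ 2 by rewrite ler_pM2r//; nra.
  move=> h1 h2 h3.
  have : s * (s * C * N ^+ 2) <= s * (2^-1 * N ^+ 2) by rewrite ler_pM2l.
  have : 0 < s * N ^+ 2 by exact: mulr_gt0.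
  nra.
split=> // c; rewrite leNgt; apply/negP => cQ.
have c0 : 0 < enorm c ^+ 2.
  rewrite exprn_gt0// lt_neqAle enorm_ge0 andbT eq_sym; apply/eqP => /enorm_eq0 c0.
  by move: cQ; rewrite c0 dot0l ltxx.
have e0 : 0 < - dot c (Q *m c) / (4 * enorm c ^+ 2).
  by rewrite divr_gt0 ?oppr_gt0// pmulr_rgt0.
have [r r0 hr] := h _ e0.
have nc0 : 0 < enorm c + 1 by rewrite ltr_wpDl ?enorm_ge0.
have [s s0 sle] : exists2 s, 0 < s & s * enorm c <= r.
  exists (r / (enorm c + 1)); first exact: divr_gt0.
  by rewrite mulrAC ler_pdivrMr// ler_pM2l// lerDl.
have := hr (s *: c); rewrite enormZ gtr0_norm// (scale _ _ (ltW s0)) D0 dot0l add0r sle.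
move=> /(_ isT); rewrite exprMn; move: (enorm c ^+ 2) c0 e0 => E c0 e0.
have -> : - dot c (Q *m c) / (4 * E) * (s ^+ 2 * E) =
   - dot c (Q *m c) / 4 * s ^+ 2 by field; rewrite gt_eqF.
have : 0 < s ^+ 2 by rewrite exprn_gt0.
nra.
Qed.

Variables (T : R) (k d : nat).
Local Notation point := (R * 'cV[R]_k)%type.

(* Maximising jointly in an auxiliary variable [g] yields, by a Schur
   complement, a superjet whose trace along any noise [s] is controlled by the
   Hessian in [g] as soon as [s] is close to [S]. *)
Lemma schur_superjet (u : point -> R) (p ph : point) (g : 'cV[R]_d)
    (H : 'cV[R]_d -> R) (G : 'cV[R]_d) (M : 'M[R]_d) (S : 'M[R]_(k, d))
    (lam rho eta : R) :
  strip T k p -> 0 < lam -> 0 < rho -> 0 < eta -> taylor2 H g G M -> M^T = M ->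
  (forall p' g', strip T k p' -> close rho p p' -> enorm (g' - g) < rho ->
    u p' - lam / 2 * enorm (p'.2 - ph.2 - S *m g') ^+ 2
         - lam / 2 * (p'.1 - ph.1) ^+ 2 - H g' <=
    u p - lam / 2 * enorm (p.2 - ph.2 - S *m g) ^+ 2
         - lam / 2 * (p.1 - ph.1) ^+ 2 - H g) ->
  exists2 X : 'M[R]_k,
    superjet T u p (lam * (p.1 - ph.1), lam *: (p.2 - ph.2 - S *m g), X) &
    forall s : 'M[R]_(k, d), \tr (s *m s^T *m X) <=
      \tr M + eta * d%:R + lam * enorm (s - S) ^+ 2.
Proof.
move=> sp lam0 rho0 eta0 tH Ms hmax.
set y := p.2 - ph.2 - S *m g; set tau := p.1 - ph.1.
have enormS c : enorm (S *m c) ^+ 2 = dot c (S^T *m S *m c).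
  by rewrite -dot_enorm dot_mull mulmxA.
(* Optimality in g at fixed p: the gradient of H is lam S^T y and its Hessian is at least - lam S^T
   S. *)
have [GE Qpos] : G - lam *: (S^T *m y) = 0 /\
    forall c, 0 <= dot c ((M + lam *: (S^T *m S)) *m c).
  apply: second_order_min => e e0; have [r r0 hr] := tH e e0.
  exists (Num.min r (rho / 2)) => [|c]; first by rewrite lt_min r0 divr_gt0.
  rewrite le_min => /andP[cr crho].
  have crho' : enorm (g + c - g) < rho by rewrite addrC addKr; lra.
  have cpp : close rho p p by rewrite /close !subrr normr0 enorm0.
  have := hmax p (g + c) sp cpp crho'; have := hr c cr.
  rewrite mulmxDr opprD addrA -/y ler_norml => /andP[_ h1].
  rewrite enormD_sqr enormN dotNr (dot_mulr S c y) (enormS c) => h2.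
  rewrite mulmxDl -scalemxAl !dotlin; lra.
have Ge c : dot G c = lam * dot y (S *m c).
  by move/eqP: GE; rewrite subr_eq0 => /eqP ->; rewrite dotZl dot_mulr.
(* The term in [eta] makes the form positive definite, hence invertible. *)
pose P := M + lam *: (S^T *m S) + eta%:M.
have Pc c : dot c (P *m c) = dot c (M *m c) + lam * enorm (S *m c) ^+ 2 + eta * enorm c ^+ 2.
  rewrite /P !mulmxDl -scalemxAl mul_scalar_mx !dotlin dot_enorm.
  by rewrite enormS.
have Ps : P^T = P.
  by rewrite /P !linearD /= linearZ /= trmx_mul trmxK Ms tr_scalar_mx.
have Punit : P \in unitmx.
  rewrite -row_free_unit -kermx_eq0; apply/eqP/row_matrixP => i; rewrite row0.
  set v := row i (kermx P).
  have vP : v *m P = 0 by apply/sub_kermxP; rewrite row_sub.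
  have : dot v^T (P *m v^T) = 0.
    by rewrite -{1}Ps -trmx_mul vP trmx0 dot0r.
  rewrite Pc; have := Qpos v^T; rewrite mulmxDl -scalemxAl !dotlin -enormS => q0 q1.
  have : enorm v^T ^+ 2 <= 0.
    rewrite -(ler_pM2l eta0) mulr0; lra.
  rewrite -dot_enorm => h; apply: trmx_inj; rewrite trmx0; apply: enorm_eq0.
  apply/eqP; rewrite -[_ == _](@expf_eq0 _ _ 2) -dot_enorm eq_le h /=.
  exact: dot_ge0.
(* [A *m s] minimises c -> <c, P c> - 2 lam <c, S^T s>: it tells how g should follow a displacement
   s of the point. *)
have [A PA] : exists A : 'M[R]_(d, k), forall s : 'cV[R]_k,
    P *m (A *m s) = lam *: (S^T *m s).
  exists (lam *: (invmx P *m S^T)) => s.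
  by rewrite -scalemxAl -scalemxAr !mulmxA mulmxV// mul1mx.
(* Value of <c, M c> + lam |s - S c|^2 at this minimiser; since the term eta |c|^2 is left out, X
   lies below the full form for every c. *)
pose X := A^T *m M *m A + lam *: ((1%:M - S *m A)^T *m (1%:M - S *m A)).
have Xs c : dot c (X *m c) = dot (A *m c) (M *m (A *m c)) + lam * enorm (c - S *m (A *m c)) ^+ 2.
  rewrite /X mulmxDl -scalemxAl !dotlin; congr (_ + _ * _).
    by rewrite dot_mull !mulmxA.
  have -> : c - S *m (A *m c) = (1%:M - S *m A) *m c by rewrite mulmxBl mul1mx mulmxA.
  by rewrite -dot_enorm dot_mull mulmxA.
have Xmin (s : 'cV[R]_k) (c : 'cV[R]_d) : dot s (X *m s) <=
    dot c (M *m c) + lam * enorm (s - S *m c) ^+ 2 + eta * enorm c ^+ 2.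
  pose F (c : 'cV[R]_d) := dot c (P *m c) - 2 * lam * dot c (S^T *m s) + lam * enorm s ^+ 2.
  have FE c' : dot c' (M *m c') + lam * enorm (s - S *m c') ^+ 2 + eta * enorm c' ^+ 2 = F c'.
    rewrite /F Pc enormD_sqr enormN dotNr (dot_mulr S c' s) (dotC (S^T *m s) c'); ring.
  have Fmin : F c - F (A *m s) = dot (c - A *m s) (P *m (c - A *m s)).
    rewrite mulmxBr !dotlin PA !dotlin (dot_mulr P c (A *m s)) Ps PA !dotlin.
    rewrite (dotC (S^T *m s) c) /F PA !dotlin; ring.
  rewrite Xs FE.
  have : 0 <= F c - F (A *m s).
    rewrite Fmin Pc; move: (c - A *m s) => z.
    have := Qpos z; rewrite mulmxDl -scalemxAl !dotlin -enormS.
    by have := mulr_ge0 (ltW eta0) (sqr_ge0 (enorm z)); lra.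
  rewrite -(FE (A *m s)).
  have := mulr_ge0 (ltW eta0) (sqr_ge0 (enorm (A *m s))); lra.
exists X; last first.
  move=> s; rewrite mx_psd_trace.
  (* The l-th column of [s] is tested against the l-th basis vector, whence the trace of M and the
     distance from [s] to S. *)
  apply: (@le_trans _ _ (\sum_l (M l l + eta + lam * enorm (col l (s - S)) ^+ 2))).
    apply: ler_sum => l _; apply: le_trans (Xmin _ (delta_mx l ord0)) _.
    have n1 : enorm (delta_mx l ord0 : 'cV[R]_d) ^+ 2 = 1.
      rewrite enorm_sqr (bigD1 l) //= big_ord1 !mxE !eqxx expr1n big1 ?addr0// => j jl.
      by rewrite big_ord1 mxE (negbTE jl) expr0n.
    rewrite n1 mulr1 -!colE linearB /= dotE (bigD1 l) //= !mxE !eqxx mul1r.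
    rewrite big1 ?addr0 => [|j jl]; last by rewrite mxE (negbTE jl) mul0r.
    by rewrite addrAC.
  rewrite !big_split /= -mulr_sumr -enorm_cols sumr_const card_ord mulr_natr.
  by [].
apply: (@superjet_quad _ _ _ _ _ _ _ _ (lam / 2)).
  rewrite /X; move: (1%:M - S *m A) => B.
  by rewrite linearD /= linearZ /= !trmx_mul !trmxK Ms mulmxA.
(* When p moves by dx, g is moved along by [A *m dx]. *)
move=> e e0; set a := enorm A.
have a0 : 0 < a ^+ 2 + 1 by rewrite ltr_wpDl ?sqr_ge0.
have [r r0 hr] := tH _ (divr_gt0 e0 a0).
have a1 : 0 < a + 1 by rewrite ltr_wpDl ?enorm_ge0.
have m0 : 0 < Num.min r rho / (a + 1) by rewrite divr_gt0 ?lt_min ?r0.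
exists (Num.min rho (Num.min r rho / (a + 1))); first by rewrite lt_min rho0.
move=> p' sp' [c1 c2]; move: c1 c2; rewrite !lt_min => /andP[c1 _] /andP[c2 c3].
set dx := p'.2 - p.2 in c2 c3 *; set dt := p'.1 - p.1 in c1 *.
have Adx : enorm (A *m dx) <= a * enorm dx by exact: enormM.
have Adx' : enorm (A *m dx) < Num.min r rho.
  apply: le_lt_trans Adx _; move: c3; rewrite ltr_pdivlMr// => c3.
  by have := enorm_ge0 dx; nra.
move: Adx'; rewrite lt_min => /andP[Adxr Adxrho].
have Adxrho' : enorm (g + A *m dx - g) < rho by rewrite addrC addKr.
have := hmax p' (g + A *m dx) sp' (conj c1 c2) Adxrho'.
have -> : p'.2 - ph.2 - S *m (g + A *m dx) = y + (dx - S *m (A *m dx)).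
  by rewrite /y /dx mulmxDr; apply/matrixP => i j; rewrite !mxE; ring.
have -> : p'.1 - ph.1 = tau + dt by rewrite /tau /dt; ring.
rewrite -/y -/tau enormD_sqr dotDr dotNr.
have := hr _ (ltW Adxr); rewrite Ge ler_norml => /andP[_ h1] h2.
rewrite /jet_poly /= -/dx -/dt dotZl Xs.
have h3 : e / (a ^+ 2 + 1) * enorm (A *m dx) ^+ 2 <= e * enorm dx ^+ 2.
  rewrite mulrAC ler_pdivrMr// -mulrA ler_pM2l//.
  have : enorm (A *m dx) ^+ 2 <= (a * enorm dx) ^+ 2.
    by rewrite ler_pXn2r ?nnegrE ?mulr_ge0 ?enorm_ge0.
  by rewrite exprMn; have := sqr_ge0 (enorm dx); nra.
move: (enorm (A *m dx) ^+ 2) h1 h3 => En h1 h3.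
move: (e / (a ^+ 2 + 1) * En) h1 h3 => En' h1 h3.
lra.
Qed.

End Schur.

(** * Sup-convolution along the noise *)

Section LocalSup.
Variables (R : realType) (T : R) (k d : nat).
Local Notation point := (R * 'cV[R]_k)%type.

(** Closed and relative to the strip, hence compact; [close] is its open counterpart. *)
Definition box (rho : R) (p : point) : set point :=
  [set p' | [/\ strip T k p', `|p'.1 - p.1| <= rho & enorm (p'.2 - p.2) <= rho]].

Lemma compact_box rho (p : point) : compact (box rho p).
Proof.
have -> : box rho p = (`[0, T]%classic `&` `[p.1 - rho, p.1 + rho]%classic)
    `*` [set y | enorm (y - p.2) <= rho].
  apply/seteqP; split => [[t x] [[/= ht _] h1 h2]|[t x] [[/= ht h1] h2]].
    by split=> //; split=> //=; rewrite in_itv /= -ler_distl.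
  by split=> //; move: h1; rewrite in_itv /= -ler_distl.
apply: compact_setX; last exact: compact_enorm_ball.
apply: compact_closedI; first exact: segment_compact.
exact: interval_closed.
Qed.

Lemma taylor2_continuous n (H : 'cV[R]_n -> R) G M :
  (forall g, taylor2 H g (G g) (M g)) -> continuous H.
Proof.
move=> tH g P /nbhs_ballP[e /= e0 hP]; apply/nbhs_enorm.
have [r r0 hr] := tH g 1 ltr01.
pose C := enorm (G g) + enorm (M g) + 1.
have C0 : 0 < C by rewrite ltr_wpDl ?addr_ge0 ?enorm_ge0.
exists (Num.min (Num.min r 1) (e / C)); first by rewrite !lt_min r0 ltr01 divr_gt0.
move=> g'; rewrite !lt_min => /andP[/andP[c1 c2] c3]; apply: hP.
rewrite -ball_normE /= distrC.
set c := g' - g in c1 c2 c3; have := hr c (ltW c1).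
have -> : g + c = g' by rewrite /c addrC subrK.
have h1 := dotC_le (G g) c; have h2 := quad_form_le (M g) c.
have c0 := enorm_ge0 c; have cc : enorm c ^+ 2 <= enorm c by rewrite expr2 ler_piMr// ltW.
have c4 : enorm c * C < e by rewrite -ltr_pdivlMr.
rewrite ler_norml => /andP[h3 h4]; move: h1 h2; rewrite !ler_norml => /andP[h5 h6] /andP[h7 h8].
have h9 : enorm (M g) * enorm c ^+ 2 <= enorm (M g) * enorm c.
  by rewrite ler_wpM2l ?enorm_ge0.
have h10 : 0 <= enorm (M g) * enorm c by rewrite mulr_ge0 ?enorm_ge0.
rewrite /C !mulrDr mulr1 in c4; rewrite ltr_norml; apply/andP; split; nra.
Qed.

(** If H 0 < 0, the penalised difference is positive at (ph, 0) and negative for |g| = r, so its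
    maximum is interior in g. As lam is at least 8 C0, the maximum point p stays within L < rho of
    ph and is interior too. [schur_superjet] then yields a superjet whose trace along sigma is below
    c1. *)
Lemma local_sup_bound (sigma : point -> 'M[R]_(k, d)) (u : point -> R) (ph : point)
    (C0 rho lam r L c c1 : R) (H : 'cV[R]_d -> R) G M :
  usc_in (strip T k) u -> strip T k ph -> u ph = 0 ->
  0 <= C0 -> 8 * C0 <= lam -> 0 < lam -> 0 < r ->
  4 * (enorm (sigma ph) + 1) * r <= L -> L < rho ->
  (forall p, box rho ph p ->
     u p <= C0 * ((p.1 - ph.1) ^+ 2 + enorm (p.2 - ph.2) ^+ 2)) ->
  (forall g, taylor2 H g (G g) (M g)) -> (forall g, (M g)^T = M g) ->
  (forall g, \tr (M g) = c) ->
  (forall g p, enorm g = r -> box rho ph p ->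
     u p - lam / 2 * enorm (p.2 - ph.2 - sigma ph *m g) ^+ 2
         - lam / 2 * (p.1 - ph.1) ^+ 2 < H g) ->
  (forall p J, strip T k p -> close L ph p -> `|u p| <= lam * L ^+ 2 ->
     superjet T u p J -> `|J.1.1| <= lam * L -> enorm J.1.2 <= lam * L ->
     c1 <= \tr (sigma p *m (sigma p)^T *m J.2)) ->
  (forall p, strip T k p -> close L ph p ->
     c + lam * enorm (sigma p - sigma ph) ^+ 2 < c1) ->
  0 <= H 0.
Proof.
move=> uu sph u0 C00 C0l lam0 r0 LE Lrho ub tH Ms trM sphere jets mods.
rewrite leNgt; apply/negP => H0.
set S := sigma ph in LE sphere mods.
pose F (z : point * 'cV[R]_d) := u z.1 + (- (lam / 2 * enorm (z.1.2 - ph.2 - S *m z.2) ^+ 2)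
         - lam / 2 * (z.1.1 - ph.1) ^+ 2 - H z.2).
have L0 : 0 < L.
  by apply: lt_le_trans LE; rewrite mulr_gt0 ?mulr_gt0 ?ltr_wpDl ?enorm_ge0.
pose K := box rho ph `*` [set g : 'cV[R]_d | enorm (g - 0) <= r].
have cK : compact K by apply: compact_setX; [exact: compact_box | exact: compact_enorm_ball].
have bph : box rho ph ph by split; rewrite ?subrr ?normr0 ?enorm0 ?ltW// (lt_trans L0).
have Kph : K (ph, 0) by split => //=; rewrite subrr enorm0 ltW.
have uF : usc_in K F.
  apply: usc_inD.
    apply: (usc_in_comp (B := strip T k) (h := fst)) => //.
      by move=> z _; apply: cvg_within_filter; exact: cvg_fst.
    by move=> z [[]].
  apply: cvg_usc_in => z.
  have c1' : (fun z : point * 'cV[R]_d => enorm (z.1.2 - ph.2 - S *m z.2)) @ z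
      --> enorm (z.1.2 - ph.2 - S *m z.2).
    apply: (@continuous_comp _ _ _ (fun z : point * 'cV[R]_d => z.1.2 - ph.2 - S *m z.2)
      (@enorm R k 1)); last exact: enorm_continuous.
    apply: (@cvgB _ 'cV[R]_k).
      apply: (@cvgB _ 'cV[R]_k); last exact: cvg_cst.
      apply: (@continuous_comp _ _ _ fst snd); [exact: cvg_fst | exact: cvg_snd].
    apply: (@continuous_comp _ _ _ snd (fun g => S *m g)); first exact: cvg_snd.
    exact: mulmx_continuous.
  have c2' : (fun z : point * 'cV[R]_d => z.1.1 - ph.1) @ z --> z.1.1 - ph.1.
    apply: cvgB; last exact: cvg_cst.
    apply: (@continuous_comp _ _ _ fst fst); [exact: cvg_fst | exact: cvg_fst].
  apply: cvgB; last first.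
    apply: (@continuous_comp _ _ _ snd H); first exact: cvg_snd.
    exact: taylor2_continuous tH _.
  apply: cvgB; last by apply: cvgMr; rewrite expr2; apply: cvgM; exact: c2'.
  by apply: cvgN; apply: cvgMr; rewrite expr2; apply: cvgM; exact: c1'.
have [[p g] [bp /= gr] pmax] := usc_max cK (ex_intro _ _ Kph) uF.
rewrite subr0 in gr.
have Fpos : 0 < F (p, g).
  apply: lt_le_trans (pmax _ Kph); rewrite /F /= u0 subrr mulmx0 subr0 enorm0 subrr.
  by rewrite expr0n /= !mulr0; lra.
have gr' : enorm g < r.
  rewrite lt_neqAle gr andbT; apply/eqP => gE.
  by have := sphere g p gE bp; move: Fpos; rewrite /F /=; lra.
have s0 := enorm_ge0 (S *m g); set s := enorm (S *m g) in s0.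
have sL : 4 * s < L.
  apply: lt_le_trans LE; rewrite -mulrA ltr_pM2l//; apply: le_lt_trans (enormM _ _) _.
  have := enorm_ge0 S; nra.
have up : u p <= C0 * ((p.1 - ph.1) ^+ 2 + enorm (p.2 - ph.2) ^+ 2) by exact: ub.
set dt := p.1 - ph.1 in up; set dx := p.2 - ph.2 in up.
set Y := enorm (dx - S *m g).
have Y0 : 0 <= Y by exact: enorm_ge0.
have dxY : enorm dx ^+ 2 <= 2 * Y ^+ 2 + 2 * s ^+ 2.
  by rewrite -{1}(subrK (S *m g) dx); exact: enorm_sqrD_le.
have dxY1 : enorm dx <= Y + s by rewrite -{1}(subrK (S *m g) dx); exact: enormD.
(* Comparison of the maximum with the value at (ph, g). *)
have h1 : - (lam / 2 * s ^+ 2) <= u p - lam / 2 * Y ^+ 2 - lam / 2 * dt ^+ 2.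
  have Kphg : K (ph, g) by split => //=; rewrite subr0.
  have := pmax _ Kphg; rewrite /F /= u0 -/S -/dx -/dt -/Y !subrr sub0r enormN -/s.
  by rewrite expr0n /= mulr0; lra.
(* Since 8 C0 <= lam, the bound on u offsets at most half of each penalty. *)
have Ys : Y ^+ 2 + dt ^+ 2 <= 3 * s ^+ 2.
  have := sqr_ge0 Y; have := sqr_ge0 s; have := sqr_ge0 dt => t2 s2 y2.
  rewrite -(ler_pM2l lam0); nra.
have Y2s : Y <= 2 * s by have := sqr_ge0 dt; nra.
have dt2s : `|dt| <= 2 * s.
  rewrite -(ler_pXn2r (n:=2)) ?nnegrE ?mulr_ge0// real_normK ?num_real//.
  by have := sqr_ge0 Y; nra.
have sp : strip T k p by case: bp.
have cL : close L ph p by split; rewrite -/dt -/dx; move: dt2s dxY1 Y2s sL s0; clear; lra.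
set rho' := Num.min (rho - L) (r - enorm g).
have rho'0 : 0 < rho' by rewrite lt_min !subr_gt0 Lrho gr'.
(* Dividing by d + 1 keeps the loss [eta * d] strictly below the available gap. *)
set eta := (c1 - (c + lam * enorm (sigma p - S) ^+ 2)) / (d%:R + 1).
have d1 : 0 < d%:R + 1 :> R by rewrite ltr_wpDl.
have mp := mods p sp cL.
have eta0 : 0 < eta by rewrite divr_gt0// subr_gt0.
have [|X jX hX] := @schur_superjet _ T k d u p ph g H (G g) (M g) S lam rho' eta
   sp lam0 rho'0 eta0 (tH g) (Ms g).
  move=> p' g' sp' [ct cx] cg.
  move: ct cx cg; rewrite !lt_min => /andP[ct _] /andP[cx _] /andP[_ cg].
  have bp' : box rho ph p'.
    split=> //.
      have := ler_normD (p'.1 - p.1) dt; rewrite /dt addrA subrK; move: ct cL.1; clear; lra.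
    have := enormD (p'.2 - p.2) dx; rewrite /dx addrA subrK; move: cx cL.2; clear; lra.
  have Kp' : K (p', g').
    split=> //=; rewrite subr0; have := enormD (g' - g) g; rewrite subrK; move: cg; clear; lra.
  have := pmax _ Kp'; rewrite /F /=; clear; lra.
have aJ : `|(lam * (p.1 - ph.1), lam *: (p.2 - ph.2 - S *m g), X).1.1| <= lam * L.
  by rewrite /= normrM gtr0_norm// ler_pM2l//; exact: ltW cL.1.
have qJ : enorm (lam * (p.1 - ph.1), lam *: (p.2 - ph.2 - S *m g), X).1.2 <= lam * L.
  by rewrite /= enormZ gtr0_norm// ler_pM2l// -/dx -/Y; move: Y2s sL s0; clear; lra.
have upL : `|u p| <= lam * L ^+ 2.
  have L2 : 16 * s ^+ 2 <= L ^+ 2.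
    have -> : 16 * s ^+ 2 = (4 * s) ^+ 2 by ring.
    by rewrite lerXn2r ?nnegrE ?mulr_ge0// ltW.
  have ll : lam * (16 * s ^+ 2) <= lam * L ^+ 2 by rewrite ler_pM2l.
  have Y2 := sqr_ge0 Y; have t2 := sqr_ge0 dt; have s2 := sqr_ge0 s.
  have lY := mulr_ge0 (ltW lam0) Y2; have lt := mulr_ge0 (ltW lam0) t2.
  have ls := mulr_ge0 (ltW lam0) s2.
  rewrite ler_norml; apply/andP; split; first by move: h1 ll lY lt ls; clear; lra.
  apply: le_trans up _.
  have : C0 * (dt ^+ 2 + enorm dx ^+ 2) <= lam * (dt ^+ 2 + enorm dx ^+ 2).
    by rewrite ler_wpM2r ?addr_ge0 ?sqr_ge0//; lra.
  have : lam * (dt ^+ 2 + enorm dx ^+ 2) <= lam * (8 * s ^+ 2).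
    by rewrite ler_pM2l//; move: Ys dxY t2; clear; lra.
  by move: ll ls; clear; lra.
have := jets p _ sp cL upL jX aJ qJ.
move=> /le_trans /(_ (hX (sigma p))); rewrite trM.
have : eta * d%:R < c1 - (c + lam * enorm (sigma p - S) ^+ 2).
  rewrite /eta mulrAC ltr_pdivrMr//.
  by rewrite ltr_pM2l ?subr_gt0// ltrDl.
clear; lra.
Qed.

End LocalSup.

(** * The trace inequality at a doubled maximum *)

Section Doubling.
Variables (R : realType) (T : R) (k d : nat).
Local Notation point := (R * 'cV[R]_k)%type.

Lemma superjet_affine (u : point -> R) (ph p : point) (b0 a0 : R) (q0 : 'cV[R]_k) J :
  superjet T (fun p => u p - b0 - a0 * (p.1 - ph.1) - dot q0 (p.2 - ph.2)) p J ->
  superjet T u p (J.1.1 + a0, J.1.2 + q0, J.2).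
Proof.
move=> /superjetP[Js h]; apply/superjetP; split=> // e e0.
have [r r0 hr] := h e e0; exists r => // p' sp cp; have := hr p' sp cp.
rewrite /jet_poly /= !dotlin; lra.
Qed.

Lemma affine_continuous (a0 : R) (q0 : 'cV[R]_k) (ph : point) :
  continuous (fun p : point => - (a0 * (p.1 - ph.1)) - dot q0 (p.2 - ph.2)).
Proof.
move=> p; apply: cvgB.
  by apply: cvgN; apply: cvgMr; apply: cvgB; [exact: cvg_fst | exact: cvg_cst].
apply: (@continuous_comp _ _ _ (fun p : point => p.2 - ph.2) (dot q0)).
  by apply: (@cvgB _ 'cV[R]_k); [exact: cvg_snd | exact: cvg_cst].
exact: dot_continuous.
Qed.

(** Jets of u and of the normalised v differ by the fixed slopes a and q, and a bound on v near ph
    gives one on u - u ph. *)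
Lemma local_sup_bound_affine (sigma : point -> 'M[R]_(k, d)) (u : point -> R)
    (ph : point) (a : R) (q : 'cV[R]_k)
    (C0 rho lam r L c c1 : R) (H : 'cV[R]_d -> R) G M :
  let v p := u p - u ph - a * (p.1 - ph.1) - dot q (p.2 - ph.2) in
  usc_in (strip T k) u -> strip T k ph ->
  0 <= C0 -> 8 * C0 <= lam -> 0 < lam -> 0 < r ->
  4 * (enorm (sigma ph) + 1) * r <= L -> L < rho ->
  (forall p, box T rho ph p ->
     v p <= C0 * ((p.1 - ph.1) ^+ 2 + enorm (p.2 - ph.2) ^+ 2)) ->
  (forall g, taylor2 H g (G g) (M g)) -> (forall g, (M g)^T = M g) ->
  (forall g, \tr (M g) = c) ->
  (forall g p, enorm g = r -> box T rho ph p ->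
     v p - lam / 2 * enorm (p.2 - ph.2 - sigma ph *m g) ^+ 2
         - lam / 2 * (p.1 - ph.1) ^+ 2 < H g) ->
  (forall p J, strip T k p -> close L ph p ->
     `|u p - u ph| <= lam * L ^+ 2 + (`|a| + enorm q) * L ->
     superjet T u p J -> `|J.1.1 - a| <= lam * L -> enorm (J.1.2 - q) <= lam * L ->
     c1 <= \tr (sigma p *m (sigma p)^T *m J.2)) ->
  (forall p, strip T k p -> close L ph p ->
     c + lam * enorm (sigma p - sigma ph) ^+ 2 < c1) ->
  0 <= H 0.
Proof.
move=> v uu sph C00 C0l lam0 r0 LE Lrho ub tH Ms trM sphere jets mods.
apply: (@local_sup_bound R T k d sigma v ph C0 rho lam r L c c1 H G M) => //.
- have -> : v = u \+ (fun p => - u ph + (- (a * (p.1 - ph.1)) - dot q (p.2 - ph.2))).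
    by apply/funext => p; rewrite /v /=; ring.
  apply: usc_inD => //; apply: cvg_usc_in => p.
  by apply: cvgD; [exact: cvg_cst | exact: affine_continuous].
- by rewrite /v !subrr mulr0 dot0r !subr0.
move=> p J sp [cL1 cL2] vp jJ aJ qJ.
have := jets p _ sp (conj cL1 cL2) _ (superjet_affine jJ); apply.
- have -> : u p - u ph = v p + a * (p.1 - ph.1) + dot q (p.2 - ph.2) by rewrite /v; ring.
  apply: le_trans (ler_normD _ _) _; apply: le_trans (lerD (ler_normD _ _) (dotC_le _ _)) _.
  rewrite -addrA mulrDl; apply: lerD => //; apply: lerD.
    by rewrite normrM ler_wpM2l// ltW.
  by rewrite ler_wpM2l ?enorm_ge0// ltW.
- by rewrite /= addrK.
- by rewrite /= addrK.
Qed.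

Lemma taylor2D n (H H' : 'cV[R]_n -> R) g G G' M M' :
  taylor2 H g G M -> taylor2 H' g G' M' ->
  taylor2 (H \+ H') g (G + G') (M + M').
Proof.
move=> h h' e e0; have e2 : 0 < e / 2 by rewrite divr_gt0.
have [r r0 hr] := h _ e2; have [r' r'0 hr'] := h' _ e2.
exists (Num.min r r') => [|c]; first by rewrite lt_min r0.
rewrite le_min => /andP[c1 c2]; have {}hr := hr c c1; have {}hr' := hr' c c2.
rewrite /= mulmxDl !dotlin.
rewrite [leRHS](_ : _ = e / 2 * enorm c ^+ 2 + e / 2 * enorm c ^+ 2); last by field.
apply: le_trans (lerD hr hr'); apply: le_trans (ler_normD _ _).
by rewrite le_eqVlt; apply/orP; left; apply/eqP; congr (`|_|); ring.
Qed.

Lemma taylor2N n (H : 'cV[R]_n -> R) g G M :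
  taylor2 H g G M -> taylor2 (\- H) g (- G) (- M).
Proof.
move=> h e e0; have [r r0 hr] := h e e0; exists r => // c cr.
rewrite /= mulNmx !dotlin; apply: le_trans (hr c cr).
rewrite -normrN le_eqVlt; apply/orP; left; apply/eqP; congr (`|_|); ring.
Qed.

Lemma taylor2_quad n (Q : 'M[R]_n) (b : R) g : Q^T = Q ->
  taylor2 (fun g => b + 2^-1 * dot g (Q *m g)) g (Q *m g) Q.
Proof.
move=> Qs e e0; exists 1 => // c _.
rewrite mulmxDr !dotlin (dotC (Q *m g)) (dot_mulr Q c g) Qs (dotC (Q *m g) c).
apply: (@le_trans _ _ 0); last by rewrite mulr_ge0 ?sqr_ge0 ?ltW.
by rewrite normr_le0; apply/eqP; field.
Qed.

End Doubling.

Section Doubling.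
Variables (R : realType) (T : R) (k d : nat).
Local Notation point := (R * 'cV[R]_k)%type.

(** Bounds the sum of the two sup-convolutions at shifts x and y by a quadratic form in x - y and x:
    write dx = x + al and dy = y + be, and let lam absorb all the squares of al and be. The price is
    tau, from Young's inequality. *)
Lemma sup_conv_quad (n tau lam Cq : R) (M : 'M[R]_k) (x y dx dy : 'cV[R]_k) (dt ds : R) :
  0 <= n -> 0 < tau -> 0 <= Cq ->
  n * (1 + tau^-1) + enorm M ^+ 2 / (4 * tau) + enorm M / 2 + Cq <= lam / 2 ->
  M^T = M ->
  n / 2 * enorm (dx - dy) ^+ 2 + 2^-1 * dot dx (M *m dx) + Cq * (dt ^+ 2 + ds ^+ 2)
   - lam / 2 * enorm (dx - x) ^+ 2 - lam / 2 * dt ^+ 2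
   - lam / 2 * enorm (dy - y) ^+ 2 - lam / 2 * ds ^+ 2 <=
  n / 2 * (1 + tau) * enorm (x - y) ^+ 2 + 2^-1 * dot x (M *m x)
   + tau * enorm x ^+ 2.
Proof.
move=> n0 tau0 Cq0 hlam Ms.
have [al ->] : exists al, dx = x + al by exists (dx - x); rewrite addrC subrK.
have [be ->] : exists be, dy = y + be by exists (dy - y); rewrite addrC subrK.
have -> : x + al - x = al by rewrite addrC addKr.
have -> : y + be - y = be by rewrite addrC addKr.
have -> : x + al - (y + be) = (x - y) + (al - be) by rewrite opprD addrACA.
have iv0 : 0 < tau^-1 by rewrite invr_gt0.
have h1 : enorm (x - y + (al - be)) ^+ 2 <=
    (1 + tau) * enorm (x - y) ^+ 2 + (1 + tau^-1) * enorm (al - be) ^+ 2.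
  rewrite enormD_sqr.
  move: (x - y) (al - be) => z v.
  have h : 0 <= tau ^+ 2 * enorm z ^+ 2 - 2 * (tau * dot z v) + enorm v ^+ 2.
    have := sqr_ge0 (enorm (tau *: z - v)).
    by rewrite enormD_sqr enormN enormZ gtr0_norm// dotNr dotZl exprMn mulrN.
  rewrite -(ler_pM2l tau0).
  have -> : tau * ((1 + tau) * enorm z ^+ 2 + (1 + tau^-1) * enorm v ^+ 2) =
    tau * enorm z ^+ 2 + tau ^+ 2 * enorm z ^+ 2 + tau * enorm v ^+ 2 + enorm v ^+ 2.
    by field; rewrite gt_eqF.
  lra.
have h2 : enorm (al - be) ^+ 2 <= 2 * enorm al ^+ 2 + 2 * enorm be ^+ 2.
  by apply: le_trans (enorm_sqrD_le _ _) _; rewrite enormN.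
have h3 : dot (x + al) (M *m (x + al)) <= dot x (M *m x)
    + 2 * (enorm x * (enorm M * enorm al)) + enorm M * enorm al ^+ 2.
  rewrite mulmxDr !dotlin (dot_mulr M al x) Ms (dotC (M *m x) al).
  have := le_trans (ler_norm _) (quad_form_le M al).
  have : dot al (M *m x) <= enorm x * (enorm M * enorm al).
    rewrite dot_mulr Ms dotC; apply: le_trans (dot_le _ _) _.
    by rewrite ler_wpM2l ?enorm_ge0// enormM.
  lra.
have h4 : enorm x * (enorm M * enorm al) <=
    tau * enorm x ^+ 2 + enorm M ^+ 2 / (4 * tau) * enorm al ^+ 2.
  rewrite -(ler_pM2l (_ : 0 < 4 * tau)) ?mulr_gt0//.
  have -> : 4 * tau * (tau * enorm x ^+ 2 + enorm M ^+ 2 / (4 * tau) * enorm al ^+ 2)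
     = (2 * tau * enorm x) ^+ 2 + (enorm M * enorm al) ^+ 2 by field; rewrite gt_eqF.
  have := sqr_ge0 (2 * tau * enorm x - enorm M * enorm al); rewrite sqrrB; lra.
have m1 := ler_wpM2l n0 h1.
have B0 : 0 <= n * (1 + tau^-1) by rewrite mulr_ge0// ltW// ltr_wpDl.
have BE : n * ((1 + tau) * enorm (x - y) ^+ 2 + (1 + tau^-1) * enorm (al - be) ^+ 2)
  = n * (1 + tau) * enorm (x - y) ^+ 2 + n * (1 + tau^-1) * enorm (al - be) ^+ 2.
  by rewrite mulrDr !mulrA.
rewrite BE in m1.
have A0 : 0 <= enorm M ^+ 2 / (4 * tau) by rewrite divr_ge0 ?sqr_ge0 ?mulr_ge0 ?ltW.
have E0 : 0 <= enorm M / 2 by rewrite divr_ge0 ?enorm_ge0.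
have m2 := ler_wpM2l B0 h2.
have l1 := ler_wpM2r (sqr_ge0 (enorm al)) hlam.
have lb : n * (1 + tau^-1) * enorm be ^+ 2 <= lam / 2 * enorm be ^+ 2.
  by apply: ler_wpM2r; [exact: sqr_ge0 | lra].
have lt : Cq * dt ^+ 2 <= lam / 2 * dt ^+ 2.
  by apply: ler_wpM2r; [exact: sqr_ge0 | lra].
have ls : Cq * ds ^+ 2 <= lam / 2 * ds ^+ 2.
  by apply: ler_wpM2r; [exact: sqr_ge0 | lra].
have lq : 0 <= Cq * enorm al ^+ 2 by rewrite mulr_ge0 ?sqr_ge0.
clear - m1 m2 l1 lb lt ls lq h3 h4.
move: (n * (1 + tau^-1)) (enorm M ^+ 2 / (4 * tau)) m1 m2 l1 lb h4 => B A m1 m2 l1 lb h4.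
lra.
Qed.

Lemma superjet_opp_sub (w : point -> R) p J :
  superjet T (\- w) p J -> subjet T w p (- J.1.1, - J.1.2, - J.2).
Proof.
move=> h; apply/subjet_opp => /=; rewrite !opprK.
by case: J h => [[a q] M].
Qed.

Lemma trace_sandwich (S : 'M[R]_(k, d)) (Q : 'M[R]_k) :
  \tr (S^T *m Q *m S) = \tr (S *m S^T *m Q).
Proof. by rewrite mxtrace_mulC mulmxA. Qed.

Lemma trace_gram (S : 'M[R]_(k, d)) : \tr (S^T *m S) = enorm S ^+ 2.
Proof.
rewrite mxtrace_mulC /mxtrace enorm_sqr; apply: eq_bigr => i _; rewrite mxE.
by apply: eq_bigr => j _; rewrite mxE expr2.
Qed.

Lemma gram_form (S : 'M[R]_(k, d)) (g : 'cV[R]_d) :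
  dot g ((S^T *m S) *m g) = enorm (S *m g) ^+ 2.
Proof. by rewrite -dot_enorm [RHS]dot_mull mulmxA. Qed.

(** Plays the part of the theorem on sums. Suppose the conclusion fails by [del]. A single H, close
    on the sphere to the sup-convolution of u, has Laplacian slightly below c1, so 0 <= H 0. Half
    the form [Q1], which bounds the sum of the two sup-convolutions, minus H and minus a constant
    [kap] > 0, exceeds the sup-convolution of - w on the sphere and has Laplacian below - c2, so 0
    <= - kap - H 0. *)
Lemma doubling_jets (sigma : point -> 'M[R]_(k, d)) (u w : point -> R) (ph pc : point)
    (a a' : R) (q q' : 'cV[R]_k) (n : R) (M : 'M[R]_k) (Cq c1 c2 rho L0 : R) :
  (0 < d)%N ->
  usc_in (strip T k) u -> usc_in (strip T k) (\- w) ->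
  strip T k ph -> strip T k pc -> 0 <= n -> M^T = M -> 0 <= Cq -> 0 < rho -> 0 < L0 ->
  (forall p p', box T rho ph p -> box T rho pc p' ->
     u p - w p' <= u ph - w pc + a * (p.1 - ph.1) - a' * (p'.1 - pc.1)
       + dot q (p.2 - ph.2) - dot q' (p'.2 - pc.2)
       + n / 2 * enorm ((p.2 - ph.2) - (p'.2 - pc.2)) ^+ 2
       + 2^-1 * dot (p.2 - ph.2) (M *m (p.2 - ph.2))
       + Cq * ((p.1 - ph.1) ^+ 2 + (p'.1 - pc.1) ^+ 2)) ->
  (forall e, 0 < e -> exists2 r, 0 < r & forall p, strip T k p -> close r ph p ->
     enorm (sigma p - sigma ph) < e) ->
  (forall e, 0 < e -> exists2 r, 0 < r & forall p, strip T k p -> close r pc p ->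
     enorm (sigma p - sigma pc) < e) ->
  (forall p J, strip T k p -> close L0 ph p -> `|u p - u ph| <= L0 ->
     superjet T u p J -> `|J.1.1 - a| <= L0 -> enorm (J.1.2 - q) <= L0 ->
     c1 <= \tr (sigma p *m (sigma p)^T *m J.2)) ->
  (forall p J, strip T k p -> close L0 pc p -> `|w p - w pc| <= L0 ->
     subjet T w p J -> `|J.1.1 - a'| <= L0 -> enorm (J.1.2 - q') <= L0 ->
     \tr (sigma p *m (sigma p)^T *m J.2) <= c2) ->
  c1 - c2 <= n * enorm (sigma ph - sigma pc) ^+ 2
      + \tr (sigma ph *m (sigma ph)^T *m M).
Proof.
move=> d0 uu uw sph spc n0 Ms Cq0 rho0 L00 huw sigh sigc jetu jetw.
set S := sigma ph; set S' := sigma pc.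
rewrite leNgt; apply/negP; rewrite -subr_gt0.
set del := (X in 0 < X); move=> del0.
have delE : del = c1 - c2 - (n * enorm (S - S') ^+ 2 + \tr (S *m S^T *m M)) by [].
have SS0 := sqr_ge0 (enorm (S - S')); have S0 := sqr_ge0 (enorm S).
have nSS0 := mulr_ge0 n0 SS0.
pose D1 := n * enorm (S - S') ^+ 2 + 2 * enorm S ^+ 2 + 1.
have D10 : 0 < D1 by rewrite /D1; lra.
(* Bookkeeping of [del]: a third lowers the Laplacian of H, a third bounds the oscillation of sigma,
   and [tau] and [io] spend a sixth each. *)
have [tau tau0 htau] : exists2 tau, 0 < tau & tau * D1 = del / 6.
  by exists (del / 6 / D1); rewrite ?divr_gt0// divfK// gt_eqF.
have dd0 : 0 < d%:R :> R by rewrite ltr0n.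
have [io io0 hio] : exists2 io, 0 < io & io * d%:R = del / 12.
  by exists (del / 12 / d%:R); rewrite ?divr_gt0// divfK// gt_eqF.
pose C0 := n / 2 + enorm M / 2 + Cq.
have EM0 := enorm_ge0 M.
have C00 : 0 <= C0 by rewrite /C0; lra.
have iv0 : 0 < tau^-1 by rewrite invr_gt0.
have A0 : 0 <= enorm M ^+ 2 / (4 * tau) by rewrite divr_ge0 ?sqr_ge0 ?mulr_ge0 ?ltW.
have B0 : 0 <= n * (1 + tau^-1) by rewrite mulr_ge0// ltW// ltr_wpDl.
pose B1 := n * (1 + tau^-1) + enorm M ^+ 2 / (4 * tau) + enorm M / 2 + Cq.
have [lam [lam1 lam8 lam0]] : exists lam, [/\ B1 <= lam / 2, 8 * C0 <= lam & 0 < lam].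
  exists (2 * B1 + 8 * C0 + 1).
  have : 0 <= B1 by rewrite /B1 !addr_ge0// divr_ge0.
  have pos (x y : R) : 0 <= x -> 0 <= y ->
      [/\ x <= (2 * x + 8 * y + 1) / 2, 8 * y <= 2 * x + 8 * y + 1 & 0 < 2 * x + 8 * y + 1].
    by clear => x0 y0; split; lra.
  by move=> B10; exact: pos.
have [es [es0 es1 esl]] : exists es, [/\ 0 < es, es <= 1 & lam * es <= del / 4].
  exists (Num.min 1 (del / 4 / lam)); rewrite lt_min ltr01 !divr_gt0//; split=> //.
    by rewrite ge_min lexx.
  by rewrite mulrC -ler_pdivlMr// ge_min lexx orbT.
have [rs rs0 hrs] := sigh _ es0; have [rs' rs'0 hrs'] := sigc _ es0.
(* L N <= L0 will bound both the slopes, which vary by lam L, and the variation of u and w at the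
   jets under consideration. *)
pose N := lam + (`|a| + enorm q) + (`|a'| + enorm q') + 1.
have aq0 : 0 <= `|a| + enorm q by rewrite addr_ge0 ?enorm_ge0.
have aq'0 : 0 <= `|a'| + enorm q' by rewrite addr_ge0 ?enorm_ge0.
have N1 : 1 <= N by rewrite /N; move: aq0 aq'0 lam0; clear; lra.
have N0 : 0 < N by exact: lt_le_trans N1.
have [L [Lp Lrho LN Lrs [Lrs' L1]]] :
    exists L, [/\ 0 < L, L < rho, L * N <= L0, L <= rs & L <= rs' /\ L <= 1].
  exists (Num.min (rho / 2) (Num.min (L0 / N) (Num.min rs (Num.min rs' 1)))).
  split; first by rewrite !lt_min !divr_gt0// rs0 rs'0 ltr01.
  - by rewrite gt_min ltr_pdivrMr// ltr_pMr// ltr1n.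
  - by rewrite -ler_pdivlMr// !ge_min lexx orbT.
  - by rewrite !ge_min lexx !orbT.
  - by split; rewrite !ge_min lexx !orbT.
have LL0 : L <= L0 by apply: le_trans LN; rewrite ler_peMr// ltW.
have [eS eS'] := (enorm_ge0 S, enorm_ge0 S').
have [r r0 rL] : exists2 r, 0 < r & 4 * (enorm S + enorm S' + 1) * r = L.
  have h : 0 < 4 * (enorm S + enorm S' + 1) by move: eS eS'; clear; lra.
  by exists (L / (4 * (enorm S + enorm S' + 1))); [exact: divr_gt0 | rewrite mulrC divfK// gt_eqF].
pose v p := u p - u ph - a * (p.1 - ph.1) - dot q (p.2 - ph.2).
pose vw p := (\- w) p - (\- w) pc - (- a') * (p.1 - pc.1) - dot (- q') (p.2 - pc.2).
have bph : box T rho ph ph by split; rewrite ?subrr ?normr0 ?enorm0 ?ltW.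
have bpc : box T rho pc pc by split; rewrite ?subrr ?normr0 ?enorm0 ?ltW.
have hv p p' : box T rho ph p -> box T rho pc p' -> v p + vw p' <=
    n / 2 * enorm ((p.2 - ph.2) - (p'.2 - pc.2)) ^+ 2
       + 2^-1 * dot (p.2 - ph.2) (M *m (p.2 - ph.2))
       + Cq * ((p.1 - ph.1) ^+ 2 + (p'.1 - pc.1) ^+ 2).
  by move=> bp bp'; have := huw p p' bp bp'; rewrite /v /vw /= dotNl; clear; lra.
have hv1 p : box T rho ph p -> v p <= C0 * ((p.1 - ph.1) ^+ 2 + enorm (p.2 - ph.2) ^+ 2).
  move=> bp; have := hv p pc bp bpc.
  rewrite /vw !subrr mulr0 dot0r !subr0 addr0 expr0n /= addr0.
  have := le_trans (ler_norm _) (quad_form_le M (p.2 - ph.2)).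
  have := sqr_ge0 (p.1 - ph.1); have := sqr_ge0 (enorm (p.2 - ph.2)).
  by clear - n0 EM0 Cq0; rewrite /C0; nra.
have hv2 p : box T rho pc p -> vw p <= C0 * ((p.1 - pc.1) ^+ 2 + enorm (p.2 - pc.2) ^+ 2).
  move=> bp; have := hv ph p bph bp.
  rewrite /v !subrr mulr0 dot0r !subr0 add0r expr0n /= mulmx0 dot0l sub0r enormN.
  have := sqr_ge0 (p.1 - pc.1); have := sqr_ge0 (enorm (p.2 - pc.2)).
  by clear - n0 EM0 Cq0; rewrite /C0; nra.
(* Expanding the square, the sup-convolution of v at g is [f1 g] - lam / 2 |S g|^2, where [f1] below
   is a maximum of affine functions of g and hence Lipschitz. *)
pose V p := v p - lam / 2 * (p.1 - ph.1) ^+ 2 - lam / 2 * enorm (p.2 - ph.2) ^+ 2.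
have VE p g : v p - lam / 2 * enorm (p.2 - ph.2 - S *m g) ^+ 2 - lam / 2 * (p.1 - ph.1) ^+ 2
   = V p + lam * dot (p.2 - ph.2) (S *m g) - lam / 2 * enorm (S *m g) ^+ 2.
  rewrite /V enormD_sqr enormN dotNr; clear; by field.
have uv : usc_in (strip T k) v.
  have -> : v = u \+ (fun p => - u ph + (- (a * (p.1 - ph.1)) - dot q (p.2 - ph.2))).
    by apply/funext => z; rewrite /v /=; ring.
  apply: usc_inD; first exact: uu.
  apply: cvg_usc_in => z.
  by apply: cvgD; [exact: cvg_cst | exact: affine_continuous].
have hex (g : 'cV[R]_d) : exists y : R,
    (exists2 p, box T rho ph p & y = V p + lam * dot (p.2 - ph.2) (S *m g)) /\
    (forall p, box T rho ph p -> V p + lam * dot (p.2 - ph.2) (S *m g) <= y).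
  have [p bp pm] : exists2 p, box T rho ph p & forall p', box T rho ph p' ->
      V p' + lam * dot (p'.2 - ph.2) (S *m g) <= V p + lam * dot (p.2 - ph.2) (S *m g).
    apply: usc_max; [exact: compact_box | by exists ph |].
    rewrite (_ : (fun p => _) = v \+ (fun p => lam * dot (S *m g) (p.2 - ph.2)
       - lam / 2 * (p.1 - ph.1) ^+ 2 - lam / 2 * enorm (p.2 - ph.2) ^+ 2)); last first.
      by apply/funext => z; rewrite /V /= dotC; ring.
    apply: usc_inD; first by apply: usc_in_sub uv => p [].
    have cx : continuous (fun p : point => p.2 - ph.2).
      by move=> p; apply: (@cvgB _ 'cV[R]_k); [exact: cvg_snd | exact: cvg_cst].
    have cn : continuous (fun p : point => enorm (p.2 - ph.2)).
      move=> p; apply: (@continuous_comp _ _ _ (fun p : point => p.2 - ph.2) (@enorm R k 1)).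
        exact: cx.
      exact: enorm_continuous.
    apply: cvg_usc_in => p; apply: cvgB.
      apply: cvgB.
        apply: cvgMr.
        apply: (@continuous_comp _ _ _ (fun p : point => p.2 - ph.2) (dot (S *m g))).
          exact: cx.
        exact: dot_continuous.
      apply: cvgMr; rewrite expr2.
      by apply: cvgM; apply: cvgB; (exact: cvg_fst || exact: cvg_cst).
    by apply: cvgMr; rewrite expr2; apply: cvgM; exact: cn.
  by exists (V p + lam * dot (p.2 - ph.2) (S *m g)); split=> //; exists p.
have [f1 hf1] := choice hex.
pose Lf := lam * (rho * enorm S).
have f1lip1 x y : f1 x - f1 y <= Lf * enorm (x - y).
  have [[p bp ->] _] := hf1 x; have [_ hy] := hf1 y; have := hy p bp.
  have : dot (p.2 - ph.2) (S *m x) - dot (p.2 - ph.2) (S *m y) <= rho * enorm S * enorm (x - y).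
    rewrite -dotNr -dotDr -mulmxBr; apply: le_trans (dot_le _ _) _; rewrite -mulrA.
    by apply: ler_pM; rewrite ?enorm_ge0 ?enormM//; case: bp.
  by rewrite -(ler_pM2l lam0) /Lf mulrA; clear; lra.
have f1lip x y : `|(f1 x + io * r ^+ 2 / 2) - (f1 y + io * r ^+ 2 / 2)| <= Lf * enorm (x - y).
  have := f1lip1 x y; have := f1lip1 y x; rewrite (enormB y x) => h1 h2.
  by rewrite ler_norml; apply/andP; split; move: h1 h2; clear; lra.
have Lf0 : 0 <= Lf.
  by apply: mulr_ge0; [exact: ltW | apply: mulr_ge0; [exact: ltW | exact: enorm_ge0]].
have ir0 : 0 < io * r ^+ 2 by rewrite mulr_gt0 ?exprn_gt0.
have ir4 : 0 < io * r ^+ 2 / 4 by rewrite divr_gt0.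
(* With the datum raised by io r^2 / 2 and an error of io r^2 / 4, H exceeds the sup-convolution on
   the sphere by one to three quarters of io r^2; the term io |g|^2 contributed by [Q1] leaves room
   for this excess and for [kap]. *)
have [H1 [G1 [M1 [tH1 sM1 trM1 hH1]]]] :=
  sphere_interpolation (c1 - del / 3 + lam * enorm S ^+ 2) d0 Lf0 r0 ir4 f1lip.
pose K1 := - lam *: (S^T *m S).
have K1s : K1^T = K1 by rewrite /K1 linearZ /= trmx_mul trmxK.
pose H := H1 \+ (fun g => 0 + 2^-1 * dot g (K1 *m g)).
have HE g : H g = H1 g - lam / 2 * enorm (S *m g) ^+ 2.
  by rewrite /H /= /K1 -scalemxAl dotZr gram_form; field.
have tH g : taylor2 H g (G1 g + K1 *m g) (M1 g + K1).
  exact: taylor2D (tH1 g) (taylor2_quad _ _ K1s).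
have sMH g : (M1 g + K1)^T = M1 g + K1 by rewrite linearD /= sM1 K1s.
have trMH g : \tr (M1 g + K1) = c1 - del / 3.
  by rewrite mxtraceD trM1 /K1 mxtraceZ trace_gram; ring.
(* Twice the bound of [sup_conv_quad] at x = S g and y = S' g, plus the margin 2 io |g|^2. *)
pose Q1 := (n * (1 + tau)) *: ((S - S')^T *m (S - S')) + S^T *m M *m S
   + (2 * tau) *: (S^T *m S) + (2 * io)%:M.
have Q1s : Q1^T = Q1.
  rewrite /Q1; move: (S - S') => Z.
  by rewrite !linearD /= !linearZ /= !trmx_mul !trmxK Ms tr_scalar_mx mulmxA.
have Q1E g : 2^-1 * dot g (Q1 *m g) = n / 2 * (1 + tau) * enorm (S *m g - S' *m g) ^+ 2
    + 2^-1 * dot (S *m g) (M *m (S *m g)) + tau * enorm (S *m g) ^+ 2 + io * enorm g ^+ 2.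
  rewrite /Q1 !mulmxDl -!scalemxAl mul_scalar_mx !dotDr !dotZr !gram_form dot_enorm mulmxBl.
  have -> : dot g (S^T *m M *m S *m g) = dot (S *m g) (M *m (S *m g)).
    by rewrite [RHS]dot_mull !mulmxA.
  clear; by field.
have trQ1 : \tr Q1 = n * (1 + tau) * enorm (S - S') ^+ 2 + \tr (S *m S^T *m M)
   + 2 * tau * enorm S ^+ 2 + 2 * io * d%:R.
  by rewrite /Q1 !mxtraceD !mxtraceZ !trace_gram mxtrace_scalar trace_sandwich -[_ *+ d]mulr_natr.
pose kap := io * r ^+ 2 / 8.
pose H2 := (fun g => - kap + 2^-1 * dot g (Q1 *m g)) \+ (\- H).
have tH2 g : taylor2 H2 g (Q1 *m g - (G1 g + K1 *m g)) (Q1 - (M1 g + K1)).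
  exact: taylor2D (taylor2_quad _ _ Q1s) (taylor2N (tH g)).
have sMH2 g : (Q1 - (M1 g + K1))^T = Q1 - (M1 g + K1).
  by rewrite [LHS]linearB /= sMH Q1s.
have trMH2 g : \tr (Q1 - (M1 g + K1)) = \tr Q1 - (c1 - del / 3).
  by rewrite raddfB /= trMH.
have mods (s : R) : 0 <= s -> s < es -> lam * s ^+ 2 < del / 3.
  move=> s0 ses; have : s ^+ 2 <= es.
    by clear - s0 ses es1; nra.
  by rewrite -(ler_pM2l lam0); clear - esl del0; lra.
have LamN : lam <= N by clear - aq0 aq'0; rewrite /N; lra.
have lamL : lam * L <= L0.
  by apply: le_trans LN; rewrite mulrC ler_pM2l.
have lamL2 : lam * L ^+ 2 <= lam * L by rewrite ler_pM2l// expr2 ler_piMr// ltW.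
have Laq := mulr_ge0 (ltW Lp) aq0; have Laq' := mulr_ge0 (ltW Lp) aq'0.
have LN1 : lam * L ^+ 2 + (`|a| + enorm q) * L <= L0.
  by apply: le_trans LN; clear - lamL2 Laq' Lp; rewrite /N; lra.
have LN2 : lam * L ^+ 2 + (`|a'| + enorm q') * L <= L0.
  by apply: le_trans LN; clear - lamL2 Laq Lp; rewrite /N; lra.
have closeL (r1 : R) (p0 p : point) : L <= r1 -> close L p0 p -> close r1 p0 p.
  by move=> h [h1 h2]; split; [exact: lt_le_trans h | exact: lt_le_trans h].
clearbody del.
have hu : 0 <= H 0.
  apply: (@local_sup_bound_affine R T k d sigma u ph a q C0 rho lam r L
            (c1 - del / 3) c1 H _ _ uu sph C00 lam8 lam0 r0 _ Lrho hv1 tH sMH trMH).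
  - by rewrite -rL ler_pM2r// ler_pM2l// lerD2r lerDl.
  - move=> g p gr bp; rewrite -/(v p) VE HE.
    have [_ hp] := hf1 g; have := hp p bp; have := hH1 g gr.
    by rewrite ler_norml => /andP[h1 h2]; clear - h1 h2 ir0; lra.
  - move=> p J sp cL up jJ aJ qJ; apply: jetu => //.
    + exact: closeL cL.
    + exact: le_trans up LN1.
    + exact: le_trans aJ lamL.
    + exact: le_trans qJ lamL.
  - move=> p sp cL.
    have := mods _ (enorm_ge0 _) (hrs p sp (closeL _ _ _ Lrs cL)).
    by rewrite -/S; clear; lra.
have hw : 0 <= H2 0.
  apply: (@local_sup_bound_affine R T k d sigma (\- w) pc (- a') (- q') C0 rho lam r L
            (\tr Q1 - (c1 - del / 3)) (- c2) H2 _ _ uw spc C00 lam8 lam0 r0 _ Lrho hv2 tH2 sMH2 trMH2).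
  - by rewrite -rL ler_pM2r// ler_pM2l// lerD2r lerDr.
  - move=> g p' gr bp'; rewrite -/(vw p').
    have [[p bp fE] _] := hf1 g.
    have := hH1 g gr; rewrite fE ler_norml => /andP[_ h1].
    have h2 := hv p p' bp bp'.
    have h3 := @sup_conv_quad n tau lam Cq M (S *m g) (S' *m g) (p.2 - ph.2) (p'.2 - pc.2)
       (p.1 - ph.1) (p'.1 - pc.1) n0 tau0 Cq0 lam1 Ms.
    have h4 := VE p g.
    rewrite /H2 /= Q1E HE gr.
    have ir8 : kap < io * r ^+ 2 / 4 by rewrite /kap; clear - ir0; lra.
    move: h1 h2 h3 h4 ir8; rewrite -/(vw p') -/(v p); move: (v p) (vw p') (V p) (H1 g).
    move: (dot (p.2 - ph.2) (S *m g)) (2^-1 * dot (S *m g) (M *m (S *m g))).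
    clear; move=> *; lra.
  - move=> p J sp cL up jJ aJ qJ.
    have jJ' := superjet_opp_sub jJ.
    rewrite lerNl -raddfN -mulmxN; apply: (jetw p _ sp _ _ jJ') => /=.
    + exact: closeL cL.
    + have -> : w p - w pc = - ((\- w) p - (\- w) pc) by rewrite /=; ring.
      by rewrite normrN; apply: le_trans up _; rewrite normrN enormN.
    + rewrite -opprD normrN; move: aJ; rewrite opprK => aJ.
      exact: le_trans aJ lamL.
    + rewrite -opprD enormN; move: qJ; rewrite opprK => qJ.
      exact: le_trans qJ lamL.
  - move=> p sp cL.
    have := mods _ (enorm_ge0 _) (hrs' p sp (closeL _ _ _ Lrs' cL)); rewrite -/S' trQ1.
    have tD : tau * (n * enorm (S - S') ^+ 2) + 2 * tau * enorm S ^+ 2 <= del / 6.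
      by rewrite -htau /D1; clear - tau0; lra.
    clear - tD hio delE; lra.
have kap0 : 0 < kap by rewrite /kap; clear - ir0; lra.
by move: hu hw; rewrite /H2 /= mulmx0 dot0r mulr0; clear - kap0; lra.
Qed.

End Doubling.

(** * Indices off the obstacle *)

Section NoLoop.
Variables (R : realType) (m : nat).

(** Iterates in a finite set repeat. A cycle of least length, over all starting points in I, visits
    distinct points, and its length is at least two because s has no fixed point in I. *)
Lemma shortest_cycle (s : 'I_m -> 'I_m) (I : pred 'I_m) (i0 : 'I_m) :
  I i0 -> (forall i, I i -> I (s i) /\ s i != i) ->
  exists L y, [/\ (1 < L)%N, I y, iter L s y = y &
    uniq [seq iter a s y | a <- iota 0 L]].
Proof.
move=> Ii0 Is.
have Iiter n y : I y -> I (iter n s y) by move=> Iy; elim: n => //= n /Is[].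
pose P L := (0 < L)%N && [exists y, I y && (iter L s y == y)].
have exP : exists L, P L.
  have : ~~ injectiveb (fun n : 'I_m.+1 => iter n s i0).
    apply/injectiveP => /leq_card; rewrite !card_ord => h.
    by have := leq_trans (ltnSn m) h; rewrite ltnn.
  case/injectivePn => a [b ab E].
  wlog lt_ab : a b ab E / (a < b)%N.
    move=> H; case: (ltngtP a b) => [h|h|/val_inj h].
    - exact: (H a b).
    - by apply: (H b a) => //; rewrite eq_sym.
    - by rewrite h eqxx in ab.
  exists (b - a)%N; rewrite /P subn_gt0 lt_ab /=; apply/existsP; exists (iter a s i0).
  by rewrite Iiter// -iterD subnK; [apply/eqP; exact: esym E | exact: ltnW].
have [L /andP[L0 /existsP[y /andP[Iy /eqP Ly]]] Lmin] := ex_minnP exP.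
exists L, y; split=> //.
  rewrite ltn_neqAle L0 andbT; apply/eqP => L1; move: Ly; rewrite -L1 /= => E.
  by have [_] := Is y Iy; rewrite E eqxx.
rewrite map_inj_in_uniq ?iota_uniq// => a b; rewrite !mem_iota !add0n /= => aL bL E.
wlog lt_ab : a b aL bL E / (a < b)%N.
  move=> H; case: (ltngtP a b) => // h; first exact: H.
  by apply/esym; apply: H.
have /Lmin : P (b - a)%N.
  rewrite /P subn_gt0 lt_ab /=; apply/existsP; exists (iter a s y).
  by rewrite Iiter// -iterD subnK; [apply/eqP; exact: esym E | exact: ltnW].
by rewrite leqNgt (leq_ltn_trans (leq_subr _ _)).
Qed.

(** Follow chosen successors around a shortest cycle: the costs are bounded by increments of phi,
    whose sum telescopes to zero. *)
Lemma no_loop_contra (c : 'I_m -> 'I_m -> R) (phi : 'I_m -> R) (I : set 'I_m) :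
  (forall (N : nat) (i : nat -> 'I_m), (3 <= N)%N -> i 1%N = i N ->
         #|[seq i n | n <- index_iota 1 N.+1]| = N.-1 ->
         0 < \sum_(1 <= n < N) c (i n) (i n.+1)) ->
  I !=set0 ->
  (forall i, I i -> exists j, [/\ j != i, I j & phi i <= phi j - c i j]) -> False.
Proof.
move=> noloop [i0 Ii0] h.
have hex i : exists j, I i -> [/\ j != i, I j & phi i <= phi j - c i j].
  have [Ii|nIi] := pselect (I i); last by exists i.
  by have [j hj] := h i Ii; exists j.
have [s hs] := choice hex.
have [||L [y [L1 Iy Ly uy]]] := @shortest_cycle s (fun i => `[< I i >]) i0.
- exact/asboolP.
- by move=> i /asboolP /hs[h1 h2 _]; split => //; exact/asboolP.
move/asboolP in Iy.
have Iiter n : I (iter n s y) by elim: n => //= n /hs[].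
(* Indices start at 1: the loop from [i 1] to [i L.+1] has L edges and L distinct vertices. *)
pose i n := iter n.-1 s y.
have /(noloop L.+1 i) : (3 <= L.+1)%N by [].
move=> /(_ (esym Ly)) H.
have : 0 < \sum_(1 <= n < L.+1) c (i n) (i n.+1).
  apply: H; rewrite -[RHS]/L.
  rewrite -[RHS](size_iota 0) -(size_map (fun a => iter a s y)) -(card_uniqP uy).
  apply: eq_card => z; apply/idP/idP => /seq.mapP[a];
      rewrite ?mem_index_iota ?mem_iota => /andP[a1 aL] ->; apply/seq.mapP.
    rewrite ltnS leq_eqVlt in aL; case/orP: aL => [/eqP ->|aL].
      by exists 0%N; [rewrite mem_iota add0n (ltnW L1) | rewrite /i /= Ly].
    by exists a.-1; rewrite ?mem_iota//=; case: a a1 aL.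
  exists a.+1 => //.
  by rewrite mem_index_iota /=; rewrite add0n in aL; rewrite ltnS ltnW.
apply/negP; rewrite -leNgt.
apply: (@le_trans _ _ (\sum_(1 <= n < L.+1) (phi (i n.+1) - phi (i n)))).
  rewrite !big_nat; apply: ler_sum => n /andP[n1 _].
  have := hs _ (Iiter n.-1) => -[_ _]; rewrite /i; case: n n1 => // n _ /=; lra.
by rewrite telescope_sumr// /i /= Ly subrr.
Qed.

End NoLoop.

(** * The weight zeta and its second-order expansion *)

Section Weight.
Variables (R : realType) (T : R) (k : nat).
Local Notation point := (R * 'cV[R]_k)%type.

Definition base (x : 'cV[R]_k) : R := 1 + dot x x.
Definition zeta (mu : R) (m : nat) (p : point) : R :=
  expR (mu * (T - p.1)) * base p.2 ^+ m.

Lemma base_ge1 x : 1 <= base x.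
Proof. by rewrite lerDl dot_ge0. Qed.

Lemma zeta_ge mu m p : 0 <= mu -> p.1 <= T -> base p.2 ^+ m <= zeta mu m p.
Proof.
move=> mu0 pT; rewrite ler_peMl ?exprn_ge0 ?(le_trans ler01 (base_ge1 _))//.
by rewrite -expR0 ler_expR mulr_ge0// subr_ge0.
Qed.

Lemma zeta_gt0 mu m p : 0 < zeta mu m p.
Proof. by rewrite mulr_gt0 ?expR_gt0// exprn_gt0// (lt_le_trans ltr01 (base_ge1 _)). Qed.

Lemma zeta_ge1 mu m p : 0 <= mu -> p.1 <= T -> 1 <= zeta mu m p.
Proof.
move=> mu0 pT; apply: le_trans (zeta_ge m mu0 pT).
by rewrite exprn_ege1 ?base_ge1.
Qed.

Lemma bernoulli_upper n (v : R) : -1 <= v <= 1 -> (1 + v) ^+ n <= 1 + n%:R * v + 3 ^+ n * v ^+ 2.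
Proof.
move=> /andP[v1 v2]; elim: n => [|n IH]; first by rewrite !expr0 mul0r addr0 mul1r lerDl sqr_ge0.
rewrite exprS; have v0 : 0 <= 1 + v by lra.
apply: le_trans (ler_wpM2l v0 IH) _.
have n3 : n%:R <= 3 ^+ n :> R by rewrite -natrX ler_nat ltnW// ltn_expl.
have h30 : 0 <= 3 ^+ n :> R by rewrite exprn_ge0.
have := sqr_ge0 v; rewrite [3 ^+ n.+1]exprS -(natr1 n).
have [w wE] : exists w, w = v ^+ 2 by exists (v ^+ 2).
rewrite -wE => w0.
have w1 : v * w <= w by rewrite ler_piMl.
have -> : (1 + v) * (1 + n%:R * v + 3 ^+ n * w) =
   1 + (n%:R + 1) * v + n%:R * w + 3 ^+ n * w + 3 ^+ n * (v * w) by rewrite wE; ring.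
have := ler_wpM2l h30 w1; have := ler_wpM2r w0 n3; lra.
Qed.

(** Inverts e^(-v) >= 1 - v, using (1 - v) (1 + v + 2 v^2) >= 1 for v <= 1/2. *)
Lemma expR_upper (v : R) : v <= 2^-1 -> expR v <= 1 + v + 2 * v ^+ 2.
Proof.
move=> v2; have h : 0 < 1 - v by lra.
have := expR_ge1Dx (- v); rewrite expRN => h1.
have e0 := expR_gt0 v.
have : (1 - v) * expR v <= 1 by rewrite -ler_pdivlMr// div1r.
move=> h2; rewrite -(ler_pM2l h); apply: le_trans h2 _.
have := sqr_ge0 v; rewrite (_ : (1 - v) * _ = 1 + v ^+ 2 * (1 - 2 * v)); last by ring.
by move=> v0; rewrite lerDl mulr_ge0//; lra.
Qed.

(** Increments are measured relative to [base x], with a constant independent of x. Against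
    coefficients of linear growth, this makes the generator applied to the weight at most a multiple
    of the weight. *)
Lemma base_expand m : exists2 c : R, 0 <= c & forall x dx : 'cV[R]_k, enorm dx <= 2^-1 ->
  base (x + dx) ^+ m <= base x ^+ m *
    (1 + (2 * m%:R) * (dot x dx / base x) + c * (enorm dx ^+ 2 / base x)).
Proof.
exists (m%:R + 10 * 3 ^+ m) => [|x dx hdx]; first by rewrite addr_ge0 ?mulr_ge0 ?exprn_ge0.
set r := base x; have r1 : 1 <= r := base_ge1 x; have r0 : 0 < r by lra.
have x2 : enorm x ^+ 2 = r - 1 by rewrite /r /base dot_enorm; ring.
have d0 := enorm_ge0 dx; have e0 := enorm_ge0 x.
have dE := dotC_le x dx.
set s := 2 * dot x dx + enorm dx ^+ 2.
have -> : base (x + dx) = r * (1 + s / r).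
  rewrite mulrDr mulr1 mulrCA divff ?gt_eqF// mulr1 /base -/r dot_enorm enormD_sqr -dot_enorm.
  by rewrite /r /base /s; ring.
have d2 : enorm dx ^+ 2 <= 2^-1 * enorm dx by rewrite expr2 ler_wpM2r.
have dd0 := sqr_ge0 (enorm dx).
have dxd : `|dot x dx| <= 2^-1 * enorm x by apply: le_trans dE _; rewrite mulrC ler_wpM2r.
have sr : `|s| <= r.
  apply: le_trans (ler_normD _ _) _; rewrite normrM (@ger0_norm _ 2)// (ger0_norm dd0).
  have : 0 <= enorm x ^+ 2 - enorm x + 2^-1 ^+ 2.
    by rewrite (_ : _ + _ = (enorm x - 2^-1) ^+ 2) ?sqr_ge0//; field.
  rewrite x2; lra.
have s2 : s ^+ 2 <= 10 * r * enorm dx ^+ 2.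
  have h1 : s ^+ 2 <= 2 * (2 * dot x dx) ^+ 2 + 2 * (enorm dx ^+ 2) ^+ 2.
    have := sqr_ge0 (2 * dot x dx - enorm dx ^+ 2); rewrite /s.
    by move: (2 * dot x dx) (enorm dx ^+ 2) => A B; clear; nra.
  apply: le_trans h1 _.
  have h2 : dot x dx ^+ 2 <= (r - 1) * enorm dx ^+ 2.
    rewrite -x2 -exprMn -real_normK ?num_real// ler_pXn2r ?nnegrE ?mulr_ge0//.
  have h3 : (enorm dx ^+ 2) ^+ 2 <= enorm dx ^+ 2.
    by rewrite expr2 ler_piMl//; lra.
  have h4 : enorm dx ^+ 2 <= r * enorm dx ^+ 2 by rewrite ler_peMl.
  rewrite exprMn; lra.
have hv : -1 <= s / r <= 1.
  by rewrite -ler_norml normrM [`|r^-1|]gtr0_norm ?invr_gt0// ler_pdivrMr// mul1r.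
rewrite exprMn ler_wpM2l ?exprn_ge0 ?(ltW r0)//.
apply: le_trans (bernoulli_upper _ hv) _.
have -> : m%:R * (s / r) = 2 * m%:R * (dot x dx / r) + m%:R * (enorm dx ^+ 2 / r).
  by rewrite /s; ring.
have : (s / r) ^+ 2 <= 10 * (enorm dx ^+ 2 / r).
  rewrite exprMn exprVn ler_pdivrMr ?exprn_gt0//.
  apply: le_trans s2 _; rewrite le_eqVlt; apply/orP; left; apply/eqP.
  by field; rewrite gt_eqF.
have h3 : 0 <= 3 ^+ m :> R by rewrite exprn_ge0.
move=> /(ler_wpM2l h3); lra.
Qed.

(** The order of the quantifiers matters: B precedes mu, which is later chosen large in terms of B,
    whereas C may depend on mu since it only multiplies a squared time increment. *)
Lemma zeta_expand m : exists2 B : R, 0 <= B & forall mu : R, 0 < mu ->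
  exists2 C : R, 0 <= C & forall p p' : point,
    `|p'.1 - p.1| <= 2^-1 / mu -> enorm (p'.2 - p.2) <= 2^-1 ->
    zeta mu m p' <= zeta mu m p * (1 - mu * (p'.1 - p.1)
      + (2 * m%:R) * (dot p.2 (p'.2 - p.2) / base p.2)
      + B * (enorm (p'.2 - p.2) ^+ 2 / base p.2)
      + C * (p'.1 - p.1) ^+ 2).
Proof.
have [c c0 hc] := base_expand m.
exists (2 * c + 4 * m%:R ^+ 2) => [|mu mu0].
  by rewrite addr_ge0 ?mulr_ge0 ?sqr_ge0.
exists ((3 + 2 * (m%:R + c)) * mu ^+ 2) => [|p p' hdt hdx].
  by rewrite mulr_ge0 ?sqr_ge0 ?addr_ge0 ?mulr_ge0 ?addr_ge0.
set dt := p'.1 - p.1 in hdt *; set dx := p'.2 - p.2 in hdx *.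
set r := base p.2; have r1 : 1 <= r := base_ge1 _; have r0 : 0 < r by lra.
pose v := - (mu * dt).
have v2 : `|v| <= 2^-1 by rewrite normrN normrM gtr0_norm// mulrC -ler_pdivlMr.
have /andP[v3 v4] : - 2^-1 <= v <= 2^-1 by rewrite -ler_norml.
rewrite /zeta.
have -> : mu * (T - p'.1) = mu * (T - p.1) + v by rewrite /v /dt; ring.
rewrite expRD -[leLHS]mulrA -[leRHS]mulrA ler_pM2l ?expR_gt0//.
have := hc p.2 dx hdx; rewrite {1}/dx addrC subrK -/r => h1.
have := expR_upper v4 => h2.
have b0 : 0 <= base p'.2 ^+ m by rewrite exprn_ge0// (le_trans ler01 (base_ge1 _)).
apply: le_trans (ler_pM (ltW (expR_gt0 _)) b0 h2 h1) _.
rewrite mulrCA ler_wpM2l ?exprn_ge0 ?(ltW r0)//.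
pose l := (2 * m%:R) * (dot p.2 dx / r).
pose kap := enorm dx ^+ 2 / r.
have kap0 : 0 <= kap by rewrite divr_ge0 ?sqr_ge0 ?ltW.
have x2 : enorm p.2 ^+ 2 = r - 1 by rewrite /r /base dot_enorm; ring.
have e0 := enorm_ge0 p.2; have d0 := enorm_ge0 dx.
have dd0 := sqr_ge0 (enorm dx).
have dE := dotC_le p.2 dx.
have dot2 : (dot p.2 dx / r) ^+ 2 <= kap.
  rewrite exprMn exprVn ler_pdivrMr ?exprn_gt0// /kap.
  rewrite (_ : _ / r * r ^+ 2 = r * enorm dx ^+ 2); last by field; rewrite gt_eqF.
  rewrite -real_normK ?num_real//.
  apply: (@le_trans _ _ ((enorm p.2 * enorm dx) ^+ 2)).
    by rewrite ler_pXn2r ?nnegrE ?mulr_ge0.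
  by rewrite exprMn x2 ler_wpM2r//; lra.
have l2 : l ^+ 2 <= 4 * m%:R ^+ 2 * kap.
  rewrite /l exprMn; have m0 : 0 <= (2 * m%:R) ^+ 2 :> R by exact: sqr_ge0.
  by have := ler_wpM2l m0 dot2; lra.
have kap1 : kap <= 1.
  rewrite /kap ler_pdivrMr// mul1r; apply: le_trans r1.
  rewrite expr2; nra.
have l1 : l <= m%:R.
  have hd : dot p.2 dx <= 2^-1 * r.
    apply: le_trans (ler_norm _) _; apply: le_trans dE _.
    apply: (@le_trans _ _ (enorm p.2 * 2^-1)); first by rewrite ler_wpM2l.
    by have := sqr_ge0 (enorm p.2 - 1); rewrite sqrrB x2; lra.
  have : dot p.2 dx / r <= 2^-1 by rewrite ler_pdivrMr.
  rewrite /l => h; have m0 : 0 <= 2 * m%:R :> R by rewrite mulr_ge0.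
  by have := ler_wpM2l m0 h; lra.
have ck1 : c * kap <= c by rewrite ler_piMr.
have ck0 : 0 <= c * kap by rewrite mulr_ge0.
have w0 := sqr_ge0 v.
have m0 : 0 <= m%:R :> R by [].
have amgm (a b : R) : a * b <= a ^+ 2 + b ^+ 2.
  have := sqr_ge0 (a - b); have := sqr_ge0 a; have := sqr_ge0 b.
  rewrite (_ : (a - b) ^+ 2 = a ^+ 2 - 2 * (a * b) + b ^+ 2); last by ring.
  by move: (a ^+ 2) (b ^+ 2) (a * b) => A B C q1 q2 q3; clear - q1 q2 q3; lra.
have vl : v * l <= v ^+ 2 + l ^+ 2 by exact: amgm.
have vk : v * (c * kap) <= c * kap by rewrite ler_piMl//; apply: le_trans v4 _; rewrite invf_le1 ?ler1n.
have h3 : 2 * v ^+ 2 * (l + c * kap) <= 2 * v ^+ 2 * (m%:R + c).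
  by apply: ler_wpM2l; [rewrite mulr_ge0 ?sqr_ge0 | exact: lerD].
have -> : (3 + 2 * (m%:R + c)) * mu ^+ 2 * dt ^+ 2 = 3 * v ^+ 2 + 2 * v ^+ 2 * (m%:R + c).
  by rewrite /v; ring.
rewrite -/l -/kap -/v.
have -> : (1 + v + 2 * v ^+ 2) * (1 + l + c * kap) =
   1 + v + l + c * kap + 2 * v ^+ 2 + v * l + v * (c * kap) + 2 * v ^+ 2 * (l + c * kap) by ring.
clear - vl vk h3 l2; lra.
Qed.

End Weight.

(** * Uniform continuity and localisation on compact boxes *)

Section Stability.
Variables (R : realType) (T : R) (k : nat).
Local Notation point := (R * 'cV[R]_k)%type.

Lemma close_trans (r1 r2 : R) (p p' p'' : point) :
  close r1 p p' -> close r2 p' p'' -> close (r1 + r2) p p''.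
Proof.
move=> [a1 b1] [a2 b2]; split.
  have := ler_normD (p''.1 - p'.1) (p'.1 - p.1); rewrite addrA subrK.
  by clear - a1 a2; lra.
have := enormD (p''.2 - p'.2) (p'.2 - p.2); rewrite addrA subrK.
by clear - b1 b2; lra.
Qed.

Lemma closeW (r1 r2 : R) (p p' : point) : r1 <= r2 -> close r1 p p' -> close r2 p p'.
Proof. by move=> h [h1 h2]; split; [exact: lt_le_trans h | exact: lt_le_trans h]. Qed.

Lemma close_sym (r : R) (p p' : point) : close r p p' -> close r p' p.
Proof. by move=> [h1 h2]; split; [rewrite distrC | rewrite enormB]. Qed.

Lemma close_refl (r : R) (p : point) : 0 < r -> close r p p.
Proof. by move=> r0; split; rewrite subrr ?normr0 ?enorm0. Qed.

Definition cont_in (D : set point) m n (f : point -> 'M[R]_(m, n)) :=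
  forall p, D p -> forall e : R, 0 < e -> exists2 r : R, 0 < r &
    forall p', D p' -> close r p p' -> enorm (f p' - f p) < e.

Lemma within_cont_in (D : set point) m n (f : point -> 'M[R]_(m, n)) :
  {within D, continuous f} -> cont_in D f.
Proof.
move=> /subspace_continuousP cf p Dp e e0.
have /(cf p Dp) : nbhs (f p) (fun M => enorm (M - f p) < e) by apply/nbhs_enorm; exists e.
by move=> /(near_close D p (fun p' => enorm (f p' - f p) < e)).
Qed.

Lemma uscP (D : set point) (u : point -> R) : usc_in D u <->
  forall p, D p -> forall e : R, 0 < e -> exists2 r : R, 0 < r &
    forall p', D p' -> close r p p' -> u p' < u p + e.
Proof.
split=> h p Dp e e0; first by apply/near_close; exact: h.
by apply/near_close; exact: h.
Qed.

Lemma box_near_covering (rho : R) (p0 : point) (P : R -> point -> Prop) :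
  (forall x, box T rho p0 x -> exists2 r : R, 0 < r & forall eta p,
     0 < eta -> eta < r -> close r x p -> P eta p) ->
  exists2 eta, 0 < eta & forall p, box T rho p0 p -> P eta p.
Proof.
move=> h; have /compact_near_coveringP ncov := @compact_box R T k rho p0.
have /ncov : forall x, box T rho p0 x -> \forall x' \near x & eta \near (0 : R)^'+, P eta x'.
  move=> x bx; have [r r0 hr] := h x bx.
  exists ([set p | close r x p], [set eta | 0 < eta < r]).
    split => /=; first by apply/nbhs_close; exists r.
    near=> eta; apply/andP; split; near: eta; [exact: nbhs_right_gt | exact: nbhs_right_lt].
  by move=> [p eta] /= [cp /andP[e0 er]]; exact: hr.
move=> hn; have hn' : \forall eta \near (0 : R)^'+, 0 < eta /\ (box T rho p0 `<=` P eta).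
  near=> eta; split; near: eta; [exact: nbhs_right_gt | exact: hn].
by have [eta [eta0 he]] := filter_ex hn'; exists eta.
Unshelve. all: by end_near. Qed.

Lemma box_unif_cont (rho : R) (p0 : point) m n (f : point -> 'M[R]_(m, n)) (e : R) :
  cont_in (strip T k) f -> 0 < e ->
  exists2 eta, 0 < eta & forall p p', box T rho p0 p -> box T rho p0 p' ->
    close eta p p' -> enorm (f p' - f p) < e.
Proof.
move=> cf e0.
have [|eta eta0 he] := @box_near_covering rho p0 (fun eta p => box T rho p0 p ->
    forall p', box T rho p0 p' -> close eta p p' -> enorm (f p' - f p) < e); last first.
  by exists eta => // p p' bp bp' c; exact: he.
move=> x [sx _ _]; have e2 : 0 < e / 2 by rewrite divr_gt0.
have [r r0 hr] := cf x sx _ e2; exists (r / 2); first by rewrite divr_gt0.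
move=> eta p eta0 er cp [sp _ _] p' [sp' _ _] cpp'.
have c1 : close r x p by apply: closeW cp; clear - r0; lra.
have c2 : close r x p'.
  by apply: closeW (close_trans cp cpp'); clear - er; lra.
have := hr p sp c1; have := hr p' sp' c2.
have := enormD (f p' - f x) (f x - f p); rewrite addrA subrK (enormB (f x) (f p)).
by clear; lra.
Qed.

(** Takes the place of a passage to the limit in the penalisation. Away from p0 the difference is
    negative on the diagonal, and by semicontinuity also for pairs near the diagonal. Near p0,
    semicontinuity bounds u and - w from above, and the sign condition then bounds each of them from
    below. *)
Lemma doubled_max_near (u w Z : point -> R) (p0 : point) (eps : R) :
  usc_in (strip T k) u -> usc_in (strip T k) (\- w) -> continuous Z ->
  strip T k p0 -> 0 < eps ->
  u p0 - w p0 - Z p0 = 0 ->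
  (forall p, strip T k p -> p <> p0 -> u p - w p - Z p < 0) ->
  exists2 eta, 0 < eta & forall p p', box T 1 p0 p -> box T 1 p0 p' ->
    close eta p p' -> 0 <= u p - w p' - Z p ->
    [/\ close eps p0 p, close eps p0 p', u p - w p' - Z p < eps,
        `|u p - u p0| < eps & `|w p' - w p0| < eps].
Proof.
move=> uu uw cZ sp0 eps0 E0 neg.
have uZ : usc_in (strip T k) (\- Z).
  by apply: cvg_usc_in => x; apply: cvgN; exact: cZ.
have uZ' : usc_in (strip T k) Z by exact: cvg_usc_in.
move: uu uw uZ uZ' => /uscP uu /uscP uw /uscP uZ /uscP uZ'.
have e4 : 0 < eps / 4 by rewrite divr_gt0.
have three p e : strip T k p -> 0 < e -> exists2 r, 0 < r & forall p', strip T k p' ->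
    close r p p' -> [/\ u p' < u p + e, - w p' < - w p + e, - Z p' < - Z p + e
      & Z p' < Z p + e].
  move=> sp e0; have [r1 r10 h1] := uu p sp e e0; have [r2 r20 h2] := uw p sp e e0.
  have [r3 r30 h3] := uZ p sp e e0; have [r4 r40 h4] := uZ' p sp e e0.
  exists (Num.min (Num.min r1 r2) (Num.min r3 r4)); first by rewrite !lt_min r10 r20 r30 r40.
  move=> p' sp' c; split.
  - by apply: h1 => //; apply: closeW c; rewrite !ge_min lexx.
  - by apply: h2 => //; apply: closeW c; rewrite !ge_min lexx orbT.
  - by apply: h3 => //; apply: closeW c; rewrite !ge_min lexx !orbT.
  - by apply: h4 => //; apply: closeW c; rewrite !ge_min lexx !orbT.
have [r0 r00 hr0] := three p0 _ sp0 e4.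
pose e1 := Num.min eps r0; have e10 : 0 < e1 by rewrite lt_min eps0.
have [|eta eta0 he] := @box_near_covering 1 p0 (fun eta p => box T 1 p0 p ->
    forall p', box T 1 p0 p' -> close eta p p' -> 0 <= u p - w p' - Z p ->
    close (e1 / 2) p0 p).
  move=> x bx; have [->|/eqP xp0] := eqVneq x p0.
    by exists (e1 / 2) => //; rewrite divr_gt0.
  have sx : strip T k x by case: bx.
  have n0 := neg x sx xp0.
  have c0 : 0 < - (u x - w x - Z x) / 4 by rewrite divr_gt0// oppr_gt0.
  have [r r_gt0 hr] := three x _ sx c0.
  exists (r / 2); first by rewrite divr_gt0.
  move=> eta p eta0 er cp [sp _ _] p' [sp' _ _] cpp' h.
  have c1 : close r x p by apply: closeW cp; clear - r_gt0; lra.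
  have c2 : close r x p' by apply: closeW (close_trans cp cpp'); clear - er; lra.
  have [h1 _ h3 _] := hr p sp c1; have [_ h2 _ _] := hr p' sp' c2.
  by exfalso; move: h h1 h2 h3 n0; clear; lra.
exists (Num.min eta (e1 / 2)); first by rewrite lt_min eta0 divr_gt0.
move=> p p' bp bp' c pos.
have c1 : close eta p p' by apply: closeW c; rewrite ge_min lexx.
have c2 : close (e1 / 2) p p' by apply: closeW c; rewrite ge_min lexx orbT.
have cp := he p bp bp p' bp' c1 pos.
have cp' : close e1 p0 p' by apply: closeW (close_trans cp c2); clear; lra.
have cpe : close e1 p0 p by apply: closeW cp; clear - e10; lra.
have sp : strip T k p by case: bp.
have sp' : strip T k p' by case: bp'.
have [h1 _ h3 h5] : [/\ u p < u p0 + eps / 4, - w p < - w p0 + eps / 4,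
    - Z p < - Z p0 + eps / 4 & Z p < Z p0 + eps / 4].
  by apply: hr0 => //; apply: closeW cpe; rewrite ge_min lexx orbT.
have [_ h2 _ _] : [/\ u p' < u p0 + eps / 4, - w p' < - w p0 + eps / 4,
    - Z p' < - Z p0 + eps / 4 & Z p' < Z p0 + eps / 4].
  by apply: hr0 => //; apply: closeW cp'; rewrite ge_min lexx orbT.
split.
- by apply: closeW cpe; rewrite ge_min lexx.
- by apply: closeW cp'; rewrite ge_min lexx.
- by move: h1 h2 h3 E0 eps0; clear; lra.
- by rewrite ltr_norml; apply/andP; split; move: pos h1 h2 h3 E0 eps0; clear; lra.
- by rewrite ltr_norml; apply/andP; split; move: pos h1 h2 h3 E0 eps0; clear; lra.
Qed.

End Stability.

(** * Comparison *)

Section OneEquation.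
Variables (R : realType) (T : R) (k d : nat).
Local Notation point := (R * 'cV[R]_k)%type.
Variables (b : point -> 'cV[R]_k) (sigma : point -> 'M[R]_(k, d))
  (fi : point -> R -> 'cV[R]_d -> R) (C : R).
Hypothesis b_cont : cont_in (strip T k) b.
Hypothesis s_cont : cont_in (strip T k) sigma.
Hypothesis C_ge0 : 0 <= C.
Hypothesis bs_growth : forall p, strip T k p ->
  enorm (b p) + enorm (sigma p) <= C * (1 + enorm p.2).
Hypothesis bs_lip : forall t x y, 0 <= t <= T ->
  enorm (b (t, x) - b (t, y)) + enorm (sigma (t, x) - sigma (t, y)) <= C * enorm (x - y).
Hypothesis f_cont : forall p, strip T k p -> forall e, 0 < e -> exists2 r : R, 0 < r &
  forall p', strip T k p' -> close r p p' -> forall y z, `|fi p' y z - fi p y z| < e.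
Hypothesis f_lip : forall p y y' z z', strip T k p ->
  `|fi p y z - fi p y' z'| <= C * (`|y - y'| + enorm (z - z')).

(** Opposite of the first-order part of the operator, f included: a sign of [pde_part] becomes an
    inequality between this quantity and half a trace. *)
Definition drift p y a (q : 'cV[R]_k) : R :=
  a + dot (b p) q + fi p y ((sigma p)^T *m q).

Lemma pde_driftE p y J : pde_part b sigma fi p y J =
  - drift p y J.1.1 J.1.2 - 2^-1 * \tr (sigma p *m (sigma p)^T *m J.2).
Proof. by rewrite /pde_part /drift; ring. Qed.

Lemma drift_cont P y a q delta : strip T k P -> 0 < delta ->
  exists2 L : R, 0 < L & forall p y' a' q', strip T k p -> close L P p ->
    `|y' - y| <= L -> `|a' - a| <= L -> enorm (q' - q) <= L ->
    `|drift p y' a' q' - drift P y a q| < delta.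
Proof.
move=> sP del0; have C0 := C_ge0.
have [eb es eq] : [/\ 0 <= enorm (b P), 0 <= enorm (sigma P) & 0 <= enorm q].
  by rewrite !enorm_ge0.
pose Q := enorm q + 1; have Q0 : 0 < Q by rewrite ltr_wpDl.
have CQ0 : 0 <= C * Q by rewrite mulr_ge0 // ltW.
have D10 : 0 < 6 * (1 + Q + C * Q) by lra.
have Cs0 : 0 <= C * enorm (sigma P) by rewrite mulr_ge0.
have D20 : 0 < 6 * (1 + enorm (b P) + C + C * enorm (sigma P)).
  by lra.
have [e1 e10 he1] : exists2 e1, 0 < e1 & e1 * (6 * (1 + Q + C * Q)) = delta.
  by exists (delta / (6 * (1 + Q + C * Q))); rewrite ?divr_gt0 ?divfK ?gt_eqF.
have [e2 e20 he2] : exists2 e2, 0 < e2 &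
    e2 * (6 * (1 + enorm (b P) + C + C * enorm (sigma P))) = delta.
  exists (delta / (6 * (1 + enorm (b P) + C + C * enorm (sigma P)))).
    by rewrite divr_gt0.
  by rewrite divfK ?gt_eqF.
have d6 : 0 < delta / 6 by rewrite divr_gt0.
have [r1 r10 h1] := b_cont sP e10; have [r2 r20 h2] := s_cont sP e10.
have [r3 r30 h3] := f_cont sP d6.
exists (Num.min (Num.min r1 r2) (Num.min r3 (Num.min 1 e2))).
  by rewrite !lt_min r10 r20 r30 ltr01 e20.
move=> p y' a' q' sp c; rewrite !le_min => /andP[_ /andP[_ /andP[_ hy]]].
move=> /andP[_ /andP[_ /andP[_ ha]]] /andP[_ /andP[_ /andP[q1 q2]]].
have {}h1 : enorm (b p - b P) < e1.
  by apply: h1 => //; apply: closeW c; rewrite !ge_min lexx.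
have {}h2 : enorm (sigma p - sigma P) < e1.
  by apply: h2 => //; apply: closeW c; rewrite !ge_min lexx ?orbT.
have {}h3 y0 z0 : `|fi p y0 z0 - fi P y0 z0| < delta / 6.
  by apply: h3 => //; apply: closeW c; rewrite !ge_min lexx ?orbT.
have q'Q : enorm q' <= Q.
  have := enormD (q' - q) q; rewrite subrK /Q; lra.
have B1 : `|dot (b p) q' - dot (b P) q| <= e1 * Q + enorm (b P) * e2.
  have -> : dot (b p) q' - dot (b P) q = dot (b p - b P) q' + dot (b P) (q' - q).
    by rewrite !dotlin; ring.
  apply: le_trans (ler_normD _ _) (lerD _ _); apply: le_trans (dotC_le _ _) _.
    by apply: ler_pM; [exact: enorm_ge0 | exact: enorm_ge0 | exact: ltW | by []].
  by rewrite ler_wpM2l ?enorm_ge0.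
set z' := (sigma p)^T *m q'; set z := (sigma P)^T *m q.
have B2 : enorm (z' - z) <= e1 * Q + enorm (sigma P) * e2.
  have -> : z' - z = (sigma p - sigma P)^T *m q' + (sigma P)^T *m (q' - q).
    by rewrite linearB /= mulmxBl mulmxBr addrA subrK.
  apply: le_trans (enormD _ _) (lerD _ _); apply: le_trans (enormM _ _) _; rewrite enorm_tr.
    by apply: ler_pM; [exact: enorm_ge0 | exact: enorm_ge0 | exact: ltW | by []].
  by rewrite ler_wpM2l ?enorm_ge0.
have B3 : `|fi p y' z' - fi P y z| <= delta / 6 + C * (e2 + (e1 * Q + enorm (sigma P) * e2)).
  have -> : fi p y' z' - fi P y z = (fi p y' z' - fi P y' z') + (fi P y' z' - fi P y z).
    by ring.
  apply: le_trans (ler_normD _ _) (lerD _ _); first exact/ltW/h3.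
  apply: le_trans (f_lip _ _ _ _ sP) _; apply: ler_wpM2l => //; exact: lerD.
have -> : drift p y' a' q' - drift P y a q =
  (a' - a) + (dot (b p) q' - dot (b P) q) + (fi p y' z' - fi P y z).
  by rewrite /drift -/z -/z'; ring.
apply: le_lt_trans (ler_normD _ _) _; apply: le_lt_trans (lerD (ler_normD _ _) (lexx _)) _.
apply: le_lt_trans (lerD (lerD ha B1) B3) _.
have -> : e2 + (e1 * Q + enorm (b P) * e2) + (delta / 6 + C * (e2 + (e1 * Q + enorm (sigma P) * e2)))
  = e1 * (Q + C * Q) + e2 * (1 + enorm (b P) + C + C * enorm (sigma P)) + delta / 6 by ring.
have := mulr_gt0 e10 Q0; lra.
Qed.

Lemma trace_scalar (s : 'M[R]_(k, d)) (a : R) : \tr (s *m s^T *m a%:M) = a * enorm s ^+ 2.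
Proof. by rewrite mul_mx_scalar mxtraceZ -[s in s *m _]trmxK trace_gram enorm_tr. Qed.

Lemma Z_continuous (theta tau mu : R) m (p0 : point) :
  continuous (fun p : point => theta * zeta T mu m p
     + tau * ((p.1 - p0.1) ^+ 2 + enorm (p.2 - p0.2) ^+ 2)).
Proof.
have c1 : continuous (fun p : point => p.1 - p0.1).
  by move=> p; apply: cvgB; [exact: cvg_fst | exact: cvg_cst].
have c2 (x0 : 'cV[R]_k) : continuous (fun p : point => enorm (p.2 - x0)).
  move=> p; apply: (@continuous_comp _ _ _ (fun p : point => p.2 - x0) (@enorm R k 1)).
    by apply: (@cvgB _ 'cV[R]_k); [exact: cvg_snd | exact: cvg_cst].
  exact: enorm_continuous.
have cb : continuous (fun p : point => base p.2).
  have -> : (fun p : point => base p.2) =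
      (fun p : point => 1 + enorm (p.2 - 0) * enorm (p.2 - 0)).
    by apply/funext => z; rewrite /base dot_enorm subr0 expr2.
  by move=> p; apply: cvgD; [exact: cvg_cst | apply: cvgM; exact: c2].
move=> p; apply: cvgD; apply: cvgMr.
  apply: cvgM.
    apply: (@continuous_comp _ _ _ (fun p : point => mu * (T - p.1)) expR).
      by apply: cvgMr; apply: cvgB; [exact: cvg_cst | exact: cvg_fst].
    exact: continuous_expR.
  apply: (@continuous_comp _ _ _ (fun p : point => base p.2) (fun x => x ^+ m)).
    exact: cb.
  exact: exprn_continuous.
by apply: cvgD; rewrite expr2; apply: cvgM; (exact: c1 || exact: c2).
Qed.

End OneEquation.

(** A stands for theta zeta at the maximum point. The lower bound on mu dominates every term
    proportional to A with one A to spare; the terms in tau and in eps take at most th / 4 each, and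
    th <= A. *)
Lemma doubling_arith (R : realType) (A th mu M C B tau S eps GP GP' da db df nS al : R) :
  0 < th -> th <= A -> 1 + 4 * M * C + 2 * B * C ^+ 2 + C + 4 * M * C ^+ 2 <= mu ->
  tau * (2 + 2 * S + S ^+ 2 + 2 * C + 2 * C * S) <= th / 4 ->
  eps * (7 + 5 * C + 4 * C ^+ 2) <= th / 4 ->
  GP' - GP <= 2 * eps + nS + al -> GP - GP' = da + db + df ->
  da <= - mu * A + 2 * tau ->
  db <= 4 * M * C * A + 2 * tau * S + (2 * C + 2) * eps ->
  df <= 2 * eps + C * (A + 2 * tau + eps + (4 * M * C * A + 2 * tau * S + (2 * C + 2) * eps)) ->
  nS <= (2 * C ^+ 2 + 1) * eps ->
  al <= 2 * B * C ^+ 2 * A + tau * S ^+ 2 -> False.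
Proof.
move=> th0 thA hmu htau heps h0 h1 h2 h3 h4 h5 h6.
have A0 : 0 <= A by lra.
have := ler_wpM2r A0 hmu; lra.
Qed.

Section OneEquation.
Variables (R : realType) (T : R) (k d : nat).
Local Notation point := (R * 'cV[R]_k)%type.
Variables (b : point -> 'cV[R]_k) (sigma : point -> 'M[R]_(k, d))
  (fi : point -> R -> 'cV[R]_d -> R) (C : R).
Hypothesis b_cont : cont_in (strip T k) b.
Hypothesis s_cont : cont_in (strip T k) sigma.
Hypothesis C_ge0 : 0 <= C.
Hypothesis bs_growth : forall p, strip T k p ->
  enorm (b p) + enorm (sigma p) <= C * (1 + enorm p.2).
Hypothesis bs_lip : forall t x y, 0 <= t <= T ->
  enorm (b (t, x) - b (t, y)) + enorm (sigma (t, x) - sigma (t, y)) <= C * enorm (x - y).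
Hypothesis f_cont : forall p, strip T k p -> forall e, 0 < e -> exists2 r : R, 0 < r &
  forall p', strip T k p' -> close r p p' -> forall y z, `|fi p' y z - fi p y z| < e.
Hypothesis f_lip : forall p y y' z z', strip T k p ->
  `|fi p y z - fi p y' z'| <= C * (`|y - y'| + enorm (z - z')).

Lemma doubled_equations (u w : point -> R) (P P' : point) a a' q q' n al Cq rho L1 eps :
  (0 < d)%N -> usc_in (strip T k) u -> usc_in (strip T k) (\- w) ->
  strip T k P -> strip T k P' -> 0 <= n -> 0 <= Cq -> 0 < rho -> 0 < L1 -> 0 < eps ->
  (forall p p', box T rho P p -> box T rho P' p' ->
     u p - w p' <= u P - w P' + a * (p.1 - P.1) - a' * (p'.1 - P'.1)
       + dot q (p.2 - P.2) - dot q' (p'.2 - P'.2)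
       + n / 2 * enorm ((p.2 - P.2) - (p'.2 - P'.2)) ^+ 2
       + al * enorm (p.2 - P.2) ^+ 2
       + Cq * ((p.1 - P.1) ^+ 2 + (p'.1 - P'.1) ^+ 2)) ->
  (forall p J, strip T k p -> close L1 P p -> `|u p - u P| <= L1 ->
     superjet T u p J -> pde_part b sigma fi p (u p) J <= 0) ->
  (forall p J, strip T k p -> close L1 P' p -> subjet T w p J ->
     0 <= pde_part b sigma fi p (w p) J) ->
  drift b sigma fi P' (w P') a' q' - drift b sigma fi P (u P) a q <=
     2 * eps + n / 2 * enorm (sigma P - sigma P') ^+ 2 + al * enorm (sigma P) ^+ 2.
Proof.
move=> d0 uu uw sP sP' n0 Cq0 rho0 L10 eps0 hmax hu hw.
have [La La0 hLa] := drift_cont b_cont s_cont C_ge0 f_cont f_lip (u P) a q sP eps0.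
have [Lb Lb0 hLb] := drift_cont b_cont s_cont C_ge0 f_cont f_lip (w P') a' q' sP' eps0.
set GP := drift b sigma fi P (u P) a q in hLa *.
set GP' := drift b sigma fi P' (w P') a' q' in hLb *.
pose L0 := Num.min L1 (Num.min La Lb).
have L00 : 0 < L0 by rewrite !lt_min L10 La0 Lb0.
have L01 : L0 <= L1 by rewrite ge_min lexx.
have L0a : L0 <= La by rewrite !ge_min lexx ?orbT.
have L0b : L0 <= Lb by rewrite !ge_min lexx ?orbT.
have Mdot (x : 'cV[R]_k) : 2^-1 * dot x ((2 * al)%:M *m x) = al * enorm x ^+ 2.
  by rewrite mul_scalar_mx dotZr dot_enorm; field.
(* Near P the subsolution inequality makes the trace at least - 2 (GP + eps); near P' the
   supersolution inequality makes it at most - 2 (GP' - eps). *)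
have := @doubling_jets R T k d sigma u w P P' a a' q q' n (2 * al)%:M Cq
  (- 2 * (GP + eps)) (- 2 * (GP' - eps)) rho L0 d0 uu uw sP sP' n0 (tr_scalar_mx _ _)
  Cq0 rho0 L00.
rewrite trace_scalar.
move=> H; have : - 2 * (GP + eps) - - 2 * (GP' - eps) <=
    n * enorm (sigma P - sigma P') ^+ 2 + 2 * al * enorm (sigma P) ^+ 2; last first.
  by move: (n) (enorm (sigma P - sigma P') ^+ 2) (al) (enorm (sigma P) ^+ 2) => *; lra.
apply: H; [by move=> p p' bp bp'; rewrite Mdot; exact: hmax | exact: s_cont sP
  | exact: s_cont sP' | |].
- move=> p J sp cp up jJ aJ qJ.
  have := hu p J sp (closeW L01 cp) (le_trans up L01) jJ.
  rewrite pde_driftE => h1.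
  have := hLa p (u p) J.1.1 J.1.2 sp (closeW L0a cp) (le_trans up L0a)
     (le_trans aJ L0a) (le_trans qJ L0a).
  by rewrite ltr_norml => /andP[_ h2]; lra.
- move=> p J sp cp up jJ aJ qJ.
  have := hw p J sp (closeW L01 cp) jJ.
  rewrite pde_driftE => h1.
  have := hLb p (w p) J.1.1 J.1.2 sp (closeW L0b cp) (le_trans up L0b)
     (le_trans aJ L0b) (le_trans qJ L0b).
  by rewrite ltr_norml => /andP[h2 _]; lra.
Qed.

End OneEquation.

(** The mixed term in dt ds of the time penalty is traded for squares through (dt + ds)^2 >= 0. *)
Lemma expansion_arith (R : realType) (uw UW Zp ZP n nu X2 D E2 e2 T0 dt ds dt0 mu A K BAr ACz
    tau D0 qd q'd : R) :
  Zp - ZP <= - mu * A * dt + K + BAr * e2 + ACz * dt ^+ 2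
     + tau * (2 * dt0 * dt + dt ^+ 2 + 2 * D0 + e2) ->
  qd - q'd = K + 2 * tau * D0 + n * D -> 0 <= ACz -> 0 <= tau -> 0 <= nu ->
  uw - Zp - n / 2 * (X2 + 2 * D + E2) - nu / 2 * (T0 + (dt - ds)) ^+ 2 <=
     UW - ZP - n / 2 * X2 - nu / 2 * T0 ^+ 2 ->
  uw <= UW + (- mu * A + 2 * tau * dt0 + nu * T0) * dt - nu * T0 * ds + qd - q'd
     + n / 2 * E2 + (BAr + tau) * e2 + (ACz + tau + nu) * (dt ^+ 2 + ds ^+ 2).
Proof.
move=> hZ hq A0 t0 n0 hh.
have h1 := mulr_ge0 n0 (sqr_ge0 (dt + ds)).
have h2 := mulr_ge0 A0 (sqr_ge0 ds); have h3 := mulr_ge0 t0 (sqr_ge0 ds).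
lra.
Qed.

Section OneEquation.
Variables (R : realType) (T : R) (k d : nat).
Local Notation point := (R * 'cV[R]_k)%type.
Variables (b : point -> 'cV[R]_k) (sigma : point -> 'M[R]_(k, d))
  (fi : point -> R -> 'cV[R]_d -> R) (C : R).
Hypothesis b_cont : cont_in (strip T k) b.
Hypothesis s_cont : cont_in (strip T k) sigma.
Hypothesis C_ge0 : 0 <= C.
Hypothesis bs_growth : forall p, strip T k p ->
  enorm (b p) + enorm (sigma p) <= C * (1 + enorm p.2).
Hypothesis bs_lip : forall t x y, 0 <= t <= T ->
  enorm (b (t, x) - b (t, y)) + enorm (sigma (t, x) - sigma (t, y)) <= C * enorm (x - y).
Hypothesis f_cont : forall p, strip T k p -> forall e, 0 < e -> exists2 r : R, 0 < r &
  forall p', strip T k p' -> close r p p' -> forall y z, `|fi p' y z - fi p y z| < e.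
Hypothesis f_lip : forall p y y' z z', strip T k p ->
  `|fi p y z - fi p y' z'| <= C * (`|y - y'| + enorm (z - z')).

Lemma box_growth (p0 p : point) : box T 1 p0 p ->
  enorm (b p) + enorm (sigma p) <= C * (2 + enorm p0.2).
Proof.
move=> [sp _ h]; apply: le_trans (bs_growth sp) _; apply: ler_wpM2l => //.
by have := enormD (p.2 - p0.2) p0.2; rewrite subrK; lra.
Qed.

Lemma penalized_equations (u w : point -> R) (p0 P P' : point)
    (theta mu B Cz rho0 tau eps n nu : R) (m : nat) :
  let Z := fun p : point => theta * zeta T mu m p
     + tau * ((p.1 - p0.1) ^+ 2 + enorm (p.2 - p0.2) ^+ 2) in
  let A := theta * zeta T mu m P in
  (0 < d)%N -> usc_in (strip T k) u -> usc_in (strip T k) (\- w) ->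
  p0.1 < T -> 0 < theta -> 0 < mu -> 0 <= B -> 0 <= Cz -> 0 < rho0 ->
  (forall p p' : point, `|p'.1 - p.1| <= 2^-1 / mu -> enorm (p'.2 - p.2) <= 2^-1 ->
    zeta T mu m p' <= zeta T mu m p * (1 - mu * (p'.1 - p.1)
      + (2 * m%:R) * (dot p.2 (p'.2 - p.2) / base p.2)
      + B * (enorm (p'.2 - p.2) ^+ 2 / base p.2)
      + Cz * (p'.1 - p.1) ^+ 2)) ->
  (forall p J, strip T k p -> close rho0 p0 p -> `|u p - u p0| <= rho0 ->
     superjet T u p J -> pde_part b sigma fi p (u p) J <= 0) ->
  (forall p J, strip T k p -> p.1 < T -> subjet T w p J ->
     0 <= pde_part b sigma fi p (w p) J) ->
  0 < tau -> 0 < eps -> eps <= rho0 / 2 ->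
  eps <= (T - p0.1) / 2 -> eps <= 2^-1 -> 0 <= n -> 0 < nu ->
  box T 1 p0 P -> box T 1 p0 P' -> close eps p0 P -> close eps p0 P' ->
  `|u P - u p0| < eps ->
  (forall p p', box T 1 p0 p -> box T 1 p0 p' ->
    u p - w p' - Z p - n / 2 * enorm (p.2 - p'.2) ^+ 2 - nu / 2 * (p.1 - p'.1) ^+ 2 <=
    u P - w P' - Z P - n / 2 * enorm (P.2 - P'.2) ^+ 2 - nu / 2 * (P.1 - P'.1) ^+ 2) ->
  drift b sigma fi P' (w P') (nu * (P.1 - P'.1)) (n *: (P.2 - P'.2))
  - drift b sigma fi P (u P) (- mu * A + 2 * tau * (P.1 - p0.1) + nu * (P.1 - P'.1))
     ((2 * m%:R * (A / base P.2)) *: P.2 + (2 * tau) *: (P.2 - p0.2) + n *: (P.2 - P'.2)) <=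
  2 * eps + n / 2 * enorm (sigma P - sigma P') ^+ 2
     + (B * (A / base P.2) + tau) * enorm (sigma P) ^+ 2.
Proof.
move=> Z A d0 uu uw p0T th0 mu0 B0 Cz0 rho00 hz hu hw tau0 eps0 epsr epsT
  eps1 n0 nu0 bP bP' cP cP' uP hPhi.
have sP : strip T k P by case: bP.
have sP' : strip T k P' by case: bP'.
set z := zeta T mu m P in A *; set r := base P.2; set M := m%:R : R.
have z0 : 0 <= z := ltW (zeta_gt0 _ _ _ _).
have A0 : 0 <= A by apply: mulr_ge0 => //; exact: ltW.
pose Ar := A / r; pose kap := 2 * M * Ar.
pose dt0 := P.1 - p0.1; pose dx0 := P.2 - p0.2.
(* [a] and [q] are the slopes at P of Z plus the penalties; those for w, [a'] and [q'], come from
   the penalties alone. [al] bounds the second-order part of Z in space. *)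
pose a := - mu * A + 2 * tau * dt0 + nu * (P.1 - P'.1).
pose a' := nu * (P.1 - P'.1).
pose q' := n *: (P.2 - P'.2).
pose q := kap *: P.2 + (2 * tau) *: dx0 + q'.
pose al := B * Ar + tau.
pose Cq := A * Cz + tau + nu.
have half0 : 0 < 2^-1 :> R by rewrite invr_gt0.
(* Within this radius, boxes about P and P' stay in the unit box about p0 and the expansion of zeta
   is valid. *)
have rho1 : 0 < Num.min 2^-1 (2^-1 / mu) by rewrite lt_min half0; exact: divr_gt0.
have AC0 : 0 <= A * Cz by exact: mulr_ge0.
have Cq0 : 0 <= Cq by apply: addr_ge0; [apply: addr_ge0 => //; exact: ltW | exact: ltW].
have dt01 : `|dt0| <= 2^-1 by case: cP => h _; apply: le_trans (ltW h) eps1.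
have dx01 : enorm dx0 <= 2^-1 by case: cP => _ h; apply: le_trans (ltW h) eps1.
have dt02 : `|P'.1 - p0.1| <= 2^-1 by case: cP' => h _; apply: le_trans (ltW h) eps1.
have dx02 : enorm (P'.2 - p0.2) <= 2^-1 by case: cP' => _ h; apply: le_trans (ltW h) eps1.
have h12 : 2^-1 + 2^-1 = 1 :> R by rewrite [RHS](splitr 1) mul1r.
have subbox (Q p : point) : `|Q.1 - p0.1| <= 2^-1 -> enorm (Q.2 - p0.2) <= 2^-1 ->
    box T (Num.min 2^-1 (2^-1 / mu)) Q p -> box T 1 p0 p.
  move=> Q1 Q2 [sp]; rewrite !le_min => /andP[l1 _] /andP[l2 _]; split=> //.
    rewrite -h12; apply: le_trans (lerD l1 Q1); apply: le_trans (ler_normD _ _).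
    by rewrite addrA subrK.
  rewrite -h12; apply: le_trans (lerD l2 Q2); apply: le_trans (enormD _ _).
  by rewrite addrA subrK.
have L10 : 0 < Num.min (rho0 / 2) ((T - p0.1) / 2) by rewrite lt_min !divr_gt0// subr_gt0.
apply: (@doubled_equations R T k d b sigma fi C b_cont s_cont C_ge0 f_cont f_lip
  u w P P' a a' q q' n al Cq (Num.min 2^-1 (2^-1 / mu)) (Num.min (rho0 / 2) ((T - p0.1) / 2)) eps
  d0 uu uw sP sP' n0 Cq0 rho1) => //.
- move=> p p' bp bp'.
  have := hPhi p p' (subbox P p dt01 dx01 bp) (subbox P' p' dt02 dx02 bp').
  case: bp => sp; rewrite !le_min => /andP[_ l1] /andP[l2 _].
  have := hz P p l1 l2; rewrite -/z -/r -/M.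
  set dt := p.1 - P.1; set dx := p.2 - P.2; set ds := p'.1 - P'.1; set dy := p'.2 - P'.2.
  move=> /(ler_wpM2l (ltW th0)) hzz hh.
  have hZ : Z p - Z P <= - mu * A * dt + kap * dot P.2 dx + B * Ar * enorm dx ^+ 2
      + A * Cz * dt ^+ 2 + tau * (2 * dt0 * dt + dt ^+ 2 + 2 * dot dx0 dx + enorm dx ^+ 2).
    have -> : Z p - Z P = theta * zeta T mu m p - theta * z
       + tau * (((p.1 - p0.1) ^+ 2 + enorm (p.2 - p0.2) ^+ 2) - (dt0 ^+ 2 + enorm dx0 ^+ 2)).
      by rewrite /Z -/z -/dt0 -/dx0; ring.
    have -> : p.1 - p0.1 = dt0 + dt by rewrite /dt0 /dt; ring.
    have -> : p.2 - p0.2 = dx0 + dx by rewrite /dx0 /dx [RHS]addrC addrA subrK.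
    rewrite enormD_sqr.
    have : theta * (z * (1 - mu * dt + 2 * M * (dot P.2 dx / r) + B * (enorm dx ^+ 2 / r)
       + Cz * dt ^+ 2)) - theta * z = - mu * A * dt + kap * dot P.2 dx
       + B * Ar * enorm dx ^+ 2 + A * Cz * dt ^+ 2 by rewrite /kap /Ar /A; ring.
    have -> : tau * ((dt0 + dt) ^+ 2 + (enorm dx0 ^+ 2 + 2 * dot dx0 dx + enorm dx ^+ 2)
        - (dt0 ^+ 2 + enorm dx0 ^+ 2)) =
       tau * (2 * dt0 * dt + dt ^+ 2 + 2 * dot dx0 dx + enorm dx ^+ 2) by ring.
    by move: hzz; lra.
  have hX : enorm (p.2 - p'.2) ^+ 2 = enorm (P.2 - P'.2) ^+ 2
     + 2 * dot (P.2 - P'.2) (dx - dy) + enorm (dx - dy) ^+ 2.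
    have -> : p.2 - p'.2 = (P.2 - P'.2) + (dx - dy).
      by rewrite /dx /dy; apply/matrixP => i j; rewrite !mxE; ring.
    by rewrite enormD_sqr.
  have hT : p.1 - p'.1 = (P.1 - P'.1) + (dt - ds) by rewrite /dt /ds; ring.
  have hq : dot q dx - dot q' dy = kap * dot P.2 dx + 2 * tau * dot dx0 dx
     + n * dot (P.2 - P'.2) (dx - dy).
    by rewrite /q /q' !dotlin; ring.
  move: hh; rewrite hX hT; exact: (expansion_arith hZ hq AC0 (ltW tau0) (ltW nu0)).
- move=> p J sp cp up jJ; apply: (hu p J sp) => //.
    apply: closeW (close_trans cP cp).
    rewrite [leRHS](splitr rho0); apply: lerD => //.
    by rewrite ge_min lexx.
  have -> : u p - u p0 = (u p - u P) + (u P - u p0) by ring.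
  apply: le_trans (ler_normD _ _) _; move: up; rewrite le_min => /andP[up _].
  by rewrite [leRHS](splitr rho0); apply: lerD => //; exact: le_trans (ltW uP) epsr.
- move=> p J sp cp jJ; apply: hw => //.
  case: cp => h1 _; case: cP' => h2 _.
  have h3 : Num.min (rho0 / 2) ((T - p0.1) / 2) <= (T - p0.1) / 2 by rewrite ge_min lexx orbT.
  have := ler_norm (p.1 - P'.1); have := ler_norm (P'.1 - p0.1).
  lra.
Qed.

End OneEquation.

Lemma gradient_term_arith (R : realType) (C eps N x : R) :
  0 <= eps -> eps * x <= eps * 1 -> C * N <= C * (2 * eps) -> C * N + eps * x <= (2 * C + 2) * eps.
Proof. lra. Qed.

Lemma affine_diff (R : realType) k d (S1 S2 : 'M[R]_(d, k)) (v1 v2 v3 : 'cV[R]_k) (x y : R) :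
  S1 *m (x *: v1 + y *: v2 + v3) - S2 *m v3 =
  x *: (S1 *m v1) + y *: (S1 *m v2) + (S1 - S2) *m v3.
Proof. by rewrite !mulmxDr -!scalemxAr mulmxBl !addrA. Qed.

Section OneEquation.
Variables (R : realType) (T : R) (k d : nat).
Local Notation point := (R * 'cV[R]_k)%type.
Variables (b : point -> 'cV[R]_k) (sigma : point -> 'M[R]_(k, d))
  (fi : point -> R -> 'cV[R]_d -> R) (C : R).
Hypothesis b_cont : cont_in (strip T k) b.
Hypothesis s_cont : cont_in (strip T k) sigma.
Hypothesis C_ge0 : 0 <= C.
Hypothesis bs_growth : forall p, strip T k p ->
  enorm (b p) + enorm (sigma p) <= C * (1 + enorm p.2).
Hypothesis bs_lip : forall t x y, 0 <= t <= T ->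
  enorm (b (t, x) - b (t, y)) + enorm (sigma (t, x) - sigma (t, y)) <= C * enorm (x - y).
Hypothesis f_cont : forall p, strip T k p -> forall e, 0 < e -> exists2 r : R, 0 < r &
  forall p', strip T k p' -> close r p p' -> forall y z, `|fi p' y z - fi p y z| < e.
Hypothesis f_lip : forall p y y' z z', strip T k p ->
  `|fi p y z - fi p y' z'| <= C * (`|y - y'| + enorm (z - z')).

(** Estimates the differences that enter [doubling_arith]. Linear growth set against [base], through
    (1 + X)^2 <= 2 r, turns the slopes of zeta into multiples of A; the slope n (x - y) is
    controlled by the Lipschitz condition and n |x - y|^2 <= 2 eps. *)
Lemma penalized_contradiction (u w : point -> R) (p0 P P' : point)
    (theta mu B tau eps n nu : R) (m : nat) :
  let S := C * (2 + enorm p0.2) in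
  let Z := fun p : point => theta * zeta T mu m p
     + tau * ((p.1 - p0.1) ^+ 2 + enorm (p.2 - p0.2) ^+ 2) in
  let A := theta * zeta T mu m P in
  0 < theta -> 0 < mu -> 0 <= B -> 0 < tau -> 0 < eps -> eps <= 2^-1 -> 1 <= n -> 0 < nu ->
  box T 1 p0 P -> box T 1 p0 P' -> close eps p0 P -> close eps p0 P' ->
  u P - w P' - Z P < eps ->
  n / 2 * enorm (P.2 - P'.2) ^+ 2 + nu / 2 * (P.1 - P'.1) ^+ 2 <= u P - w P' - Z P ->
  enorm (b P' - b (P.1, P'.2)) <= eps / n ->
  enorm (sigma P' - sigma (P.1, P'.2)) <= eps / n ->
  (forall y z, `|fi P y z - fi p0 y z| < eps) ->
  (forall y z, `|fi P' y z - fi p0 y z| < eps) ->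
  1 + 4 * m%:R * C + 2 * B * C ^+ 2 + C + 4 * m%:R * C ^+ 2 <= mu ->
  tau * (2 + 2 * S + S ^+ 2 + 2 * C + 2 * C * S) <= theta / 4 ->
  eps * (7 + 5 * C + 4 * C ^+ 2) <= theta / 4 ->
  drift b sigma fi P' (w P') (nu * (P.1 - P'.1)) (n *: (P.2 - P'.2))
  - drift b sigma fi P (u P) (- mu * A + 2 * tau * (P.1 - p0.1) + nu * (P.1 - P'.1))
     ((2 * m%:R * (A / base P.2)) *: P.2 + (2 * tau) *: (P.2 - p0.2) + n *: (P.2 - P'.2)) <=
  2 * eps + n / 2 * enorm (sigma P - sigma P') ^+ 2
     + (B * (A / base P.2) + tau) * enorm (sigma P) ^+ 2 ->
  False.
Proof.
move=> S Z A th0 mu0 B0 tau0 eps0 eps1 n1 nu0 bP bP' cP cP' hPsi Phi0 db1 ds1.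
have C0 := C_ge0.
have CC0 := sqr_ge0 C.
have n0 : 0 < n by apply: lt_le_trans n1.
have sP : strip T k P by case: bP.
have sP' : strip T k P' by case: bP'.
have nn0 := mulr_ge0 (ltW n0) (sqr_ge0 (enorm (P.2 - P'.2))).
have nunu0 := mulr_ge0 (ltW nu0) (sqr_ge0 (P.1 - P'.1)).
have nxy : n * enorm (P.2 - P'.2) ^+ 2 <= 2 * eps by lra.
have uw0 : 0 <= u P - w P' - Z P by lra.
have M0 : 0 <= m%:R :> R by [].
have Pt : 0 <= P.1 <= T by case: sP => /=; rewrite in_itv /=.
have zg := zeta_gt0 T mu m P.
have z1 : 1 <= zeta T mu m P by apply: zeta_ge1; [exact: ltW | case/andP: Pt].
have ZPE : Z P = A + tau * ((P.1 - p0.1) ^+ 2 + enorm (P.2 - p0.2) ^+ 2) by [].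
move: (Z P) ZPE hPsi Phi0 uw0 => ZP ZPE hPsi Phi0 uw0; clear Z.
move: (zeta T mu m P) z1 zg @A ZPE => z z1 zg A ZPE.
set r := base P.2; set X := enorm P.2; set M := m%:R : R in M0 *.
have r1 : 1 <= r := base_ge1 _.
have r0 : 0 < r by apply: lt_le_trans r1.
have X0 : 0 <= X := enorm_ge0 _.
have Xr : X ^+ 2 = r - 1 by rewrite /X /r /base dot_enorm; ring.
have XX : (1 + X) * X <= 2 * r by have := sqr_ge0 (1 - X); rewrite sqrrB expr1n; lra.
have XX' : (1 + X) ^+ 2 <= 2 * r by have := sqr_ge0 (1 - X); rewrite sqrrB sqrrD expr1n; lra.
have thA : theta <= A by rewrite /A ler_peMr// ltW.
have A0 : 0 < A by apply: lt_le_trans thA.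
have [Ar ArE] : exists Ar, Ar = A / r by eexists.
have Ar0 : 0 <= Ar by rewrite ArE divr_ge0// ltW.
rewrite -ArE; have {}ArE : Ar * r = A by rewrite ArE divfK// gt_eqF.
have [kap kapE] : exists kap, kap = 2 * M * Ar by eexists.
rewrite -kapE.
have kap0 : 0 <= kap by rewrite kapE; apply: mulr_ge0 => //; apply: mulr_ge0.
have kapr : kap * r = 2 * M * A by rewrite kapE -mulrA ArE.
set dt0 := P.1 - p0.1; set dx0 := P.2 - p0.2.
have dt01 : `|dt0| <= 1 by case: bP.
have dx1 : enorm dx0 <= 1 by case: bP.
set q' := n *: (P.2 - P'.2).
set q := kap *: P.2 + (2 * tau) *: dx0 + q'.
have bsP := bs_growth sP; rewrite -/X in bsP.
have bsK := box_growth C_ge0 bs_growth bP; rewrite -/S in bsK.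
have b0 := enorm_ge0 (b P); have s0 := enorm_ge0 (sigma P).
set bb := enorm (b P) in bsP bsK b0; set ss := enorm (sigma P) in bsP bsK s0.
set xy := enorm (P.2 - P'.2) in nn0 nxy Phi0.
have xy0 : 0 <= xy := enorm_ge0 _.
have Pt' : 0 <= P'.1 <= T by case: sP' => /=; rewrite in_itv /=.
have lipP := bs_lip P.2 P'.2 Pt.
have PE : P = (P.1, P.2) by case: (P).
(* The space increment is taken at frozen time; the time increment costs eps / n, which stays small
   after multiplication by the slope n |x - y|. *)
have db2 : enorm (b P - b P') <= C * xy + eps / n.
  have -> : b P - b P' = (b (P.1, P.2) - b (P.1, P'.2)) + (b (P.1, P'.2) - b P') by rewrite -PE addrA subrK.
  apply: le_trans (enormD _ _) (lerD _ _); last by rewrite enormB.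
  by apply: le_trans lipP; rewrite lerDl enorm_ge0.
have ds2 : enorm (sigma P - sigma P') <= C * xy + eps / n.
  have -> : sigma P - sigma P' = (sigma (P.1, P.2) - sigma (P.1, P'.2)) + (sigma (P.1, P'.2) - sigma P').
    by rewrite -PE addrA subrK.
  apply: le_trans (enormD _ _) (lerD _ _); last by rewrite enormB.
  by apply: le_trans lipP; rewrite lerDr enorm_ge0.
have xy1 : xy <= 1.
  rewrite /xy (_ : P.2 - P'.2 = dx0 - (P'.2 - p0.2)); last first.
    by rewrite /dx0 opprB addrA subrK.
  apply: le_trans (enormD _ _) _; rewrite enormN [leRHS](splitr 1) mul1r.
  by apply: lerD; [case: cP => _ h | case: cP' => _ h]; exact: le_trans (ltW h) eps1.
have nDxy : (C * xy + eps / n) * (n * xy) <= (2 * C + 2) * eps.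
  have -> : (C * xy + eps / n) * (n * xy) = C * (n * xy ^+ 2) + eps * xy.
    by field; rewrite gt_eqF.
  exact: gradient_term_arith (ltW eps0) (ler_wpM2l (ltW eps0) xy1) (ler_wpM2l C0 nxy).
have q'n : enorm q' = n * xy by rewrite /q' enormZ gtr0_norm.
have Cn0 : 0 <= n * xy by rewrite mulr_ge0// ltW.
have bX : kap * (bb * X) <= 4 * M * C * A.
  have h : bb * X <= C * (2 * r).
    apply: (@le_trans _ _ (C * (1 + X) * X)); first apply: ler_wpM2r => //.
      by apply: le_trans bsP; rewrite (lerDl, lerDr).
    by rewrite -mulrA ler_wpM2l.
  apply: le_trans (ler_wpM2l kap0 h) _.
  rewrite (_ : kap * (C * (2 * r)) = 2 * C * (kap * r)); last by ring.
  by rewrite kapr [leLHS](_ : _ = 4 * M * C * A)//; ring.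
have sX : kap * (ss * X) <= 4 * M * C * A.
  have h : ss * X <= C * (2 * r).
    apply: (@le_trans _ _ (C * (1 + X) * X)); first apply: ler_wpM2r => //.
      by apply: le_trans bsP; rewrite (lerDl, lerDr).
    by rewrite -mulrA ler_wpM2l.
  apply: le_trans (ler_wpM2l kap0 h) _.
  rewrite (_ : kap * (C * (2 * r)) = 2 * C * (kap * r)); last by ring.
  by rewrite kapr [leLHS](_ : _ = 4 * M * C * A)//; ring.
have ssS : ss <= S by apply: le_trans bsK; rewrite lerDr.
have bbS : bb <= S by apply: le_trans bsK; rewrite lerDl.
have sD : ss * enorm dx0 <= S by apply: le_trans (ler_piMr s0 dx1) ssS.
have bD : bb * enorm dx0 <= S by apply: le_trans (ler_piMr b0 dx1) bbS.
have t20 : 0 <= 2 * tau by rewrite mulr_ge0// ltW.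
move=> fP fP' hmu htau heps main.
apply: (@doubling_arith R A theta mu M C B tau S eps
  (drift b sigma fi P (u P) (- mu * A + 2 * tau * dt0 + nu * (P.1 - P'.1)) q)
  (drift b sigma fi P' (w P') (nu * (P.1 - P'.1)) q')
  (- mu * A + 2 * tau * dt0) (dot (b P) q - dot (b P') q')
  (fi P (u P) ((sigma P)^T *m q) - fi P' (w P') ((sigma P')^T *m q'))
  (n / 2 * enorm (sigma P - sigma P') ^+ 2) ((B * Ar + tau) * ss ^+ 2)) => //.
all: move: fP fP' => fP fP'; clear hmu htau heps main.
- by rewrite /drift; ring.
- rewrite lerD2l -[leRHS]mulr1; apply: ler_wpM2l => //; exact: le_trans (ler_norm _) dt01.
- have -> : dot (b P) q - dot (b P') q' = kap * dot (b P) P.2 + 2 * tau * dot (b P) dx0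
     + dot (b P - b P') q' by rewrite /q !dotlin; ring.
  apply: lerD; first apply: lerD.
  + by apply: le_trans bX; rewrite ler_wpM2l// dot_le.
  + by apply: ler_wpM2l => //; apply: le_trans (dot_le _ _) _.
  + apply: le_trans (dot_le _ _) _; rewrite q'n; apply: le_trans nDxy.
    by rewrite ler_wpM2r.
- set zz := (sigma P)^T *m q; set zz' := (sigma P')^T *m q'.
  have hz' : enorm (zz - zz') <= 4 * M * C * A + 2 * tau * S + (2 * C + 2) * eps.
    have -> : zz - zz' = kap *: ((sigma P)^T *m P.2) + (2 * tau) *: ((sigma P)^T *m dx0)
        + (sigma P - sigma P')^T *m q'.
      rewrite (_ : (sigma P - sigma P')^T = (sigma P)^T - (sigma P')^T); last by rewrite linearB.
      exact: affine_diff.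
    apply: le_trans (enormD _ _) (lerD _ _); first apply: le_trans (enormD _ _) (lerD _ _).
    + rewrite enormZ ger0_norm//; apply: le_trans sX; rewrite ler_wpM2l//.
      by apply: le_trans (enormM _ _) _; rewrite enorm_tr.
    + rewrite enormZ ger0_norm// ler_wpM2l//; apply: le_trans sD.
      by apply: le_trans (enormM _ _) _; rewrite enorm_tr.
    + apply: le_trans (enormM _ _) _; rewrite enorm_tr q'n; apply: le_trans nDxy.
      by rewrite ler_wpM2r.
  have D0 : 0 <= dt0 ^+ 2 + enorm dx0 ^+ 2 by rewrite addr_ge0 ?sqr_ge0.
  have ZPb : ZP <= A + 2 * tau.
    rewrite ZPE lerD2l mulrC; apply: ler_wpM2r; first exact: ltW.
    have h1 : dt0 ^+ 2 <= 1 by rewrite -real_normK ?num_real// exprn_ile1.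
    have h2 : enorm dx0 ^+ 2 <= 1 by rewrite exprn_ile1 ?enorm_ge0.
    exact: lerD.
  have ZP0 : 0 <= ZP.
    by rewrite ZPE; apply: addr_ge0; [exact: ltW | apply: mulr_ge0 => //; exact: ltW].
  have uw' : `|u P - w P'| <= A + 2 * tau + eps.
    rewrite ger0_norm; last by move: uw0; rewrite subr_ge0; exact: le_trans.
    by have h := ltW hPsi; rewrite lerBlDr in h; apply: le_trans h _; rewrite addrC lerD2r.
  have -> : fi P (u P) zz - fi P' (w P') zz' =
     (fi P (u P) zz - fi p0 (u P) zz) - (fi P' (u P) zz - fi p0 (u P) zz)
     + (fi P' (u P) zz - fi P' (w P') zz') by ring.
  apply: lerD.
    have h1 := fP (u P) zz.
    have h2 := fP' (u P) zz.
    apply: le_trans (ler_norm _) _; apply: le_trans (ler_normB _ _) _.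
    by apply: le_trans (lerD (ltW h1) (ltW h2)) _; rewrite mulrDl mul1r.
  apply: le_trans (ler_norm _) _; apply: le_trans (f_lip _ _ _ _ sP') _.
  by apply: ler_wpM2l => //; exact: lerD.
- have e10 : 0 <= C * xy + eps / n by apply: addr_ge0; [exact: mulr_ge0 | apply: divr_ge0; exact: ltW].
  have h1 : enorm (sigma P - sigma P') ^+ 2 <= (C * xy + eps / n) ^+ 2.
    by rewrite ler_pXn2r ?nnegrE ?enorm_ge0.
  have n20 : 0 <= n / 2 by rewrite divr_ge0// ltW.
  apply: le_trans (ler_wpM2l n20 h1) _.
  have h2 : n / 2 * (C * xy + eps / n) ^+ 2 <= C ^+ 2 * (n * xy ^+ 2) + eps * (eps / n).
    rewrite -subr_ge0 (_ : _ - _ = n / 2 * (C * xy - eps / n) ^+ 2); last first.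
      by field; rewrite gt_eqF.
    by rewrite mulr_ge0 ?sqr_ge0.
  apply: le_trans h2 _; rewrite mulrDl mul1r; apply: lerD.
    by apply: le_trans (ler_wpM2l CC0 nxy) _; rewrite mulrA [_ * 2]mulrC.
  rewrite -[leRHS]mulr1; apply: ler_wpM2l; first exact: ltW.
  by rewrite ler_pdivrMr// mul1r; apply: le_trans n1; apply: le_trans eps1 _; rewrite invf_le1 ?ler1n.
- rewrite mulrDl; apply: lerD; last first.
    by apply: ler_wpM2l; [exact: ltW | rewrite ler_pXn2r ?nnegrE//; exact: le_trans ssS].
  have h : ss ^+ 2 <= C ^+ 2 * (2 * r).
    apply: (@le_trans _ _ ((C * (1 + X)) ^+ 2)).
      by rewrite ler_pXn2r ?nnegrE ?mulr_ge0 ?addr_ge0//; apply: le_trans bsP; rewrite lerDr.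
    by rewrite exprMn ler_wpM2l.
  have BA0 : 0 <= B * Ar by rewrite mulr_ge0.
  apply: le_trans (ler_wpM2l BA0 h) _.
  by rewrite -ArE -subr_ge0 [leRHS](_ : _ = 0) //; ring.
Qed.

Lemma comparison_core (u w : point -> R) (p0 P P' : point)
    (theta mu B Cz rho0 tau eps n nu : R) (m : nat) :
  let S := C * (2 + enorm p0.2) in
  let Z := fun p : point => theta * zeta T mu m p
     + tau * ((p.1 - p0.1) ^+ 2 + enorm (p.2 - p0.2) ^+ 2) in
  (0 < d)%N -> usc_in (strip T k) u -> usc_in (strip T k) (\- w) ->
  p0.1 < T -> 0 < theta -> 0 < mu -> 0 <= B -> 0 <= Cz -> 0 < rho0 ->
  (forall p p' : point, `|p'.1 - p.1| <= 2^-1 / mu -> enorm (p'.2 - p.2) <= 2^-1 ->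
    zeta T mu m p' <= zeta T mu m p * (1 - mu * (p'.1 - p.1)
      + (2 * m%:R) * (dot p.2 (p'.2 - p.2) / base p.2)
      + B * (enorm (p'.2 - p.2) ^+ 2 / base p.2)
      + Cz * (p'.1 - p.1) ^+ 2)) ->
  1 + 4 * m%:R * C + 2 * B * C ^+ 2 + C + 4 * m%:R * C ^+ 2 <= mu ->
  (forall p J, strip T k p -> close rho0 p0 p -> `|u p - u p0| <= rho0 ->
     superjet T u p J -> pde_part b sigma fi p (u p) J <= 0) ->
  (forall p J, strip T k p -> p.1 < T -> subjet T w p J ->
     0 <= pde_part b sigma fi p (w p) J) ->
  0 < tau -> tau * (2 + 2 * S + S ^+ 2 + 2 * C + 2 * C * S) <= theta / 4 ->
  0 < eps -> eps * (7 + 5 * C + 4 * C ^+ 2) <= theta / 4 -> eps <= rho0 / 2 ->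
  eps <= (T - p0.1) / 2 -> eps <= 2^-1 -> 1 <= n -> 0 < nu ->
  box T 1 p0 P -> box T 1 p0 P' -> close eps p0 P -> close eps p0 P' ->
  (forall y z, `|fi P y z - fi p0 y z| < eps) ->
  (forall y z, `|fi P' y z - fi p0 y z| < eps) ->
  u P - w P' - Z P < eps -> `|u P - u p0| < eps ->
  n / 2 * enorm (P.2 - P'.2) ^+ 2 + nu / 2 * (P.1 - P'.1) ^+ 2 <= u P - w P' - Z P ->
  (forall p p', box T 1 p0 p -> box T 1 p0 p' ->
    u p - w p' - Z p - n / 2 * enorm (p.2 - p'.2) ^+ 2 - nu / 2 * (p.1 - p'.1) ^+ 2 <=
    u P - w P' - Z P - n / 2 * enorm (P.2 - P'.2) ^+ 2 - nu / 2 * (P.1 - P'.1) ^+ 2) ->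
  enorm (b P' - b (P.1, P'.2)) <= eps / n ->
  enorm (sigma P' - sigma (P.1, P'.2)) <= eps / n ->
  False.
Proof.
move=> S Z d0 uu uw p0T th0 mu0 B0 Cz0 rho00 hz hmu hu hw tau0 htau eps0 heps epsr epsT
  eps1 n1 nu0 bP bP' cP cP' fP fP' hPsi uP Phi0 hPhi db1 ds1.
have n0 : 0 <= n by apply: le_trans n1.
apply: (@penalized_contradiction u w p0 P P' theta mu B tau eps n nu m) => //.
exact: (@penalized_equations R T k d b sigma fi C b_cont s_cont C_ge0 f_cont f_lip u w p0 P P'
  theta mu B Cz rho0).
Qed.

End OneEquation.

Section OneEquation.
Variables (R : realType) (T : R) (k d : nat).
Local Notation point := (R * 'cV[R]_k)%type.
Variables (b : point -> 'cV[R]_k) (sigma : point -> 'M[R]_(k, d))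
  (fi : point -> R -> 'cV[R]_d -> R) (C : R).
Hypothesis b_cont : cont_in (strip T k) b.
Hypothesis s_cont : cont_in (strip T k) sigma.
Hypothesis C_ge0 : 0 <= C.
Hypothesis bs_growth : forall p, strip T k p ->
  enorm (b p) + enorm (sigma p) <= C * (1 + enorm p.2).
Hypothesis bs_lip : forall t x y, 0 <= t <= T ->
  enorm (b (t, x) - b (t, y)) + enorm (sigma (t, x) - sigma (t, y)) <= C * enorm (x - y).
Hypothesis f_cont : forall p, strip T k p -> forall e, 0 < e -> exists2 r : R, 0 < r &
  forall p', strip T k p' -> close r p p' -> forall y z, `|fi p' y z - fi p y z| < e.
Hypothesis f_lip : forall p y y' z z', strip T k p ->
  `|fi p y z - fi p y' z'| <= C * (`|y - y'| + enorm (z - z')).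

(* [lra] fails once a section variable has been cleared, so [focus] keeps them. *)
Ltac focus := clear - b_cont s_cont C_ge0 bs_growth bs_lip f_cont f_lip.

(** Order of the choices: tau makes p0 a strict maximum, eps fixes the admissible errors, n brings
    the two space variables within [eta], and nu comes last, since the two times must be close
    enough for the moduli of b and sigma at level eps / n. *)
Lemma comparison_point (u w : point -> R) (p0 : point) (theta mu B Cz rho0 : R) (m : nat) :
  (0 < d)%N -> usc_in (strip T k) u -> usc_in (strip T k) (\- w) ->
  strip T k p0 -> p0.1 < T -> 0 < theta -> 0 < mu -> 0 <= B -> 0 <= Cz -> 0 < rho0 ->
  (forall p p' : point, `|p'.1 - p.1| <= 2^-1 / mu -> enorm (p'.2 - p.2) <= 2^-1 ->
    zeta T mu m p' <= zeta T mu m p * (1 - mu * (p'.1 - p.1)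
      + (2 * m%:R) * (dot p.2 (p'.2 - p.2) / base p.2)
      + B * (enorm (p'.2 - p.2) ^+ 2 / base p.2)
      + Cz * (p'.1 - p.1) ^+ 2)) ->
  1 + 4 * m%:R * C + 2 * B * C ^+ 2 + C + 4 * m%:R * C ^+ 2 <= mu ->
  (forall p, strip T k p -> u p - w p <= theta * zeta T mu m p) ->
  u p0 - w p0 = theta * zeta T mu m p0 ->
  (forall p J, strip T k p -> close rho0 p0 p -> `|u p - u p0| <= rho0 ->
     superjet T u p J -> pde_part b sigma fi p (u p) J <= 0) ->
  (forall p J, strip T k p -> p.1 < T -> subjet T w p J ->
     0 <= pde_part b sigma fi p (w p) J) ->
  False.
Proof.
move=> d0 uu uw sp0 p0T th0 mu0 B0 Cz0 rho00 hz hmu huw hE hu hw.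
have C0 := C_ge0.
set S := C * (2 + enorm p0.2).
have S0 : 0 <= S by rewrite mulr_ge0 ?addr_ge0 ?enorm_ge0.
have CS0 : 0 <= C * S by rewrite mulr_ge0.
have SS0 := sqr_ge0 S; have CC0 := sqr_ge0 C.
pose E1 := 2 + 2 * S + S ^+ 2 + 2 * C + 2 * C * S.
pose E2 := 7 + 5 * C + 4 * C ^+ 2.
have E10 : 0 < E1 by rewrite /E1; lra.
have E20 : 0 < E2 by rewrite /E2; lra.
have [tau tau0 htau] : exists2 tau, 0 < tau & tau * E1 <= theta / 4.
  by exists (theta / 4 / E1); rewrite ?divr_gt0 ?divfK ?gt_eqF.
have [eps [eps0 heps epsr epsT eps1]] : exists eps,
    [/\ 0 < eps, eps * E2 <= theta / 4, eps <= rho0 / 2, eps <= (T - p0.1) / 2 & eps <= 2^-1].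
  exists (Num.min (theta / 4 / E2) (Num.min (rho0 / 2) (Num.min ((T - p0.1) / 2) 2^-1))).
  split; first by rewrite !lt_min !divr_gt0 ?subr_gt0//= invr_gt0.
  - by rewrite -ler_pdivlMr// ge_min lexx.
  - by rewrite !ge_min lexx ?orbT.
  - by rewrite !ge_min lexx ?orbT.
  - by rewrite !ge_min lexx ?orbT.
have [rf rf0 hrf] := f_cont sp0 eps0.
pose ep := Num.min eps rf; have ep0 : 0 < ep by rewrite lt_min eps0.
pose Z (p : point) := theta * zeta T mu m p
     + tau * ((p.1 - p0.1) ^+ 2 + enorm (p.2 - p0.2) ^+ 2).
have E0 : u p0 - w p0 - Z p0 = 0.
  by rewrite hE /Z !subrr enorm0 !expr0n /= addr0 mulr0 addr0 subrr.
have neg p : strip T k p -> p <> p0 -> u p - w p - Z p < 0.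
  move=> sp pp0; have h1 := huw p sp.
  suff : 0 < tau * ((p.1 - p0.1) ^+ 2 + enorm (p.2 - p0.2) ^+ 2) by rewrite /Z; lra.
  rewrite pmulr_rgt0// lt_neqAle eq_sym addr_ge0 ?sqr_ge0// andbT.
  apply/eqP => /eqP; rewrite paddr_eq0 ?sqr_ge0// !sqrf_eq0 => /andP[/eqP h2 /eqP h3].
  apply: pp0; rewrite (surjective_pairing p) (surjective_pairing p0); congr (_, _).
    by apply/eqP; rewrite -subr_eq0 h2.
  by apply/eqP; rewrite -subr_eq0; apply/eqP/enorm_eq0.
have cZ : continuous Z by exact: Z_continuous.
have [eta eta0 heta] := @doubled_max_near R T k u w Z p0 ep uu uw cZ sp0 ep0 E0 neg.
have bp0 : box T 1 p0 p0 by split; rewrite // subrr ?normr0 ?enorm0.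
pose K := box T 1 p0 `*` box T 1 p0.
have cK : compact K by apply: compact_setX; exact: compact_box.
pose Psi (z : point * point) := u z.1 + (- w z.2 + - Z z.1).
have uPsi : usc_in K Psi.
  apply: usc_inD.
    apply: (usc_in_comp (B := strip T k) (h := fst)) => //; last by move=> z [[]].
    by move=> z _; apply: cvg_within_filter; exact: cvg_fst.
  apply: (usc_inD (f := fun z => - w z.2) (g := fun z => - Z z.1)).
    apply: (usc_in_comp (f := \- w) (B := strip T k) (h := snd)) => //; last by move=> z [_ []].
    by move=> z _; apply: cvg_within_filter; exact: cvg_snd.
  apply: cvg_usc_in => z; apply: cvgN.
  by apply: (@continuous_comp _ _ _ fst Z); [exact: cvg_fst | exact: cZ].
have K0 : K (p0, p0) by [].
have [zM _ hM] := usc_max cK (ex_intro _ _ K0) uPsi.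
set PM := Psi zM in hM.
have PM0 : 0 <= PM by apply: le_trans (hM _ K0); rewrite /Psi /= addrA E0.
(* [PM] is the maximum without the penalties, so it depends neither on n nor on nu, and a penalty
   bounded by it confines y below e for this weight. *)
have big (e : R) : 0 < e -> exists n : R, [/\ 1 <= n & forall y, n / 2 * y ^+ 2 <= PM -> 0 <= y -> y < e].
  move=> e0; exists (1 + 4 * (PM + 1) / e ^+ 2).
  have e20 : 0 < e ^+ 2 by rewrite exprn_gt0.
  have K4 : 0 <= 4 * (PM + 1) / e ^+ 2.
    by apply: divr_ge0; [rewrite mulr_ge0// addr_ge0 | exact: ltW].
  split; first by rewrite lerDl.
  move=> y hy y0; rewrite ltNge; apply/negP => ey.
  have ey2 : e ^+ 2 <= y ^+ 2 by rewrite lerXn2r ?nnegrE// ltW.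
  have : (1 + 4 * (PM + 1) / e ^+ 2) / 2 * e ^+ 2 <= PM.
    by apply: le_trans hy; rewrite ler_wpM2l// divr_ge0// addr_ge0.
  rewrite mulrAC mulrDl divfK ?gt_eqF// => h; move: h e20 PM0; focus; lra.
have [n [n1 hn]] := big eta eta0.
have n0 : 0 < n by exact: lt_le_trans n1.
have epn0 : 0 < eps / n by rewrite divr_gt0.
have [eb eb0 heb] := box_unif_cont 1 p0 b_cont epn0.
have [es es0 hes] := box_unif_cont 1 p0 s_cont epn0.
have em0 : 0 < Num.min eta (Num.min eb es) by rewrite !lt_min eta0 eb0 es0.
have [nu [nu1 hnu]] := big _ em0.
have nu0 : 0 < nu by exact: lt_le_trans nu1.
pose Phi (z : point * point) := Psi z +
  (- (n / 2 * enorm (z.1.2 - z.2.2) ^+ 2) - nu / 2 * (z.1.1 - z.2.1) ^+ 2).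
have uPhi : usc_in K Phi.
  apply: usc_inD => //; apply: cvg_usc_in => z; apply: cvgB.
    apply: cvgN; apply: cvgMr; rewrite expr2.
    have c1 : (fun z : point * point => enorm (z.1.2 - z.2.2)) @ z --> enorm (z.1.2 - z.2.2).
      apply: (@continuous_comp _ _ _ (fun z : point * point => z.1.2 - z.2.2) (@enorm R k 1)).
        apply: (@cvgB _ 'cV[R]_k).
          by apply: (@continuous_comp _ _ _ fst snd); [exact: cvg_fst | exact: cvg_snd].
        by apply: (@continuous_comp _ _ _ snd snd); [exact: cvg_snd | exact: cvg_snd].
      exact: enorm_continuous.
    by apply: cvgM.
  apply: cvgMr; rewrite expr2.
  have c2 : (fun z : point * point => z.1.1 - z.2.1) @ z --> z.1.1 - z.2.1.
    apply: cvgB.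
      by apply: (@continuous_comp _ _ _ fst fst); [exact: cvg_fst | exact: cvg_fst].
    by apply: (@continuous_comp _ _ _ snd fst); [exact: cvg_snd | exact: cvg_fst].
  by apply: cvgM.
have [[P P'] [/= bP bP'] hPhi] := usc_max cK (ex_intro _ _ K0) uPhi.
have nn0 := mulr_ge0 (ltW n0) (sqr_ge0 (enorm (P.2 - P'.2))).
have nunu0 := mulr_ge0 (ltW nu0) (sqr_ge0 (P.1 - P'.1)).
have Phi0 : n / 2 * enorm (P.2 - P'.2) ^+ 2 + nu / 2 * (P.1 - P'.1) ^+ 2 <= u P - w P' - Z P.
  have := hPhi _ K0; rewrite /Phi /Psi /= !subrr enorm0 expr0n /= !mulr0 subr0 oppr0 addr0.
  by rewrite addrA E0; focus; lra.
have PsiM : u P - w P' - Z P <= PM by rewrite -addrA; exact: (hM (P, P')).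
have xe : enorm (P.2 - P'.2) < eta by apply: hn; rewrite ?enorm_ge0//; move: Phi0 PsiM nunu0; focus; lra.
have : `|P.1 - P'.1| < Num.min eta (Num.min eb es).
  by apply: hnu => //; rewrite real_normK ?num_real//; move: Phi0 PsiM nn0; focus; lra.
rewrite !lt_min => /andP[te /andP[tb ts]].
have cPP' : close eta P P' by split; [rewrite distrC | rewrite enormB].
have Psi0 : 0 <= u P - w P' - Z P by move: Phi0 nn0 nunu0; focus; lra.
have [cP cP' hPsi uP wP'] := heta P P' bP bP' cPP' Psi0.
have epe : ep <= eps by rewrite ge_min lexx.
have epf : ep <= rf by rewrite ge_min lexx orbT.
have sP : strip T k P by case: bP.
have sP' : strip T k P' by case: bP'.
(* Mixed point, with the time of P and the position of P': it differs from P' in time only. *)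
pose Pm : point := (P.1, P'.2).
have bPm : box T 1 p0 Pm.
  have [[sPt _] tP _] := bP; have [_ _ xP'] := bP'.
  by split=> //; split.
have cPm : close eb Pm P' by split => /=; [rewrite distrC | rewrite subrr enorm0].
have cPms : close es Pm P' by split => /=; [rewrite distrC | rewrite subrr enorm0].
apply: (@comparison_core R T k d b sigma fi C b_cont s_cont C_ge0 bs_growth bs_lip f_cont f_lip
  u w p0 P P' theta mu B Cz rho0 tau eps n nu m) => //.
- exact: closeW epe cP.
- exact: closeW epe cP'.
- exact: hrf P sP (closeW epf cP).
- exact: hrf P' sP' (closeW epf cP').
- exact: lt_le_trans hPsi epe.
- exact: lt_le_trans uP epe.
- move=> p p' bp bp'; have := hPhi (p, p') (conj bp bp'); rewrite /Phi /Psi /=.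
  by rewrite -/(Z p) -/(Z P); focus; lra.
- exact/ltW/heb.
- exact/ltW/hes.
Qed.

End OneEquation.

(** * Comparison and stability of jets *)

Section Jets.
Variables (R : realType) (T : R) (k : nat).
Local Notation point := (R * 'cV[R]_k)%type.

Lemma superjet_le (u v : point -> R) p J (r0 : R) : 0 < r0 ->
  (forall p', strip T k p' -> close r0 p p' -> u p' <= v p') -> u p = v p ->
  superjet T v p J -> superjet T u p J.
Proof.
move=> r00 huv E /superjetP[sJ hJ]; apply/superjetP; split=> // e e0.
have [r rgt0 hr] := hJ e e0; exists (Num.min r r0); first by rewrite lt_min rgt0.
move=> p' sp c; rewrite E; apply: le_trans (huv p' sp _) (hr p' sp _).
  by apply: closeW c; rewrite ge_min lexx orbT.
by apply: closeW c; rewrite ge_min lexx.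
Qed.

Lemma le0_small (x K s0 : R) : 0 < s0 -> (forall s, 0 < s -> s <= s0 -> x <= s * K) -> x <= 0.
Proof.
move=> s00 h; rewrite leNgt; apply/negP => x0.
have K1 : 0 < `|K| + 1 by rewrite ltr_wpDl.
pose s := Num.min s0 (x / 2 / (`|K| + 1)).
have sg0 : 0 < s by rewrite lt_min s00 !divr_gt0.
have h1 := h s sg0 (_ : s <= s0); rewrite ge_min lexx in h1.
have h2 : s * (`|K| + 1) <= x / 2 by rewrite -ler_pdivlMr// ge_min lexx orbT.
have h3 : s * K <= s * (`|K| + 1).
  by rewrite ler_pM2l//; have := ler_norm K; lra.
have := h1 isT; lra.
Qed.

(** Evaluate both expansions at p + (t, y) with t >= 0 and compare orders. Using later times only,
    the statement covers the initial time and test functions with a concave kink in time; this is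
    also why only a <= A results. *)
Lemma jet_compare (u : point -> R) p a (q : 'cV[R]_k) (M : 'M[R]_k) A Q N (C r0 : R) :
  strip T k p -> p.1 < T -> superjet T u p (A, Q, N) -> 0 < r0 ->
  (forall p', strip T k p' -> close r0 p p' -> p.1 <= p'.1 ->
     jet_poly (u p) p a q M p' - C * (p'.1 - p.1) ^+ 2 <= u p') ->
  [/\ a <= A, q = Q & forall y, dot y (M *m y) <= dot y (N *m y)].
Proof.
move=> sp pT /superjetP[_ /= hJ] r00 hl.
have key (e : R) : 0 < e -> exists2 r : R, 0 < r & forall t y, 0 <= t -> t < r -> enorm y < r ->
    a * t + dot q y + 2^-1 * dot y (M *m y) - C * t ^+ 2 <=
    A * t + dot Q y + 2^-1 * dot y (N *m y) + e * (t + enorm y ^+ 2).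
  move=> e0; have [r rgt0 hr] := hJ e e0.
  exists (Num.min (Num.min r r0) (T - p.1)); first by rewrite !lt_min rgt0 r00 subr_gt0.
  move=> t y t0; rewrite !lt_min => /andP[/andP[t1 t2] t3] /andP[/andP[y1 y2] _].
  pose p' : point := (p.1 + t, p.2 + y).
  have E1 : p'.1 - p.1 = t by rewrite /p' /= addrC addKr.
  have E2 : p'.2 - p.2 = y by rewrite /p' /= addrC addKr.
  have sp' : strip T k p'.
    split=> //=; move: sp => [/= +] _; rewrite !in_itv /= => /andP[p0 _].
    by rewrite addr_ge0//=; lra.
  have n1 : `|p'.1 - p.1| = t by rewrite E1 ger0_norm.
  have c1 : close r p p' by split; rewrite ?n1 ?E2.
  have c2 : close r0 p p' by split; rewrite ?n1 ?E2.
  have := hl p' sp' c2 (_ : p.1 <= p'.1); rewrite lerDl => /(_ t0).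
  have := hr p' sp' c1; rewrite /jet_poly /jet_gauge n1 E1 E2; lra.
have aA : a <= A.
  rewrite leNgt; apply/negP => aA.
  have e0 : 0 < (a - A) / 2 by rewrite divr_gt0// subr_gt0.
  have [r rgt0 hr] := key _ e0.
  suff : a - A - (a - A) / 2 <= 0 by lra.
  apply: (@le0_small _ C (r / 2)); first by rewrite divr_gt0.
  move=> s s0 s1; have sr : s < r by lra.
  have := hr s 0 (ltW s0) sr; rewrite enorm0 => /(_ rgt0).
  rewrite !mulmx0 !dot0r expr0n /= => h.
  rewrite -(ler_pM2l s0); move: h; rewrite mulr0 addr0 expr2; lra.
have qQ : q = Q.
  apply/eqP; rewrite -subr_eq0; apply/eqP/enorm_eq0/eqP.
  rewrite -sqrf_eq0 eq_le sqr_ge0 andbT.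
  set y := q - Q; have [r rgt0 hr] := key 1 ltr01.
  have y1 : 0 < enorm y + 1 by rewrite ltr_wpDl ?enorm_ge0.
  apply: (@le0_small _ (2^-1 * dot y (N *m y) - 2^-1 * dot y (M *m y) + enorm y ^+ 2)
     (r / 2 / (enorm y + 1))); first by rewrite !divr_gt0.
  move=> s s0 s1; have := hr 0 (s *: y) (lexx _) rgt0.
  rewrite enormZ gtr0_norm// -!scalemxAr !dotZl !dotZr.
  have s2 : s * (enorm y + 1) <= r / 2 by rewrite -ler_pdivlMr.
  have sr : s * enorm y < r by lra.
  move=> /(_ sr) h; rewrite -(ler_pM2l s0) -dot_enorm.
  have -> : dot y y = dot q y - dot Q y by rewrite -[y in dot y _]/(q - Q) !dotlin.
  have := dot_enorm y; have -> : dot y y = dot q y - dot Q y by rewrite -[y in dot y _]/(q - Q) !dotlin.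
  move: h; rewrite exprMn; set X := enorm y ^+ 2; nra.
split=> // y; subst Q.
rewrite -subr_le0; apply/ler_addgt0Pr => e e0; rewrite add0r.
have y1 : 0 < 2 * (enorm y ^+ 2 + 1) by rewrite mulr_gt0// ltr_wpDl ?sqr_ge0.
have [e' e'0 he] : exists2 e', 0 < e' & e' * (2 * (enorm y ^+ 2 + 1)) = e.
  by exists (e / (2 * (enorm y ^+ 2 + 1))); rewrite ?divr_gt0 ?divfK ?gt_eqF.
have [r rgt0 hr] := key e' e'0.
have y2 : 0 < enorm y + 1 by rewrite ltr_wpDl ?enorm_ge0.
have [s s0 hs] : exists2 s, 0 < s & s * (enorm y + 1) = r / 2.
  by exists (r / 2 / (enorm y + 1)); rewrite ?divr_gt0 ?divfK ?gt_eqF.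
have sr : enorm (s *: y) < r by rewrite enormZ gtr0_norm//; lra.
have := hr 0 (s *: y) (lexx _) rgt0 sr.
rewrite enormZ gtr0_norm// -!scalemxAr !dotZl !dotZr => h.
have ss : 0 < s * s by rewrite mulr_gt0.
have : (s * s) * (dot y (M *m y) - dot y (N *m y)) <= (s * s) * (e' * 2 * enorm y ^+ 2).
  by move: h; rewrite exprMn; lra.
rewrite ler_pM2l//; lra.
Qed.

Lemma test_continuous (c g w a : R) (q : 'cV[R]_k) (M : 'M[R]_k) (p0 : point) : M^T = M ->
  continuous (fun p => jet_poly c p0 a q M p + g * enorm (p.2 - p0.2) ^+ 2
    + w * (p.1 - p0.1) ^+ 2).
Proof.
move=> sM; have -> : (fun p => jet_poly c p0 a q M p + g * enorm (p.2 - p0.2) ^+ 2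
    + w * (p.1 - p0.1) ^+ 2) =
  (fun p : point => (- (- a * (p.1 - p0.1)) - dot (- q) (p.2 - p0.2))
     + (c + 2^-1 * dot (p.2 - p0.2) (M *m (p.2 - p0.2)))
     + g * (enorm (p.2 - p0.2) * enorm (p.2 - p0.2)) + w * ((p.1 - p0.1) * (p.1 - p0.1))).
  by apply/funext => p; rewrite /jet_poly !dotlin; ring.
have c1 : continuous (fun p : point => p.1 - p0.1).
  by move=> p; apply: cvgB; [exact: cvg_fst | exact: cvg_cst].
have c2 : continuous (fun p : point => p.2 - p0.2).
  by move=> p; apply: (@cvgB _ 'cV[R]_k); [exact: cvg_snd | exact: cvg_cst].
have c3 : continuous (fun p : point => enorm (p.2 - p0.2)).
  move=> p; apply: (@continuous_comp _ _ _ (fun p : point => p.2 - p0.2) (@enorm R k 1)).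
    exact: c2.
  exact: enorm_continuous.
move=> p; apply: cvgD; first apply: cvgD; first apply: cvgD.
- exact: affine_continuous.
- apply: (@continuous_comp _ _ _ (fun p : point => p.2 - p0.2)
    (fun y => c + 2^-1 * dot y (M *m y))); first exact: c2.
  by apply: taylor2_continuous => g0; exact: taylor2_quad sM.
- by apply: cvgMr; apply: cvgM; exact: c3.
- by apply: cvgMr; apply: cvgM; exact: c1.
Qed.

(* Time is penalised by a multiple of (t - t0)^2, since the kink of |t - t0| would leave the
   test function without superjet; its large weight absorbs the o(|t - t0|) of the jet. *)
Lemma superjet_stability (V : point -> R) p0 J (L : R) : strip T k p0 ->
  superjet T V p0 J -> 0 < L ->
  exists r eta : R, [/\ 0 < r, 0 < eta & forall (u : point -> R) p1,
    usc_in (strip T k) u -> (forall p, strip T k p -> close r p0 p -> u p <= V p) ->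
    strip T k p1 -> close eta p0 p1 -> V p0 - eta <= u p1 ->
    exists p J', [/\ strip T k p, close L p0 p, `|u p - V p0| <= L, superjet T u p J' &
      [/\ `|J'.1.1 - J.1.1| <= L, enorm (J'.1.2 - J.1.2) <= L & enorm (J'.2 - J.2) <= L]]].
Proof.
case: J => [[a q] M] sp0 /superjetP[/= sM hJ] L0.
have I0 := enorm_ge0 (1%:M : 'M[R]_k); have M0 := enorm_ge0 M; have q0 := enorm_ge0 q.
have a0 := normr_ge0 a.
(* The space penalty changes the Hessian by 2 g I, and the time slope will change by at most 4 w s^2
   = 2 g; both have to stay within L. *)
have [g [g0 gL gI]] : exists g : R, [/\ 0 < g, 2 * g <= L & 2 * g * enorm (1%:M : 'M[R]_k) <= L].
  have I1 : 0 < 2 * (1 + enorm (1%:M : 'M[R]_k)) by lra.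
  exists (L / (2 * (1 + enorm (1%:M : 'M[R]_k)))); split; first exact: divr_gt0.
    rewrite mulrA ler_pdivrMr//; have := mulr_ge0 (ltW L0) I0; lra.
  rewrite mulrAC mulrA ler_pdivrMr//; lra.
have g20 : 0 < g / 2 by rewrite divr_gt0.
have [r rgt0 hr] := hJ (g / 2) g20.
have [rho [rho0 rhor rhoL]] : exists rho : R, [/\ 0 < rho, rho < r & rho < L].
  exists (Num.min r L / 2); have m0 : 0 < Num.min r L by rewrite lt_min rgt0.
  have m1 : Num.min r L <= r by rewrite ge_min lexx.
  have m2 : Num.min r L <= L by rewrite ge_min lexx orbT.
  by split; lra.
pose D := 2 * `|a| + enorm q + enorm M + 4 * g + 1.
have D0 : 0 < D by rewrite /D; lra.
have [s [s0 s1 srho sD]] : exists s : R, [/\ 0 < s, s <= 1, 2 * s < rho & s * D <= L].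
  exists (Num.min 1 (Num.min (rho / 4) (L / D))); split.
  - by rewrite !lt_min ltr01 !divr_gt0.
  - by rewrite ge_min lexx.
  - have : Num.min 1 (Num.min (rho / 4) (L / D)) <= rho / 4 by rewrite !ge_min lexx orbT.
    lra.
  - by rewrite -ler_pdivlMr// !ge_min lexx !orbT.
have s20 : 0 < s ^+ 2 by rewrite exprn_gt0.
(* For this weight, Young's inequality bounds the jet error g / 2 |t - t0| by w / 2 (t - t0)^2 + w
   s^4 / 2. *)
have [w w0 wE] : exists2 w : R, 0 < w & w * s ^+ 2 = g / 2.
  exists (g / (2 * s ^+ 2)); first by rewrite divr_gt0 ?mulr_gt0.
  by field; rewrite gt_eqF.
pose E := 1 + `|a| + enorm q + enorm M + g + w.
have E0 : 0 < E by rewrite /E; lra.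
have [eta [eta0 eta1 etar etaE]] : exists eta : R,
    [/\ 0 < eta, eta <= 1, eta <= rho & eta * E <= w * s ^+ 2 * s ^+ 2 / 2].
  have ws0 : 0 < w * s ^+ 2 * s ^+ 2 / 2 by rewrite divr_gt0// mulr_gt0// mulr_gt0.
  exists (Num.min 1 (Num.min rho (w * s ^+ 2 * s ^+ 2 / 2 / E))); split.
  - by rewrite !lt_min ltr01 rho0 divr_gt0.
  - by rewrite ge_min lexx.
  - by rewrite !ge_min lexx orbT.
  - by rewrite -ler_pdivlMr// !ge_min lexx !orbT.
exists r, eta; split=> // u p1 uu huV sp1 [c11 c12] hu1.
pose phi (p : point) := jet_poly (V p0) p0 a q M p + g * enorm (p.2 - p0.2) ^+ 2
   + w * (p.1 - p0.1) ^+ 2.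
have phib (p : point) : `|phi p - V p0| <= `|a| * `|p.1 - p0.1| + enorm q * enorm (p.2 - p0.2)
    + 2^-1 * (enorm M * enorm (p.2 - p0.2) ^+ 2) + g * enorm (p.2 - p0.2) ^+ 2
    + w * (p.1 - p0.1) ^+ 2.
  have -> : phi p - V p0 = a * (p.1 - p0.1) + dot q (p.2 - p0.2)
     + 2^-1 * dot (p.2 - p0.2) (M *m (p.2 - p0.2)) + g * enorm (p.2 - p0.2) ^+ 2
     + w * (p.1 - p0.1) ^+ 2 by rewrite /phi /jet_poly; ring.
  have trD (x y x' y' : R) : `|x| <= x' -> `|y| <= y' -> `|x + y| <= x' + y'.
    by move=> hx hy; apply: le_trans (ler_normD _ _) (lerD hx hy).
  apply: (trD); first apply: (trD); first apply: (trD); first apply: (trD).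
  - by rewrite normrM.
  - exact: dotC_le.
  - rewrite normrM ger0_norm ?invr_ge0// ler_wpM2l ?invr_ge0//.
    apply: le_trans (dotC_le _ _) _; rewrite expr2 mulrA [enorm M * _]mulrC -mulrA.
    by rewrite ler_wpM2l ?enorm_ge0 ?enormM.
  - by rewrite ger0_norm// mulr_ge0 ?sqr_ge0// ltW.
  - by rewrite ger0_norm// mulr_ge0 ?sqr_ge0// ltW.
have uphi : usc_in (box T rho p0) (u \+ \- phi).
  apply: usc_inD; first by apply: usc_in_sub uu => p [].
  apply: cvg_usc_in; by move=> p; apply: cvgN; exact: test_continuous.
have b0 : box T rho p0 p0 by split; rewrite // subrr ?normr0 ?enorm0 ltW.
have [pm [sm tm xm] hm] := usc_max (@compact_box R T k rho p0) (ex_intro _ _ b0) uphi.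
have b1 : box T rho p0 p1 by split=> //; apply/ltW; exact: lt_le_trans etar.
have up (p : point) : box T rho p0 p -> u p - phi p <=
    - (g / 2) * enorm (p.2 - p0.2) ^+ 2 - w / 2 * (p.1 - p0.1) ^+ 2 + w * s ^+ 2 * s ^+ 2 / 2.
  move=> [sp t1 x1].
  have cp : close r p0 p by split; exact: le_lt_trans rhor.
  have h1 := huV p sp cp; have h2 := hr p sp cp.
  have h3 : g / 2 * `|p.1 - p0.1| <= w / 2 * (p.1 - p0.1) ^+ 2 + w * s ^+ 2 * s ^+ 2 / 2.
    rewrite -wE -[(p.1 - p0.1) ^+ 2]real_normK ?num_real//.
    have := mulr_ge0 (ltW w0) (sqr_ge0 (`|p.1 - p0.1| - s ^+ 2)).
    rewrite sqrrB -mulr_natr; clear; lra.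
  move: h2; rewrite /jet_gauge mulrDr /phi; move: h1 h3; clear; lra.
have lo : - (w * s ^+ 2 * s ^+ 2 / 2) <= u p1 - phi p1.
  have : `|phi p1 - V p0| <= eta * (E - 1).
    apply: le_trans (phib p1) _.
    have t1 : (p1.1 - p0.1) ^+ 2 <= eta.
      rewrite -real_normK ?num_real//; apply: (@le_trans _ _ (eta * 1)); last by rewrite mulr1.
      by rewrite expr2 ler_pM//; [exact: ltW | exact: le_trans (ltW c11) eta1].
    have x1 : enorm (p1.2 - p0.2) ^+ 2 <= eta.
      apply: (@le_trans _ _ (eta * 1)); last by rewrite mulr1.
      by rewrite expr2 ler_pM ?enorm_ge0//; [exact: ltW | exact: le_trans (ltW c12) eta1].
    have m1 := ler_wpM2l a0 (ltW c11); have m2 := ler_wpM2l q0 (ltW c12).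
    have m3 := ler_wpM2l M0 x1; have m4 := ler_wpM2l (ltW g0) x1; have m5 := ler_wpM2l (ltW w0) t1.
    have m6 := mulr_ge0 M0 (ltW eta0).
    by rewrite /E; move: m1 m2 m3 m4 m5 m6; clear; lra.
  by rewrite ler_norml => /andP[_ h]; move: h hu1 etaE; clear; lra.
have hm1 := hm p1 b1; have hm2 := up pm (And3 sm tm xm); rewrite /= in hm1.
(* Hence the maximum point is within s of p0 in space and within 2 s^2 in time. *)
have bnd : g / 2 * enorm (pm.2 - p0.2) ^+ 2 + w / 2 * (pm.1 - p0.1) ^+ 2 <= w * s ^+ 2 * s ^+ 2.
  by move: lo hm1 hm2; clear; lra.
have dxs : enorm (pm.2 - p0.2) <= s.
  have : g / 2 * enorm (pm.2 - p0.2) ^+ 2 <= g / 2 * s ^+ 2.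
    by have := mulr_ge0 (ltW w0) (sqr_ge0 (pm.1 - p0.1)); move: bnd; rewrite wE; clear; lra.
  by rewrite ler_pM2l// ler_pXn2r ?nnegrE ?enorm_ge0// ltW.
have dts : `|pm.1 - p0.1| <= 2 * s ^+ 2.
  have : w / 2 * (pm.1 - p0.1) ^+ 2 <= w / 2 * (2 * s ^+ 2) ^+ 2.
    have := mulr_ge0 (ltW g20) (sqr_ge0 (enorm (pm.2 - p0.2))).
    have := mulr_ge0 (ltW w0) (sqr_ge0 (s ^+ 2)); move: bnd; clear; lra.
  rewrite ler_pM2l ?divr_gt0// -[(pm.1 - p0.1) ^+ 2]real_normK ?num_real//.
  by rewrite ler_pXn2r ?nnegrE// mulr_ge0// ltW.
have ss : s ^+ 2 <= s by rewrite expr2 ger_pMl.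
have dtr : `|pm.1 - p0.1| < rho by move: dts ss srho s0; clear; lra.
have dxr : enorm (pm.2 - p0.2) < rho by move: dxs srho s0; clear; lra.
exists pm, (a + 2 * w * (pm.1 - p0.1), q + M *m (pm.2 - p0.2) + (2 * g) *: (pm.2 - p0.2),
   M + (2 * g) *: 1%:M); split=> //.
- by split; [move: dtr | move: dxr]; move: rhoL; clear; lra.
- have h1 := phib pm.
  have h2 : `|u pm - phi pm| <= w * s ^+ 2 * s ^+ 2 / 2.
    rewrite ler_norml; apply/andP; split; first by move: lo hm1; clear; lra.
    have := mulr_ge0 (ltW w0) (sqr_ge0 (pm.1 - p0.1)).
    by have := mulr_ge0 (ltW g20) (sqr_ge0 (enorm (pm.2 - p0.2))); move: hm2; clear; lra.
  have -> : u pm - V p0 = (u pm - phi pm) + (phi pm - V p0) by ring.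
  apply: le_trans (ler_normD _ _) (le_trans (lerD h2 h1) _).
  have t2 : (pm.1 - p0.1) ^+ 2 <= (2 * s ^+ 2) ^+ 2.
    by rewrite -real_normK ?num_real// ler_pXn2r ?nnegrE// mulr_ge0// ltW.
  have x2 : enorm (pm.2 - p0.2) ^+ 2 <= s.
    by apply: le_trans ss; rewrite ler_pXn2r ?nnegrE ?enorm_ge0// ltW.
  have m1 := ler_wpM2l a0 dts; have m2 := ler_wpM2l q0 dxs; have m3 := ler_wpM2l M0 x2.
  have m4 := ler_wpM2l (ltW g0) x2; have m5 := ler_wpM2l (ltW w0) t2.
  have m6 := ler_wpM2l a0 ss; have m7 := mulr_ge0 M0 (ltW s0).
  have m8 := ler_wpM2l (ltW g0) ss; have m9 := mulr_ge0 (ltW g0) (ltW s0).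
  have m10 : w * (2 * s ^+ 2) ^+ 2 = 2 * g * s ^+ 2.
    rewrite (_ : _ * _ = 4 * (w * s ^+ 2) * s ^+ 2); last by clear; ring.
    by rewrite wE; clear; lra.
  apply: le_trans sD; rewrite /D wE; move: m5; rewrite m10.
  move: m1 m2 m3 m4 m6 m7 m8 m9 ss (ltW s0) q0 (mulr_ge0 q0 (ltW s0)); clear; lra.
- apply: (@superjet_quad R T k u pm _ _ _ w).
    by rewrite linearD linearZ /= tr_scalar_mx sM.
  move=> e e0; exists (rho - Num.max `|pm.1 - p0.1| (enorm (pm.2 - p0.2))).
    by rewrite subr_gt0 gt_max dtr.
  move=> p sp [c1 c2]; have m1 : `|pm.1 - p0.1| <= Num.max `|pm.1 - p0.1| (enorm (pm.2 - p0.2)).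
    by rewrite le_max lexx.
  have m2 : enorm (pm.2 - p0.2) <= Num.max `|pm.1 - p0.1| (enorm (pm.2 - p0.2)).
    by rewrite le_max lexx orbT.
  have bp : box T rho p0 p.
    split=> //.
      by have := ler_normD (p.1 - pm.1) (pm.1 - p0.1); rewrite addrA subrK; move: c1 m1; clear; lra.
    by have := enormD (p.2 - pm.2) (pm.2 - p0.2); rewrite addrA subrK; move: c2 m2; clear; lra.
  have := hm p bp; rewrite /= /phi /jet_poly.
  set X := pm.2 - p0.2; set dx := p.2 - pm.2.
  have -> : p.2 - p0.2 = X + dx by rewrite /X /dx [RHS]addrC addrA subrK.
  rewrite enormD_sqr; move: X dx => X dx.
  rewrite mulmxDl mulmxDr -scalemxAl mul1mx.
  have sym : dot X (M *m dx) = dot dx (M *m X) by rewrite dot_mulr sM dotC.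
  rewrite !dotlin sym [dot (M *m X) dx]dotC dot_enorm.
  have := mulr_ge0 (ltW e0) (sqr_ge0 (enorm dx)); clear; lra.
- split=> /=.
  + rewrite addrC addKr !normrM (gtr0_norm w0) ger0_norm//.
    have := ler_wpM2l (ltW w0) dts; rewrite (mulrCA w) wE; move: gL; clear; lra.
  + rewrite (_ : _ - q = M *m (pm.2 - p0.2) + (2 * g) *: (pm.2 - p0.2)); last first.
      by rewrite addrAC [q + _]addrC addrK.
    apply: le_trans (enormD _ _) _.
    rewrite enormZ ger0_norm; last by rewrite mulr_ge0// ltW.
    have h1 : enorm (M *m (pm.2 - p0.2)) <= enorm M * s.
      by apply: le_trans (enormM _ _) _; rewrite ler_wpM2l.
    have h2 : 2 * g * enorm (pm.2 - p0.2) <= 2 * g * s by rewrite ler_wpM2l// mulr_ge0// ltW.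
    apply: le_trans (lerD h1 h2) _; apply: le_trans sD; rewrite -mulrDl mulrC.
    by apply: ler_wpM2l; [exact: ltW | rewrite /D; move: a0 q0 g0; clear; lra].
  + by rewrite (addrC M) addrK enormZ ger0_norm// mulr_ge0// ltW.
Qed.

End Jets.

Lemma mxtrace_le (R : realType) k (A : 'M[R]_k) : `|\tr A| <= k%:R * enorm A.
Proof.
rewrite /mxtrace; apply: le_trans (ler_norm_sum _ _ _) _.
apply: (@le_trans _ _ (\sum_(i < k) enorm A)); first by apply: ler_sum => i _; exact: enorm_le_coord.
by rewrite sumr_const card_ord mulr_natl.
Qed.

Section OneEquation.
Variables (R : realType) (T : R) (k d : nat).
Local Notation point := (R * 'cV[R]_k)%type.
Variables (b : point -> 'cV[R]_k) (sigma : point -> 'M[R]_(k, d))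
  (fi : point -> R -> 'cV[R]_d -> R) (C : R).
Hypothesis b_cont : cont_in (strip T k) b.
Hypothesis s_cont : cont_in (strip T k) sigma.
Hypothesis C_ge0 : 0 <= C.
Hypothesis bs_growth : forall p, strip T k p ->
  enorm (b p) + enorm (sigma p) <= C * (1 + enorm p.2).
Hypothesis bs_lip : forall t x y, 0 <= t <= T ->
  enorm (b (t, x) - b (t, y)) + enorm (sigma (t, x) - sigma (t, y)) <= C * enorm (x - y).
Hypothesis f_cont : forall p, strip T k p -> forall e, 0 < e -> exists2 r : R, 0 < r &
  forall p', strip T k p' -> close r p p' -> forall y z, `|fi p' y z - fi p y z| < e.
Hypothesis f_lip : forall p y y' z z', strip T k p ->
  `|fi p y z - fi p y' z'| <= C * (`|y - y'| + enorm (z - z')).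


(** Degenerate ellipticity, together with monotonicity in the time slope. *)
Lemma pde_part_mono p y a A q (M N : 'M[R]_k) :
  a <= A -> (forall x, dot x (M *m x) <= dot x (N *m x)) ->
  pde_part b sigma fi p y (A, q, N) <= pde_part b sigma fi p y (a, q, M).
Proof.
move=> aA MN; rewrite /pde_part /= !mx_psd_trace.
have : \sum_l dot (col l (sigma p)) (M *m col l (sigma p)) <=
   \sum_l dot (col l (sigma p)) (N *m col l (sigma p)) by apply: ler_sum => l _.
lra.
Qed.

Lemma trace_cont P (M : 'M[R]_k) delta : strip T k P -> 0 < delta ->
  exists2 L : R, 0 < L & forall p M', strip T k p -> close L P p -> enorm (M' - M) <= L ->
    `|\tr (sigma p *m (sigma p)^T *m M') - \tr (sigma P *m (sigma P)^T *m M)| < delta.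
Proof.
move=> sP del0.
have S0 := enorm_ge0 (sigma P); have N0 := enorm_ge0 M.
have [S [S1 hS]] : exists S, 1 <= S /\ S = enorm (sigma P) + 1.
  by eexists; split; [|reflexivity]; rewrite lerDr.
have [N [N1 hN]] : exists N, 1 <= N /\ N = enorm M + 1 by eexists; split; [|reflexivity]; rewrite lerDr.
have D0 : 0 < 2 * k%:R * (2 * S * N + S * S) + 1.
  have : 0 <= k%:R * (2 * S * N + S * S).
    by rewrite mulr_ge0// addr_ge0// !mulr_ge0//; apply: le_trans ler01 _.
  lra.
have [e e0 he] : exists2 e, 0 < e & e * (2 * k%:R * (2 * S * N + S * S) + 1) = delta.
  by exists (delta / (2 * k%:R * (2 * S * N + S * S) + 1)); rewrite ?divr_gt0 ?divfK ?gt_eqF.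
have m0 : 0 < Num.min 1 e by rewrite lt_min ltr01.
have [r r0 hr] := s_cont sP m0.
exists (Num.min r (Num.min 1 e)); first by rewrite !lt_min r0 ltr01 e0.
move=> p M' sp cp; rewrite !le_min => /andP[_ /andP[M1 Me]].
have := hr p sp (closeW (_ : _ <= r) cp); rewrite ge_min lexx => /(_ isT).
rewrite lt_min => /andP[s1 se]; set s := sigma p in s1 se *; set s0 := sigma P in S0 s1 se hS *.
have sS : enorm s <= S by have := enormD (s - s0) s0; rewrite subrK hS; lra.
have s0S : enorm s0 <= S by rewrite hS; lra.
have MN : enorm M' <= N by have := enormD (M' - M) M; rewrite subrK hN; lra.
have -> : \tr (s *m s^T *m M') - \tr (s0 *m s0^T *m M) =
   \tr ((s - s0) *m s^T *m M' + s0 *m (s - s0)^T *m M' + s0 *m s0^T *m (M' - M)).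
  rewrite -raddfB /=; congr (\tr _); rewrite [(s - s0)^T]linearB /= !mulmxBr !mulmxBl.
  by rewrite !addrA subrK subrK.
apply: le_lt_trans (mxtrace_le _) _.
have m3 (m1 n1 p1 q1 : nat) (X : 'M[R]_(m1, n1)) (Y : 'M[R]_(n1, p1)) (Z : 'M[R]_(p1, q1)) x y z :
    enorm X <= x -> enorm Y <= y -> enorm Z <= z -> enorm (X *m Y *m Z) <= x * y * z.
  move=> hX hY hZ; apply: le_trans (enormM _ _) _; apply: ler_pM => //; try exact: enorm_ge0.
  by apply: le_trans (enormM _ _) _; apply: ler_pM => //; exact: enorm_ge0.
have t1 : enorm ((s - s0) *m s^T *m M') <= e * S * N.
  by apply: m3 => //; [exact: ltW | rewrite enorm_tr].
have t2 : enorm (s0 *m (s - s0)^T *m M') <= S * e * N.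
  by apply: m3 => //; rewrite enorm_tr; exact: ltW.
have t3 : enorm (s0 *m s0^T *m (M' - M)) <= S * S * e by apply: m3 => //; rewrite enorm_tr.
have t : enorm ((s - s0) *m s^T *m M' + s0 *m (s - s0)^T *m M' + s0 *m s0^T *m (M' - M))
    <= e * (2 * S * N + S * S).
  apply: le_trans (enormD _ _) _; apply: le_trans (lerD (enormD _ _) (lexx _)) _.
  apply: le_trans (lerD (lerD t1 t2) t3) _; rewrite le_eqVlt; apply/orP; left; apply/eqP; ring.
have k0 : 0 <= k%:R :> R by [].
apply: le_lt_trans (ler_wpM2l k0 t) _; rewrite -he.
have : 0 <= k%:R * (e * (2 * S * N + S * S)).
  by apply: le_trans (mulr_ge0 k0 (enorm_ge0 _)) (ler_wpM2l k0 t).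
lra.
Qed.

(** With this, a strict sign of the operator at a jet persists at approximating jets, which is how
    limiting jets and envelopes are dealt with. *)
Lemma pde_part_cont P y J delta : strip T k P -> 0 < delta ->
  exists2 L : R, 0 < L & forall p y' J', strip T k p -> close L P p ->
    `|y' - y| <= L -> `|J'.1.1 - J.1.1| <= L -> enorm (J'.1.2 - J.1.2) <= L ->
    enorm (J'.2 - J.2) <= L ->
    `|pde_part b sigma fi p y' J' - pde_part b sigma fi P y J| < delta.
Proof.
move=> sP del0; have d2 : 0 < delta / 2 by rewrite divr_gt0.
have [L1 L10 h1] := drift_cont b_cont s_cont C_ge0 f_cont f_lip y J.1.1 J.1.2 sP d2.
have [L2 L20 h2] := trace_cont J.2 sP d2.
exists (Num.min L1 L2); first by rewrite lt_min L10.
move=> p y' J' sp cp; rewrite !le_min => /andP[y1 y2] /andP[a1 a2] /andP[q1 q2] /andP[M1 M2].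
have {}h1 := h1 p y' J'.1.1 J'.1.2 sp (closeW _ cp) y1 a1 q1.
rewrite ge_min lexx in h1; have {}h1 := h1 isT.
have {}h2 := h2 p J'.2 sp (closeW _ cp) M2.
rewrite ge_min lexx orbT in h2; have {}h2 := h2 isT.
rewrite !pde_driftE; move: h1 h2; rewrite !ltr_norml => /andP[h1 h2] /andP[h3 h4].
by apply/andP; split; lra.
Qed.

End OneEquation.

Section Aux.
Variables (R : realType) (k : nat).
Local Notation point := (R * 'cV[R]_k)%type.

Definition rcont_in (D : set point) (phi : point -> R) :=
  forall p, D p -> forall e : R, 0 < e -> exists2 r : R, 0 < r &
    forall p', D p' -> close r p p' -> `|phi p' - phi p| < e.

Lemma within_rcont_in (D : set point) (phi : point -> R) :
  {within D, continuous phi} -> rcont_in D phi.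
Proof.
move=> /subspace_continuousP cf p Dp e e0; apply/near_close.
have /cvgrPdist_lt /(_ e e0) := cf p Dp.
by apply: filterS => p'; rewrite distrC.
Qed.

Lemma rcont_in_usc (D : set point) (phi : point -> R) : rcont_in D phi -> usc_in D phi.
Proof.
move=> h; apply/uscP => p Dp e e0; have [r r0 hr] := h p Dp e e0.
by exists r => // p' Dp' c; have := hr p' Dp' c; rewrite ltr_norml => /andP[_]; lra.
Qed.

Lemma rcont_inN (D : set point) (phi : point -> R) : rcont_in D phi -> rcont_in D (\- phi).
Proof.
move=> h p Dp e e0; have [r r0 hr] := h p Dp e e0; exists r => // p' Dp' c /=.
by rewrite -opprD normrN; exact: hr.
Qed.

Lemma usc_inM (D : set point) (u c : point -> R) : usc_in D u -> continuous c ->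
  (forall p, D p -> 0 < c p) -> usc_in D (fun p => u p * c p).
Proof.
move=> uu cc c0 p Dp e e0; have c1 := c0 p Dp.
have [e1 e10 he1] : exists2 e1, 0 < e1 & e1 * c p = e / 2.
  by exists (e / 2 / c p); rewrite ?divr_gt0 ?divfK ?gt_eqF.
have e20 : 0 < e / 2 by rewrite divr_gt0.
have h1 := uu p Dp e1 e10.
have h2 : \forall y \near within D (nbhs p), (u p + e1) * c y < (u p + e1) * c p + e / 2.
  have : (fun y => (u p + e1) * c y) @ p --> (u p + e1) * c p by apply: cvgMr; exact: cc.
  move=> /cvgrPdist_lt /(_ _ e20) hh; apply: cvg_within.
  by apply: filterS hh => y; rewrite ltr_norml => /andP[h _]; lra.
have h3 : \forall y \near within D (nbhs p), D y by exact: withinT.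
near=> y; have Dy : D y by near: y.
apply: (@lt_trans _ _ ((u p + e1) * c y)); first by rewrite ltr_pM2r ?c0//; near: y.
have : (u p + e1) * c y < (u p + e1) * c p + e / 2 by near: y.
lra.
Unshelve. all: by end_near. Qed.

Lemma common_radius m (P : 'I_m -> R -> Prop) :
  (forall j r r', r' <= r -> P j r -> P j r') ->
  (forall j, exists2 r : R, 0 < r & P j r) -> exists2 r : R, 0 < r & forall j, P j r.
Proof.
move=> mono hex; have hex' j : exists r : R, 0 < r /\ P j r by have [r] := hex j; exists r.
have [s hs] := choice hex'.
exists (\big[Order.min/1]_(j < m) s j); first by apply: lt_bigmin => // j _; case: (hs j).
move=> j; case: (hs j) => _; apply: mono; rewrite (bigD1 j)//= ge_min lexx //.
Qed.

End Aux.

(** * Comparison for the system *)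

Section System.
Variables (R : realType) (T : R) (k d m : nat).
Local Notation point := (R * 'cV[R]_k)%type.
Variables (b : point -> 'cV[R]_k) (sigma : point -> 'M[R]_(k, d))
  (f : 'I_m -> point -> R -> 'cV[R]_d -> R) (g : 'I_m -> 'I_m -> point -> R) (C : R).
Hypothesis d_gt0 : (0 < d)%N.
Hypothesis b_cont : cont_in (strip T k) b.
Hypothesis s_cont : cont_in (strip T k) sigma.
Hypothesis C_ge0 : 0 <= C.
Hypothesis bs_growth : forall p, strip T k p ->
  enorm (b p) + enorm (sigma p) <= C * (1 + enorm p.2).
Hypothesis bs_lip : forall t x y, 0 <= t <= T ->
  enorm (b (t, x) - b (t, y)) + enorm (sigma (t, x) - sigma (t, y)) <= C * enorm (x - y).
Hypothesis f_cont : forall i p, strip T k p -> forall e, 0 < e -> exists2 r : R, 0 < r &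
  forall p', strip T k p' -> close r p p' -> forall y z, `|f i p' y z - f i p y z| < e.
Hypothesis f_lip : forall i p y y' z z', strip T k p ->
  `|f i p y z - f i p y' z'| <= C * (`|y - y'| + enorm (z - z')).
Hypothesis g_cont : forall i j, i != j -> rcont_in (strip T k) (g i j).
Hypothesis no_loop : forall p, strip T k p ->
  forall (N : nat) (i : nat -> 'I_m), (3 <= N)%N -> i 1%N = i N ->
    #|[seq i n | n <- index_iota 1 N.+1]| = N.-1 ->
    0 < \sum_(1 <= n < N) g (i n) (i n.+1) p.

(** Working forms of the sub- and supersolution properties, with jets at the point itself instead of
    limiting jets. The two halves of the supersolution inequality are kept apart, so that
    [above_obstacle] is required at every point, whether or not it carries a jet. *)
Definition jet_sub (u : 'I_m -> point -> R) := forall i p J, strip T k p -> p.1 < T ->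
  superjet T (u i) p J ->
  (exists2 j, j != i & u i p <= u j p - g i j p) \/ pde_part b sigma (f i) p (u i p) J <= 0.

Definition jet_super (w : 'I_m -> point -> R) := forall i p J, strip T k p -> p.1 < T ->
  subjet T (w i) p J -> 0 <= pde_part b sigma (f i) p (w i p) J.

Definition above_obstacle (w : 'I_m -> point -> R) := forall i j p, strip T k p -> p.1 < T ->
  j != i -> w j p - g i j p <= w i p.

(** The value y is left free near y0 because an upper semicontinuous u_i may drop at points near p0;
    the jets to which this is applied come with a value close to y0. *)
Lemma obstacle_free (u : 'I_m -> point -> R) i p0 y0 :
  (forall j, usc_in (strip T k) (u j)) -> strip T k p0 ->
  (forall j, j != i -> u j p0 - g i j p0 < y0) ->
  exists2 r : R, 0 < r & forall p y, strip T k p -> close r p0 p -> `|y - y0| <= r ->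
    forall j, j != i -> u j p - g i j p < y.
Proof.
move=> uu sp0 hlt.
have [|j|r r0 hr] := @common_radius R m (fun j r => forall p y, strip T k p -> close r p0 p ->
    `|y - y0| <= r -> j != i -> u j p - g i j p < y).
- by move=> j r r' rr' h p y sp c hu; apply: h => //; [exact: closeW c | exact: le_trans rr'].
- have [-> | ji] := eqVneq j i; first by exists 1 => // p y _ _ _; rewrite eqxx.
  have [e e0 eE] : exists2 e, 0 < e & e * 4 = y0 - (u j p0 - g i j p0).
    by exists ((y0 - (u j p0 - g i j p0)) / 4); rewrite ?divr_gt0 ?subr_gt0 ?hlt ?divfK.
  have [r1 r10 h1] := (uscP _ _).1 (uu j) p0 sp0 e e0.
  have ij : i != j by rewrite eq_sym.
  have [r2 r20 h2] := g_cont ij sp0 e0.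
  exists (Num.min e (Num.min r1 r2)); first by rewrite !lt_min e0 r10.
  move=> p y sp c; rewrite le_min => /andP[hu _] _.
  have := h1 p sp (closeW _ c); rewrite !ge_min lexx orbT => /(_ isT) {}h1.
  have := h2 p sp (closeW _ c); rewrite !ge_min lexx !orbT => /(_ isT).
  rewrite ltr_norml => /andP[{}h2 _]; move: hu; rewrite ler_norml => /andP[hu _].
  lra.
by exists r => // p y sp c hu j; exact: hr.
Qed.

Lemma comparison (u w : 'I_m -> point -> R) n K :
  (forall i, usc_in (strip T k) (u i)) -> (forall i, usc_in (strip T k) (\- w i)) ->
  (forall i p, strip T k p -> u i p <= K * base p.2 ^+ n) ->
  (forall i p, strip T k p -> - (K * base p.2 ^+ n) <= w i p) ->
  (forall i p, strip T k p -> p.1 = T -> u i p <= w i p) ->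
  jet_sub u -> jet_super w -> above_obstacle w ->
  forall i p, strip T k p -> u i p <= w i p.
Proof.
move=> uu uw gu gw hT su sw ow i0 p1 sp1; rewrite leNgt; apply/negP => h01.
(* One power more than the growth of u and w, so that F can be at least c0 > 0 only in a bounded
   region. *)
have [B B0 hB] := zeta_expand T k n.+1.
have C0 := C_ge0.
have [mu muE] : exists mu, mu = 1 + 4 * n.+1%:R * C + 2 * B * C ^+ 2 + C + 4 * n.+1%:R * C ^+ 2.
  by eexists.
have n0 : 0 <= n.+1%:R :> R by [].
have mu0 : 0 < mu.
  have := mulr_ge0 n0 C0; have := mulr_ge0 B0 (sqr_ge0 C); have := mulr_ge0 n0 (sqr_ge0 C).
  by rewrite muE; lra.
have [Cz Cz0 hz] := hB mu mu0.
pose z : point -> R := zeta T mu n.+1.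
have z0 p : 0 < z p by exact: zeta_gt0.
have cz : continuous z.
  have -> : z = (fun p : point => 1 * zeta T mu n.+1 p
      + 0 * ((p.1 - p1.1) ^+ 2 + enorm (p.2 - p1.2) ^+ 2)).
    by apply/funext => p; rewrite mul1r mul0r addr0.
  exact: Z_continuous.
pose F i p := (u i p - w i p) * (z p)^-1.
have F0 : 0 < F i0 p1 by rewrite mulr_gt0 ?invr_gt0// subr_gt0.
pose c0 := F i0 p1; rewrite -/c0 in F0.
have FE i p th : F i p <= th -> u i p - w i p <= th * z p.
  by rewrite /F ler_pdivrMr.
have uF i : usc_in (strip T k) (F i).
  apply: (@usc_inM _ _ _ (fun p => u i p - w i p) (fun p => (z p)^-1)).
  - by apply: usc_inD; [exact: uu | exact: uw].
  - by move=> p; apply: cvgV; [rewrite gt_eqF | exact: cz].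
  - by move=> p _; rewrite invr_gt0.
have [Q [Q1 hQ]] : exists Q : R, 1 <= Q /\ forall i p, strip T k p -> c0 <= F i p -> base p.2 <= Q.
  exists (1 + `|2 * K / c0|); split; first by rewrite lerDl.
  move=> i p sp; rewrite /F ler_pdivlMr// => hc.
  have bg := base_ge1 p.2; have b0 : 0 < base p.2 by apply: lt_le_trans bg.
  have pT : p.1 <= T by case: sp => /=; rewrite in_itv /= => /andP[].
  have zg : base p.2 ^+ n.+1 <= z p by apply: zeta_ge => //; exact: ltW.
  have bn0 : 0 < base p.2 ^+ n by rewrite exprn_gt0.
  have : c0 * base p.2 * base p.2 ^+ n <= 2 * K * base p.2 ^+ n.
    rewrite -mulrA -exprS; apply: le_trans (ler_wpM2l (ltW F0) zg) _.
    by have := gu i p sp; have := gw i p sp; lra.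
  rewrite ler_pM2r// mulrC -ler_pdivlMr// => h; apply: le_trans h _.
  by apply: le_trans (ler_norm _) _; rewrite lerDr.
pose bx := box T (Q + T) ((0, 0) : point).
have T0 : 0 <= T by case: sp1 => /=; rewrite in_itv /= => /andP[h1 h2] _; apply: le_trans h2.
have inbox i p : strip T k p -> c0 <= F i p -> bx p.
  move=> sp /(hQ i p sp) bQ; split=> //=; rewrite subr0.
    case: sp => /=; rewrite in_itv /= => /andP[h1 h2] _; rewrite ger0_norm//.
    by apply: le_trans h2 _; rewrite lerDr; apply: le_trans Q1.
  apply: (@le_trans _ _ Q); last by rewrite lerDl.
  have Q0 : 0 <= Q by apply: le_trans Q1.
  rewrite -(ler_pXn2r (n:=2)) ?nnegrE ?enorm_ge0// -dot_enorm.
  apply: (@le_trans _ _ Q); first by apply: le_trans bQ; rewrite lerDr.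
  by rewrite expr2 ler_peMr.
have bx1 : bx p1 by exact: (inbox i0).
have hmax i : exists x, bx x /\ forall y, bx y -> F i y <= F i x.
  have [|x bx_x hx] := @usc_max R _ _ (F i) (@compact_box R T k (Q + T) (0, 0)) (ex_intro _ _ bx1).
    by apply: usc_in_sub (uF i) => p [].
  by exists x.
have [s hs] := choice hmax.
pose j0 := [arg max_(i > i0) F i (s i)]%O.
have hj0 i : F i (s i) <= F j0 (s j0).
  by rewrite /j0; case: arg_maxP => // j _ hj; exact: hj.
have [p0 p0E] : exists p0, p0 = s j0 by eexists.
have [th thE] : exists th, th = F j0 p0 by eexists.
have bp0 : bx p0 by rewrite p0E; case: (hs j0).
have sp0 : strip T k p0 by case: bp0.
have c0th : c0 <= th.
  by rewrite thE p0E; apply: le_trans (hj0 i0); case: (hs i0) => _; exact.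
have Fth i p : strip T k p -> F i p <= th.
  move=> sp; have [h|h] := leP c0 (F i p); last by apply: le_trans (ltW h) c0th.
  rewrite thE p0E; apply: le_trans (hj0 i); case: (hs i) => _; apply.
  exact: inbox h.
have th0 : 0 < th by apply: lt_le_trans c0th.
have FthE i : F i p0 = th -> u i p0 - w i p0 = th * z p0.
  by move=> <-; rewrite /F divfK// gt_eqF.
have p0T : p0.1 < T.
  rewrite lt_neqAle; apply/andP; split; last by case: sp0 => /=; rewrite in_itv /= => /andP[].
  apply/eqP => p0T; have := hT j0 p0 sp0 p0T.
  have := FthE j0 (esym thE); have := mulr_gt0 th0 (z0 p0); lra.
(* If u_i <= u_j - g_ij at p0, then w_j - g_ij <= w_i makes j maximal as well; were every maximal
   index to meet its obstacle, there would be a free loop. *)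
have [i [Ii hi]] : exists i, F i p0 = th /\ forall j, j != i -> u j p0 - g i j p0 < u i p0.
  apply: contrapT => hn.
  apply: (@no_loop_contra R m (fun i j => g i j p0) (fun i => u i p0) [set i | F i p0 = th]).
  - by move=> N i; exact: no_loop.
  - by exists j0; rewrite /= thE.
  - move=> i /= Ii; have [j ji hj] : exists2 j, j != i & u i p0 <= u j p0 - g i j p0.
      apply: contrapT => hn'; apply: hn; exists i; split=> // j ji.
      by rewrite ltNge; apply/negP => hj; apply: hn'; exists j.
    exists j; split=> //; apply/eqP; rewrite eq_le Fth//=.
    have := ow i j p0 sp0 p0T ji; have := FthE i Ii => h1 h2.
    by rewrite /F ler_pdivlMr//; lra.
have [r r0 hr] := obstacle_free uu sp0 hi.
have r'0 : 0 < Num.min r (T - p0.1) by rewrite lt_min r0 subr_gt0.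
apply: (@comparison_point R T k d b sigma (f i) C b_cont s_cont C_ge0 bs_growth bs_lip
  (f_cont i) (f_lip i) (u i) (w i) p0 th mu B Cz (Num.min r (T - p0.1)) n.+1) => //.
- by rewrite muE.
- by move=> p sp; apply: FE; exact: Fth.
- exact: FthE.
- move=> p J sp c; rewrite le_min => /andP[hu _] jJ.
  have pT : p.1 < T.
    have [c1 _] : close (T - p0.1) p0 p by apply: closeW c; rewrite ge_min lexx orbT.
    have := ler_norm (p.1 - p0.1); lra.
  have cr : close r p0 p by apply: closeW c; rewrite ge_min lexx.
  case: (su i p J sp pT jJ) => // -[j ji].
  by rewrite leNgt hr.
- by move=> p J sp pT jJ; exact: sw.
Qed.

End System.

(** * Barriers *)

Section Barrier.
Variables (R : realType) (T : R) (k d : nat).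
Local Notation point := (R * 'cV[R]_k)%type.
Variables (b : point -> 'cV[R]_k) (sigma : point -> 'M[R]_(k, d)) (C : R).
Hypothesis C_ge0 : 0 <= C.
Hypothesis bs_growth : forall p, strip T k p ->
  enorm (b p) + enorm (sigma p) <= C * (1 + enorm p.2).

Lemma barrier_arith (mu V C' n B s1 s2 s3 f0 a : R) :
  0 <= V -> 1 + 4 * n * C' + 2 * B * C' ^+ 2 + C' + 4 * n * C' ^+ 2 <= mu -> 0 <= C' ->
  mu * V <= a -> s1 <= 4 * n * C' * V -> s2 <= 2 * B * C' ^+ 2 * V -> f0 <= V ->
  s3 <= 4 * n * C' * V ->
  - a + s1 + s2 + (f0 + C' * (V + s3)) <= 0.
Proof.
move=> V0 hmu C0 ha h1 h2 h3 h4.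
have := ler_wpM2r V0 hmu; have := ler_wpM2l C0 h4; lra.
Qed.

(** [zeta_expand] places a paraboloid below - K zeta at p, and [jet_compare] transfers its
    coefficients to an arbitrary superjet. The resulting terms are absorbed by mu as in the
    comparison. *)
Lemma barrier_sub (fi : point -> R -> 'cV[R]_d -> R) K mu B Cz n p J :
  strip T k p -> p.1 < T -> 0 <= K -> 0 < mu -> 0 <= B -> 0 <= Cz ->
  (forall y z, `|fi p y z - fi p 0 0| <= C * (`|y - 0| + enorm (z - 0))) ->
  `|fi p 0 0| <= K * base p.2 ^+ n ->
  (forall p p' : point, `|p'.1 - p.1| <= 2^-1 / mu -> enorm (p'.2 - p.2) <= 2^-1 ->
    zeta T mu n p' <= zeta T mu n p * (1 - mu * (p'.1 - p.1)
      + (2 * n%:R) * (dot p.2 (p'.2 - p.2) / base p.2)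
      + B * (enorm (p'.2 - p.2) ^+ 2 / base p.2)
      + Cz * (p'.1 - p.1) ^+ 2)) ->
  1 + 4 * n%:R * C + 2 * B * C ^+ 2 + C + 4 * n%:R * C ^+ 2 <= mu ->
  superjet T (fun p => - (K * zeta T mu n p)) p J ->
  pde_part b sigma fi p (- (K * zeta T mu n p)) J <= 0.
Proof.
move=> sp pT K0 mu0 B0 Cz0 flip f0 hz hmu; case: J => [[A Q] N] jJ.
have C0 := C_ge0.
have pT' := ltW pT.
set V := K * zeta T mu n p in jJ *.
have V0 : 0 <= V by rewrite mulr_ge0// ltW// zeta_gt0.
set r := base p.2; have r1 : 1 <= r := base_ge1 _.
have r0 : 0 < r by apply: lt_le_trans r1.
have fV : `|fi p 0 0| <= V.
  by apply: le_trans f0 _; apply: ler_wpM2l => //; apply: zeta_ge => //; exact: ltW.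
have [Vr [Vr0 VrE]] : exists Vr, 0 <= Vr /\ Vr * r = V.
  by exists (V / r); rewrite divfK ?gt_eqF// divr_ge0// ltW.
have half0 : 0 < 2^-1 :> R by rewrite invr_gt0.
have m0 : 0 < Num.min 2^-1 (2^-1 / mu) by rewrite lt_min half0; exact: divr_gt0.
have [|hA hQ hN] := @jet_compare R T k (fun p => - (K * zeta T mu n p)) p (mu * V)
   (- (2 * n%:R * Vr) *: p.2) (- (2 * B * Vr))%:M A Q N (V * Cz) _ sp pT jJ m0.
  move=> p' sp' [c1 c2] _; move: c1 c2; rewrite !lt_min => /andP[_ c1] /andP[c2 _].
  have := ler_wpM2l K0 (hz p p' (ltW c1) (ltW c2)); rewrite -/r.
  rewrite /jet_poly /= mul_scalar_mx !dotZl !dotZr dot_enorm.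
  set dt := p'.1 - p.1; set X := dot p.2 _; set E := enorm _ ^+ 2.
  have -> : K * (zeta T mu n p * (1 - mu * dt + 2 * n%:R * (X / r) + B * (E / r) + Cz * dt ^+ 2))
      = V - mu * V * dt + 2 * n%:R * Vr * X + B * Vr * E + V * Cz * dt ^+ 2.
    by rewrite (mulrA K) -/V -VrE; field; rewrite gt_eqF.
  by rewrite -/V; clear; lra.
have bsP := bs_growth sp; set X := enorm p.2 in bsP.
have b0 := enorm_ge0 (b p); have s0 := enorm_ge0 (sigma p).
set bb := enorm (b p) in bsP b0; set ss := enorm (sigma p) in bsP s0.
have X0 : 0 <= X := enorm_ge0 _.
have Xr : X ^+ 2 = r - 1 by rewrite /X /r /base dot_enorm; ring.
have XX : (1 + X) * X <= 2 * r by have := sqr_ge0 (1 - X); rewrite sqrrB expr1n; lra.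
have XX' : (1 + X) ^+ 2 <= 2 * r by have := sqr_ge0 (1 - X); rewrite sqrrB sqrrD expr1n; lra.
have key y : 0 <= y -> y <= C * (1 + X) -> 2 * n%:R * Vr * (y * X) <= 4 * n%:R * C * V.
  move=> y0 hy; have h : y * X <= C * (2 * r).
    apply: (@le_trans _ _ (C * (1 + X) * X)); first exact: ler_wpM2r.
    by rewrite -mulrA ler_wpM2l.
  have nV0 : 0 <= 2 * n%:R * Vr by rewrite !mulr_ge0.
  apply: le_trans (ler_wpM2l nV0 h) _; rewrite -VrE le_eqVlt; apply/orP; left; apply/eqP; ring.
have bC : bb <= C * (1 + X) by apply: le_trans bsP; rewrite lerDl.
have sC : ss <= C * (1 + X) by apply: le_trans bsP; rewrite lerDr.
have nV0 : 0 <= 2 * n%:R * Vr by rewrite !mulr_ge0.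
have BV0 : 0 <= B * Vr by rewrite mulr_ge0.
rewrite /pde_part /= mx_psd_trace -hQ.
have tr : - (2^-1 * \sum_l dot (col l (sigma p)) (N *m col l (sigma p))) <= 2 * B * C ^+ 2 * V.
  apply: (@le_trans _ _ (B * Vr * ss ^+ 2)).
    rewrite enorm_cols -mulrN -sumrN !mulr_sumr; apply: ler_sum => l _.
    have := hN (col l (sigma p)); rewrite mul_scalar_mx dotZr dot_enorm; lra.
  have h : ss ^+ 2 <= C ^+ 2 * (2 * r).
    apply: (@le_trans _ _ ((C * (1 + X)) ^+ 2)); last by rewrite exprMn ler_wpM2l ?sqr_ge0.
    by rewrite ler_pXn2r ?nnegrE// mulr_ge0// addr_ge0.
  apply: le_trans (ler_wpM2l BV0 h) _; rewrite -VrE le_eqVlt; apply/orP; left; apply/eqP; ring.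
have db : - dot (b p) (- (2 * n%:R * Vr) *: p.2) <= 4 * n%:R * C * V.
  rewrite dotZr mulNr opprK; apply: le_trans (key _ b0 bC).
  by rewrite ler_wpM2l// dot_le.
have fz : - fi p (- V) ((sigma p)^T *m (- (2 * n%:R * Vr) *: p.2)) <=
    `|fi p 0 0| + C * (V + 4 * n%:R * C * V).
  have := flip (- V) ((sigma p)^T *m (- (2 * n%:R * Vr) *: p.2)).
  rewrite !subr0 normrN (ger0_norm V0) => h.
  have h2 : enorm ((sigma p)^T *m (- (2 * n%:R * Vr) *: p.2)) <= 4 * n%:R * C * V.
    rewrite -scalemxAr enormZ normrN ger0_norm//; apply: le_trans (key _ s0 sC).
    by rewrite ler_wpM2l//; apply: le_trans (enormM _ _) _; rewrite enorm_tr.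
  have h3 : C * (V + enorm ((sigma p)^T *m (- (2 * n%:R * Vr) *: p.2))) <=
     C * (V + 4 * n%:R * C * V) by rewrite ler_wpM2l// lerD2l.
  have := le_trans h h3; rewrite ler_norml => /andP[+ _].
  have := ler_norm (- fi p 0 0); rewrite normrN; lra.
have := @barrier_arith mu V C n%:R B _ _ _ _ A V0 hmu C0 hA db tr fV (lexx _).
lra.
Qed.

End Barrier.

Section System.
Variables (R : realType) (T : R) (k d m : nat).
Local Notation point := (R * 'cV[R]_k)%type.
Variables (b : point -> 'cV[R]_k) (sigma : point -> 'M[R]_(k, d))
  (f : 'I_m -> point -> R -> 'cV[R]_d -> R) (g : 'I_m -> 'I_m -> point -> R) (C : R).
Hypothesis d_gt0 : (0 < d)%N.
Hypothesis b_cont : cont_in (strip T k) b.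
Hypothesis s_cont : cont_in (strip T k) sigma.
Hypothesis C_ge0 : 0 <= C.
Hypothesis bs_growth : forall p, strip T k p ->
  enorm (b p) + enorm (sigma p) <= C * (1 + enorm p.2).
Hypothesis bs_lip : forall t x y, 0 <= t <= T ->
  enorm (b (t, x) - b (t, y)) + enorm (sigma (t, x) - sigma (t, y)) <= C * enorm (x - y).
Hypothesis f_cont : forall i p, strip T k p -> forall e, 0 < e -> exists2 r : R, 0 < r &
  forall p', strip T k p' -> close r p p' -> forall y z, `|f i p' y z - f i p y z| < e.
Hypothesis f_lip : forall i p y y' z z', strip T k p ->
  `|f i p y z - f i p y' z'| <= C * (`|y - y'| + enorm (z - z')).
Hypothesis g_cont : forall i j, i != j -> rcont_in (strip T k) (g i j).
Hypothesis no_loop : forall p, strip T k p ->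
  forall (N : nat) (i : nat -> 'I_m), (3 <= N)%N -> i 1%N = i N ->
    #|[seq i n | n <- index_iota 1 N.+1]| = N.-1 ->
    0 < \sum_(1 <= n < N) g (i n) (i n.+1) p.

Hypothesis g_ge0 : forall i j p, i != j -> strip T k p -> 0 <= g i j p.

(* A function and its opposite are both controlled by [barrier_sub], applied to f and to
   -f(., -y, -z). *)
Lemma barrier_exists K0 n : 0 <= K0 ->
  (forall i p, strip T k p -> `|f i p 0 0| <= K0 * base p.2 ^+ n) ->
  exists V : point -> R, [/\ continuous V,
    forall p, strip T k p -> K0 * base p.2 ^+ n <= V p,
    exists K, forall p, strip T k p -> V p <= K * base p.2 ^+ n,
    jet_sub T b sigma f g (fun _ => \- V) & jet_super T b sigma f (fun _ => V)].
Proof.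
move=> K00 hf.
have [B B0 hB] := zeta_expand T k n.
have C0 := C_ge0.
have [mu muE] : exists mu, mu = 1 + 4 * n%:R * C + 2 * B * C ^+ 2 + C + 4 * n%:R * C ^+ 2.
  by eexists.
have n0 : 0 <= n%:R :> R by [].
have mu0 : 0 < mu.
  have := mulr_ge0 n0 C0; have := mulr_ge0 B0 (sqr_ge0 C); have := mulr_ge0 n0 (sqr_ge0 C).
  by rewrite muE; lra.
have [Cz Cz0 hz] := hB mu mu0.
exists (fun p => K0 * zeta T mu n p); split.
- have -> : (fun p : point => K0 * zeta T mu n p) = (fun p : point => K0 * zeta T mu n p
      + 0 * ((p.1 - 0) ^+ 2 + enorm (p.2 - 0) ^+ 2)).
    by apply/funext => p; rewrite mul0r addr0.
  exact: (@Z_continuous R T k K0 0 mu n (0, 0)).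
- move=> p [/=]; rewrite in_itv /= => /andP[_ pT] _.
  by apply: ler_wpM2l => //; apply: zeta_ge => //; exact: ltW.
- exists (K0 * expR (mu * T)) => p [/=]; rewrite in_itv /= => /andP[p0 _] _.
  rewrite -mulrA; apply: ler_wpM2l => //; rewrite /zeta ler_wpM2r//.
    by rewrite exprn_ge0// (le_trans ler01)// base_ge1.
  by rewrite ler_expR ler_pM2l// gerBl.
- move=> i p J sp pT jJ; right.
  apply: (@barrier_sub R T k d b sigma C C_ge0 bs_growth (f i) K0 mu B Cz n p J) => //.
  + by move=> y z; exact: f_lip.
  + exact: hf.
  + by rewrite muE.
- move=> i p J sp pT /subjet_opp jJ.
  have := @barrier_sub R T k d b sigma C C_ge0 bs_growth (fun p y z => - f i p (- y) (- z))
     K0 mu B Cz n p (- J.1.1, - J.1.2, - J.2) sp pT K00 mu0 B0 Cz0.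
  have -> : pde_part b sigma (fun p y z => - f i p (- y) (- z)) p (- (K0 * zeta T mu n p))
      (- J.1.1, - J.1.2, - J.2) = - pde_part b sigma (f i) p (K0 * zeta T mu n p) J.
    rewrite /pde_part /= !dotNr !mulmxN raddfN /= !opprK; ring.
  rewrite oppr_le0; apply => //.
  + move=> y z; rewrite !oppr0 -opprD normrN !addr0; have := f_lip i (- y) 0 (- z) 0 sp.
    by rewrite !oppr0 !addr0 normrN enormN.
  + by rewrite !oppr0 normrN; exact: hf.
  + by rewrite muE.
Qed.

End System.

(** * Perron's method *)

Section Envelope.
Variables (R : realType) (T : R) (k : nat).
Local Notation point := (R * 'cV[R]_k)%type.

Definition local_bound (phi : point -> R) p (y : R) :=
  exists2 r : R, 0 < r & forall p', strip T k p' -> close r p p' -> phi p' <= y.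

(** Upper semicontinuous envelope over the closed strip: unlike in [upper_env], points at time T
    count, so the envelope dominates the function there too. *)
Definition uenv (phi : point -> R) p := inf (local_bound phi p).

Variable phi : point -> R.
Hypothesis loc_bounded : forall p, strip T k p -> exists y, local_bound phi p y.

Lemma local_bound_ge p y : strip T k p -> local_bound phi p y -> phi p <= y.
Proof. by move=> sp [r r0 hr]; apply: hr => //; exact: close_refl. Qed.

Lemma has_inf_local_bound p : strip T k p -> has_inf (local_bound phi p).
Proof.
move=> sp; split; first exact: loc_bounded.
by exists (phi p) => y; exact: local_bound_ge.
Qed.

Lemma le_uenv p : strip T k p -> phi p <= uenv phi p.
Proof.
move=> sp; apply: lb_le_inf; first by case: (has_inf_local_bound sp).
by move=> y; exact: local_bound_ge.
Qed.

Lemma uenv_le p y : strip T k p -> local_bound phi p y -> uenv phi p <= y.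
Proof. by move=> sp h; apply: ge_inf => //; case: (has_inf_local_bound sp). Qed.

Lemma uenv_usc : usc_in (strip T k) (uenv phi).
Proof.
apply/uscP => p sp e e0.
have [y [r r0 hr] hy] := inf_adherent e0 (has_inf_local_bound sp).
exists (r / 2); first by rewrite divr_gt0.
move=> p' sp' c; apply: le_lt_trans hy; apply: uenv_le => //.
exists (r / 2); first by rewrite divr_gt0.
move=> p'' sp'' c'; apply: hr => //; apply: closeW (close_trans c c'); lra.
Qed.

Lemma uenv_approx p e : strip T k p -> 0 < e ->
  exists p1, [/\ strip T k p1, close e p p1 & uenv phi p - e < phi p1].
Proof.
move=> sp e0; apply: contrapT => hn.
have : uenv phi p <= uenv phi p - e.
  apply: uenv_le => //; exists e => // p' sp' c; rewrite leNgt; apply/negP => h.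
  by apply: hn; exists p'.
lra.
Qed.

End Envelope.

Section System.
Variables (R : realType) (T : R) (k d m : nat).
Local Notation point := (R * 'cV[R]_k)%type.
Variables (b : point -> 'cV[R]_k) (sigma : point -> 'M[R]_(k, d))
  (f : 'I_m -> point -> R -> 'cV[R]_d -> R) (g : 'I_m -> 'I_m -> point -> R) (C : R).
Hypothesis d_gt0 : (0 < d)%N.
Hypothesis b_cont : cont_in (strip T k) b.
Hypothesis s_cont : cont_in (strip T k) sigma.
Hypothesis C_ge0 : 0 <= C.
Hypothesis bs_growth : forall p, strip T k p ->
  enorm (b p) + enorm (sigma p) <= C * (1 + enorm p.2).
Hypothesis bs_lip : forall t x y, 0 <= t <= T ->
  enorm (b (t, x) - b (t, y)) + enorm (sigma (t, x) - sigma (t, y)) <= C * enorm (x - y).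
Hypothesis f_cont : forall i p, strip T k p -> forall e, 0 < e -> exists2 r : R, 0 < r &
  forall p', strip T k p' -> close r p p' -> forall y z, `|f i p' y z - f i p y z| < e.
Hypothesis f_lip : forall i p y y' z z', strip T k p ->
  `|f i p y z - f i p y' z'| <= C * (`|y - y'| + enorm (z - z')).
Hypothesis g_cont : forall i j, i != j -> rcont_in (strip T k) (g i j).
Hypothesis no_loop : forall p, strip T k p ->
  forall (N : nat) (i : nat -> 'I_m), (3 <= N)%N -> i 1%N = i N ->
    #|[seq i n | n <- index_iota 1 N.+1]| = N.-1 ->
    0 < \sum_(1 <= n < N) g (i n) (i n.+1) p.

Hypothesis g_ge0 : forall i j p, i != j -> strip T k p -> 0 <= g i j p.
Variable h : 'I_m -> 'cV[R]_k -> R.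

(** The growth constants may vary from one member to another; a common bound is recovered from the
    barrier in [class_le_barrier]. *)
Definition perron_class (u : 'I_m -> point -> R) :=
  [/\ forall i, usc_in (strip T k) (u i),
    exists n K, forall i p, strip T k p -> u i p <= K * base p.2 ^+ n,
    jet_sub T b sigma f g u & forall i x, u i (T, x) <= h i x].

Lemma class_le_barrier u (V : point -> R) : perron_class u -> continuous V ->
  (forall p, strip T k p -> 0 <= V p) -> (forall i x, h i x <= V (T, x)) ->
  jet_super T b sigma f (fun _ => V) -> forall i p, strip T k p -> u i p <= V p.
Proof.
move=> [uu [n [K hK]] su uT] cV V0 VT sV.
apply: (@comparison R T k d m b sigma f g C d_gt0 b_cont s_cont C_ge0 bs_growth bs_lip f_cont
  f_lip g_cont no_loop u (fun _ => V) n `|K|) => //.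
- by move=> _; apply: cvg_usc_in => p; apply: cvgN; exact: cV.
- move=> i p sp; apply: le_trans (hK i p sp) _; rewrite ler_wpM2r ?ler_norm//.
  by rewrite exprn_ge0// (le_trans ler01)// base_ge1.
- move=> i p sp; apply: le_trans (V0 p sp); rewrite oppr_le0 mulr_ge0// exprn_ge0//.
  by rewrite (le_trans ler01)// base_ge1.
- move=> i [t x] sp /= ->; apply: le_trans (uT i x) (VT i x).
- move=> i j p sp pT ji; rewrite lerBlDr lerDl; apply: g_ge0 => //.
  by rewrite eq_sym.
Qed.

(** Where the maximum is attained by the obstacle, the obstacle alternative holds; elsewhere a
    superjet of the maximum is one of u_i. Applied to the largest member of the class, this puts it
    above its obstacles. *)
Lemma class_obstacle u i0 j0 : perron_class u -> j0 != i0 ->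
  (forall x, h j0 x - g i0 j0 (T, x) <= h i0 x) ->
  perron_class (fun l p => if l == i0 then Num.max (u i0 p) (u j0 p - g i0 j0 p) else u l p).
Proof.
move=> [uu [n [K hK]] su uT] ji hcomp.
set u' := fun l p => _.
have uu' l p : u l p <= u' l p.
  by rewrite /u'; case: eqP => [->|//]; rewrite le_max lexx.
have ij : i0 != j0 by rewrite eq_sym.
split.
- move=> l; apply/uscP => p sp e e0; rewrite /u'; case: eqP => [_|_].
    have e2 : 0 < e / 2 by rewrite divr_gt0.
    have [r1 r10 h1] := (uscP _ _).1 (uu i0) p sp e e0.
    have [r2 r20 h2] := (uscP _ _).1 (uu j0) p sp _ e2.
    have [r3 r30 h3] := g_cont ij sp e2.
    exists (Num.min r1 (Num.min r2 r3)); first by rewrite !lt_min r10 r20.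
    move=> p' sp' c; rewrite gt_max; apply/andP; split.
      apply: lt_le_trans (h1 p' sp' _) _; first by apply: closeW c; rewrite ge_min lexx.
      by rewrite lerD2r le_max lexx.
    have m1 : u j0 p - g i0 j0 p <= Num.max (u i0 p) (u j0 p - g i0 j0 p).
      by rewrite le_max lexx orbT.
    have := h2 p' sp' (closeW _ c); rewrite !ge_min lexx orbT => /(_ isT).
    have := h3 p' sp' (closeW _ c); rewrite !ge_min lexx !orbT => /(_ isT).
    by rewrite ltr_norml => /andP[+ _]; lra.
  exact: (uscP _ _).1 (uu l) p sp e e0.
- exists n, K => l p sp; rewrite /u'; case: eqP => [_|_]; last exact: hK.
  rewrite ge_max hK//=; apply: le_trans (hK j0 p sp); rewrite lerBlDr lerDl.
  exact: g_ge0.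
- move=> l p J sp pT jJ.
  have [E|/eqP E] := eqVneq (u' l p) (u l p).
    rewrite E; have jJ' : superjet T (u l) p J.
      by apply: (superjet_le ltr01 _ (esym E) jJ) => p' _ _.
    case: (su l p J sp pT jJ') => [[j jl hj]|]; [left | by right].
    by exists j => //; apply: le_trans hj _; rewrite lerD2r.
  left; move: E; rewrite /u'; case: eqP => [->|//].
  have [hle|/ltW hle] := lerP (u j0 p - g i0 j0 p) (u i0 p); first by [].
  by move=> _; exists j0 => //; rewrite (negbTE ji).
- move=> l x; rewrite /u'; case: eqP => [->|_]; last exact: uT.
  by rewrite ge_max uT /=; apply: le_trans (hcomp x); rewrite lerD2r.
Qed.

(** Perron's bump: psi is inserted inside a ball and is below u_i on the outer annulus, so near the
    boundary the maximum coincides with u_i and semicontinuity is kept. *)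
Lemma class_glue u i0 (psi : point -> R) p0 rho : perron_class u ->
  usc_in (strip T k) psi -> strip T k p0 -> 0 < rho ->
  (exists K, forall p, strip T k p -> close rho p0 p -> psi p <= K) ->
  (forall p, strip T k p -> close rho p0 p -> ~ close (rho / 2) p0 p -> psi p < u i0 p) ->
  (forall p J, strip T k p -> p.1 < T -> close rho p0 p -> u i0 p <= psi p ->
     superjet T psi p J -> pde_part b sigma (f i0) p (psi p) J <= 0) ->
  (forall x, close rho p0 (T, x) -> psi (T, x) <= h i0 x) ->
  perron_class (fun l p => if (l == i0) && `[< close rho p0 p >]
     then Num.max (u i0 p) (psi p) else u l p).
Proof.
move=> [uu [n [K hK]] su uT] upsi sp0 rho0 [Kp hKp] hann hpde hpT.
set u' := fun l p => _.
have uu' l p : u l p <= u' l p.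
  rewrite /u'; case: eqP => [->|//] /=; case: asboolP => // _; by rewrite le_max lexx.
have T0 : strip T k (T, p0.2).
  split=> //=; case: sp0 => /=; rewrite !in_itv /= => /andP[h1 h2] _.
  by rewrite lexx (le_trans h1 h2).
split.
- move=> l; apply/uscP => p sp e e0; rewrite /u'; case: eqP => [->|_] /=; last first.
    exact: (uscP _ _).1 (uu l) p sp e e0.
  have [r1 r10 h1] := (uscP _ _).1 (uu i0) p sp e e0.
  have [r2 r20 h2] := (uscP _ _).1 upsi p sp e e0.
  have low p' : u i0 p <= (if `[< close rho p0 p >] then Num.max (u i0 p) (psi p) else u i0 p).
    by case: asboolP => // _; rewrite le_max lexx.
  have [cp|ncp] := pselect (close rho p0 p).
    exists (Num.min r1 r2); first by rewrite !lt_min r10 r20.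
    move=> p' sp' c; rewrite (asboolT cp).
    have g1 := h1 p' sp' (closeW (_ : _ <= r1) c); rewrite ge_min lexx in g1.
    have g2 := h2 p' sp' (closeW (_ : _ <= r2) c); rewrite ge_min lexx orbT in g2.
    have m1 : u i0 p <= Num.max (u i0 p) (psi p) by rewrite le_max lexx.
    have m2 : psi p <= Num.max (u i0 p) (psi p) by rewrite le_max lexx orbT.
    have {}g1 := g1 isT; have {}g2 := g2 isT.
    by case: asboolP => _; rewrite ?gt_max; [apply/andP; split|]; lra.
  (* A point of the ball within rho / 2 of a point outside lies in the annulus, where psi is below
     u_i. *)
  rewrite (asboolF ncp); exists (Num.min r1 (rho / 2)); first by rewrite lt_min r10 divr_gt0.
  move=> p' sp' c.
  have g1 : u i0 p' < u i0 p + e by apply: h1 => //; apply: closeW c; rewrite ge_min lexx.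
  case: asboolP => // cp'; rewrite max_l//; apply/ltW/hann => // cp2; apply: ncp.
  have c2 : close (rho / 2) p p' by apply: closeW c; rewrite ge_min lexx orbT.
  by apply: closeW (close_trans cp2 (close_sym c2)); lra.
- exists n, (`|K| + `|Kp|) => l p sp.
  have b1 : 1 <= base p.2 ^+ n by rewrite exprn_ege1// base_ge1.
  have b0 : 0 <= base p.2 ^+ n by apply: le_trans b1.
  have uK i : u i p <= (`|K| + `|Kp|) * base p.2 ^+ n.
    apply: le_trans (hK i p sp) _; rewrite ler_wpM2r// (le_trans (ler_norm _))//.
    by rewrite lerDl.
  rewrite /u'; case: eqP => [_|_] //=; case: asboolP => // cp.
  rewrite ge_max uK /=; apply: le_trans (hKp p sp cp) _.
  apply: (@le_trans _ _ ((`|K| + `|Kp|) * 1)).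
    by rewrite mulr1; apply: le_trans (ler_norm _) _; rewrite lerDr.
  by rewrite ler_wpM2l.
- move=> l p J sp pT jJ.
  have [E|/eqP E] := eqVneq (u' l p) (u l p).
    rewrite E; have jJ' : superjet T (u l) p J.
      by apply: (superjet_le ltr01 _ (esym E) jJ) => p' _ _.
    case: (su l p J sp pT jJ') => [[j jl hj]|]; [left | by right].
    by exists j => //; apply: le_trans hj _; rewrite lerD2r.
  right; move: jJ E; rewrite /u'; case: eqP => [->|//] /=; case: asboolP => // cp jJ.
  have [hle|/ltW hle] := lerP (psi p) (u i0 p); first by [].
  move=> _; apply: hpde => //.
  have [r r0 hr] : exists2 r, 0 < r & forall p', close r p p' -> close rho p0 p'.
    case: cp => c1 c2; exists (rho - Num.max `|p.1 - p0.1| (enorm (p.2 - p0.2))).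
      by rewrite subr_gt0 gt_max c1.
    have m1 : `|p.1 - p0.1| <= Num.max `|p.1 - p0.1| (enorm (p.2 - p0.2)) by rewrite le_max lexx.
    have m2 : enorm (p.2 - p0.2) <= Num.max `|p.1 - p0.1| (enorm (p.2 - p0.2)).
      by rewrite le_max lexx orbT.
    move=> p' [d1 d2]; split.
      by have := ler_normD (p'.1 - p.1) (p.1 - p0.1); rewrite addrA subrK; lra.
    by have := enormD (p'.2 - p.2) (p.2 - p0.2); rewrite addrA subrK; lra.
  apply: (superjet_le r0 _ _ jJ) => [p' sp' c|] /=.
    by rewrite (asboolT (hr p' c)) le_max lexx orbT.
  by rewrite (asboolT cp) (max_idPr hle).
- move=> l x; rewrite /u'; case: eqP => [->|_] /=; last exact: uT.
  by case: asboolP => [c|_]; rewrite ?ge_max ?uT//=; exact: hpT.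
Qed.

End System.

Lemma close_open (R : realType) k (rho : R) (p0 p : R * 'cV[R]_k) : close rho p0 p ->
  exists2 r : R, 0 < r & forall p', close r p p' -> close rho p0 p'.
Proof.
move=> [c1 c2]; exists (rho - Num.max `|p.1 - p0.1| (enorm (p.2 - p0.2))).
  by rewrite subr_gt0 gt_max c1.
have m1 : `|p.1 - p0.1| <= Num.max `|p.1 - p0.1| (enorm (p.2 - p0.2)) by rewrite le_max lexx.
have m2 : enorm (p.2 - p0.2) <= Num.max `|p.1 - p0.1| (enorm (p.2 - p0.2)).
  by rewrite le_max lexx orbT.
move=> p' [d1 d2]; split.
  by have := ler_normD (p'.1 - p.1) (p.1 - p0.1); rewrite addrA subrK; lra.
by have := enormD (p'.2 - p.2) (p.2 - p0.2); rewrite addrA subrK; lra.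
Qed.

(** * The supremum of the class and its upper envelope *)

Section System.
Variables (R : realType) (T : R) (k d m : nat).
Local Notation point := (R * 'cV[R]_k)%type.
Variables (b : point -> 'cV[R]_k) (sigma : point -> 'M[R]_(k, d))
  (f : 'I_m -> point -> R -> 'cV[R]_d -> R) (g : 'I_m -> 'I_m -> point -> R) (C : R).
Hypothesis d_gt0 : (0 < d)%N.
Hypothesis b_cont : cont_in (strip T k) b.
Hypothesis s_cont : cont_in (strip T k) sigma.
Hypothesis C_ge0 : 0 <= C.
Hypothesis bs_growth : forall p, strip T k p ->
  enorm (b p) + enorm (sigma p) <= C * (1 + enorm p.2).
Hypothesis bs_lip : forall t x y, 0 <= t <= T ->
  enorm (b (t, x) - b (t, y)) + enorm (sigma (t, x) - sigma (t, y)) <= C * enorm (x - y).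
Hypothesis f_cont : forall i p, strip T k p -> forall e, 0 < e -> exists2 r : R, 0 < r &
  forall p', strip T k p' -> close r p p' -> forall y z, `|f i p' y z - f i p y z| < e.
Hypothesis f_lip : forall i p y y' z z', strip T k p ->
  `|f i p y z - f i p y' z'| <= C * (`|y - y'| + enorm (z - z')).
Hypothesis g_cont : forall i j, i != j -> rcont_in (strip T k) (g i j).
Hypothesis no_loop : forall p, strip T k p ->
  forall (N : nat) (i : nat -> 'I_m), (3 <= N)%N -> i 1%N = i N ->
    #|[seq i n | n <- index_iota 1 N.+1]| = N.-1 ->
    0 < \sum_(1 <= n < N) g (i n) (i n.+1) p.

Hypothesis T_gt0 : 0 < T.
Hypothesis g_ge0 : forall i j p, i != j -> strip T k p -> 0 <= g i j p.
Variables (h : 'I_m -> 'cV[R]_k -> R) (K0 : R) (n : nat) (V : point -> R).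
Hypothesis h_cont : forall i x e, 0 < e -> exists2 r : R, 0 < r &
  forall x', enorm (x' - x) < r -> `|h i x' - h i x| < e.
Hypothesis h_compat : forall i j x, j != i -> h j x - g i j (T, x) <= h i x.
Hypothesis K0_ge0 : 0 <= K0.
Hypothesis f_growth : forall i p, strip T k p -> `|f i p 0 0| <= K0 * base p.2 ^+ n.
Hypothesis h_growth : forall i x, `|h i x| <= K0 * base x ^+ n.
Hypothesis V_cont : continuous V.
Hypothesis V_ge : forall p, strip T k p -> K0 * base p.2 ^+ n <= V p.
Hypothesis V_growth : exists K, forall p, strip T k p -> V p <= K * base p.2 ^+ n.
Hypothesis V_sub : jet_sub T b sigma f g (fun _ => \- V).
Hypothesis V_super : jet_super T b sigma f (fun _ => V).

Local Notation class := (perron_class T b sigma f g h).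

Lemma strip_T x : strip T k (T, x).
Proof. by split=> //=; rewrite in_itv /= lexx ltW. Qed.

Lemma V_ge0 p : strip T k p -> 0 <= V p.
Proof.
move=> sp; apply: le_trans (V_ge sp); rewrite mulr_ge0// exprn_ge0//.
by rewrite (le_trans ler01)// base_ge1.
Qed.

Lemma V_f i p : strip T k p -> `|f i p 0 0| <= V p.
Proof. by move=> sp; apply: le_trans (f_growth i sp) (V_ge sp). Qed.

Lemma V_h i x : `|h i x| <= V (T, x).
Proof. exact: le_trans (h_growth i x) (V_ge (strip_T x)). Qed.

Lemma V_near p : exists2 r : R, 0 < r & forall p', close r p p' -> V p' <= V p + 1.
Proof.
have [r r0 hr] := (uscP setT V).1 (cvg_usc_in V_cont) p I 1 ltr01.
by exists r => // p' c; apply/ltW/hr.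
Qed.

Lemma class_negV : class (fun _ => \- V).
Proof.
split=> //.
- by move=> _; apply: cvg_usc_in => p; apply: cvgN; exact: V_cont.
- by exists 0%N, 0 => _ p sp; rewrite mul0r oppr_le0 V_ge0.
- by move=> i x /=; have := V_h i x; rewrite ler_norml => /andP[].
Qed.

Lemma class_le_V u i p : class u -> strip T k p -> u i p <= V p.
Proof.
move=> cu; apply: (class_le_barrier d_gt0 b_cont s_cont C_ge0 bs_growth bs_lip f_cont
  f_lip g_cont no_loop g_ge0 cu) => //; first exact: V_ge0.
by move=> j x; apply: le_trans (ler_norm _) (V_h j x).
Qed.

Definition psup i p := sup [set y | exists2 u, class u & y = u i p].

Lemma has_sup_class i p : strip T k p -> has_sup [set y | exists2 u, class u & y = u i p].
Proof.
move=> sp; split; first by exists (- V p), (fun _ => \- V) => //; exact: class_negV.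
by exists (V p) => _ [u cu ->]; exact: class_le_V.
Qed.

Lemma class_le_psup u i p : class u -> strip T k p -> u i p <= psup i p.
Proof.
move=> cu sp; apply: ub_le_sup; first by case: (has_sup_class i sp).
by exists u.
Qed.

Lemma psup_le i p y : strip T k p -> (forall u, class u -> u i p <= y) -> psup i p <= y.
Proof.
move=> sp hy; apply: ge_sup; first by case: (has_sup_class i sp).
by move=> _ [u cu ->]; exact: hy.
Qed.

Lemma psup_approx i p e : strip T k p -> 0 < e -> exists2 u, class u & psup i p - e < u i p.
Proof.
move=> sp e0; have [_ [u cu ->] hy] := sup_adherent e0 (has_sup_class i sp).
by exists u.
Qed.

Lemma psup_le_V i p : strip T k p -> psup i p <= V p.
Proof. by move=> sp; apply: psup_le => // u cu; exact: class_le_V. Qed.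

Lemma psup_loc_bounded i p : strip T k p -> exists y, local_bound T (psup i) p y.
Proof.
move=> sp; have [r r0 hr] := V_near p; exists (V p + 1), r => // p' sp' c.
exact: le_trans (psup_le_V i sp') (hr p' c).
Qed.

Definition pusc i := uenv T (psup i).

Lemma psup_le_pusc i p : strip T k p -> psup i p <= pusc i p.
Proof. by move=> sp; apply: le_uenv => //; exact: psup_loc_bounded. Qed.

Lemma pusc_usc i : usc_in (strip T k) (pusc i).
Proof. by apply: uenv_usc => p; exact: psup_loc_bounded. Qed.

Lemma pusc_le_V i p : strip T k p -> pusc i p <= V p.
Proof.
move=> sp; apply/ler_addgt0Pr => e e0.
have [r r0 hr] := (uscP setT V).1 (cvg_usc_in V_cont) p I e e0.
apply: uenv_le => //; first by move=> p'; exact: psup_loc_bounded.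
exists r => // p' sp' c; apply: le_trans (psup_le_V i sp') _.
exact/ltW/hr.
Qed.

(** If both alternatives fail at a superjet of the envelope, they still fail, by continuity, at
    nearby jets. [superjet_stability] finds such a jet for a single member of the class that nearly
    attains the envelope, and this contradicts the subsolution property of that member. *)
Lemma pusc_sub : jet_sub T b sigma f g pusc.
Proof.
move=> i p J sp pT jJ; apply: contrapT => hn.
have hobs j : j != i -> pusc j p - g i j p < pusc i p.
  by move=> ji; rewrite ltNge; apply/negP => hj; apply: hn; left; exists j.
have hpde : 0 < pde_part b sigma (f i) p (pusc i p) J.
  by rewrite ltNge; apply/negP => hj; apply: hn; right.
have [r1 r10 h1] := obstacle_free g_cont pusc_usc sp hobs.
have [L1 L10 h2] := pde_part_cont b_cont s_cont C_ge0 (f_cont i) (f_lip i) (pusc i p) J sp hpde.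
have L0 : 0 < Num.min (T - p.1) (Num.min r1 L1) by rewrite !lt_min r10 L10 subr_gt0 pT.
have [r [eta [r0 eta0 hst]]] := superjet_stability sp jJ L0.
have eta2 : 0 < eta / 2 by rewrite divr_gt0.
have [p1 [sp1 c1 hp1]] := uenv_approx (@psup_loc_bounded i) sp eta2.
have [u cu hu] := psup_approx i sp1 eta2.
have [uu _ su _] := cu.
have ule j p' : strip T k p' -> u j p' <= pusc j p'.
  by move=> sp'; apply: le_trans (class_le_psup j cu sp') (psup_le_pusc j sp').
have [||||p' [J' [sp' cp' hup' jJ' [ha hq hM]]]] := hst (u i) p1 (uu i).
- by move=> p' sp' _; exact: ule.
- exact: sp1.
- by apply: closeW c1; lra.
- by rewrite -/(pusc i p) in hp1; lra.
move: hup' ha hq hM; rewrite !le_min.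
move=> /andP[_ /andP[u1 u2]] /andP[_ /andP[_ a2]] /andP[_ /andP[_ q2]] /andP[_ /andP[_ M2]].
have cT : close (T - p.1) p p' by apply: closeW cp'; rewrite ge_min lexx.
have cr : close r1 p p' by apply: closeW cp'; rewrite !ge_min lexx orbT.
have cL : close L1 p p' by apply: closeW cp'; rewrite !ge_min lexx !orbT.
have pT' : p'.1 < T by case: cT => cT _; have := ler_norm (p'.1 - p.1); lra.
case: (su i p' J' sp' pT' jJ') => [[j ji hj]|hj].
  have := h1 p' (u i p') sp' cr u1 j ji; have := ule j p' sp'; lra.
by have := h2 p' (u i p') J' sp' cL u2 a2 q2 M2; rewrite ltr_norml => /andP[]; lra.
Qed.

(** Everything but the time slope [a] is bounded independently of [a], so a steep slope decides the
    sign on the paraboloids used near time T. *)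
Lemma quad_pde_bound i p y (a l S F Y : R) (dx : 'cV[R]_k) : strip T k p ->
  enorm (b p) + enorm (sigma p) <= S -> enorm dx <= 1 -> `|y| <= Y -> `|f i p 0 0| <= F ->
  `|pde_part b sigma (f i) p y (a, l *: dx, l%:M) + a| <=
    `|l| * S + `|l| * S ^+ 2 + F + C * (Y + `|l| * S).
Proof.
move=> sp hS dx1 hy hF.
have C0 := C_ge0; have d0 := enorm_ge0 dx; have l0 := normr_ge0 l.
have b0 := enorm_ge0 (b p); have s0 := enorm_ge0 (sigma p).
have bS : enorm (b p) <= S by apply: le_trans hS; rewrite lerDl.
have sS : enorm (sigma p) <= S by apply: le_trans hS; rewrite lerDr.
have S0 : 0 <= S by apply: le_trans bS.
have -> : pde_part b sigma (f i) p y (a, l *: dx, l%:M) + a =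
    - (l * dot (b p) dx) - 2^-1 * (l * enorm (sigma p) ^+ 2) - f i p y ((sigma p)^T *m (l *: dx)).
  by rewrite /pde_part /= dotZr trace_scalar; ring.
have sd : enorm ((sigma p)^T *m (l *: dx)) <= `|l| * S.
  rewrite -scalemxAr enormZ ler_wpM2l//; apply: le_trans (enormM _ _) _.
  rewrite enorm_tr; apply: le_trans (ler_piMr s0 dx1) sS.
have h1 : `|l * dot (b p) dx| <= `|l| * S.
  by rewrite normrM ler_wpM2l//; apply: le_trans (dotC_le _ _) (le_trans (ler_piMr b0 dx1) bS).
have h2 : `|2^-1 * (l * enorm (sigma p) ^+ 2)| <= `|l| * S ^+ 2.
  have s2 : enorm (sigma p) ^+ 2 <= S ^+ 2 by rewrite ler_pXn2r ?nnegrE.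
  rewrite normrM (normrM l) (ger0_norm (sqr_ge0 (enorm (sigma p)))) gtr0_norm ?invr_gt0//.
  by have := ler_wpM2l l0 s2; have := mulr_ge0 l0 (sqr_ge0 (enorm (sigma p))); lra.
have h3 : `|f i p y ((sigma p)^T *m (l *: dx))| <= F + C * (Y + `|l| * S).
  rewrite (_ : f i p y _ = f i p 0 0 + (f i p y ((sigma p)^T *m (l *: dx)) - f i p 0 0)); last by ring.
  apply: le_trans (ler_normD _ _) (lerD hF _); apply: le_trans (f_lip _ _ _ _ _ sp) _.
  by rewrite !subr0 ler_wpM2l// lerD.
apply: le_trans (ler_normB _ _) _; apply: le_trans (lerD (ler_normB _ _) h3) _.
by rewrite normrN; lra.
Qed.

Ltac focus := clear - d_gt0 b_cont s_cont C_ge0 bs_growth bs_lip f_cont f_lip g_cont no_loop T_gt0 g_ge0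
  h_cont h_compat K0_ge0 f_growth h_growth V_cont V_ge V_growth V_sub V_super.

(** Compatibility of h propagates the excess over h: if pusc_i <= pusc_j - g_ij and pusc_j <= h_j,
    then pusc_i <= h_i. So [no_loop_contra] gives an index that is above h and off its obstacle.
    There a barrier c + C1 (T - t) + K |x - x0|^2, with c below the envelope at (T, x0), dominates
    every member of the class nearby, hence the envelope itself. *)
Lemma pusc_terminal i x0 : pusc i (T, x0) <= h i x0.
Proof.
pose P0 : point := (T, x0); have sP0 : strip T k P0 := strip_T x0.
rewrite leNgt; apply/negP => hi.
have [{hi} i0 [hi hobs]] : exists i0, h i0 x0 < pusc i0 P0 /\
    forall j, j != i0 -> pusc j P0 - g i0 j P0 < pusc i0 P0.
  apply: contrapT => hn.
  apply: (@no_loop_contra R m (fun i j => g i j P0) (fun i => pusc i P0)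
    [set i | h i x0 < pusc i P0]).
  - by move=> N s; exact: no_loop.
  - by exists i.
  - move=> i1 /= hi1; have [j ji hj] : exists2 j, j != i1 & pusc i1 P0 <= pusc j P0 - g i1 j P0.
      apply: contrapT => hn'; apply: hn; exists i1; split=> // j ji.
      by rewrite ltNge; apply/negP => hj; apply: hn'; exists j.
    exists j; split=> //=; rewrite ltNge; apply/negP => hj'.
    by have := h_compat x0 ji; lra.
have [r1 r10 h1] := obstacle_free g_cont pusc_usc sP0 hobs.
(* Above h, so that members of the class are below the barrier at time T; below the envelope, for
   the contradiction; and within r1 of it, so that the value c is still off the obstacle. *)
have [c [ch cy c1]] : exists c, [/\ h i0 x0 < c, c < pusc i0 P0 & pusc i0 P0 - r1 <= c].
  exists (Num.max (pusc i0 P0 - r1) ((h i0 x0 + pusc i0 P0) / 2)); split.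
  - by rewrite lt_max; apply/orP; right; lra.
  - by rewrite gt_max; apply/andP; split; lra.
  - by rewrite le_max lexx.
have [r2 r20 h2] := V_near P0; set U := V P0 + 1 in h2.
have hc0 : 0 < c - h i0 x0 by rewrite subr_gt0.
have [r3 r30 h3] := h_cont i0 x0 hc0.
have [rho [rho0 rho11 rho1 rho2 rho3]] : exists rho : R,
    [/\ 0 < rho, rho <= 1, rho < r1, rho < r2 & rho < r3].
  have m0 : 0 < Num.min 1 (Num.min r1 (Num.min r2 r3)).
    by rewrite !lt_min ltr01 r10 r20.
  exists (Num.min 1 (Num.min r1 (Num.min r2 r3)) / 2).
  have mx y : Num.min 1 (Num.min r1 (Num.min r2 r3)) <= y ->
      Num.min 1 (Num.min r1 (Num.min r2 r3)) / 2 < y by lra.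
  split; try (by apply: mx; rewrite !ge_min lexx ?orbT); first by lra.
  by apply/ltW/mx; rewrite !ge_min lexx ?orbT.
have U0 : 0 <= U by rewrite /U addr_ge0// V_ge0.
have cU : c < U by rewrite /U; have := pusc_le_V i0 sP0; lra.
have [S [S0 hS]] : exists S, 0 <= S /\ forall p, box T rho P0 p ->
    enorm (b p) + enorm (sigma p) <= S.
  exists (C * (2 + enorm x0)); split; first by rewrite mulr_ge0 ?addr_ge0 ?enorm_ge0.
  move=> p [sp t1 x1]; apply: (box_growth C_ge0 bs_growth (p0 := P0)).
  by split=> //; exact: le_trans rho11.
(* U bounds the class near (T, x0), and K lifts the barrier to at least U on the lateral boundary of
   the box. *)
have [K [Kp hK]] : exists K, 0 <= K /\ U - c <= K * rho ^+ 2.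
  exists ((U - c) / rho ^+ 2); rewrite divfK ?gt_eqF ?exprn_gt0//; split=> //.
  by apply: divr_ge0; rewrite ?sqr_ge0//; lra.
pose D := 2 * K * S + 2 * K * S ^+ 2 + U + C * (`|c| + U + 2 * K * S).
(* C1 lifts the barrier to at least U at the earliest time of the box; exceeding [D], it also makes
   the operator positive on the barrier. *)
have [C1 [C10 hC1 hC1D]] : exists C1, [/\ 0 <= C1, U - c <= C1 * rho & D < C1].
  exists ((U - c) / rho + `|D| + 1).
  have u0 : 0 <= (U - c) / rho by apply: divr_ge0; [lra | exact: ltW].
  have D0 := normr_ge0 D; have D1 := ler_norm D.
  split; [| rewrite -ler_pdivrMr// |]; move: u0 D0 D1; focus; lra.
pose bar (p : point) := jet_poly c P0 (- C1) 0 0 p + K * enorm (p.2 - P0.2) ^+ 2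
  + 0 * (p.1 - P0.1) ^+ 2.
have barE p : bar p = c + C1 * (T - p.1) + K * enorm (p.2 - x0) ^+ 2.
  by rewrite /bar /jet_poly mul0mx !dot0l dot0r /=; ring.
have barc : continuous bar by apply: test_continuous; rewrite trmx0.
have bar_ge p : strip T k p -> c <= bar p.
  move=> [/=]; rewrite in_itv /= => /andP[_ pT] _; rewrite barE -addrA lerDl addr_ge0//.
    by rewrite mulr_ge0// subr_ge0.
  by rewrite mulr_ge0 ?sqr_ge0.
have main u : class u -> forall p, box T rho P0 p -> u i0 p <= bar p.
  move=> cu; have [uu _ su uT] := cu.
  have ule j p : strip T k p -> u j p <= pusc j p.
    by move=> sp; apply: le_trans (class_le_psup j cu sp) (psup_le_pusc j sp).
  have bP0 : box T rho P0 P0 by split; rewrite // subrr ?normr0 ?enorm0 ltW.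
  have uF : usc_in (box T rho P0) (u i0 \+ \- bar).
    apply: usc_inD; first by apply: usc_in_sub (uu i0) => p [].
    by apply: cvg_usc_in => p; apply: cvgN; exact: barc.
  have [pm [sm tm xm] hm] := usc_max (@compact_box R T k rho P0) (ex_intro _ _ bP0) uF.
  suff : u i0 pm <= bar pm by move=> hpm p bp; have := hm p bp; rewrite /=; lra.
  rewrite leNgt; apply/negP => hlt.
  have cpm := bar_ge pm sm.
  have cl2 : close r2 P0 pm by split; [exact: le_lt_trans rho2 | exact: le_lt_trans rho2].
  have cl1 : close r1 P0 pm by split; [exact: le_lt_trans rho1 | exact: le_lt_trans rho1].
  have uU : u i0 pm <= U by apply: le_trans (class_le_V i0 cu sm) (h2 pm cl2).
  have pmT : pm.1 <= T by case: sm => /=; rewrite in_itv /= => /andP[].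
  have K2 : 0 <= K * enorm (pm.2 - x0) ^+ 2 by rewrite mulr_ge0 ?sqr_ge0.
  have C2 : 0 <= C1 * (T - pm.1) by rewrite mulr_ge0// subr_ge0.
  rewrite barE in hlt.
  have pmT' : pm.1 < T.
    rewrite lt_neqAle pmT andbT; apply/eqP => E.
    have := uT i0 pm.2; rewrite (_ : (T, pm.2) = pm); last by rewrite -E; case: (pm).
    have := h3 pm.2 (le_lt_trans xm rho3); rewrite ltr_norml => /andP[_].
    by move: hlt K2 C2; focus; lra.
  have tm' : `|pm.1 - T| < rho.
    rewrite lt_neqAle tm andbT; apply/eqP => E.
    have : C1 * (T - pm.1) = C1 * rho by rewrite -E distrC ger0_norm// subr_ge0.
    by move: hlt uU hC1 K2; focus; lra.
  have xm' : enorm (pm.2 - x0) < rho.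
    rewrite lt_neqAle xm andbT; apply/eqP => E; rewrite E in hlt K2; move: hlt uU hK C2; focus; lra.
  have jm : superjet T (u i0) pm (- C1, (2 * K) *: (pm.2 - x0), (2 * K)%:M).
    apply: (@superjet_quad R T k (u i0) pm _ _ _ 0); first by rewrite tr_scalar_mx.
    have [r4 r40 h4] := close_open (conj tm' xm' : close rho P0 pm).
    move=> e e0; exists r4 => // p sp cl; have bp : box T rho P0 p.
      by have [t1 x1] := h4 p cl; split=> //; exact: ltW.
    have := hm p bp; rewrite /= !barE /jet_poly.
    set X := pm.2 - x0; set dx := p.2 - pm.2.
    have -> : p.2 - x0 = X + dx by rewrite /X /dx [RHS]addrC addrA subrK.
    rewrite enormD_sqr mul_scalar_mx dotZl dotZr dot_enorm.
    have := mulr_ge0 (ltW e0) (sqr_ge0 (enorm dx)).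
    by focus; lra.
  have yc : `|c - pusc i0 P0| <= r1.
    by rewrite ler_norml; apply/andP; split; move: c1 cy r10; focus; lra.
  case: (su i0 pm _ sm pmT' jm) => [[j ji hj]|].
    by have := h1 pm c sm cl1 yc j ji; have := ule j pm sm; move: hj hlt K2 C2; focus; lra.
  have Y : `|u i0 pm| <= `|c| + U.
    have := ler_norm (- c); rewrite normrN; have := normr_ge0 c => cc0 cc1.
    by rewrite ler_norml; apply/andP; split; move: cc0 cc1 uU hlt K2 C2 U0; focus; lra.
  have dx1 : enorm (pm.2 - x0) <= 1 by exact: le_trans rho11.
  have bpm : box T rho P0 pm by [].
  have := quad_pde_bound (- C1) (2 * K) sm (hS pm bpm) dx1 Y (le_trans (V_f i0 sm) (h2 pm cl2)).
  rewrite (ger0_norm (_ : 0 <= 2 * K)); last by rewrite mulr_ge0.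
  by rewrite -/D ler_norml => /andP[h5 _]; move: h5 hC1D; focus; lra.
have e0 : 0 < (pusc i0 P0 - c) / 2 by rewrite divr_gt0// subr_gt0.
have [r4 r40 h4] := (uscP setT bar).1 (cvg_usc_in barc) P0 I _ e0.
have barP0 : bar P0 = c by rewrite barE /= !subrr enorm0 expr0n /= !mulr0 !addr0.
suff : pusc i0 P0 <= c + (pusc i0 P0 - c) / 2 by lra.
apply: uenv_le => //; first by move=> p; exact: psup_loc_bounded.
exists (Num.min r4 rho); first by rewrite lt_min r40.
move=> p sp cl; apply: psup_le => // u cu.
apply: le_trans (main u cu p _) _.
  have [t1 x1] : close rho P0 p by apply: closeW cl; rewrite ge_min lexx orbT.
  by split=> //; exact: ltW.
rewrite -{1}barP0; apply/ltW/h4 => //; apply: closeW cl; by rewrite ge_min lexx.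
Qed.

Lemma pusc_class : class pusc.
Proof.
split; [exact: pusc_usc | | exact: pusc_sub | exact: pusc_terminal].
have [K hK] := V_growth; exists n, K => i p sp.
exact: le_trans (pusc_le_V i sp) (hK p sp).
Qed.

Lemma class_le_pusc u i p : class u -> strip T k p -> u i p <= pusc i p.
Proof. by move=> cu sp; apply: le_trans (class_le_psup i cu sp) (psup_le_pusc i sp). Qed.

End System.

(** * The lower envelope of the largest subsolution *)

Section System.
Variables (R : realType) (T : R) (k d m : nat).
Local Notation point := (R * 'cV[R]_k)%type.
Variables (b : point -> 'cV[R]_k) (sigma : point -> 'M[R]_(k, d))
  (f : 'I_m -> point -> R -> 'cV[R]_d -> R) (g : 'I_m -> 'I_m -> point -> R) (C : R).
Hypothesis d_gt0 : (0 < d)%N.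
Hypothesis b_cont : cont_in (strip T k) b.
Hypothesis s_cont : cont_in (strip T k) sigma.
Hypothesis C_ge0 : 0 <= C.
Hypothesis bs_growth : forall p, strip T k p ->
  enorm (b p) + enorm (sigma p) <= C * (1 + enorm p.2).
Hypothesis bs_lip : forall t x y, 0 <= t <= T ->
  enorm (b (t, x) - b (t, y)) + enorm (sigma (t, x) - sigma (t, y)) <= C * enorm (x - y).
Hypothesis f_cont : forall i p, strip T k p -> forall e, 0 < e -> exists2 r : R, 0 < r &
  forall p', strip T k p' -> close r p p' -> forall y z, `|f i p' y z - f i p y z| < e.
Hypothesis f_lip : forall i p y y' z z', strip T k p ->
  `|f i p y z - f i p y' z'| <= C * (`|y - y'| + enorm (z - z')).
Hypothesis g_cont : forall i j, i != j -> rcont_in (strip T k) (g i j).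
Hypothesis no_loop : forall p, strip T k p ->
  forall (N : nat) (i : nat -> 'I_m), (3 <= N)%N -> i 1%N = i N ->
    #|[seq i n | n <- index_iota 1 N.+1]| = N.-1 ->
    0 < \sum_(1 <= n < N) g (i n) (i n.+1) p.

Hypothesis T_gt0 : 0 < T.
Hypothesis g_ge0 : forall i j p, i != j -> strip T k p -> 0 <= g i j p.
Variables (h : 'I_m -> 'cV[R]_k -> R) (K0 : R) (n : nat) (V : point -> R).
Hypothesis h_cont : forall i x e, 0 < e -> exists2 r : R, 0 < r &
  forall x', enorm (x' - x) < r -> `|h i x' - h i x| < e.
Hypothesis h_compat : forall i j x, j != i -> h j x - g i j (T, x) <= h i x.
Hypothesis K0_ge0 : 0 <= K0.
Hypothesis f_growth : forall i p, strip T k p -> `|f i p 0 0| <= K0 * base p.2 ^+ n.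
Hypothesis h_growth : forall i x, `|h i x| <= K0 * base x ^+ n.
Hypothesis V_cont : continuous V.
Hypothesis V_ge : forall p, strip T k p -> K0 * base p.2 ^+ n <= V p.
Hypothesis V_growth : exists K, forall p, strip T k p -> V p <= K * base p.2 ^+ n.
Hypothesis V_sub : jet_sub T b sigma f g (fun _ => \- V).
Hypothesis V_super : jet_super T b sigma f (fun _ => V).

Local Notation class := (perron_class T b sigma f g h).

Variable v : 'I_m -> point -> R.
Hypothesis v_class : class v.
Hypothesis v_max : forall u i p, class u -> strip T k p -> u i p <= v i p.
Hypothesis v_le_V : forall i p, strip T k p -> v i p <= V p.
Hypothesis negV_class : class (fun _ => \- V).

Ltac focus := clear - d_gt0 b_cont s_cont C_ge0 bs_growth bs_lip f_cont f_lip g_cont no_loop T_gt0 g_ge0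
  h_cont h_compat K0_ge0 f_growth h_growth V_cont V_ge V_growth V_sub V_super
  v_class v_max v_le_V negV_class.

Definition vlow i p := - uenv T (fun p => - v i p) p.

Lemma negv_loc_bounded i p : strip T k p -> exists y, local_bound T (fun p => - v i p) p y.
Proof.
move=> sp; have [r r0 hr] := V_near V_cont p; exists (V p + 1), r => // p' sp' c.
by apply: le_trans (hr p' c); rewrite lerNl; exact: v_max negV_class sp'.
Qed.

Lemma vlow_le i p : strip T k p -> vlow i p <= v i p.
Proof.
by move=> sp; rewrite /vlow lerNl; apply: le_uenv => //; exact: negv_loc_bounded.
Qed.

Lemma vlow_ge i p y : strip T k p ->
  (exists2 r : R, 0 < r & forall p', strip T k p' -> close r p p' -> y <= v i p') ->
  y <= vlow i p.
Proof.
move=> sp [r r0 hr]; rewrite /vlow lerNr; apply: uenv_le => //.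
  by move=> p'; exact: negv_loc_bounded.
by exists r => // p' sp' c; rewrite lerN2 hr.
Qed.

Lemma vlow_usc i : usc_in (strip T k) (\- vlow i).
Proof.
have -> : \- vlow i = uenv T (fun p => - v i p).
  by apply/funext => p; rewrite /= /vlow opprK.
by apply: uenv_usc => p; exact: negv_loc_bounded.
Qed.

Lemma vlow_geV i p : strip T k p -> - V p <= vlow i p.
Proof.
move=> sp; apply/ler_addgt0Pr => e e0; rewrite -lerBlDr; apply: vlow_ge => //.
have [r r0 hr] := (uscP setT V).1 (cvg_usc_in V_cont) p I e e0.
exists r => // p' sp' c; have := v_max i negV_class sp'; have := hr p' I c; rewrite /=; lra.
Qed.

Lemma vlow_above i j p : strip T k p -> j != i -> vlow j p - g i j p <= vlow i p.
Proof.
move=> sp ji; have ij : i != j by rewrite eq_sym.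
apply/ler_addgt0Pr => e e0; rewrite -lerBlDr; apply: vlow_ge => //.
have e2 : 0 < e / 2 by rewrite divr_gt0.
have [r1 r10 h1] := (uscP _ _).1 (@vlow_usc j) p sp _ e2.
have [r2 r20 h2] := g_cont ij sp e2.
exists (Num.min r1 r2); first by rewrite lt_min r10.
move=> p' sp' c.
have := h1 p' sp' (closeW (_ : _ <= r1) c); rewrite ge_min lexx /= => /(_ isT) {}h1.
have := h2 p' sp' (closeW (_ : _ <= r2) c); rewrite ge_min lexx orbT => /(_ isT).
rewrite ltr_norml => /andP[_ {}h2].
have cu := class_obstacle g_cont g_ge0 v_class ji (fun x => h_compat x ji).
have := v_max i cu sp'; rewrite eqxx ge_max => /andP[_ h3].
have := vlow_le j sp'; lra.
Qed.

(** The bump h_i x0 - e / 2 - C1 (T - t) - K |x - x0|^2, glued to - V, belongs to the class; by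
    maximality v is at least h_i x0 - e near (T, x0). *)
Lemma vlow_terminal i x0 : h i x0 <= vlow i (T, x0).
Proof.
pose P0 : point := (T, x0); have sP0 : strip T k P0 := strip_T T_gt0 x0.
apply/ler_addgt0Pr => e e0; rewrite -lerBlDr; apply: vlow_ge => //.
have e2 : 0 < e / 2 by rewrite divr_gt0.
have [r2 r20 h2] := V_near V_cont P0; set U := V P0 + 1 in h2.
have [r3 r30 h3] := h_cont i x0 e2.
have [rho [rho0 rho11 rho2 rho3]] : exists rho : R,
    [/\ 0 < rho, rho <= 1, rho < r2 & rho < r3].
  have m0 : 0 < Num.min 1 (Num.min r2 r3) by rewrite !lt_min ltr01 r20.
  exists (Num.min 1 (Num.min r2 r3) / 2).
  have mx y : Num.min 1 (Num.min r2 r3) <= y -> Num.min 1 (Num.min r2 r3) / 2 < y by lra.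
  split; try (by apply: mx; rewrite !ge_min lexx ?orbT); first by lra.
  by apply/ltW/mx; rewrite !ge_min lexx ?orbT.
have U0 : 0 <= U by rewrite /U addr_ge0// (V_ge0 K0_ge0 V_ge).
have [S [S0 hS]] : exists S, 0 <= S /\ forall p, strip T k p -> close rho P0 p ->
    enorm (b p) + enorm (sigma p) <= S.
  exists (C * (2 + enorm x0)); split; first by rewrite mulr_ge0 ?addr_ge0 ?enorm_ge0.
  move=> p sp [t1 x1]; apply: (box_growth C_ge0 bs_growth (p0 := P0)).
  by split=> //; apply: le_trans rho11; exact: ltW.
(* Depth by which psi has to sink on the annulus to fall below - V; it also bounds |psi| wherever
   psi is above - V. *)
pose Y := U + `|h i x0 - e / 2|.
have Y0 : 0 <= Y by rewrite /Y addr_ge0.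
have [K [Kp hK]] : exists K, 0 <= K /\ Y < K * (rho / 2) ^+ 2.
  have q0 : 0 < (rho / 2) ^+ 2 by rewrite exprn_gt0// divr_gt0.
  exists ((Y + 1) / (rho / 2) ^+ 2); rewrite divfK ?gt_eqF//; split; last by rewrite ltrDl.
  by apply: divr_ge0; [rewrite addr_ge0 | exact: ltW].
pose D := 2 * K * S + 2 * K * S ^+ 2 + U + C * (Y + 2 * K * S).
have [C1 [C10 hC1 hC1D]] : exists C1, [/\ 0 <= C1, Y < C1 * (rho / 2) & D <= C1].
  have q0 : 0 < rho / 2 by rewrite divr_gt0.
  exists (Y / (rho / 2) + `|D| + 1).
  have u0 : 0 <= Y / (rho / 2) by apply: divr_ge0 => //; exact: ltW.
  have D0 := normr_ge0 D; have D1 := ler_norm D.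
  split; [| rewrite -ltr_pdivrMr// |]; move: u0 D0 D1; focus; lra.
pose psi (p : point) := jet_poly (h i x0 - e / 2) P0 C1 0 0 p + - K * enorm (p.2 - P0.2) ^+ 2
  + 0 * (p.1 - P0.1) ^+ 2.
have psiE p : psi p = h i x0 - e / 2 - C1 * (T - p.1) - K * enorm (p.2 - x0) ^+ 2.
  by rewrite /psi /jet_poly mul0mx !dot0l dot0r /=; ring.
have psic : continuous psi by apply: test_continuous; rewrite trmx0.
have psi_le p : strip T k p -> psi p <= h i x0 - e / 2.
  move=> [/=]; rewrite in_itv /= => /andP[_ pT] _; rewrite psiE.
  have := mulr_ge0 Kp (sqr_ge0 (enorm (p.2 - x0))).
  have : 0 <= C1 * (T - p.1) by rewrite mulr_ge0// subr_ge0.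
  lra.
have cu : class (fun l p => if (l == i) && `[< close rho P0 p >]
     then Num.max (- V p) (psi p) else - V p).
  apply: (class_glue (u := fun _ => \- V) negV_class _ sP0 rho0) => //.
  - by apply: cvg_usc_in; exact: psic.
  - by exists (h i x0 - e / 2) => p sp _; exact: psi_le.
  - move=> p sp cp ncp /=.
    have Vp : V p <= U by apply: h2; exact: closeW (ltW rho2) cp.
    have q1 := ler_norm (h i x0 - e / 2).
    suff : Y < C1 * (T - p.1) + K * enorm (p.2 - x0) ^+ 2 by rewrite psiE /Y; lra.
    have pT : p.1 <= T by case: sp => /=; rewrite in_itv /= => /andP[].
    have K2 : 0 <= K * enorm (p.2 - x0) ^+ 2 by rewrite mulr_ge0 ?sqr_ge0.
    have C2 : 0 <= C1 * (T - p.1) by rewrite mulr_ge0// subr_ge0.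
    have [t1|t1] := ltP `|p.1 - T| (rho / 2); last first.
      rewrite distrC ger0_norm ?subr_ge0// in t1.
      by have := ler_wpM2l C10 t1; lra.
    have [x1|x1] := ltP (enorm (p.2 - x0)) (rho / 2); first by exfalso; exact: ncp.
    have : (rho / 2) ^+ 2 <= enorm (p.2 - x0) ^+ 2.
      by rewrite ler_pXn2r ?nnegrE ?enorm_ge0// divr_ge0// ltW.
    by move=> /(ler_wpM2l Kp); lra.
  - move=> p [[A Q] N] sp pT cp hV jJ.
    have [r4 r40 h4] := close_open cp.
    have [|hA hQ hN] := @jet_compare R T k psi p C1 ((- 2 * K) *: (p.2 - x0)) (- 2 * K)%:M
      A Q N 0 r4 sp pT jJ r40.
      move=> p' sp' c' _; rewrite /jet_poly !psiE.
      set X := p.2 - x0; set dx := p'.2 - p.2.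
      have -> : p'.2 - x0 = X + dx by rewrite /X /dx [RHS]addrC addrA subrK.
      by rewrite enormD_sqr mul_scalar_mx dotZl dotZr dot_enorm; lra.
    rewrite -hQ; apply: le_trans (pde_part_mono b sigma (f i) p (psi p) _ hA hN) _.
    have Vp : V p <= U by apply: h2; exact: closeW (ltW rho2) cp.
    have hY : `|psi p| <= Y.
      have := psi_le p sp; have := ler_norm (h i x0 - e / 2) => q1 q2.
      have := normr_ge0 (h i x0 - e / 2) => q3.
      rewrite ler_norml /Y; apply/andP; split; last by lra.
      by move: hV => /=; lra.
    have dx1 : enorm (p.2 - x0) <= 1 by case: cp => _ x1; apply: le_trans (ltW x1) rho11.
    have := quad_pde_bound C_ge0 f_lip C1 (- 2 * K) sp (hS p sp cp) dx1 hY
       (le_trans (V_f f_growth V_ge i sp) Vp).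
    rewrite (_ : `|- 2 * K| = 2 * K); last by rewrite normrM normrN !ger0_norm.
    by rewrite -/D ler_norml => /andP[_ h5]; lra.
  - move=> x [_ x1] /=; apply: le_trans (psi_le _ (strip_T T_gt0 x)) _.
    have := h3 x (lt_trans x1 rho3); rewrite ltr_norml => /andP[h5 _]; lra.
have psiP0 : psi P0 = h i x0 - e / 2 by rewrite psiE /= !subrr enorm0 expr0n /= !mulr0 !subr0.
have e4 : 0 < e / 2 by [].
have [r4 r40 h4] := (uscP setT (\- psi)).1 (cvg_usc_in (fun p => cvgN (psic p))) P0 I _ e4.
exists (Num.min r4 rho); first by rewrite lt_min r40.
move=> p sp cl.
have cp : close rho P0 p by apply: closeW cl; rewrite ge_min lexx orbT.
have := h4 p I (closeW (_ : _ <= r4) cl); rewrite ge_min lexx /= psiP0 => /(_ isT) h5.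
have := v_max i cu sp; rewrite eqxx (asboolT cp) /= ge_max => /andP[_]; lra.
Qed.

(** Were the operator negative at a subjet of [vlow], the test paraboloid raised by [del] and bent
    down by [gam] would be a local subsolution, below v on an annulus. Glued to v it gives a member
    of the class, so v is at least psi near p0 and [vlow] at p0 exceeds itself by del / 2. *)
Lemma vlow_super : jet_super T b sigma f vlow.
Proof.
move=> i p0 [[a q] M] sp0 p0T /subjetP[/= sM hJ]; rewrite leNgt; apply/negP => hneg.
have del0 : 0 < - pde_part b sigma (f i) p0 (vlow i p0) (a, q, M) by rewrite oppr_gt0.
have [L L0 hL] := pde_part_cont b_cont s_cont C_ge0 (f_cont i) (f_lip i) (vlow i p0) (a, q, M)
  sp0 del0.
have I0 := enorm_ge0 (1%:M : 'M[R]_k); have M0 := enorm_ge0 M; have q0 := enorm_ge0 q.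
have a0 := normr_ge0 a.
have [gam [gam0 gL gI]] : exists gam : R,
    [/\ 0 < gam, gam <= L & 2 * gam * enorm (1%:M : 'M[R]_k) <= L].
  have I1 : 0 < 2 * (1 + enorm (1%:M : 'M[R]_k)) by lra.
  exists (L / (2 * (1 + enorm (1%:M : 'M[R]_k)))); split; first exact: divr_gt0.
    rewrite ler_pdivrMr//; have := mulr_ge0 (ltW L0) I0; lra.
  rewrite mulrAC mulrA ler_pdivrMr//; lra.
have g20 : 0 < gam / 2 by rewrite divr_gt0.
have [r rgt0 hr] := hJ (gam / 2) g20.
have [E [E0 EE]] : exists E, 0 < E /\ E = `|a| + enorm q + enorm M + 2 * gam + 1.
  by eexists; split; last reflexivity; lra.
have [rho [rho0 rho1 rhor rhoT rhoL]] : exists rho : R,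
    [/\ 0 < rho, rho <= 1, rho <= r, rho <= T - p0.1 & rho * E <= L / 2].
  exists (Num.min 1 (Num.min r (Num.min (T - p0.1) (L / 2 / E)))); split.
  - by rewrite !lt_min ltr01 rgt0 subr_gt0 p0T !divr_gt0.
  - by rewrite ge_min lexx.
  - by rewrite !ge_min lexx ?orbT.
  - by rewrite !ge_min lexx ?orbT.
  - by rewrite -ler_pdivlMr// !ge_min lexx ?orbT.
(* As rho <= 1, the gauge is at least (rho / 2)^2 on the annulus, so this [del] keeps psi below v
   there. *)
have [del [d0 dL dg]] : exists del : R,
    [/\ 0 < del, del <= L / 2 & del < gam / 2 * (rho / 2) ^+ 2].
  have m0 : 0 < Num.min L (gam / 2 * (rho / 2) ^+ 2).
    by rewrite lt_min L0 mulr_gt0// exprn_gt0// divr_gt0.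
  exists (Num.min L (gam / 2 * (rho / 2) ^+ 2) / 2).
  have m1 : Num.min L (gam / 2 * (rho / 2) ^+ 2) <= L by rewrite ge_min lexx.
  have m2 : Num.min L (gam / 2 * (rho / 2) ^+ 2) <= gam / 2 * (rho / 2) ^+ 2.
    by rewrite ge_min lexx orbT.
  by split; move: m0 m1 m2; focus; lra.
(* The time penalty is |t - t0|, to match the o(|t - t0|) of the jet; its concave kink is admissible
   in [jet_compare]. *)
pose psi (p : point) := jet_poly (vlow i p0 + del) p0 a q M p + - gam * enorm (p.2 - p0.2) ^+ 2
  + 0 * (p.1 - p0.1) ^+ 2 - gam * `|p.1 - p0.1|.
have psic : continuous psi.
  move=> p; apply: cvgB; first exact: test_continuous.
  apply: cvgMr; apply: (@cvg_norm _ R^o); apply: cvgB; [exact: cvg_fst | exact: cvg_cst].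
have psi_near p : close rho p0 p -> `|psi p - vlow i p0| <= L.
  move=> [/ltW t1 /ltW x1].
  have x2 : enorm (p.2 - p0.2) ^+ 2 <= rho.
    apply: (@le_trans _ _ (rho * 1)); last by rewrite mulr1.
    by rewrite expr2 ler_pM ?enorm_ge0//; exact: le_trans rho1.
  rewrite (_ : psi p - vlow i p0 = del + a * (p.1 - p0.1) + dot q (p.2 - p0.2)
    + 2^-1 * dot (p.2 - p0.2) (M *m (p.2 - p0.2)) - gam * enorm (p.2 - p0.2) ^+ 2
    - gam * `|p.1 - p0.1|); last by rewrite /psi /jet_poly; ring.
  apply: le_trans (ler_normB _ _) _; apply: le_trans (lerD (ler_normB _ _) (lexx _)) _.
  have h1 : `|del + a * (p.1 - p0.1) + dot q (p.2 - p0.2)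
      + 2^-1 * dot (p.2 - p0.2) (M *m (p.2 - p0.2))| <=
      del + `|a| * rho + enorm q * rho + enorm M * rho.
    apply: le_trans (ler_normD _ _) _; apply: lerD; last first.
      rewrite normrM gtr0_norm ?invr_gt0//.
      have h1 := dotC_le (p.2 - p0.2) (M *m (p.2 - p0.2)).
      have h2 := ler_wpM2l (enorm_ge0 (p.2 - p0.2)) (enormM M (p.2 - p0.2)).
      have h3 := ler_wpM2l M0 x2; have h4 := mulr_ge0 M0 (ltW rho0).
      rewrite expr2 in h3; move: h1 h2 h3 h4; focus; lra.
    apply: le_trans (ler_normD _ _) _; apply: lerD; last first.
      by apply: le_trans (dotC_le _ _) _; rewrite ler_wpM2l.
    apply: le_trans (ler_normD _ _) _; rewrite gtr0_norm// normrM lerD2l.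
    by rewrite ler_wpM2l.
  rewrite (ger0_norm (mulr_ge0 (ltW gam0) (sqr_ge0 (enorm (p.2 - p0.2))))).
  rewrite (ger0_norm (mulr_ge0 (ltW gam0) (normr_ge0 (p.1 - p0.1)))).
  have h2 := ler_wpM2l (ltW gam0) x2; have h3 := ler_wpM2l (ltW gam0) t1.
  move: rhoL h1 h2 h3 dL (ltW rho0); rewrite EE; focus; lra.
have cu : class (fun l p => if (l == i) && `[< close rho p0 p >]
     then Num.max (v i p) (psi p) else v l p).
  apply: (class_glue v_class _ sp0 rho0).
  - by apply: cvg_usc_in; exact: psic.
  - exists (vlow i p0 + L) => p sp cp; have := psi_near p cp; rewrite ler_norml => /andP[_]; lra.
  - move=> p sp cp ncp; apply: lt_le_trans (vlow_le i sp).
    apply: lt_le_trans (hr p sp (closeW rhor cp)).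
    suff : del < gam / 2 * jet_gauge p0 p.
      rewrite /psi /jet_gauge /jet_poly; move: (`|p.1 - p0.1|) => t; focus; lra.
    apply: lt_le_trans dg _; apply: ler_wpM2l; first exact: ltW.
    have r2 : 0 < rho / 2 by rewrite divr_gt0.
    rewrite /jet_gauge; have [t1|t1] := ltP `|p.1 - p0.1| (rho / 2); last first.
      apply: le_trans (_ : rho / 2 <= _).
        by rewrite expr2 ger_pMl//; lra.
      by apply: le_trans t1 _; rewrite lerDl sqr_ge0.
    have [x1|x1] := ltP (enorm (p.2 - p0.2)) (rho / 2); first by exfalso; exact: ncp.
    apply: (@le_trans _ _ (enorm (p.2 - p0.2) ^+ 2)); last by rewrite lerDr.
    by rewrite ler_pXn2r ?nnegrE ?enorm_ge0// ltW.
  - move=> p [[A Q] N] sp pT cp hv jJ.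
    have [r4 r40 h4] := close_open cp.
    have [|hA hQ hN] := @jet_compare R T k psi p (a - gam)
      (q + M *m (p.2 - p0.2) - (2 * gam) *: (p.2 - p0.2)) (M - (2 * gam)%:M)
      A Q N 0 r4 sp pT jJ r40.
      move=> p' sp' c' pp'; rewrite /jet_poly /psi /jet_poly.
      set X := p.2 - p0.2; set dx := p'.2 - p.2.
      have -> : p'.2 - p0.2 = X + dx by rewrite /X /dx [RHS]addrC addrA subrK.
      have tt : `|p'.1 - p0.1| <= (p'.1 - p.1) + `|p.1 - p0.1|.
        have := ler_normD (p'.1 - p.1) (p.1 - p0.1); rewrite addrA subrK.
        by rewrite (ger0_norm (_ : 0 <= p'.1 - p.1)) ?subr_ge0.
      have := ler_wpM2l (ltW gam0) tt; move: X dx => X dx.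
      rewrite enormD_sqr mulmxBl mulmxDr mul_scalar_mx.
      have sym : dot X (M *m dx) = dot dx (M *m X) by rewrite dot_mulr sM dotC.
      rewrite !dotlin sym [dot (M *m X) dx]dotC dot_enorm.
      by focus; lra.
    rewrite -hQ; apply: le_trans (pde_part_mono b sigma (f i) p (psi p) _ hA hN) _.
    have [/ltW t1 /ltW x1] := cp.
    have rE : rho * E <= L by move: rhoL L0; focus; lra.
    have h5 : `|pde_part b sigma (f i) p (psi p)
        (a - gam, q + M *m (p.2 - p0.2) - (2 * gam) *: (p.2 - p0.2), M - (2 * gam)%:M)
        - pde_part b sigma (f i) p0 (vlow i p0) (a, q, M)| <
        - pde_part b sigma (f i) p0 (vlow i p0) (a, q, M).
      apply: hL => //=.
      - apply: closeW cp; apply: le_trans rE; rewrite ler_peMr//; first exact: ltW.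
        by rewrite EE; move: a0 q0 M0 gam0; focus; lra.
      - exact: psi_near.
      - by rewrite addrC addKr normrN gtr0_norm.
      - rewrite (_ : _ - q = M *m (p.2 - p0.2) + - ((2 * gam) *: (p.2 - p0.2))); last first.
          by rewrite -(addrA q) [q + _]addrC addrK.
        apply: le_trans (enormD _ _) _; rewrite enormN enormZ ger0_norm; last first.
          by rewrite mulr_ge0// ltW.
        have h6 : enorm (M *m (p.2 - p0.2)) <= enorm M * rho.
          by apply: le_trans (enormM _ _) _; rewrite ler_wpM2l.
        have h7 : 2 * gam * enorm (p.2 - p0.2) <= 2 * gam * rho.
          by rewrite ler_wpM2l// mulr_ge0// ltW.
        apply: le_trans (lerD h6 h7) _; apply: le_trans rE; rewrite -mulrDl mulrC.
        by apply: ler_wpM2l; [exact: ltW | rewrite EE; move: a0 q0 M0 gam0; focus; lra].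
      - rewrite addrC addKr enormN -scalemx1 enormZ ger0_norm//.
        by rewrite mulr_ge0// ltW.
    by move: h5; rewrite ltr_norml => /andP[_]; focus; lra.
  - by move=> x [/=]; have := ler_norm (T - p0.1) => h1 h2; lra.
have psip0 : psi p0 = vlow i p0 + del.
  by rewrite /psi /jet_poly !subrr normr0 enorm0 expr0n /= dot0r mulmx0 dot0r; ring.
have d2 : 0 < del / 2 by rewrite divr_gt0.
have [r4 r40 h4] := (uscP setT (\- psi)).1 (cvg_usc_in (fun p => cvgN (psic p))) p0 I _ d2.
suff : vlow i p0 + del / 2 <= vlow i p0 by move: d0; focus; lra.
apply: vlow_ge => //; exists (Num.min r4 rho); first by rewrite lt_min r40.
move=> p sp cl.
have cp : close rho p0 p by apply: closeW cl; rewrite ge_min lexx orbT.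
have := h4 p I (closeW (_ : _ <= r4) cl); rewrite ge_min lexx /= psip0 => /(_ isT) h5.
have := v_max i cu sp; rewrite eqxx (asboolT cp) /= ge_max => /andP[_].
by move: h5; focus; lra.
Qed.

Lemma vlow_eq i p : strip T k p -> vlow i p = v i p.
Proof.
move=> sp; apply/eqP; rewrite eq_le vlow_le//=.
have [K hK] := V_growth; have [vu _ vs vT] := v_class.
have VK p' : strip T k p' -> V p' <= `|K| * base p'.2 ^+ n.
  move=> sp'; apply: le_trans (hK p' sp') _; rewrite ler_wpM2r ?ler_norm// exprn_ge0//.
  by rewrite (le_trans ler01)// base_ge1.
apply: (comparison d_gt0 b_cont s_cont C_ge0 bs_growth bs_lip f_cont f_lip g_cont no_loop
  (u := v) (w := vlow) (n := n) (K := `|K|)) => //.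
- exact: vlow_usc.
- by move=> j p' sp'; apply: le_trans (v_le_V j sp') (VK p' sp').
- by move=> j p' sp'; apply: le_trans (vlow_geV j sp'); rewrite lerN2 VK.
- move=> j [t x] sp' /= ->; exact: le_trans (vT j x) (vlow_terminal j x).
- exact: vlow_super.
- by move=> j j' p' sp' _; exact: vlow_above.
Qed.

End System.

(** * Envelopes, limiting jets and growth *)

Section Growth.
Variables (R : realType) (k : nat).

Lemma base_gt0 (x : 'cV[R]_k) : 0 < base x.
Proof. by apply: lt_le_trans (base_ge1 _). Qed.

Lemma base_expn_ge1 n (x : 'cV[R]_k) : 1 <= base x ^+ n.
Proof. by rewrite exprn_ege1// base_ge1. Qed.

(** Growth is measured internally by integer powers of [base]; this lemma and [base_growth]
    translate from and to real exponents of the norm. *)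
Lemma growth_base (gamma : R) : 0 <= gamma -> exists n, forall x : 'cV[R]_k,
  1 + enorm x `^ gamma <= 2 * base x ^+ n.
Proof.
move=> g0; have [n hn] : exists n : nat, gamma <= n%:R.
  exists (Num.truncn `|gamma|).+1; apply: le_trans (ler_norm _) _.
  by apply/ltW/truncnS_gt.
exists n => x; have b1 := base_ge1 x.
have xb : enorm x <= base x.
  by rewrite /base dot_enorm; have := sqr_ge0 (1 - enorm x); rewrite sqrrB expr1n; have := enorm_ge0 x; lra.
have bn := base_expn_ge1 n x.
suff : enorm x `^ gamma <= base x ^+ n by lra.
have b0 := ltW (base_gt0 x).
apply: (@le_trans _ _ (base x `^ gamma)).
  by apply: ge0_ler_powR; rewrite ?nnegrE ?enorm_ge0.
by rewrite -powR_mulrn//; exact: ler_powR.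
Qed.

Lemma base_growth n : exists2 D : R, 0 <= D & forall x : 'cV[R]_k,
  base x ^+ n <= D * (1 + enorm x `^ (2 * n)%:R).
Proof.
exists (2 ^+ n) => [|x]; first by rewrite exprn_ge0.
rewrite powR_mulrn ?enorm_ge0// exprM /base dot_enorm.
have := sqr_ge0 (enorm x); move: (enorm x ^+ 2) => y y0.
have [y1|/ltW y1] := leP y 1.
  apply: (@le_trans _ _ (2 ^+ n * 1)).
    by rewrite mulr1; apply: lerXn2r; rewrite ?nnegrE ?addr_ge0//; lra.
  by rewrite ler_wpM2l ?exprn_ge0// lerDl exprn_ge0.
apply: (@le_trans _ _ (2 ^+ n * y ^+ n)).
  by rewrite -exprMn; apply: lerXn2r; rewrite ?nnegrE ?addr_ge0 ?mulr_ge0//; lra.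
by rewrite ler_wpM2l ?exprn_ge0// lerDr.
Qed.

Lemma common_growth (I : finType) (X : Type) (D : X -> Prop) (r : X -> R) (phi : I -> X -> R) :
  (forall x, 1 <= r x) ->
  (forall i, exists n K, forall x, D x -> `|phi i x| <= K * r x ^+ n) ->
  exists n K, 0 <= K /\ forall i x, D x -> `|phi i x| <= K * r x ^+ n.
Proof.
move=> r1 /choice[N /choice[K hK]].
exists (\sum_i N i)%N, (\sum_i `|K i|); split; first by rewrite sumr_ge0.
move=> i x Dx; apply: le_trans (hK i x Dx) _.
have r0 : 0 <= r x by apply: le_trans (r1 x).
apply: (@le_trans _ _ (`|K i| * r x ^+ N i)); first by rewrite ler_wpM2r ?exprn_ge0 ?ler_norm.
apply: ler_pM; rewrite ?exprn_ge0//.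
  by rewrite (bigD1 i)//= lerDl sumr_ge0.
by rewrite (bigD1 i)//= ler_weXn2l// leq_addr.
Qed.

End Growth.

(** * Envelopes of continuous functions and density of subjets *)

Section Interface.
Variables (R : realType) (T : R) (k : nat).
Local Notation point := (R * 'cV[R]_k)%type.
Implicit Types (u v : point -> R) (p : point).

Lemma rcont_in_within (D : set point) u : rcont_in D u -> {within D, continuous u}.
Proof.
move=> h; apply/subspace_continuousP => p Dp; apply/cvgrPdist_lt => e e0.
by apply/near_close; have [r r0 hr] := h p Dp e e0; exists r => // p' Dp' c; rewrite distrC hr.
Qed.

Lemma usc_rcont_in (D : set point) u : usc_in D u -> usc_in D (\- u) -> rcont_in D u.
Proof.
move=> /uscP h1 /uscP h2 p Dp e e0; have [r1 r10 g1] := h1 p Dp e e0.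
have [r2 r20 g2] := h2 p Dp e e0; exists (Num.min r1 r2); first by rewrite lt_min r10.
move=> p' Dp' c; have := g1 p' Dp' (closeW (_ : _ <= r1) c); rewrite ge_min lexx => /(_ isT) i1.
have := g2 p' Dp' (closeW (_ : _ <= r2) c); rewrite ge_min lexx orbT /= => /(_ isT) i2.
by rewrite ltr_norml; apply/andP; split; lra.
Qed.

Lemma rcont_in_eq (D : set point) u v : (forall p, D p -> u p = v p) -> rcont_in D u -> rcont_in D v.
Proof.
move=> E h p Dp e e0; have [r r0 hr] := h p Dp e e0; exists r => // p' Dp' c.
by rewrite -!E//; exact: hr.
Qed.

Lemma rcont_in_lsc (D : set point) u : rcont_in D u -> lsc_on D u.
Proof.
move=> /rcont_in_within cu p a; rewrite lte_fin => ap.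
exists [set p' : point | a < u p']; last by move=> y; rewrite lte_fin.
exact: (cu p [set y | a < y] (open_nbhs_nbhs (conj (@open_gt R a) ap))).
Qed.

Lemma superjet_eq u v p J : strip T k p -> (forall p, strip T k p -> u p = v p) ->
  superjet T u p J -> superjet T v p J.
Proof.
move=> sp E; apply: (superjet_le ltr01) => [p' sp' _|]; last by rewrite E.
by rewrite E.
Qed.

Lemma subjet_eq u v p J : strip T k p -> (forall p, strip T k p -> u p = v p) ->
  subjet T u p J -> subjet T v p J.
Proof.
move=> sp E /subjet_opp jJ; apply/subjet_opp; apply: superjet_eq jJ => // p' sp' /=.
by rewrite E.
Qed.

(** At time T the limits that define the envelopes run over earlier times only; the points found
    here keep them from being taken over an empty set. *)
Lemma strip_open_close p e : 0 < T -> strip T k p -> 0 < e ->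
  exists2 p', strip_open T k p' & close e p p'.
Proof.
move=> T0 sp e0; have [pT|pT] := ltP p.1 T.
  exists p; last exact: close_refl.
  by case: sp => /=; rewrite !in_itv /= => /andP[p0 _] _; split=> //=; rewrite in_itv /= p0.
have E : p.1 = T by apply/eqP; rewrite eq_le pT andbT; case: sp => /=; rewrite in_itv /= => /andP[].
exists (T - Num.min T (e / 2), p.2).
  split=> //=; rewrite in_itv /= subr_ge0 ge_min lexx /= ltrBlDr ltrDl lt_min T0 divr_gt0//.
split=> /=; last by rewrite subrr enorm0.
rewrite E addrC addKr normrN ger0_norm ?le_min ?(ltW T0) ?divr_ge0 ?(ltW e0)//.
by rewrite gt_min; apply/orP; right; lra.
Qed.

Lemma upper_env_eq u p : 0 < T -> rcont_in (strip T k) u -> strip T k p -> upper_env T u p = u p.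
Proof.
move=> T0 cu sp; rewrite /upper_env.
suff -> : limf_esup (fun p' => (u p')%:E) (within (strip_open T k) (nbhs p)) = (u p)%:E by [].
have sub p' : strip_open T k p' -> strip T k p'.
  move=> [/=]; rewrite in_itv /= => /andP[h1 h2] _; split=> //=.
  by rewrite in_itv /= h1 ltW.
apply/eqP; rewrite eq_le; apply/andP; split.
  apply/lee_addgt0Pr => e e0; have [r r0 hr] := cu p sp e e0.
  apply: (@le_trans _ _ (ereal_sup ((fun p' => (u p')%:E) @`
      [set p' | strip_open T k p' /\ close r p p']))).
    apply: ereal_inf_lbound; exists [set p' | strip_open T k p' /\ close r p p'] => //.
    by apply/near_close; exists r.
  apply: ge_ereal_sup => _ [p' [sp' c] <-]; rewrite -EFinD lee_fin.
  by have := hr p' (sub p' sp') c; rewrite ltr_norml => /andP[_]; lra.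
apply: le_ereal_inf_tmp => _ [W hW <-].
apply/lee_subgt0Pr => e e0; have [r r0 hr] := cu p sp e e0.
have [r' r'0 hr'] := (near_close _ _ W).1 hW.
have m0 : 0 < Num.min r r' by rewrite lt_min r0.
have [p' sp' c] := strip_open_close T0 sp m0.
apply: (@le_trans _ _ (u p')%:E).
  rewrite -EFinB lee_fin.
  have := hr p' (sub p' sp') (closeW (_ : _ <= r) c); rewrite ge_min lexx => /(_ isT).
  by rewrite ltr_norml => /andP[]; lra.
apply: ereal_sup_ubound; exists p' => //; apply: hr' => //.
by apply: closeW c; rewrite ge_min lexx orbT.
Qed.

Lemma lower_env_eq u p : 0 < T -> rcont_in (strip T k) u -> strip T k p -> lower_env T u p = u p.
Proof.
move=> T0 cu sp; have := upper_env_eq T0 (rcont_inN cu) sp.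
rewrite /upper_env /lower_env /limf_einf fineN => E.
by rewrite [X in - X](_ : _ = - u p) ?opprK// -E.
Qed.

Lemma rcont_in_locally_bounded u : rcont_in (strip T k) u ->
  [locally [bounded u p | p in strip T k]].
Proof.
move=> cu p sp; exists (`|u p| + 1); split; first exact: num_real.
move=> M hM; apply/near_close; have [r r0 hr] := cu p sp 1 ltr01; exists r => // p' sp' c /=.
have := hr p' sp' c; have := ler_normD (u p' - u p) (u p); rewrite subrK; lra.
Qed.

(** The definition of a supersolution yields the obstacle inequality only at points with a limiting
    subjet. Subjets exist at a dense set of points, where a steep paraboloid touches u from below,
    and continuity extends the inequality to all others. *)
Lemma subjet_dense u p0 r : rcont_in (strip T k) u -> strip T k p0 -> 0 < r ->
  exists p J, [/\ strip T k p, close r p0 p & subjet T u p J].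
Proof.
move=> cu sp0 r0; pose rho := r / 2; have rho0 : 0 < rho by rewrite divr_gt0.
have b0 : box T rho p0 p0 by split; rewrite // subrr ?normr0 ?enorm0 ltW.
have uN := rcont_in_usc (rcont_inN cu).
have sub : box T rho p0 `<=` strip T k by move=> p [].
have [p1 bp1 hp1] := usc_max (@compact_box R T k rho p0) (ex_intro _ _ b0) (usc_in_sub sub uN).
(* Steep enough to keep the touching point off the boundary of the box. *)
have [N N0 hN] : exists2 N, 0 <= N & u p0 - u p1 < N * rho ^+ 2.
  have q0 : 0 < rho ^+ 2 by rewrite exprn_gt0.
  have := hp1 p0 b0; rewrite /= lerN2 => h.
  exists ((u p0 - u p1 + 1) / rho ^+ 2); last by rewrite divfK ?gt_eqF// ltrDl.
  by apply: divr_ge0; [lra | exact: ltW].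
pose test (p : point) := jet_poly 0 p0 0 0 0 p + N * enorm (p.2 - p0.2) ^+ 2 + N * (p.1 - p0.1) ^+ 2.
have testE p : test p = N * enorm (p.2 - p0.2) ^+ 2 + N * (p.1 - p0.1) ^+ 2.
  by rewrite /test /jet_poly mul0mx dot0l dot0r; ring.
have uF : usc_in (box T rho p0) (\- u \+ \- test).
  apply: usc_inD; first exact: usc_in_sub uN.
  apply: cvg_usc_in => p; apply: cvgN; apply: test_continuous; exact: trmx0.
have [pm [sm tm xm] hm] := usc_max (@compact_box R T k rho p0) (ex_intro _ _ b0) uF.
have h0 := hm p0 b0; have h1 := hp1 pm (And3 sm tm xm); rewrite /= !testE !subrr enorm0 expr0n /= in h0 h1.
have e1 := mulr_ge0 N0 (sqr_ge0 (enorm (pm.2 - p0.2))); have e2 := mulr_ge0 N0 (sqr_ge0 (pm.1 - p0.1)).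
have tm' : `|pm.1 - p0.1| < rho.
  rewrite lt_neqAle tm andbT; apply/eqP => E.
  have E2 : (pm.1 - p0.1) ^+ 2 = rho ^+ 2 by rewrite -real_normK ?num_real// E.
  by rewrite E2 in h0; lra.
have xm' : enorm (pm.2 - p0.2) < rho.
  by rewrite lt_neqAle xm andbT; apply/eqP => E; rewrite E in h0; lra.
have [r4 r40 h4] := close_open (conj tm' xm' : close rho p0 pm).
exists pm, (- (2 * N * (pm.1 - p0.1)), - ((2 * N) *: (pm.2 - p0.2)), - (2 * N)%:M).
split=> //; first by apply: closeW (conj tm' xm'); rewrite /rho; lra.
apply/subjet_opp; rewrite /= !opprK.
apply: (@superjet_quad R T k _ pm _ _ _ N); first by rewrite tr_scalar_mx.
move=> e e0; exists r4 => // p sp cl.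
have bp : box T rho p0 p by have [t1 x1] := h4 p cl; split=> //; exact: ltW.
have := hm p bp; rewrite /= !testE /jet_poly.
set X := pm.2 - p0.2; set dx := p.2 - pm.2.
have -> : p.2 - p0.2 = X + dx by rewrite /X /dx [RHS]addrC addrA subrK.
rewrite enormD_sqr mul_scalar_mx !dotZl dotZr dot_enorm.
have := mulr_ge0 (ltW e0) (sqr_ge0 (enorm dx)); lra.
Qed.

End Interface.

Section Obstacle.
Variables (R : realType) (m : nat).
Implicit Types (y : 'I_m -> R) (c : 'I_m -> 'I_m -> R).

Lemma obstacle_leP y c i (z : R) :
  (obstacle y c i <= z%:E)%E <-> forall j, j != i -> y j - c i j <= z.
Proof.
split=> [/bigmax_leP[_ h] j ji|h]; first by have := h j ji; rewrite lee_fin.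
by apply/bigmax_leP; split; [exact: leNye | move=> j ji; rewrite lee_fin h].
Qed.

Lemma obstacle_geP y c i (z : R) :
  (z%:E <= obstacle y c i)%E <-> exists2 j, j != i & z <= y j - c i j.
Proof.
split=> [h|[j ji h]]; last first.
  by apply: le_trans (le_bigmax_cond _ (fun j => (y j - c i j)%:E) ji); rewrite lee_fin.
apply: contrapT => hn; move: h; rewrite leNgt => /negP; apply.
apply/bigmax_ltP; split; first exact: ltNyr.
move=> j ji; rewrite lte_fin ltNge; apply/negP => h; apply: hn; by exists j.
Qed.

End Obstacle.

Section Limits.
Variables (R : realType) (T : R) (k : nat).
Local Notation point := (R * 'cV[R]_k)%type.

Lemma jet_limiting jet (u : point -> R) p (J : point * 'M[R]_k) : strip T k p -> jet p J ->
  limiting_jet T jet u p J.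
Proof.
by move=> sp jJ; exists (fun _ => p), (fun _ => J); split=> //; exact: cvg_cst.
Qed.

Lemma limiting_jet_close jet (u : point -> R) p (J : point * 'M[R]_k) L :
  limiting_jet T jet u p J -> 0 < L ->
  exists p' J', [/\ strip T k p', jet p' J', close L p p', `|u p' - u p| <= L &
    [/\ `|J'.1.1 - J.1.1| <= L, enorm (J'.1.2 - J.1.2) <= L & enorm (J'.2 - J.2) <= L]].
Proof.
case: J => [J1 J2] [P [Js [sP jJ cP cu cJ]]] L0.
have h1 : \forall n \near \oo, close L p (P n).
  by apply: cP; apply/nbhs_close; exists L.
have h2 : \forall n \near \oo, `|u (P n) - u p| < L.
  by have /cvgrPdist_lt /(_ L L0) := cu; apply: filterS => n; rewrite distrC.
have h3 : \forall n \near \oo, close L J1 (Js n).1.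
  have c1 : (fun n => (Js n).1) @ \oo --> J1.
    by apply: (cvg_comp _ _ cJ); exact: cvg_fst.
  by apply: c1; apply/nbhs_close; exists L.
have h4 : \forall n \near \oo, enorm ((Js n).2 - J2) < L.
  have c1 : (fun n => (Js n).2) @ \oo --> J2.
    by apply: (cvg_comp _ _ cJ); exact: cvg_snd.
  by apply: (c1 (fun M => enorm (M - J2) < L)); apply/nbhs_enorm; exists L.
have [n [[[g1 g2] [g3 g3']] g4]] := filter_ex (filterI (filterI (filterI h1 h2) h3) h4).
by exists (P n), (Js n); split=> //; [exact: ltW | split; exact: ltW].
Qed.

End Limits.

(** * Equivalence of the working forms with viscosity solutions *)

Section System.
Variables (R : realType) (T : R) (k d m : nat).
Local Notation point := (R * 'cV[R]_k)%type.
Variables (b : point -> 'cV[R]_k) (sigma : point -> 'M[R]_(k, d))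
  (f : 'I_m -> point -> R -> 'cV[R]_d -> R) (g : 'I_m -> 'I_m -> point -> R) (C : R).
Hypothesis d_gt0 : (0 < d)%N.
Hypothesis b_cont : cont_in (strip T k) b.
Hypothesis s_cont : cont_in (strip T k) sigma.
Hypothesis C_ge0 : 0 <= C.
Hypothesis bs_growth : forall p, strip T k p ->
  enorm (b p) + enorm (sigma p) <= C * (1 + enorm p.2).
Hypothesis bs_lip : forall t x y, 0 <= t <= T ->
  enorm (b (t, x) - b (t, y)) + enorm (sigma (t, x) - sigma (t, y)) <= C * enorm (x - y).
Hypothesis f_cont : forall i p, strip T k p -> forall e, 0 < e -> exists2 r : R, 0 < r &
  forall p', strip T k p' -> close r p p' -> forall y z, `|f i p' y z - f i p y z| < e.
Hypothesis f_lip : forall i p y y' z z', strip T k p ->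
  `|f i p y z - f i p y' z'| <= C * (`|y - y'| + enorm (z - z')).
Hypothesis g_cont : forall i j, i != j -> rcont_in (strip T k) (g i j).
Hypothesis no_loop : forall p, strip T k p ->
  forall (N : nat) (i : nat -> 'I_m), (3 <= N)%N -> i 1%N = i N ->
    #|[seq i n | n <- index_iota 1 N.+1]| = N.-1 ->
    0 < \sum_(1 <= n < N) g (i n) (i n.+1) p.

Hypothesis T_gt0 : 0 < T.
Variable h : 'I_m -> 'cV[R]_k -> R.

Lemma system_op_ge0 (v : 'I_m -> point -> R) i p J :
  (0 <= system_op b sigma f g v i p J)%E <->
  (forall j, j != i -> v j p - g i j p <= v i p) /\ 0 <= pde_part b sigma (f i) p (v i p) J.
Proof.
rewrite /system_op le_min subre_ge0// lee_fin; split.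
  by move=> /andP[/obstacle_leP h1 h2].
by move=> [h1 h2]; rewrite h2 andbT; apply/obstacle_leP.
Qed.

Lemma system_op_le0 (v : 'I_m -> point -> R) i p J :
  (system_op b sigma f g v i p J <= 0)%E <->
  (exists2 j, j != i & v i p <= v j p - g i j p) \/ pde_part b sigma (f i) p (v i p) J <= 0.
Proof.
rewrite /system_op ge_min sube_le0 lee_fin; split.
  by move=> /orP[/obstacle_geP h1|h1]; [left | right].
by move=> [h1|->]; rewrite ?orbT//; apply/orP; left; apply/obstacle_geP.
Qed.

(** A strict failure at a limiting jet persists, by continuity of the operator, of v and of g, at
    the ordinary jet supplied by [limiting_jet_close]. *)
Lemma solution_of_jets (v : 'I_m -> point -> R) : (forall i, rcont_in (strip T k) (v i)) ->
  jet_sub T b sigma f g v -> jet_super T b sigma f v -> above_obstacle T g v ->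
  (forall i x, v i (T, x) = h i x) -> viscosity_solution T b sigma f g h v.
Proof.
move=> cv sv Sv ov vT.
have lE i p : strip T k p -> lower_env T (v i) p = v i p by exact: lower_env_eq.
have uE i p : strip T k p -> upper_env T (v i) p = v i p by exact: upper_env_eq.
have sT x : strip T k (T, x) by exact: strip_T.
have open p : strip_open T k p -> strip T k p /\ p.1 < T.
  move=> [/=]; rewrite in_itv /= => /andP[h1 h2] _; split=> //; split=> //=.
  by rewrite in_itv /= h1 ltW.
have near (p' p : point) (L : R) : p.1 < T -> L <= T - p.1 -> close L p p' -> p'.1 < T.
  by move=> pT LT [c _]; have := ler_norm (p'.1 - p.1); lra.
split; first by move=> i; exact: rcont_in_locally_bounded.
- split; last by move=> i x; rewrite lE// vT.
    by move=> i; apply: rcont_in_lsc; apply: rcont_in_eq (cv i) => p sp; rewrite lE.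
  move=> i p J /open[sp pT] jJ; apply/system_op_ge0; split.
    by move=> j ji; rewrite !lE//; exact: ov.
  rewrite lE// leNgt; apply/negP => hneg.
  have d0 : 0 < - pde_part b sigma (f i) p (v i p) J by rewrite oppr_gt0.
  have [L L0 hL] := pde_part_cont b_cont s_cont C_ge0 (f_cont i) (f_lip i) (v i p) J sp d0.
  have m0 : 0 < Num.min L (T - p.1) by rewrite lt_min L0 subr_gt0.
  have [p' [J' [sp' jJ' cp' up' [a1 q1 M1]]]] := limiting_jet_close jJ m0.
  rewrite !lE// in up'.
  have mL : Num.min L (T - p.1) <= L by rewrite ge_min lexx.
  have mT : Num.min L (T - p.1) <= T - p.1 by rewrite ge_min lexx orbT.
  have := Sv i p' J' sp' (near p' p _ pT mT cp') (subjet_eq sp' (lE i) jJ').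
  have := hL p' (v i p') J' sp' (closeW mL cp') (le_trans up' mL) (le_trans a1 mL)
    (le_trans q1 mL) (le_trans M1 mL).
  by rewrite ltr_norml => /andP[]; lra.
- split; last by move=> i x; rewrite uE// vT.
    move=> i; apply: rcont_in_lsc; apply: rcont_in_eq (rcont_inN (cv i)) => p sp /=.
    by rewrite uE.
  move=> i p J /open[sp pT] jJ; apply/system_op_le0.
  apply: contrapT => hn.
  have hobs j : j != i -> v j p - g i j p < v i p.
    move=> ji; rewrite ltNge; apply/negP => hj; apply: hn; left; exists j => //.
    by rewrite !uE.
  have d0 : 0 < pde_part b sigma (f i) p (v i p) J.
    by rewrite ltNge; apply/negP => hj; apply: hn; right; rewrite uE.
  have [r r0 hr] := obstacle_free g_cont (fun j => rcont_in_usc (cv j)) sp hobs.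
  have [L L0 hL] := pde_part_cont b_cont s_cont C_ge0 (f_cont i) (f_lip i) (v i p) J sp d0.
  have m0 : 0 < Num.min L (Num.min r (T - p.1)) by rewrite !lt_min L0 r0 subr_gt0.
  have [p' [J' [sp' jJ' cp' up' [a1 q1 M1]]]] := limiting_jet_close jJ m0.
  rewrite !uE// in up'.
  have mL : Num.min L (Num.min r (T - p.1)) <= L by rewrite ge_min lexx.
  have mr : Num.min L (Num.min r (T - p.1)) <= r by rewrite !ge_min lexx orbT.
  have mT : Num.min L (Num.min r (T - p.1)) <= T - p.1 by rewrite !ge_min lexx !orbT.
  have := hL p' (v i p') J' sp' (closeW mL cp') (le_trans up' mL) (le_trans a1 mL)
    (le_trans q1 mL) (le_trans M1 mL).
  case: (sv i p' J' sp' (near p' p _ pT mT cp') (superjet_eq sp' (uE i) jJ')) => [[j ji]|].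
    by rewrite leNgt (hr p' (v i p') sp' (closeW mr cp') (le_trans up' mr) j ji).
  by rewrite ltr_norml => ? /andP[]; lra.
Qed.

Lemma jets_of_solution (v : 'I_m -> point -> R) : (forall i, rcont_in (strip T k) (v i)) ->
  viscosity_solution T b sigma f g h v ->
  [/\ jet_sub T b sigma f g v, jet_super T b sigma f v, above_obstacle T g v
    & forall i x, v i (T, x) = h i x].
Proof.
move=> cv [_ [_ Sv ST] [_ sv sT]].
have lE i p : strip T k p -> lower_env T (v i) p = v i p by exact: lower_env_eq.
have uE i p : strip T k p -> upper_env T (v i) p = v i p by exact: upper_env_eq.
have tT x : strip T k (T, x) by exact: strip_T.
have open p : strip T k p -> p.1 < T -> strip_open T k p.
  by move=> [/=]; rewrite in_itv /= => /andP[h1 h2] _ pT; split=> //=; rewrite in_itv /= h1.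
have super i p J : strip T k p -> p.1 < T -> subjet T (v i) p J ->
    (forall j, j != i -> v j p - g i j p <= v i p) /\ 0 <= pde_part b sigma (f i) p (v i p) J.
  move=> sp pT jJ.
  have jJ' : subjet T (lower_env T (v i)) p J.
    by apply: subjet_eq jJ => // p' sp'; rewrite lE.
  have := Sv i p J (open p sp pT) (jet_limiting _ sp jJ').
  move=> /system_op_ge0[h1 h2]; rewrite lE// in h2; split=> // j ji.
  by have := h1 j ji; rewrite !lE.
split.
- move=> i p J sp pT jJ.
  have jJ' : superjet T (upper_env T (v i)) p J.
    by apply: superjet_eq jJ => // p' sp'; rewrite uE.
  have := sv i p J (open p sp pT) (jet_limiting _ sp jJ').
  move=> /system_op_le0; rewrite uE// => -[[j ji hj]|]; [left | by right].
  by exists j => //; rewrite uE in hj.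
- by move=> i p J sp pT jJ; case: (super i p J sp pT jJ).
- move=> i j p0 sp0 p0T ji; rewrite leNgt; apply/negP => hlt.
  have ij : i != j by rewrite eq_sym.
  have [e e0 eE] : exists2 e, 0 < e & e * 4 = v j p0 - g i j p0 - v i p0.
    by exists ((v j p0 - g i j p0 - v i p0) / 4); rewrite ?divfK// divr_gt0// subr_gt0.
  have [r1 r10 h1] := cv i p0 sp0 e e0; have [r2 r20 h2] := cv j p0 sp0 e e0.
  have [r3 r30 h3] := g_cont ij sp0 e0.
  have m0 : 0 < Num.min (T - p0.1) (Num.min r1 (Num.min r2 r3)).
    by rewrite !lt_min r10 r20 r30 subr_gt0 p0T.
  have [p [J [sp cp jJ]]] := subjet_dense (cv i) sp0 m0.
  have pT : p.1 < T.
    have [c _] : close (T - p0.1) p0 p by apply: closeW cp; rewrite ge_min lexx.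
    by have := ler_norm (p.1 - p0.1); lra.
  have [ho _] := super i p J sp pT jJ; have {}ho := ho j ji.
  have := h1 p sp (closeW (_ : _ <= r1) cp); rewrite !ge_min lexx orbT => /(_ isT).
  have := h2 p sp (closeW (_ : _ <= r2) cp); rewrite !ge_min lexx !orbT => /(_ isT).
  have := h3 p sp (closeW (_ : _ <= r3) cp); rewrite !ge_min lexx !orbT => /(_ isT).
  by rewrite !ltr_norml => /andP[? ?] /andP[? ?] /andP[? ?]; lra.
- move=> i x; apply/eqP; rewrite eq_le; apply/andP; split.
    by have := sT i x; rewrite uE.
  by have := ST i x; rewrite lE.
Qed.

Definition plain_solution (v : 'I_m -> point -> R) :=
  [/\ forall i, rcont_in (strip T k) (v i), jet_sub T b sigma f g v, jet_super T b sigma f v,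
    above_obstacle T g v & forall i x, v i (T, x) = h i x].

Lemma plain_solution_unique (v w : 'I_m -> point -> R) n1 K1 n2 K2 :
  plain_solution v -> plain_solution w ->
  (forall i p, strip T k p -> `|v i p| <= K1 * base p.2 ^+ n1) ->
  (forall i p, strip T k p -> `|w i p| <= K2 * base p.2 ^+ n2) ->
  forall i p, strip T k p -> w i p = v i p.
Proof.
move=> pv pw hv hw i p sp.
have bnd (u : 'I_m -> point -> R) K n : (n = n1 /\ K = K1) \/ (n = n2 /\ K = K2) ->
    (forall j p, strip T k p -> `|u j p| <= K * base p.2 ^+ n) ->
    forall j p, strip T k p -> `|u j p| <= (`|K1| + `|K2|) * base p.2 ^+ (n1 + n2).
  move=> hn hu j q sq; apply: le_trans (hu j q sq) _.
  have b0 N : 0 <= base q.2 ^+ N by rewrite exprn_ge0// (le_trans ler01)// base_ge1.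
  apply: (@le_trans _ _ (`|K| * base q.2 ^+ n)); first by rewrite ler_wpM2r ?ler_norm.
  apply: ler_pM => //.
    by case: hn => -[_ ->]; rewrite (lerDl, lerDr).
  apply: ler_weXn2l; first exact: base_ge1.
  by case: hn => -[-> _]; rewrite (leq_addr, leq_addl).
have {}hv := bnd v K1 n1 (or_introl (conj erefl erefl)) hv.
have {}hw := bnd w K2 n2 (or_intror (conj erefl erefl)) hw.
have half (u u' : 'I_m -> point -> R) : plain_solution u -> plain_solution u' ->
    (forall j p, strip T k p -> `|u j p| <= (`|K1| + `|K2|) * base p.2 ^+ (n1 + n2)) ->
    (forall j p, strip T k p -> `|u' j p| <= (`|K1| + `|K2|) * base p.2 ^+ (n1 + n2)) ->
    u i p <= u' i p.
  move=> [cu su _ _ uT] [cu' _ su' ou' uT'] hu hu'.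
  apply: (comparison d_gt0 b_cont s_cont C_ge0 bs_growth bs_lip f_cont f_lip g_cont no_loop
    (u := u) (w := u') (n := (n1 + n2)%N) (K := `|K1| + `|K2|)) => //.
  - by move=> j; exact: rcont_in_usc.
  - by move=> j; apply: rcont_in_usc; exact: rcont_inN.
  - by move=> j q sq; apply: le_trans (hu j q sq); exact: ler_norm.
  - by move=> j q sq; have := hu' j q sq; rewrite ler_norml => /andP[].
  - by move=> j [t x] sq /= ->; rewrite uT uT'.
by apply/eqP; rewrite eq_le !half.
Qed.

End System.

(* The premises are discharged from last to first, so that those which determine the
   constants come before the positivity assumptions. *)
Ltac solve_by_hyps H := eapply H; revgoals; eassumption.

(** * Existence and uniqueness for the system *)

Section System.
Variables (R : realType) (T : R) (k d m : nat).
Local Notation point := (R * 'cV[R]_k)%type.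
Variables (b : point -> 'cV[R]_k) (sigma : point -> 'M[R]_(k, d))
  (f : 'I_m -> point -> R -> 'cV[R]_d -> R) (g : 'I_m -> 'I_m -> point -> R) (C : R).
Hypothesis d_gt0 : (0 < d)%N.
Hypothesis b_cont : cont_in (strip T k) b.
Hypothesis s_cont : cont_in (strip T k) sigma.
Hypothesis C_ge0 : 0 <= C.
Hypothesis bs_growth : forall p, strip T k p ->
  enorm (b p) + enorm (sigma p) <= C * (1 + enorm p.2).
Hypothesis bs_lip : forall t x y, 0 <= t <= T ->
  enorm (b (t, x) - b (t, y)) + enorm (sigma (t, x) - sigma (t, y)) <= C * enorm (x - y).
Hypothesis f_cont : forall i p, strip T k p -> forall e, 0 < e -> exists2 r : R, 0 < r &
  forall p', strip T k p' -> close r p p' -> forall y z, `|f i p' y z - f i p y z| < e.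
Hypothesis f_lip : forall i p y y' z z', strip T k p ->
  `|f i p y z - f i p y' z'| <= C * (`|y - y'| + enorm (z - z')).
Hypothesis g_cont : forall i j, i != j -> rcont_in (strip T k) (g i j).
Hypothesis no_loop : forall p, strip T k p ->
  forall (N : nat) (i : nat -> 'I_m), (3 <= N)%N -> i 1%N = i N ->
    #|[seq i n | n <- index_iota 1 N.+1]| = N.-1 ->
    0 < \sum_(1 <= n < N) g (i n) (i n.+1) p.

Hypothesis T_gt0 : 0 < T.
Hypothesis g_ge0 : forall i j p, i != j -> strip T k p -> 0 <= g i j p.
Variables (h : 'I_m -> 'cV[R]_k -> R) (K0 : R) (n : nat) (V : point -> R).
Hypothesis h_cont : forall i x e, 0 < e -> exists2 r : R, 0 < r &
  forall x', enorm (x' - x) < r -> `|h i x' - h i x| < e.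
Hypothesis h_compat : forall i j x, j != i -> h j x - g i j (T, x) <= h i x.
Hypothesis K0_ge0 : 0 <= K0.
Hypothesis f_growth : forall i p, strip T k p -> `|f i p 0 0| <= K0 * base p.2 ^+ n.
Hypothesis h_growth : forall i x, `|h i x| <= K0 * base x ^+ n.
Hypothesis V_cont : continuous V.
Hypothesis V_ge : forall p, strip T k p -> K0 * base p.2 ^+ n <= V p.
Hypothesis V_growth : exists K, forall p, strip T k p -> V p <= K * base p.2 ^+ n.
Hypothesis V_sub : jet_sub T b sigma f g (fun _ => \- V).
Hypothesis V_super : jet_super T b sigma f (fun _ => V).

Local Notation class := (perron_class T b sigma f g h).

Lemma plain_solution_exists : exists v,
  plain_solution T b sigma f g h v /\ forall i p, strip T k p -> `|v i p| <= V p.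
Proof.
pose v := pusc T b sigma f g h.
have v_class : class v by solve_by_hyps pusc_class.
have v_max u i p : class u -> strip T k p -> u i p <= v i p.
  move=> cu sp; solve_by_hyps class_le_pusc.
have v_le i p : strip T k p -> v i p <= V p by move=> sp; solve_by_hyps pusc_le_V.
have nV : class (fun _ => \- V) by solve_by_hyps class_negV.
have E i p : strip T k p -> vlow T v i p = v i p by move=> sp; solve_by_hyps vlow_eq.
exists v; split; last first.
  move=> i p sp; rewrite ler_norml v_le// andbT; exact: v_max nV sp.
have [vu _ vs vT] := v_class; split=> //.
- move=> i; apply: usc_rcont_in => //.
  have hu : usc_in (strip T k) (\- vlow T v i) by solve_by_hyps vlow_usc.
  apply/uscP => p sp e e0; have [r r0 hr] := (uscP _ _).1 hu p sp e e0.
  by exists r => // p' sp' c; have := hr p' sp' c; rewrite /= !E.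
- have hs : jet_super T b sigma f (vlow T v) by solve_by_hyps vlow_super.
  move=> i p J sp pT jJ; rewrite -E//; apply: hs => //.
  by apply: subjet_eq jJ => // p' sp'; rewrite E.
- move=> i j p sp pT ji; rewrite -!E//; solve_by_hyps vlow_above.
- move=> i x; have sp : strip T k (T, x) by exact: strip_T.
  apply/eqP; rewrite eq_le vT /= -E//; solve_by_hyps vlow_terminal.
Qed.

End System.

Theorem theorem5 (R : realType) (T : R) (k d m : nat)
    (T_gt0 : 0 < T) (k_gt0 : (0 < k)%N) (d_gt0 : (0 < d)%N) (m_gt0 : (0 < m)%N)
    (b : R * 'cV[R]_k -> 'cV[R]_k) (sigma : R * 'cV[R]_k -> 'M[R]_(k, d))
    (f : 'I_m -> R * 'cV[R]_k -> R -> 'cV[R]_d -> R)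
    (g : 'I_m -> 'I_m -> R * 'cV[R]_k -> R)
    (h : 'I_m -> 'cV[R]_k -> R)
    (b_cont : {within strip T k, continuous b})
    (sigma_cont : {within strip T k, continuous sigma})
    (b_sigma_lip : exists2 C : R, 0 <= C &
       forall (t : R) (x x' : 'cV[R]_k), 0 <= t <= T ->
         enorm (b (t, x)) + enorm (sigma (t, x)) <= C * (1 + enorm x) /\
         enorm (b (t, x) - b (t, x')) + enorm (sigma (t, x) - sigma (t, x'))
           <= C * enorm (x - x'))
    (f_cont : forall (i : 'I_m) (p : R * 'cV[R]_k), strip T k p ->
       forall e : R, 0 < e ->
       \forall p' \near within (strip T k) (nbhs p),
         forall (y : R) (z : 'cV[R]_d), `|f i p' y z - f i p y z| < e)
    (f_lip : forall i : 'I_m, exists2 C : R, 0 <= C &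
       forall (p : R * 'cV[R]_k) (y y' : R) (z z' : 'cV[R]_d), strip T k p ->
         `|f i p y z - f i p y' z'| <= C * (`|y - y'| + enorm (z - z')))
    (f_borel : forall i : 'I_m, borel_on_strip T (fun p => f i p 0 0))
    (f_growth : forall i : 'I_m, poly_growth_strip T (fun p => f i p 0 0))
    (g_cont : forall i j : 'I_m, i != j ->
       {within strip T k, continuous (g i j)})
    (g_ge0 : forall i j : 'I_m, i != j ->
       forall p, strip T k p -> 0 <= g i j p)
    (g_growth : forall i j : 'I_m, i != j -> poly_growth_strip T (g i j))
    (g_no_free_loop : forall p, strip T k p ->
       forall (N : nat) (i : nat -> 'I_m), (3 <= N)%N -> i 1%N = i N ->
         #|[seq i n | n <- index_iota 1 N.+1]| = N.-1 ->
         0 < \sum_(1 <= n < N) g (i n) (i n.+1) p)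
    (h_cont : forall i : 'I_m, continuous (h i))
    (h_growth : forall i : 'I_m, poly_growth (h i))
    (h_compat : forall (i : 'I_m) (x : 'cV[R]_k),
       (obstacle (fun j => h j x) (fun l j => g l j (T, x)) i <= (h i x)%:E)%E) :
  exists2 v : 'I_m -> R * 'cV[R]_k -> R,
    continuous_poly_growth_solution T b sigma f g h v &
    forall w : 'I_m -> R * 'cV[R]_k -> R,
      continuous_poly_growth_solution T b sigma f g h w ->
      forall (i : 'I_m) (p : R * 'cV[R]_k), strip T k p -> w i p = v i p.
Proof.
have [C1 C10 hC1] := b_sigma_lip.
have hex i : exists Cf : R, 0 <= Cf /\ forall p y y' z z', strip T k p ->
    `|f i p y z - f i p y' z'| <= Cf * (`|y - y'| + enorm (z - z')).
  by have [Cf h0 h1] := f_lip i; exists Cf.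
have [Cs hCs] := choice hex.
(* One constant for b, sigma and all the f_i; the sum serves as an upper bound of finitely many
   constants. *)
have [C [C0 CC1 CCs]] : exists C, [/\ 0 <= C, C1 <= C & forall i, Cs i <= C].
  have s0 : 0 <= \sum_i Cs i by apply: sumr_ge0 => i _; case: (hCs i).
  exists (C1 + \sum_i Cs i); split; [exact: addr_ge0 | by rewrite lerDl |] => i.
  rewrite (bigD1 i)//= addrCA lerDl addr_ge0//.
  by apply: sumr_ge0 => j _; case: (hCs j).
have bc := within_cont_in b_cont; have sc := within_cont_in sigma_cont.
have bsg p : strip T k p -> enorm (b p) + enorm (sigma p) <= C * (1 + enorm p.2).
  case: p => t x [/=]; rewrite in_itv /= => tT _; apply: le_trans (hC1 t x x tT).1 _.
  by rewrite ler_wpM2r// addr_ge0// enorm_ge0.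
have bsl t x y : 0 <= t <= T ->
    enorm (b (t, x) - b (t, y)) + enorm (sigma (t, x) - sigma (t, y)) <= C * enorm (x - y).
  by move=> tT; apply: le_trans (hC1 t x y tT).2 _; rewrite ler_wpM2r// enorm_ge0.
have fc i p : strip T k p -> forall e, 0 < e -> exists2 r : R, 0 < r &
    forall p', strip T k p' -> close r p p' -> forall y z, `|f i p' y z - f i p y z| < e.
  by move=> sp e e0; apply/near_close; exact: f_cont.
have fl i p y y' z z' : strip T k p ->
    `|f i p y z - f i p y' z'| <= C * (`|y - y'| + enorm (z - z')).
  move=> sp; apply: le_trans ((hCs i).2 p y y' z z' sp) _.
  by rewrite ler_wpM2r// addr_ge0// enorm_ge0.
have gc i j : i != j -> rcont_in (strip T k) (g i j).
  by move=> ij; apply: within_rcont_in; exact: g_cont.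
have gg i j p : i != j -> strip T k p -> 0 <= g i j p by move=> ij; exact: g_ge0.
have hc i x e : 0 < e -> exists2 r : R, 0 < r &
    forall x', enorm (x' - x) < r -> `|h i x' - h i x| < e.
  move=> e0; have /cvgrPdist_lt /(_ e e0) := h_cont i x.
  by move=> /nbhs_enorm[r r0 hr]; exists r => // x' c; rewrite distrC; exact: hr.
have hco i j x : j != i -> h j x - g i j (T, x) <= h i x.
  by move=> ji; have /obstacle_leP := h_compat i x; apply.
have [n1 [K1 [K10 hK1]]] : exists n K, 0 <= K /\
    forall i p, strip T k p -> `|f i p 0 0| <= K * base p.2 ^+ n.
  apply: (@common_growth R _ _ (strip T k) (fun p => base p.2) (fun i p => f i p 0 0)).
    by move=> p; exact: base_ge1.
  move=> i; have [D [gam [D0 gam0 hD]]] := f_growth i.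
  have [n hn] := growth_base k gam0; exists n, (D * 2) => p sp.
  by apply: le_trans (hD p sp) _; rewrite -mulrA ler_wpM2l.
have [n2 [K2 [K20 hK2]]] : exists n K, 0 <= K /\
    forall i x, setT x -> `|h i x| <= K * base x ^+ n.
  apply: (@common_growth R _ _ setT (fun x => base x) h); first by move=> x; exact: base_ge1.
  move=> i; have [D [gam [D0 gam0 hD]]] := h_growth i.
  have [n hn] := growth_base k gam0; exists n, (D * 2) => x _.
  by apply: le_trans (hD x) _; rewrite -mulrA ler_wpM2l.
have b0 (x : 'cV[R]_k) N : 0 <= base x ^+ N by rewrite exprn_ge0// ltW// base_gt0.
(* The same V has to dominate both f_i(., 0, 0) and h_i, hence a common constant and a common
   exponent. *)
have K0 : 0 <= K1 + K2 by exact: addr_ge0.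
have fg i p : strip T k p -> `|f i p 0 0| <= (K1 + K2) * base p.2 ^+ (n1 + n2).
  move=> sp; apply: le_trans (hK1 i p sp) _; apply: ler_pM => //; first by rewrite lerDl.
  by apply: ler_weXn2l; [exact: base_ge1 | rewrite leq_addr].
have hg i x : `|h i x| <= (K1 + K2) * base x ^+ (n1 + n2).
  apply: le_trans (hK2 i x I) _; apply: ler_pM => //; first by rewrite lerDr.
  by apply: ler_weXn2l; [exact: base_ge1 | rewrite leq_addl].
have [V [Vc Vge [KV VK] Vsub Vsup]] : exists V : R * 'cV[R]_k -> R, [/\ continuous V,
    forall p, strip T k p -> (K1 + K2) * base p.2 ^+ (n1 + n2) <= V p,
    exists K, forall p, strip T k p -> V p <= K * base p.2 ^+ (n1 + n2),
    jet_sub T b sigma f g (fun _ => \- V) & jet_super T b sigma f (fun _ => V)].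
  solve_by_hyps barrier_exists.
have VK' : exists K, forall p, strip T k p -> V p <= K * base p.2 ^+ (n1 + n2) by exists KV.
have [v [pv hv]] : exists v, plain_solution T b sigma f g h v /\
    forall i p, strip T k p -> `|v i p| <= V p.
  solve_by_hyps plain_solution_exists.
have vK i p : strip T k p -> `|v i p| <= KV * base p.2 ^+ (n1 + n2).
  by move=> sp; apply: le_trans (hv i p sp) (VK p sp).
exists v.
  have [cv sv Sv ov vT] := pv; split.
  - by move=> i; apply: rcont_in_within.
  - move=> i; have [D D0 hD] := base_growth R k (n1 + n2).
    exists (`|KV| * D), (2 * (n1 + n2))%:R; split; [exact: mulr_ge0 | by [] |] => p sp.
    apply: le_trans (vK i p sp) _; rewrite -mulrA.
    apply: (@le_trans _ _ (`|KV| * base p.2 ^+ (n1 + n2))).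
      by rewrite ler_wpM2r ?ler_norm.
    by rewrite ler_wpM2l.
  - solve_by_hyps solution_of_jets.
move=> w [cw gw sw] i p sp.
have rw_ j : rcont_in (strip T k) (w j) by apply: within_rcont_in; exact: cw.
have pw : plain_solution T b sigma f g h w.
  have [? ? ? ?] : [/\ jet_sub T b sigma f g w, jet_super T b sigma f w, above_obstacle T g w
    & forall i x, w i (T, x) = h i x] by solve_by_hyps jets_of_solution.
  by split.
have [n3 [K3 [K30 hK3]]] : exists n K, 0 <= K /\
    forall i p, strip T k p -> `|w i p| <= K * base p.2 ^+ n.
  apply: (@common_growth R _ _ (strip T k) (fun p => base p.2) w).
    by move=> q; exact: base_ge1.
  move=> j; have [D [gam [D0 gam0 hD]]] := gw j.
  have [n hn] := growth_base k gam0; exists n, (D * 2) => q sq.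
  by apply: le_trans (hD q sq) _; rewrite -mulrA ler_wpM2l.
solve_by_hyps plain_solution_unique.
Qed.
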